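(* Let $\delta>0$. For $X,D\to\infty$ with $X\ll(\log D)^{2-\delta}$, we have $$\frac{1}{D^{*}}\sum_{0<d\leq D}{}^{\flat}\ L(\tfrac12,\chi_{8d})\,P_{X}(\chi_{8d})^{-1}\sim\frac{1}{\sqrt{2}}\,\frac{\log D}{e^{\gamma}\log X}.$$
   Context: The sum $\sum^{\flat}_{0<d\le D}$ runs over odd, positive, square-free integers $d\le D$, and $D^{*}$ is the number of such $d$ in $(0,D]$. For such $d$, $\chi_{8d}$ denotes the real primitive Dirichlet character of conductor $8d$ with $\chi_{8d}(-1)=1$ (i.e. the Kronecker symbol $\left(\frac{8d}{\cdot}\right)$), and $L(s,\chi_{8d})$ is its Dirichlet $L$-function. For real $X\ge 2$, $$P_{X}(\chi_{8d})=\exp\bigg(\sum_{2\le n\leq X}\frac{\Lambda(n)\chi_{8d}(n)}{n^{1/2}\log n}\bigg),$$ where $\Lambda$ is von Mangoldt's function. $\gamma$ is Euler's constant. *)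

(* Defs.v *)
From HB Require Import structures.
From mathcomp Require Import all_boot all_order all_algebra.
From mathcomp Require Import all_classical all_reals all_analysis.

Set Implicit Arguments.
Unset Strict Implicit.
Unset Printing Implicit Defensive.

Import Order.TTheory GRing.Theory Num.Theory.
Import numFieldNormedType.Exports.

Local Open Scope classical_set_scope.
Local Open Scope ring_scope.

Definition squarefree (n : nat) : bool :=
  (0 < n)%N && all (fun e => (e ^ 2 %| n)%N ==> (e == 1%N)) (divisors n).

Definition kronecker_prime (a : int) (p : nat) : int :=
  if p == 2%N then
    if (2 %| a)%Z then 0
    else if (a %% 8)%Z \in [:: 1; 7] then 1 else -1
  else
    if (p%:Z %| a)%Z then 0
    else if [exists x : 'I_p, (x%:Z ^+ 2 == a %[mod p%:Z])%Z] then 1 else -1.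

(* The Kronecker symbol (a / n), extended from primes by complete
   multiplicativity in n, with (a / 0) = 1 if a = 1 or -1, and 0 otherwise. *)
Definition kronecker (a : int) (n : nat) : int :=
  if n == 0%N then (`|a|%N == 1%N)%:Z
  else \prod_(p <- primes n) kronecker_prime a p ^+ logn p n.

Definition chi8 (d : nat) (n : nat) : int := kronecker (8 * d)%N%:Z n.

(* For a non-principal Dirichlet character chi and real s > 0, the Dirichlet
   series converges (conditionally when s <= 1), and its value, the limit of
   the partial sums in the natural order, is that of the entire function
   L(s, chi). *)
Definition dirichletL (R : realType) (chi : nat -> int) (s : R) : R :=
  limn (fun N : nat => \sum_(1 <= n < N.+1) (chi n)%:~R / (n%:R `^ s)).

(* n is a power p ^ k of a prime, k >= 1, exactly when p is its only prime
   divisor. *)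
Definition von_mangoldt (R : realType) (n : nat) : R :=
  if primes n is [:: p] then ln p%:R else 0.

Definition euler_gamma (R : realType) : R :=
  limn (fun n : nat => series harmonic n - ln n%:R).

Definition euler_product (R : realType) (X : R) (chi : nat -> int) : R :=
  expR (\sum_(2 <= n < (Num.truncn X).+1)
          (von_mangoldt R n * (chi n)%:~R) / (n%:R `^ 2^-1 * ln n%:R)).

Definition Dstar (R : realType) (D : R) : nat :=
  \sum_(1 <= d < (Num.truncn D).+1 | odd d && squarefree d) 1.

Definition twisted_mean (R : realType) (X D : R) : R :=
  (Dstar D)%:R^-1 *
  \sum_(1 <= d < (Num.truncn D).+1 | odd d && squarefree d)
     dirichletL (chi8 d) (2^-1 : R) * (euler_product X (chi8 d))^-1.

(* The filter describing (X, D) -> (+oo, +oo) subject to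
   X <= C (log D) ^ (2 - delta). *)
Definition XD_filter (R : realType) (delta C : R) : set_system (R * R) :=
  within [set p | p.1 <= C * (ln p.2 `^ (2 - delta))]
         (filter_prod +oo +oo).

Lemma XD_filter_filter (R : realType) (delta C : R) :
  Filter (XD_filter delta C).
Proof. exact: within_filter. Qed.

Canonical XD_filter_on (R : realType) (delta C : R) :=
  FilterType (XD_filter delta C) (XD_filter_filter delta C).

(* Main.v *)
(* Write S_chi(x) for the sum of chi(n) / sqrt n over n <= x. The functional
   equation of the theta function of chi = chi8 d, on a logarithmic scale,
   expresses L(1/2, chi) as a weighted mean over t of 2 S_chi(tau(t) sqrt d), so
   it is enough to average P_X(chi)^-1 S_chi(u sqrt d) over d for each u. As
   chi(p) is 0, 1 or -1, P_X(chi)^-1 is a product over p <= X of quadratic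
   polynomials in chi(p), that is, a finite sum of terms c_l chi(l). The terms
   with l > D^(1/100) are negligible by Rankin's trick and a bound for the first
   moment of S_chi; this is where X << (log D)^(2 - delta) enters, since the sum
   of p^(-1/2) over p <= X must be o(log D). In the mean over d of chi(l n), by
   the Polya-Vinogradov inequality only the n with l n a square matter. The
   resulting main terms recombine to an Euler product over p <= X whose factor
   is close to 1 - 1/p for p <= sqrt X, but close to (1 - 1/p)^(1/2) for
   sqrt X < p <= X, where the higher powers of p are missing from P_X. By Mertens'
   theorem this product is asymptotic to a constant times
   (M(sqrt X) M(X))^(1/2) ~ sqrt 2 e^-gamma / log X, where M(y) is the product of
   1 - 1/p over p <= y: the factor sqrt 2 has its origin here. *)
Require Import Defs.
From HB Require Import structures.
From mathcomp Require Import all_boot all_order all_algebra.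
From mathcomp Require Import all_field.
From mathcomp Require Import all_classical all_reals all_analysis.
From mathcomp Require Import measurable_realfun.
From mathcomp Require Import complex zify ring lra.

Set Implicit Arguments.
Unset Strict Implicit.
Unset Printing Implicit Defensive.

Import Order.TTheory GRing.Theory Num.Theory.
Import numFieldNormedType.Exports.

Local Open Scope classical_set_scope.
Local Open Scope ring_scope.

(** * The Kronecker symbol *)

(** The sign of the Gauss sum of [chi8 d] is essential: with the opposite sign the theta function on
    the logarithmic scale would be odd, and L(1/2) could not be recovered from a half-line. Hence
    the way through Gauss's q-binomial product, reciprocity and [chi8_gauss]. A finite identity for
    powers of cosines takes the place of Poisson summation. Sharply cut sums are used because the
    condition n <= u sqrt d is monotone in d: it selects a final segment of the d, so that bounds
    for all initial segments suffice. The price is uniformity: the estimates must hold for all u >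
    0, with a loss polynomial in u and |ln u| that the kernel absorbs. Square-free d are sieved out
    with an error at the modulus E interpolated, in the exponents 2/5 and 3/5, between a bound
    independent of E and the trivial Y / E. The density of the odd square-free numbers cancels
    against D*, while [odd_constant] joins the Euler product over p <= X. *)

Lemma sum_period (V : nmodType) (I : finType) (N : nat) (g : I -> nat)
    (f : nat -> V) : (0 < N)%N -> #|I| = N ->
  (forall i j, g i = g j %[mod N] -> i = j) ->
  (forall x, f (x %% N)%N = f x) ->
  \sum_(x < N) f x = \sum_i f (g i).
Proof.
move=> N0 cI inj fper.
pose h i : 'I_N := Ordinal (ltn_pmod (g i) N0).
have hinj : injective h by move=> i j /(congr1 val) /= /inj.
have hb : bijective h by apply: inj_card_bij => //; rewrite card_ord cI.
rewrite (reindex h) /=; last exact: onW_bij.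
by apply: eq_bigr => i _; rewrite fper.
Qed.

Lemma sum_period_scale (V : nmodType) (N u : nat) (f : nat -> V) :
  (0 < N)%N -> coprime u N -> (forall x, f (x %% N)%N = f x) ->
  \sum_(x < N) f (u * x)%N = \sum_(x < N) f x.
Proof.
move=> N0 cu fp.
rewrite (@sum_period V 'I_N N (fun i => u * i)%N f) ?card_ord //.
move=> i j /eqP; wlog le : i j / (j <= i)%N => [H|].
  by case/orP: (leq_total j i) => l E; [|symmetry]; apply: H; rewrite // eq_sym.
rewrite eqn_mod_dvd ?leq_mul2l ?le ?orbT // -mulnBr Gauss_dvdr; last first.
  by rewrite coprime_sym.
move=> d; apply/val_inj => /=.
have := ltn_ord i; have := dvdn_leq _ d; move: le; lia.
Qed.

Lemma sum_period_shift (V : nmodType) (N u : nat) (f : nat -> V) :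
  (0 < N)%N -> (forall x, f (x %% N)%N = f x) ->
  \sum_(x < N) f (x + u)%N = \sum_(x < N) f x.
Proof.
move=> N0 fp.
rewrite (@sum_period V 'I_N N (fun i => i + u)%N f) ?card_ord //.
move=> i j /eqP; rewrite eqn_modDr => /eqP; rewrite !modn_small // => e.
exact/val_inj.
Qed.

(** By the Chinese remainder theorem the values m y + n z represent each residue modulo m n once. In
    this parametrization the square of x has no mixed term modulo m n, which splits a Gauss sum. *)
Lemma sum_period_crt (V : nmodType) (m n : nat) (f : nat -> V) :
  (0 < m)%N -> (0 < n)%N -> coprime m n ->
  (forall x, f (x %% (m * n))%N = f x) ->
  \sum_(x < m * n) f x = \sum_(y < n) \sum_(z < m) f (m * y + n * z)%N.
Proof.
move=> m0 n0 cmn fp.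
rewrite pair_big /= (@sum_period V ('I_n * 'I_m)%type (m * n)
  (fun yz => m * yz.1 + n * yz.2)%N f) ?muln_gt0 ?m0 //.
  by rewrite card_prod !card_ord mulnC.
case=> y z [y' z'] /= E.
have aux k l a b a' b' : (0 < k)%N -> coprime l k -> (a < k)%N -> (a' < k)%N ->
    (l * a + k * b = l * a' + k * b' %[mod l * k])%N -> a = a'.
  move=> k0 clk lta lta' e.
  have /eqP : (l * a = l * a' %[mod k])%N.
    have := congr1 (fun x => x %% k)%N e; rewrite !modn_dvdm ?dvdn_mull //.
    by rewrite ![(l * _ + _)%N]addnC ![(k * _)%N]mulnC !modnMDl => ->.
  wlog le : a a' lta lta' {e} / (a' <= a)%N => [H|].
    case/orP: (leq_total a' a) => h E'; first by apply: H.
    by symmetry; apply: H; rewrite // eq_sym.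
  rewrite eqn_mod_dvd ?leq_mul2l ?le ?orbT // -mulnBr Gauss_dvdr; last first.
    by rewrite coprime_sym.
  by case: (posnP (a - a')) => [|P d]; [lia | have := dvdn_leq P d; lia].
congr pair; apply: val_inj => /=.
  exact: (aux n m y z y' z').
apply: (aux m n z y z' y') => //; first by rewrite coprime_sym.
by rewrite (mulnC n m) !(addnC (n * _)%N).
Qed.

(** Mixed-radix digits, for pairs of moduli such as p m and p, to which the Chinese remainder
    theorem does not apply. *)
Lemma sum_mixed (V : nmodType) (m n : nat) (f : nat -> V) :
  (0 < m)%N -> (0 < n)%N ->
  \sum_(x < m * n) f x = \sum_(y < m) \sum_(z < n) f (y + m * z)%N.
Proof.
move=> m0 n0; rewrite pair_big /=.
have lt (yz : 'I_m * 'I_n) : (yz.1 + m * yz.2 < m * n)%N.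
  case: yz => y z /=; apply: (@leq_trans (m * z.+1)%N).
    by rewrite mulnS ltn_add2r.
  by rewrite leq_mul2l ltn_ord orbT.
pose h yz : 'I_(m * n) := Ordinal (lt yz).
rewrite (reindex h) /=; first by apply: eq_bigr; case.
apply: onW_bij; apply: inj_card_bij; last by rewrite card_prod !card_ord.
case=> y z [y' z'] /(congr1 val) /= E.
have Ey : y = y' :> nat.
  have := congr1 (fun x => x %% m)%N E.
  by rewrite !(mulnC m) !(addnC _ (_ * m)%N) !modnMDl !modn_small.
congr pair; apply: val_inj => //=.
by move: E; rewrite Ey => /addnI /eqP; rewrite eqn_pmul2l // => /eqP.
Qed.

Lemma Fp_natP (p : nat) (m n : nat) : prime p ->
  reflect (m = n %[mod p]) ((m%:R : 'F_p) == n%:R).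
Proof.
move=> pp; apply: (iffP eqP) => [/(congr1 val)|e] /=.
  by rewrite !val_Fp_nat.
by apply: val_inj; rewrite /= !val_Fp_nat.
Qed.

Lemma Fp_nat_eq0 (p m : nat) : prime p -> ((m%:R : 'F_p) == 0) = (p %| m)%N.
Proof.
move=> pp; rewrite -[0]/(0%:R); apply/(Fp_natP m 0 pp)/idP; rewrite mod0n => /eqP //.
Qed.

Lemma kronecker_primeE (a p : nat) : prime p -> odd p ->
  kronecker_prime a%:Z p =
  if (p %| a)%N then 0
  else if [exists x : 'F_p, x ^+ 2 == a%:R] then 1 else -1.
Proof.
move=> pp op; rewrite /kronecker_prime.
have -> : (p == 2%N) = false by apply/eqP => e; rewrite e in op.
rewrite dvdzE /=; case: ifP => // _; congr (if _ then _ else _).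
have p0 := prime_gt0 pp.
apply/existsP/existsP => -[x].
  rewrite expr2 -PoszM !modz_nat eqz_nat => /eqP e.
  by exists (x%:R); rewrite expr2 -natrM; apply/Fp_natP.
move=> e; have lt : (val x < p)%N by rewrite -[X in (_ < X)%N](Fp_cast pp); exact: ltn_ord.
exists (Ordinal lt); rewrite expr2 -PoszM !modz_nat eqz_nat.
by apply/eqP/(Fp_natP _ _ pp); rewrite natrM natr_Zp -expr2.
Qed.

Lemma euler_criterion (p a : nat) : prime p -> odd p ->
  (kronecker_prime a%:Z p)%:~R = a%:R ^+ p./2 :> 'F_p.
Proof.
move=> pp op; rewrite kronecker_primeE //.
have p1 := prime_gt1 pp.
have p2 : (p = (p./2).*2.+1)%N by have := odd_double_half p; rewrite op; lia.
have h0 : (0 < p./2)%N by lia.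
case: ifPn => [|npa].
  by rewrite -Fp_nat_eq0 // => /eqP ->; rewrite expr0n eqn0Ngt h0.
have fer (y : 'F_p) : y != 0 -> y ^+ (p./2).*2 = 1.
  move=> y0; apply: (mulfI y0); rewrite -exprS -p2 mulr1.
  by have := expf_card y; rewrite card_Fp.
have x0 : (a%:R : 'F_p) != 0 by rewrite Fp_nat_eq0.
case: ifPn => [/existsP[y /eqP e]|].
  have y0 : y != 0 by apply: contraNneq x0 => y0; rewrite -e y0 expr0n.
  by rewrite -e -exprM mul2n fer.
rewrite negb_exists => /forallP nsq.
have : (a%:R ^+ p./2 - 1) * (a%:R ^+ p./2 + 1) = 0 :> 'F_p.
  by rewrite -subr_sqr expr1n -exprM muln2 fer // subrr.
move/eqP; rewrite mulf_eq0 subr_eq0 addr_eq0 => /orP[/eqP e|/eqP -> //].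
(* If [a ^+ p./2] were 1 for a non-residue a, then a together with the [p./2] distinct squares of 1,
   ..., [p./2] would be one root too many of X^(p./2) - 1. *)
pose sq := [seq (i.+1%:R : 'F_p) ^+ 2 | i <- iota 0 p./2].
have : (size (a%:R :: sq)%R < size ('X^(p./2) - 1%:P : {poly 'F_p})%R)%N.
  apply: max_poly_roots.
  - by rewrite -size_poly_eq0 size_XnsubC.
  - rewrite /= rootE !hornerE e subrr eqxx /=; apply/allP => y /mapP[j].
    rewrite mem_iota => /andP[_ lt] ->.
    rewrite rootE !hornerE -exprM mul2n fer ?subrr // Fp_nat_eq0 //.
    by apply/negP => /dvdn_leq; lia.
  rewrite cons_uniq; apply/andP; split.
    by apply/negP => /mapP[j _ E]; have := nsq j.+1%:R; rewrite -E eqxx.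
  rewrite map_inj_in_uniq ?iota_uniq // => i j.
  rewrite !mem_iota => /andP[_ li] /andP[_ lj] /eqP.
  rewrite -subr_eq0 subr_sqr mulf_eq0 subr_eq0 -natrD.
  case/orP => [/Fp_natP|]; last by rewrite Fp_nat_eq0 // => /dvdn_leq; lia.
  by move=> /(_ pp); rewrite !modn_small; lia.
by rewrite /= size_map size_iota size_XnsubC // ltnn.
Qed.

Lemma kronecker_prime_val (a : int) (p : nat) :
  kronecker_prime a p \in [:: 0; 1; -1].
Proof. by rewrite /kronecker_prime; do !case: ifP => //. Qed.

(** Euler's criterion gives the identity in ['F_p]; it lifts to the integers because 0, 1 and -1
    stay distinct modulo an odd prime. *)
Lemma kronecker_primeM (a b p : nat) : prime p -> odd p ->
  kronecker_prime (a * b)%N%:Z p =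
  kronecker_prime a%:Z p * kronecker_prime b%:Z p.
Proof.
move=> pp op; have p1 := prime_gt1 pp.
have E : (kronecker_prime (a * b)%N%:Z p)%:~R =
   (kronecker_prime a%:Z p * kronecker_prime b%:Z p)%:~R :> 'F_p.
  rewrite intrM !euler_criterion //.
  by rewrite natrM exprMn.
have n1 : (1 : 'F_p) != 0 by apply: oner_neq0.
have n2 : (1 : 'F_p) != -1.
  rewrite -subr_eq0 opprK -[1 + 1]/(2%:R) Fp_nat_eq0 //.
  by apply/negP => /dvdn_leq => /(_ isT); have := odd_prime_gt2 op pp; lia.
move: E; have := kronecker_prime_val (a * b)%N%:Z p.
have := kronecker_prime_val a%:Z p; have := kronecker_prime_val b%:Z p.
have n3 : (0 : 'F_p) != 1 by rewrite eq_sym.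
have n4 : (0 : 'F_p) != -1 by rewrite eq_sym oppr_eq0.
rewrite !inE => /or3P[]/eqP-> /or3P[]/eqP-> /or3P[]/eqP-> //= /eqP;
  rewrite ?mulr0 ?mul0r ?mulr1 ?mulrN1 ?opprK ?rmorphN ?rmorph1 ?rmorph0 //=;
  rewrite ?(negPf n1) ?(negPf n2) ?(negPf n3) ?(negPf n4) //;
  rewrite eq_sym ?(negPf n1) ?(negPf n2) ?(negPf n3) ?(negPf n4) //.
Qed.

(** With a range of primes that does not depend on n, multiplicativity in n can be checked factor by
    factor. *)
Lemma kroneckerE (a : int) (n B : nat) : (0 < n < B)%N ->
  kronecker a n = \prod_(p < B | prime p) kronecker_prime a p ^+ logn p n.
Proof.
case/andP=> n0 nB; rewrite /kronecker gtn_eqF //.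
rewrite -(big_mkord prime (fun p => kronecker_prime a p ^+ logn p n)).
rewrite -[RHS]big_filter.
rewrite [RHS](bigID (fun p => p \in primes n)) /=.
rewrite [X in _ * X]big1_seq ?mulr1; last first.
  move=> p /andP[np]; rewrite mem_filter => /andP[pp _].
  by move: np; rewrite -logn_gt0 lt0n negbK => /eqP ->.
rewrite -[RHS]big_filter; apply: perm_big; apply: uniq_perm.
- exact: primes_uniq.
- by rewrite !filter_uniq // iota_uniq.
move=> p; rewrite !mem_filter mem_index_iota /=.
case pn : (p \in primes n) => //=; move: pn; rewrite mem_primes n0 => /and3P[-> _ d] /=.
by symmetry; apply: leq_ltn_trans nB; exact: dvdn_leq.
Qed.

Lemma kroneckerM (a : int) (m n : nat) : (0 < m)%N -> (0 < n)%N ->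
  kronecker a (m * n) = kronecker a m * kronecker a n.
Proof.
move=> m0 n0; rewrite !(@kroneckerE a _ (m * n).+1) ?muln_gt0 ?m0 ?n0 ?ltnS ?leq_pmulr ?leq_pmull //=.
by rewrite -big_split /=; apply: eq_bigr => p _; rewrite lognM // exprD.
Qed.

Lemma kronecker1 (a : int) : kronecker a 1 = 1.
Proof. by rewrite /kronecker /= big_nil. Qed.

Lemma kronecker_primeP (a : int) (p : nat) : prime p -> kronecker a p = kronecker_prime a p.
Proof.
move=> pp; rewrite /kronecker gtn_eqF ?prime_gt0 // primes_prime // big_seq1.
by rewrite logn_prime // eqxx expr1.
Qed.

Lemma kronecker_topM (a b n : nat) : odd n ->
  kronecker (a * b)%N%:Z n = kronecker a%:Z n * kronecker b%:Z n.
Proof.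
move=> on; rewrite /kronecker gtn_eqF ?odd_gt0 // -big_split /=.
rewrite big_seq [RHS]big_seq; apply: eq_bigr => p.
rewrite mem_primes => /and3P[pp n0 d]; rewrite kronecker_primeM ?exprMn //.
exact: dvdn_odd d on.
Qed.

Lemma kronecker_mod (a b n : nat) : odd n -> (a = b %[mod n])%N ->
  kronecker a%:Z n = kronecker b%:Z n.
Proof.
move=> on e; rewrite /kronecker gtn_eqF ?odd_gt0 //.
rewrite big_seq [RHS]big_seq; apply: eq_bigr => p.
rewrite mem_primes => /and3P[pp n0 d]; have op := dvdn_odd d on.
have e' : (a = b %[mod p])%N by rewrite -(modn_dvdm a d) e modn_dvdm.
rewrite !kronecker_primeE // /dvdn e'.
by have /(Fp_natP _ _ pp)/eqP -> := e'.
Qed.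

Lemma kronecker_coprime (a n : nat) : odd n -> coprime a n ->
  kronecker a%:Z n = 1 \/ kronecker a%:Z n = -1.
Proof.
move=> on can; rewrite /kronecker gtn_eqF ?odd_gt0 //.
rewrite big_seq; elim/big_ind: _ => [|x y [->|->] [->|->]|p]; try by [left|right].
rewrite mem_primes => /and3P[pp n0 d]; rewrite kronecker_primeE ?(dvdn_odd d) //.
have /negPf -> : ~~ (p %| a)%N.
  by rewrite -prime_coprime //; apply: coprime_dvdl d _; rewrite coprime_sym.
case: ifP => _; first by left; rewrite expr1n.
by rewrite -signr_odd; case: odd; [right|left].
Qed.

Lemma kronecker_ncoprime (a : int) (n : nat) : (0 < n)%N ->
  ~~ coprime `|a|%N n -> kronecker a n = 0.
Proof.
move=> n0 nc; rewrite /kronecker gtn_eqF //.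
have [p pp d] := pdivP (n := gcdn `|a|%N n) ltac:(by move: nc; rewrite /coprime; have := gcdn_gt0 `|a|%N n; rewrite n0 orbT; case: gcdn => [|[|]]).
have [da dn] : (p %| `|a|)%N /\ (p %| n)%N by apply/andP; rewrite -dvdn_gcd.
have pn : p \in primes n by rewrite mem_primes pp n0.
rewrite (big_rem p) //=.
have -> : kronecker_prime a p = 0.
  by rewrite /kronecker_prime; case: eqP => [p2|_]; [rewrite p2 in da|]; rewrite !dvdzE /= da.
by rewrite expr0n gtn_eqF ?logn_gt0 //= mul0r.
Qed.

(** * Quadratic Gauss sums *)

Section RootsOfUnity.
Context (R : realType).
Notation C := (complex R).
Implicit Types (x : R) (a m n k : nat).

Definition cis x : C := Complex (cos x) (sin x).

Lemma cisD x y : cis (x + y) = cis x * cis y.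
Proof.
by apply/eqP; rewrite eq_complex /= cosD sinD eqxx /= addrC.
Qed.

Lemma cis0 : cis 0 = 1.
Proof. by rewrite /cis cos0 sin0. Qed.

Lemma cisX x n : cis x ^+ n = cis (x *+ n).
Proof.
elim: n => [|n IH]; first by rewrite mulr0n cis0 expr0.
by rewrite exprS IH mulrS cisD.
Qed.

Lemma cisN x : cis (- x) = (cis x)^-1.
Proof.
have e : cis x * cis (- x) = 1 by rewrite -cisD subrr cis0.
have n0 : cis x != 0 by apply/eqP => h; move/eqP: e; rewrite h mul0r eq_sym oner_eq0.
by apply: (mulfI n0); rewrite e mulfV.
Qed.

Lemma conj_cis x : conjc (cis x) = cis (- x).
Proof. by rewrite /cis cosN sinN. Qed.

Definition unity_root n : C := cis (pi *+ 2 / n%:R).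

Lemma unity_rootX n k : unity_root n ^+ k = cis (pi *+ 2 * (k%:R / n%:R)).
Proof. by rewrite cisX; congr cis; rewrite -[LHS]mulr_natr -mulrA [_^-1 * _]mulrC. Qed.

Lemma unity_root_mul m n : (0 < m)%N -> unity_root (m * n) ^+ m = unity_root n.
Proof.
move=> m0; rewrite unity_rootX /unity_root natrM; congr cis; congr (_ * _).
rewrite invfM mulrA divff ?mul1r //.
by rewrite pnatr_eq0 -lt0n.
Qed.

Lemma unity_root_prim n : (0 < n)%N -> n.-primitive_root (unity_root n).
Proof.
move=> n0; have nR : (n%:R : R) != 0 by rewrite pnatr_eq0 -lt0n.
apply/andP; split=> //; apply/forallP => j; rewrite unity_rootE; apply/eqP.
apply/idP/eqP => [|->]; last first.
  by rewrite unity_rootX divff // mulr1 /cis cos2pi sin2pi; apply/eqP.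
move=> h; apply/eqP; rewrite eqn_leq ltn_ord leqNgt; apply/negP => lt.
(* e^(2 i x) = 1 forces sin x = 0, but for 0 < j + 1 < n the angle pi (j + 1) / n lies strictly
   between 0 and pi. *)
have : sin (pi * (j.+1%:R / n%:R)) > 0 :> R.
  apply: sin_gt0_pi; rewrite mulr_gt0 ?pi_gt0 ?divr_gt0 ?ltr0n //=.
  by rewrite gtr_pMr ?pi_gt0 // ltr_pdivrMr ?ltr0n // mul1r ltr_nat.
move: h; rewrite unity_rootX eq_complex /= => /andP[/eqP hc _].
move: hc; rewrite (mulrnAl pi) cos_mulr2n cos2sin2 => hc s0.
have : sin (pi * (j.+1%:R / n%:R)) ^+ 2 > 0 :> R by rewrite exprn_gt0.
by move: hc; lra.
Qed.

Lemma unity_root_per n : (0 < n)%N -> forall k, unity_root n ^+ (k %% n) = unity_root n ^+ k.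
Proof. by move=> n0 k; apply: prim_expr_mod; apply: unity_root_prim. Qed.

Lemma unity_root_neq0 n k : unity_root n ^+ k != 0.
Proof.
rewrite expf_neq0 // /unity_root eq_complex /=; apply/negP => /andP[/eqP c /eqP s].
by have := cos2Dsin2 (pi *+ 2 / n%:R : R); rewrite c s !expr0n /= addr0 => /eqP; rewrite eq_sym oner_eq0.
Qed.

End RootsOfUnity.

Lemma sum_prim_root (F : fieldType) (n k : nat) (w : F) : n.-primitive_root w ->
  \sum_(x < n) w ^+ (k * x) = if (n %| k)%N then n%:R else 0.
Proof.
move=> pw; case: ifPn => d.
  rewrite (eq_bigr (fun=> 1)) ?sumr_const ?card_ord // => x _.
  by rewrite exprM; move: d; rewrite (prim_order_dvd pw) => /eqP ->; rewrite expr1n.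
have wk : w ^+ k - 1 != 0 by rewrite subr_eq0 -(prim_order_dvd pw).
apply: (mulfI wk); rewrite mulr0.
under eq_bigr do rewrite exprM.
by rewrite -subrX1 -exprM mulnC exprM (prim_expr_order pw) expr1n subrr.
Qed.

(* Gauss's evaluation: the alternating sum of q-binomial coefficients is the
   product of the 1 - q^(2j+1); at a root of unity the sum becomes, up to a
   factor, a quadratic Gauss sum. *)
Section QBinomial.
Context (F : fieldType) (q : F).

Fixpoint qbin (m k : nat) : F :=
  match m, k with
  | _, 0 => 1
  | 0, _.+1 => 0
  | m'.+1, k'.+1 => qbin m' k'.+1 + q ^+ (m' - k') * qbin m' k'
  end.

Lemma qbin_small m k : (m < k)%N -> qbin m k = 0.
Proof.
elim: m k => [|m IH] [|k] //= lt; rewrite !IH ?mulr0 ?addr0 //; lia.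
Qed.

Lemma qbin0 m : qbin m 0 = 1. Proof. by case: m. Qed.

Lemma qbinS m k : qbin m.+1 k.+1 = qbin m k.+1 + q ^+ (m - k) * qbin m k.
Proof. by []. Qed.

Arguments qbin : simpl never.

Lemma qbin_step m k : (k <= m)%N ->
  (1 - q ^+ k.+1) * qbin m k.+1 = (1 - q ^+ (m - k)) * qbin m k.
Proof.
elim: m k => [|m IH] k le.
  by move: le; rewrite leqn0 => /eqP ->; rewrite qbin_small // mulr0 subrr mul0r.
have E3 j : (j <= m)%N ->
    (1 - q ^+ j.+1) * qbin m.+1 j.+1 = (1 - q ^+ m.+1) * qbin m j.
  move=> lj; rewrite qbinS mulrDr IH //.
  have -> : q ^+ m.+1 = q ^+ (m - j) * q ^+ j.+1 by rewrite -exprD; congr (_ ^+ _); lia.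
  by ring.
case: k le => [|k] le.
  by rewrite E3 // !qbin0 subn0.
have [lt|ge] := ltnP k m; last first.
  have -> : k = m by lia.
  by rewrite subnn expr0 subrr mul0r [qbin m.+1 m.+2]qbin_small ?mulr0.
rewrite E3 // qbinS subSS mulrDr.
have := IH k (ltnW lt) => E.
have -> : q ^+ m.+1 = q ^+ (m - k) * q ^+ k.+1 by rewrite -exprD; congr (_ ^+ _); lia.
rewrite [X in _ = _ + X]mulrCA -E; ring.
Qed.

Lemma qbin_lower m k : (k <= m.+1)%N ->
  (1 - q ^+ (m.+1 - k)) * qbin m.+1 k = (1 - q ^+ m.+1) * qbin m k.
Proof.
case: k => [|k]; first by rewrite !qbin0 subn0.
rewrite ltnS => le; have E := qbin_step le.
rewrite qbinS subSS mulrDr [X in _ + X = _]mulrCA -E.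
have -> : q ^+ m.+1 = q ^+ (m - k) * q ^+ k.+1 by rewrite -exprD; congr (_ ^+ _); lia.
by ring.
Qed.

Definition alt_qbin m := \sum_(k < m.+1) (-1) ^+ k * qbin m k.

(** Gauss's recursion. The Pascal rule turns the sum into a difference of two alternating sums,
    whose terms [qbin_lower] identifies with 1 - q^(m+1) times the terms for m. *)
Lemma alt_qbinSS m : alt_qbin m.+2 = (1 - q ^+ m.+1) * alt_qbin m.
Proof.
have E0 : alt_qbin m.+1 = 1 + \sum_(k < m.+2) (-1) ^+ k.+1 * qbin m.+1 k.+1.
  have : \sum_(k < m.+3) (-1) ^+ k * qbin m.+1 k = alt_qbin m.+1.
    by rewrite big_ord_recr /= (qbin_small (ltnSn _)) mulr0 addr0.
  by move <-; rewrite big_ord_recl /= mul1r.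
rewrite /alt_qbin big_ord_recl /= mul1r.
rewrite (eq_bigr (fun k : 'I_m.+2 => (-1) ^+ k.+1 * qbin m.+1 k.+1
   - (-1) ^+ k * (q ^+ (m.+1 - k) * qbin m.+1 k))); last first.
  by move=> k _; rewrite qbinS mulrDr; congr (_ + _); rewrite exprS mulN1r mulNr.
rewrite sumrB addrA -E0 /alt_qbin -sumrB.
rewrite (eq_bigr (fun k : 'I_m.+2 => (1 - q ^+ m.+1) * ((-1) ^+ k * qbin m k))); last first.
  by move=> k _; rewrite [RHS]mulrCA -qbin_lower; [ring|have := ltn_ord k; lia].
by rewrite -mulr_sumr big_ord_recr /= (qbin_small (ltnSn _)) mulr0 addr0.
Qed.

Lemma alt_qbin_prod r : alt_qbin r.*2 = \prod_(j < r) (1 - q ^+ j.*2.+1).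
Proof.
elim: r => [|r IH]; first by rewrite /alt_qbin big_ord_recl !big_ord0 /= mul1r addr0.
by rewrite doubleS alt_qbinSS IH big_ord_recr /= mulrC.
Qed.

(** As q^(n+1) = 1, the ratio (1 - q^(n-k)) / (1 - q^(k+1)) of consecutive coefficients is
    -q^(-(k+1)), and the exponents add up to a triangular number. *)
Lemma qbin_root n k : n.+1.-primitive_root q -> (k <= n)%N ->
  q ^+ (k * k.+1)./2 * qbin n k = (-1) ^+ k.
Proof.
move=> pq; elim: k => [|k IH] le; first by rewrite qbin0 mul1r.
have E := @qbin_step n k (ltnW le).
have n0 : 1 - q ^+ k.+1 != 0.
  rewrite subr_eq0 eq_sym -(prim_order_dvd pq); apply/negP => /dvdn_leq; lia.
apply: (mulfI n0).
have -> : (k.+1 * k.+2)./2 = ((k * k.+1)./2 + k.+1)%N.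
  by rewrite mulnC [(k.+2 * _)%N](_ : _ = k * k.+1 + k.+1.*2)%N; [rewrite halfD oddM /= andbN doubleK odd_double | lia].
rewrite exprD -mulrA mulrCA [_ * (_ * qbin _ _)]mulrCA E.
rewrite [(-1) ^+ k.+1]exprS -(IH (ltnW le)) [q ^+ k.+1 * (_ * _)]mulrA.
have -> : q ^+ k.+1 * (1 - q ^+ (n - k)) = q ^+ k.+1 - 1.
  by rewrite mulrBr mulr1 -exprD; congr (_ - _); rewrite -(prim_expr_order pq); congr (_ ^+ _); lia.
ring.
Qed.

Lemma gauss_product r : r.*2.+1.-primitive_root q ->
  \sum_(k < r.*2.+1) (q^-1) ^+ (k * k.+1)./2 = \prod_(j < r) (1 - q ^+ j.*2.+1).
Proof.
move=> pq; rewrite -alt_qbin_prod; apply: eq_bigr => k _.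
have q0 : q ^+ (k * k.+1)./2 != 0.
  by rewrite expf_neq0 // (prim_root_eq0 pq).
have := qbin_root pq (ltn_ord k : (k <= r.*2)%N) => E.
apply: (mulfI q0); rewrite exprVn mulfV // mulrCA E.
by rewrite -exprMn mulrNN mulr1 expr1n.
Qed.

End QBinomial.

Section GaussSum.
Context (R : realType).
Notation C := (complex R).
Local Notation e := (unity_root R).

Definition gauss_sum (a n : nat) : C := \sum_(x < n) e n ^+ (a * x ^ 2).

Lemma gauss_sum_mod a b n : (0 < n)%N -> (a = b %[mod n])%N ->
  gauss_sum a n = gauss_sum b n.
Proof.
move=> n0 ab; apply: eq_bigr => x _.
by rewrite -unity_root_per // -modnMml ab modnMml unity_root_per.
Qed.

Lemma gauss_periodic a n : (0 < n)%N -> forall x : nat,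
  e n ^+ (a * (x %% n) ^ 2) = e n ^+ (a * x ^ 2).
Proof.
move=> n0 x; rewrite -unity_root_per // -modnMmr modnXm modnMmr unity_root_per //.
Qed.

Lemma gauss_sumX a b n : (0 < n)%N -> coprime b n ->
  gauss_sum (a * b ^ 2) n = gauss_sum a n.
Proof.
move=> n0 cb; rewrite /gauss_sum.
rewrite -(sum_period_scale n0 cb (f := fun x => e n ^+ (a * x ^ 2))); last exact: gauss_periodic.
by apply: eq_bigr => x _; rewrite expnMn mulnA.
Qed.

Lemma gauss_sum_crt a m n : (0 < m)%N -> (0 < n)%N -> coprime m n ->
  gauss_sum a (m * n) = gauss_sum (a * m) n * gauss_sum (a * n) m.
Proof.
move=> m0 n0 cmn; rewrite /gauss_sum (sum_period_crt (f := fun x => e (m * n) ^+ (a * x ^ 2))) //; last first.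
  by apply: gauss_periodic; rewrite muln_gt0 m0.
rewrite big_distrl /=; apply: eq_bigr => y _; rewrite big_distrr /=.
apply: eq_bigr => z _.
have mn0 : (0 < m * n)%N by rewrite muln_gt0 m0.
rewrite -(unity_root_mul R n m0) -[e m](unity_root_mul R m n0) (mulnC n m) -!exprM -exprD.
rewrite -[LHS]unity_root_per // -[RHS]unity_root_per //; congr (_ ^+ _).
have -> : (a * (m * y + n * z) ^ 2 = (2 * a * y * z) * (m * n) +
   (m * (a * m * y ^ 2) + n * (a * n * z ^ 2)))%N by rewrite !expnS !expn0; lia.
by rewrite modnMDl.
Qed.

Lemma sum_unity_root k n : (0 < n)%N ->
  \sum_(x < n) e n ^+ (k * x) = if (n %| k)%N then n%:R else 0.
Proof. by move=> n0; apply: sum_prim_root; exact: unity_root_prim. Qed.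

(** Put x = y + p m z. The sum over z is a complete sum of p-th roots of unity with frequency 2 a y,
    so only the y divisible by p survive, and for these the exponent is the one of the modulus m. *)
Lemma gauss_sum_psq a p m : prime p -> odd p -> (0 < m)%N -> ~~ (p %| a)%N ->
  gauss_sum a (p ^ 2 * m) = p%:R * gauss_sum a m.
Proof.
move=> pp op m0 pa; have p0 := prime_gt0 pp.
have pm0 : (0 < p * m)%N by rewrite muln_gt0 p0.
have n0 : (0 < p * m * p)%N by rewrite muln_gt0 pm0.
have -> : (p ^ 2 * m = p * m * p)%N by rewrite expnS expn1; lia.
rewrite /gauss_sum (sum_mixed (fun x => e (p * m * p) ^+ (a * x ^ 2))) //.
have E (y : nat) : \sum_(z < p) e (p * m * p) ^+ (a * (y + p * m * z) ^ 2) =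
    (if (p %| y)%N then p%:R else 0) * e (p * m * p) ^+ (a * y ^ 2).
  have -> : (p %| y)%N = (p %| 2 * a * y)%N.
    by rewrite !Euclid_dvdM // (negPf pa) orbF (_ : (p %| 2)%N = false) //;
      apply/negP => /dvdn_leq => /(_ isT); have := odd_prime_gt2 op pp; lia.
  rewrite -sum_unity_root // big_distrl /=; apply: eq_bigr => z _.
  rewrite -(unity_root_mul R p pm0) -exprM -exprD.
  rewrite -[LHS]unity_root_per // -[RHS]unity_root_per //; congr (_ ^+ _).
  have -> : (a * (y + p * m * z) ^ 2 = a * m * z ^ 2 * (p * m * p) +
     (p * m * (2 * a * y * z) + a * y ^ 2))%N by rewrite !expnS !expn0; lia.
  by rewrite modnMDl.
under eq_bigr do rewrite E.
rewrite (sum_mixed (fun y => (if (p %| y)%N then p%:R else 0) * e (p * m * p) ^+ (a * y ^ 2))) //.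
rewrite -[in LHS](prednK p0) big_ord_recl /= (prednK p0).
rewrite [X in _ + X]big1 ?addr0; last first.
  move=> y _; apply: big1 => z _; rewrite dvdn_addl ?dvdn_mulr //.
  case: ifP => [/dvdn_leq|_]; last by rewrite mul0r.
  by move=> /(_ isT); have := ltn_ord y; rewrite /= /bump /=; lia.
rewrite mulr_sumr; apply: eq_bigr => z _.
have -> : e m = e (p * m * p) ^+ (p ^ 2).
  rewrite (_ : p * m * p = p ^ 2 * m)%N; last by rewrite expnS expn1; lia.
  by rewrite unity_root_mul // expn_gt0 p0.
rewrite add0n dvdn_mulr // -exprM; apply: congr1; apply: congr1.
by rewrite expnMn mulnCA.
Qed.

End GaussSum.

Section GaussEval.
Context (R : realType).
Notation C := (complex R).
Local Notation e := (unity_root R).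
Local Notation G := (gauss_sum R).

Lemma gauss_sum_residue k c p : prime p -> odd p -> ~~ (p %| c)%N ->
  [exists x : 'F_p, x ^+ 2 == c%:R] -> G (k * c) p = G k p.
Proof.
move=> pp op pc /existsP[x /eqP xc]; have p0 := prime_gt0 pp.
have E : (c = (val x) ^ 2 %[mod p])%N.
  by apply/(Fp_natP _ _ pp); rewrite natrX natr_Zp xc.
rewrite (@gauss_sum_mod _ (k * c) (k * (val x) ^ 2)) //; last by rewrite -modnMmr E modnMmr.
apply: gauss_sumX => //; rewrite coprime_sym prime_coprime //.
by apply: contra pc => d; rewrite /dvdn E -/(dvdn _ _) Euclid_dvdX // d.
Qed.

(** Multiplication by the non-residue a permutes the residues and changes the sign of the symbol, so
    the sum is its own negative. *)
Lemma sum_kronecker_prime a p : prime p -> odd p ->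
  kronecker_prime a%:Z p = -1 -> \sum_(c < p) kronecker_prime (c : nat)%:Z p = 0.
Proof.
move=> pp op ka; have p0 := prime_gt0 pp.
have ca : coprime a p.
  rewrite coprime_sym prime_coprime //; apply/negP => d.
  by move: ka; rewrite kronecker_primeE // d.
have := @sum_period_scale int p a (fun c => kronecker_prime c%:Z p) p0 ca.
have per x : kronecker_prime (x %% p)%N%:Z p = kronecker_prime x%:Z p.
  by rewrite -!kronecker_primeP //; apply: kronecker_mod; rewrite ?modn_mod.
move=> /(_ per).
under eq_bigr do rewrite kronecker_primeM // ka mulN1r.
by rewrite sumrN => /eqP; rewrite eq_sym -addr_eq0 -mulr2n mulrn_eq0 => /eqP.
Qed.

(** G c p depends only on the class of c: it is G 1 p for residues and, for a fixed non-residue a, G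
    a p for the non-residues. The sum of G c p over all c is p, which is already the term c = 0, so
    G 1 p + G a p = 0. *)
Lemma gauss_sum_prime a p : prime p -> odd p -> ~~ (p %| a)%N ->
  G a p = (kronecker_prime a%:Z p)%:~R * G 1 p.
Proof.
move=> pp op pa; have p0 := prime_gt0 pp.
have [sq|nsq] := boolP [exists x : 'F_p, x ^+ 2 == a%:R].
  rewrite kronecker_primeE // (negPf pa) sq mul1r.
  by rewrite -[a in LHS]mul1n gauss_sum_residue.
have ka : kronecker_prime a%:Z p = -1.
  by rewrite kronecker_primeE // (negPf pa) (negPf nsq).
rewrite ka; apply/eqP; rewrite mulN1r -addr_eq0; apply/eqP.
have S : \sum_(c < p) G c p = p%:R.
  rewrite /gauss_sum exchange_big /=.
  rewrite (eq_bigr (fun x : 'I_p => if x == 0%N :> nat then p%:R else 0)); last first.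
    move=> x _; under eq_bigr do rewrite mulnC; rewrite sum_unity_root //.
    rewrite Euclid_dvdX //; case: (posnP x) => [->|x0]; first by rewrite dvdn0.
    case: ifP => [/andP[d _]|//].
    by have := dvdn_leq x0 d; have := ltn_ord x; lia.
  rewrite -big_mkcond /= (big_pred1 (Ordinal p0)) //.
have key c : G c p *+ 2 = (1 + (kronecker_prime c%:Z p)%:~R) * G 1 p
   + (1 - (kronecker_prime c%:Z p)%:~R) * G a p +
   (if (p %| c)%N then p%:R *+ 2 - G 1 p - G a p else 0).
  have [d|nd] := boolP (p %| c)%N.
    rewrite kronecker_primeE // d (@gauss_sum_mod _ c 0) //; last by rewrite mod0n; apply/eqP.
    have -> : G 0 p = p%:R.
      by rewrite /gauss_sum; under eq_bigr do rewrite mul0n expr0; rewrite sumr_const card_ord.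
    ring.
  rewrite addr0 kronecker_primeE // (negPf nd); case: ifPn => [sq|nsq'].
    rewrite -[c in LHS]mul1n gauss_sum_residue //.
    by rewrite mulr1z subrr mul0r addr0 mulrDl !mul1r mulr2n.
  have kca : kronecker_prime (c * a)%N%:Z p = 1.
    by rewrite kronecker_primeM // ka kronecker_primeE // (negPf nd) (negPf nsq').
  have nca : ~~ (p %| c * a)%N by rewrite Euclid_dvdM // negb_or nd pa.
  have -> : G c p = G a p.
    have ca : coprime a p by rewrite coprime_sym prime_coprime.
    rewrite -(@gauss_sumX _ c a p) // (_ : c * a ^ 2 = a * (c * a))%N; last by rewrite expnS expn1; lia.
    apply: gauss_sum_residue => //.
    by move: kca; rewrite kronecker_primeE // (negPf nca); case: ifP.
  by rewrite mulrN1z subrr mul0r add0r opprK mulrDl !mul1r mulr2n.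
have : (\sum_(c < p) G c p) *+ 2 = p%:R *+ 2 by rewrite S.
rewrite -sumrMnl (eq_bigr _ (fun (c : 'I_p) _ => key c)) !big_split /= -!mulr_suml !big_split /=.
rewrite sumrN -!(rmorph_sum intr) /= (sum_kronecker_prime pp op ka).
rewrite sumr_const card_ord mulr0z subr0 !addr0 (bigD1 (Ordinal p0)) //= dvdn0 big1 ?addr0; last first.
  move=> c; rewrite -val_eqE /= => c0; case: ifP => // /dvdn_leq.
  by rewrite lt0n c0 => /(_ isT); have := ltn_ord c; lia.
move=> E.
have : (p%:R - 1) * (G a p + G 1 p) = 0.
  by apply/eqP; rewrite -[X in _ == X](subrr (p%:R *+ 2 : C)) -{1}E; apply/eqP; ring.
move/eqP; rewrite mulf_eq0 => /orP[|/eqP //].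
rewrite subr_eq0 -[1]/(1%:R) eqr_nat => /eqP p1.
by rewrite p1 in pp.
Qed.

(** Induction on n, removing the least prime factor p. If p^2 divides n, a factor p comes out of
    both sides; otherwise n = p m with coprime factors, and the symbols (p / m) and (m / p) created
    by the splitting are the same for a as for 1. *)
Lemma gauss_sum_kronecker a n : odd n -> coprime a n ->
  G a n = (kronecker a%:Z n)%:~R * G 1 n.
Proof.
elim/ltn_ind: n a => n IH a on can; have n0 := odd_gt0 on.
have [n1|n1] := leqP n 1.
  have -> : n = 1%N by lia.
  by rewrite kronecker1 mul1r; apply: gauss_sum_mod => //; rewrite !modn1.
have pp := pdiv_prime n1; set p := pdiv n in pp.
have /dvdnP[m nE] := pdiv_dvd n; rewrite -/p in nE.
have op : odd p by move: on; rewrite nE oddM => /andP[].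
have om : odd m by move: on; rewrite nE oddM => /andP[].
have p1 := prime_gt1 pp; have p0 := prime_gt0 pp; have m0 := odd_gt0 om.
have [ca cap] : coprime a m /\ coprime a p by apply/andP; rewrite -coprimeMr -nE.
have pa : ~~ (p %| a)%N by rewrite -prime_coprime // coprime_sym.
have [/dvdnP[m' mE]|pm] := boolP (p %| m)%N.
  have m'0 : (0 < m')%N by move: m0; rewrite mE muln_gt0 => /andP[].
  have nE' : (n = p ^ 2 * m')%N by rewrite nE mE expnS expn1; lia.
  have om' : odd m' by move: om; rewrite mE oddM => /andP[].
  have ca' : coprime a m' by move: ca; rewrite mE coprimeMr => /andP[].
  have lt' : (m' < n)%N.
    by apply: (@leq_trans m); rewrite ?nE ?leq_pmulr // mE ltn_Pmulr.
  have p1' : ~~ (p %| 1)%N by rewrite dvdn1; lia.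
  have e1 : G a n = p%:R * G a m' by rewrite nE'; exact: gauss_sum_psq.
  have e2 : G 1 n = p%:R * G 1 m' by rewrite nE'; exact: gauss_sum_psq.
  have kE : kronecker a%:Z n = kronecker a%:Z m'.
    rewrite nE' kroneckerM ?expn_gt0 ?p0 // expnS expn1 kroneckerM //.
    by case: (kronecker_coprime op cap) => ->; rewrite ?mulrNN !mul1r.
  by rewrite e1 e2 kE (IH m' lt' a om' ca') mulrCA.
have cpm : coprime p m by rewrite prime_coprime.
have nE' : n = (p * m)%N by rewrite nE mulnC.
have cmp : coprime m p by rewrite coprime_sym.
have ltm : (m < n)%N by rewrite nE' ltn_Pmull.
have pam : ~~ (p %| a * m)%N by rewrite Euclid_dvdM // negb_or pa.
have e1 : G a n = G (a * p) m * G (a * m) p by rewrite nE'; exact: gauss_sum_crt.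
have e2 : G 1 n = G p m * G m p.
  by rewrite nE' -[X in G X m]mul1n -[X in _ * G X p]mul1n; exact: gauss_sum_crt.
have cap' : coprime (a * p) m by rewrite coprimeMl ca.
have kE : kronecker a%:Z n = kronecker a%:Z m * kronecker_prime a%:Z p.
  by rewrite nE' kroneckerM // kronecker_primeP // mulrC.
rewrite e1 e2 kE (IH m ltm _ om cap') (IH m ltm _ om cpm).
rewrite (gauss_sum_prime pp op pam) (gauss_sum_prime pp op pm).
rewrite kronecker_primeM // kronecker_topM // !intrM.
set x := _%:~R; set y := _%:~R; set z := _%:~R; set t := _%:~R.
by rewrite -!mulrA [G 1 m * (z * _)]mulrCA [y * (z * _)]mulrCA.
Qed.

(** [n.-1] acts as -1, so the second factor is the conjugate sum. Substituting x = y + h leaves the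
    exponent h^2 + 2 h y, and the sum over y kills every h except 0, n being odd. *)
Lemma gauss_sum_norm n : odd n -> G 1 n * G n.-1 n = n%:R.
Proof.
move=> on; have n0 := odd_gt0 on.
have aux (N a b : nat) : (0 < N)%N ->
    (1 * (a + b) ^ 2 + N.-1 * b ^ 2 = b ^ 2 * N + (a ^ 2 + 2 * a * b))%N.
  by case: N => // N _; rewrite !expnS !expn0 /=; lia.
rewrite /gauss_sum mulr_sumr.
rewrite (eq_bigr (fun y : 'I_n => \sum_(h < n) e n ^+ (h ^ 2) * e n ^+ (2 * h * y))); last first.
  move=> y _.
  rewrite -(sum_period_shift y n0 (f := fun x => e n ^+ (1 * x ^ 2))); last exact: gauss_periodic.
  rewrite mulr_suml; apply: eq_bigr => h _; rewrite -!exprD -[LHS]unity_root_per // -[RHS]unity_root_per //.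
  by congr (_ ^+ _); rewrite aux // modnMDl.
rewrite exchange_big /=.
rewrite (eq_bigr (fun h : 'I_n => if h == Ordinal n0 then n%:R else 0)); last first.
  move=> h _; rewrite -mulr_sumr sum_unity_root // mulnC Gauss_dvdl; last by rewrite coprimen2.
  rewrite -val_eqE /=; case: (posnP h) => [->|h0]; first by rewrite dvdn0 expr0 mul1r.
  case: ifP => [/dvdn_leq|]; last by rewrite mulr0.
  by move=> /(_ h0); have := ltn_ord h; lia.
by rewrite -big_mkcond /= big_pred1_eq.
Qed.

End GaussEval.

Section GaussSign.
Context (R : realType).
Notation C := (complex R).
Local Notation e := (unity_root R).
Local Notation G := (gauss_sum R).

Lemma conj_unity_root n k : (0 < n)%N -> conjc (e n ^+ k) = e n ^+ (n.-1 * k).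
Proof.
move=> n0; rewrite unity_rootX conj_cis cisN -unity_rootX.
have u0 := unity_root_neq0 R n k.
apply: (mulfI u0); rewrite mulfV // -exprD.
rewrite (_ : k + n.-1 * k = n * k)%N; last by case: (n) n0 => // n' _ /=; lia.
by rewrite exprM (prim_expr_order (unity_root_prim R n0)) expr1n.
Qed.

Lemma conj_gauss_sum a n : (0 < n)%N -> conjc (G a n) = G (n.-1 * a) n.
Proof.
move=> n0; rewrite /gauss_sum rmorph_sum; apply: eq_bigr => x _.
transitivity (conjc (e n ^+ (a * x ^ 2))) => //.
by rewrite conj_unity_root // mulnA.
Qed.

Lemma gauss_sum1_prod r : G 1 r.*2.+1 =
  \prod_(j < r) (e r.*2.+1 ^+ j.*2.+1 - (e r.*2.+1 ^+ j.*2.+1)^-1).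
Proof.
set n := r.*2.+1; have n0 : (0 < n)%N by [].
have pw := unity_root_prim R n0; set w := e n in pw *.
have wn : w ^+ n = 1 := prim_expr_order pw.
(* q is w^(-2), because 4 r = 2 n - 2. The shift of x by r + 1 below completes the square: it turns
   x^2 into r^2 + k (k + 1) modulo n. *)
pose q := w ^+ (4 * r).
have pq : n.-primitive_root q.
  rewrite prim_root_exp_coprime // (_ : 4 * r = 2 * r.*2)%N; last by lia.
  by rewrite coprimeMl coprime2n /n /= odd_double coprimenS.
have qV : q^-1 = w ^+ 2.
  have q0 : q != 0 by apply: unity_root_neq0.
  apply: (mulfI q0); rewrite mulfV // -exprD (_ : 4 * r + 2 = n * 2)%N; last by rewrite /n; lia.
  by rewrite exprM wn expr1n.
have S : G 1 n = w ^+ (r ^ 2) * \sum_(k < n) (q^-1) ^+ (k * k.+1)./2.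
  rewrite /gauss_sum -(sum_period_shift r.+1 n0 (f := fun x => e n ^+ (1 * x ^ 2))); last exact: gauss_periodic.
  rewrite mulr_sumr; apply: eq_bigr => k _.
  rewrite qV -exprM -exprD -[LHS]unity_root_per // -[RHS]unity_root_per //.
  apply: congr1; have -> : (2 * (k * k.+1)./2 = k * k.+1)%N.
    by rewrite mul2n halfK oddM /= andbN subn0.
  have -> : (1 * (k + r.+1) ^ 2 = k.+1 * n + (r ^ 2 + k * k.+1))%N by rewrite /n !expnS !expn0; lia.
  by rewrite modnMDl.
rewrite S (gauss_product pq).
(* The prefactor is shared out among the factors, r^2 being the sum of the first r odd numbers; each
   factor becomes a root of unity minus its inverse, hence a sine. *)
have -> : w ^+ (r ^ 2) = \prod_(j < r) w ^+ j.*2.+1.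
  elim: (r) => [|k IH]; first by rewrite big_ord0.
  by rewrite big_ord_recr /= -IH -exprD; congr (_ ^+ _); rewrite !expnS !expn0; lia.
rewrite -big_split /=; apply: eq_bigr => j _.
rewrite mulrBr mulr1; congr (_ - _).
have u0 : w ^+ j.*2.+1 != 0 by apply: unity_root_neq0.
apply: (mulfI u0); rewrite mulfV // -exprM -!exprD.
rewrite (_ : _ + _ = n * (2 * j.*2.+1))%N; last by rewrite /n; lia.
by rewrite exprM wn expr1n.
Qed.

(** For odd n this is 1 or i according as n is 1 or 3 modulo 4. *)
Definition gauss_eps n : C := if odd n./2 then Complex 0 1 else 1.

(** The angle stays below pi for j < [uphalf r] and lies between pi and 2 pi for the remaining
    [r./2] values of j, where the sine is negative. *)
Lemma prod_sin_sign r : exists2 c : R, 0 < c &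
  \prod_(j < r) (2 * sin (pi *+ 2 * (j.*2.+1%:R / r.*2.+1%:R))) = (-1) ^+ r./2 * c.
Proof.
pose f (j : nat) : R := 2 * sin (pi *+ 2 * (j.*2.+1%:R / r.*2.+1%:R)).
have n0 : 0 < (r.*2.+1%:R : R) by rewrite ltr0n.
have ang j : pi *+ 2 * (j.*2.+1%:R / r.*2.+1%:R) = pi * ((2 * j.*2.+1)%:R / r.*2.+1%:R) :> R.
  by rewrite natrM -mulr_natr; ring.
have fpos j : (j < uphalf r)%N -> 0 < f j.
  move=> lt; rewrite /f mulr_gt0 // ang sin_gt0_pi // mulr_gt0 ?pi_gt0 ?divr_gt0 ?ltr0n //=.
  rewrite gtr_pMr ?pi_gt0 // ltr_pdivrMr // mul1r ltr_nat.
  by move: lt; rewrite uphalf_half; have := odd_double_half r; lia.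
have fneg j : (uphalf r <= j < r)%N -> 0 < - f j.
  move=> /andP[le lt]; rewrite /f -mulrN mulr_gt0 //.
  have -> : pi *+ 2 * (j.*2.+1%:R / r.*2.+1%:R) = (pi *+ 2 * (j.*2.+1%:R / r.*2.+1%:R) - pi) + pi :> R by rewrite subrK.
  rewrite sinDpi opprK; apply: sin_gt0_pi.
  have -> : pi *+ 2 * (j.*2.+1%:R / r.*2.+1%:R) - pi = pi * ((2 * j.*2.+1%:R - r.*2.+1%:R) / r.*2.+1%:R) :> R.
    by rewrite -mulr_natr; field; rewrite gt_eqF.
  rewrite mulr_gt0 ?pi_gt0 ?divr_gt0 // -?natrM ?subr_gt0 ?ltr_nat //=.
    rewrite gtr_pMr ?pi_gt0 // ltr_pdivrMr // mul1r ltrBlDr -natrD ltr_nat.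
    by move: lt; lia.
  by move: le; rewrite uphalf_half; have := odd_double_half r; lia.
have le : (uphalf r <= r)%N by rewrite uphalf_half; have := odd_double_half r; lia.
rewrite -(big_mkord xpredT f) (big_cat_nat (leq0n _) le) //=.
exists (\prod_(0 <= j < uphalf r) f j * \prod_(uphalf r <= j < r) (- f j)).
  apply: mulr_gt0; rewrite big_nat; apply: prodr_gt0 => j.
    by move=> /andP[_]; exact: fpos.
  exact: fneg.
rewrite mulrCA; congr (_ * _).
have -> : r./2 = (r - uphalf r)%N by rewrite uphalf_half; have := odd_double_half r; lia.
rewrite -(prodr_const_nat (uphalf r) r (-1 : R)) -big_split /=.
by apply: eq_bigr => j _; rewrite mulN1r opprK.
Qed.

(** By [gauss_sum1_prod] the r factors are 2 i sin; i^r and the sign (-1)^(r./2) of the sines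
    combine to 1 or i. *)
Lemma gauss_sum1_sign n : odd n -> exists2 c : R, 0 < c & G 1 n = gauss_eps n * Complex c 0.
Proof.
move=> on; have nE : n = n./2.*2.+1 by have := odd_double_half n; rewrite on; lia.
rewrite /gauss_eps; set r := n./2 in nE *; rewrite nE gauss_sum1_prod.
have [c c0 cE] := prod_sin_sign r; exists c => //.
rewrite (eq_bigr (fun j : 'I_r => Complex 0 1 *
   Complex (2 * sin (pi *+ 2 * (j.*2.+1%:R / r.*2.+1%:R))) 0)); last first.
  move=> j _; rewrite unity_rootX -cisN /cis cosN sinN.
  apply/eqP; rewrite eq_complex /=; apply/andP; split; apply/eqP; ring.
rewrite big_split /= prodr_const card_ord -(rmorph_prod (real_complex R)) /= cE.
have i2 : (Complex 0 1 : C) ^+ 2 = -1 by exact: sqr_i.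
rewrite -[X in _ ^+ X](odd_double_half r) exprD -mul2n exprM i2.
rewrite rmorphM rmorphXn rmorphN1 mulrA -[X in X * _ = _]mulrA -exprMn mulrNN mulr1 expr1n mulr1.
by congr (_ * _); case: (odd r); rewrite ?expr1 ?expr0.
Qed.

Lemma gauss_sum1E n : odd n -> G 1 n = gauss_eps n * Complex (Num.sqrt n%:R) 0.
Proof.
move=> on; have n0 := odd_gt0 on; have [c c0 E] := gauss_sum1_sign on.
have := gauss_sum_norm R on.
have -> : G n.-1 n = conjc (G 1 n) by rewrite conj_gauss_sum // muln1.
rewrite E => N.
have N2 : (c ^+ 2 = n%:R).
  apply: (@complexI R); rewrite rmorph_nat -N /gauss_eps; case: odd;
  by apply/eqP; rewrite eq_complex /=; apply/andP; split; apply/eqP; ring.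
by rewrite -N2 sqrtr_sqr gtr0_norm.
Qed.

End GaussSign.

Lemma odd_halfM m n : odd m -> odd n -> odd (m * n)./2 = odd m./2 (+) odd n./2.
Proof.
move=> om on.
have aux a b : ((a.*2.+1 * b.*2.+1)./2 = (a * b).*2 + a + b)%N.
  have -> : (a.*2.+1 * b.*2.+1 = ((a * b).*2 + a + b).*2.+1)%N by rewrite -!muln2; lia.
  by rewrite /= uphalf_double.
have mE : m = m./2.*2.+1 by have := odd_double_half m; rewrite om.
have nE : n = n./2.*2.+1 by have := odd_double_half n; rewrite on.
by rewrite {1}mE {1}nE aux !oddD odd_double.
Qed.

(** * Quadratic reciprocity with its two supplements *)

Section Reciprocity.
Context (R : realType).
Notation C := (complex R).
Local Notation e := (unity_root R).
Local Notation G := (gauss_sum R).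

Lemma intrC_inj (x y : int) : x%:~R = y%:~R :> C -> x = y.
Proof. exact: intr_inj. Qed.

(** First supplement, with [n.-1] standing for -1: compare [gauss_sum_norm] with the square of the
    Gauss sum in closed form. *)
Lemma kronecker_pred n : odd n -> kronecker (n.-1)%:Z n = (-1) ^+ n./2.
Proof.
move=> on; have n0 := odd_gt0 on.
have cn : coprime n.-1 n by rewrite -{2}(prednK n0) coprimenS.
have E : (kronecker (n.-1)%:Z n)%:~R * G 1 n ^+ 2 = n%:R.
  by rewrite -(gauss_sum_norm R on) (gauss_sum_kronecker R on cn) mulrCA.
apply: (@intrC_inj); move: E; rewrite (gauss_sum1E R on) exprMn.
have -> : (Complex (Num.sqrt n%:R) 0 : C) ^+ 2 = n%:R.
  by rewrite -(rmorphXn (real_complex R)) /= sqr_sqrtr ?ler0n // rmorph_nat.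
rewrite mulrA -[X in _ = X]mul1r => /mulIf E.
have {}E := E ltac:(by rewrite pnatr_eq0 gtn_eqF).
move: E; rewrite -signr_odd /gauss_eps; case: odd; rewrite ?expr1n ?mulr1 //=.
by rewrite sqr_i mulrN1 => /eqP; rewrite eqr_oppLR => /eqP ->; rewrite expr1 rmorphN1.
Qed.

(** The splitting of G 1 (m n) produces both symbols, and all three Gauss sums are known exactly, so
    the product of the symbols is the quotient of their factors [gauss_eps]. *)
Lemma quadratic_reciprocity m n : odd m -> odd n -> coprime m n ->
  kronecker m%:Z n * kronecker n%:Z m = (-1) ^+ (m./2 * n./2).
Proof.
move=> om on cmn; have m0 := odd_gt0 om; have n0 := odd_gt0 on.
have cnm : coprime n m by rewrite coprime_sym.
have omn : odd (m * n) by rewrite oddM om.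
have E : G 1 (m * n) = (kronecker m%:Z n * kronecker n%:Z m)%:~R * (G 1 n * G 1 m).
  rewrite gauss_sum_crt // !mul1n (gauss_sum_kronecker R on cmn) (gauss_sum_kronecker R om cnm).
  by rewrite intrM mulrACA.
apply: (@intrC_inj); move: E; rewrite !(gauss_sum1E R) // natrM sqrtrM ?ler0n //.
set a := Num.sqrt n%:R; set b := Num.sqrt m%:R; set k := _%:~R.
have a0 : a != 0 by rewrite gt_eqF // sqrtr_gt0 ltr0n.
have b0 : b != 0 by rewrite gt_eqF // sqrtr_gt0 ltr0n.
have -> : (Complex (b * a) 0 : C) = Complex a 0 * Complex b 0.
  by rewrite mulrC -(rmorphM (real_complex R)).
rewrite [X in _ = _ * X]mulrACA [RHS]mulrA => /mulIf E.
have {}E := E ltac:(by rewrite mulf_neq0 // (fmorph_eq0 (real_complex R))).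
move: E; rewrite -signr_odd oddM /gauss_eps odd_halfM //.
have i2 : (Complex 0 1 : C) * Complex 0 1 = -1 by rewrite -expr2; exact: sqr_i.
have i0 : (Complex 0 1 : C) != 0 by rewrite eq_complex /= oner_eq0 andbF.
case: (odd m./2); case: (odd n./2); rewrite /= ?mulr1 ?mul1r ?expr0 ?expr1 ?rmorphN1 => E //.
- by move: E; rewrite i2 mulrN1 => /eqP; rewrite eq_sym eqr_oppLR => /eqP.
- by apply: (mulIf i0); rewrite -E mul1r.
- by apply: (mulIf i0); rewrite -E mul1r.
Qed.

(** The symbol (2 / n) for odd n; at even n the value -1 is a mere default. *)
Definition chi_two (n : nat) : int := if (n %% 8 == 1)%N || (n %% 8 == 7)%N then 1 else -1.

Lemma chi_two_mod n : chi_two (n %% 8) = chi_two n.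
Proof. by rewrite /chi_two modn_mod. Qed.

Lemma chi_two_step m : odd m -> chi_two m.+2 = (-1) ^+ m./2.+1 * chi_two m.
Proof.
have lt : (m %% 8 < 8)%N by rewrite ltn_mod.
rewrite (divn_eq m 8) -signr_odd; move: (m %/ 8)%N (m %% 8)%N lt => t r lt.
have -> : ((t * 8 + r)./2.+1 = (t * 2).*2 + r./2.+1)%N.
  rewrite (_ : t * 8 = (t * 4).*2)%N ?halfD ?odd_double ?doubleK; last by rewrite -muln2; lia.
  by rewrite add0n -muln2; lia.
rewrite oddD oddM andbF addFb [odd (_ + _)]oddD odd_double addFb -2!addnS -(chi_two_mod (_ + _)) -(chi_two_mod (_ + r)) !modnMDl.
by move: r lt; do 8?[case=> [|]//].
Qed.

(** Second supplement, by steps of 2: reciprocity between n - 2 and n relates (n / (n - 2)) = (2 /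
    (n - 2)) to ((n - 2) / n) = (-2 / n). *)
Lemma kronecker_two n : odd n -> kronecker 2%N%:Z n = chi_two n.
Proof.
elim/ltn_ind: n => n IH on.
have [n3|n3] := leqP 3 n; last first.
  have -> : n = 1%N by move: on n3; case: n {IH} => [|[|[|]]].
  by rewrite kronecker1.
have n0 := odd_gt0 on; have [m nE] : exists m, n = m.+2 by exists n.-2; lia.
have om : odd m by move: on; rewrite nE /= negbK.
have := IH m ltac:(by rewrite nE) om => IHm.
have cmn : coprime m n by rewrite nE -addn2 /coprime gcdnDl -/(coprime m 2) coprimen2.
have := quadratic_reciprocity om on cmn.
have -> : kronecker n%:Z m = chi_two m.
  by rewrite -IHm; apply: kronecker_mod => //; rewrite nE -addn2 modnDl.
have -> : kronecker m%:Z n = kronecker (n.-1)%:Z n * kronecker 2%N%:Z n.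
  have sq : kronecker (n.-1)%:Z n ^+ 2 = 1 by rewrite kronecker_pred // -exprM mulnC exprM sqrrN !expr1n.
  rewrite -[LHS]mul1r -sq expr2 -mulrA; congr (_ * _).
  rewrite -kronecker_topM //; apply: kronecker_mod => //.
  have -> : (n.-1 * m = 2 + (m - 1) * n)%N by rewrite nE /=; nia.
  by rewrite addnC modnMDl.
rewrite kronecker_pred // nE chi_two_step //=.
have -> : (-1) ^+ (m./2 * m./2.+1) = 1 :> int.
  by rewrite -signr_odd oddM /= andbN.
have s2 : ((-1) ^+ m./2.+1 * (-1) ^+ m./2.+1 : int) = 1 by rewrite -exprMn mulrNN mulr1 expr1n.
have c2 : (chi_two m * chi_two m) = 1 by rewrite /chi_two; case: ifP.
move=> E; rewrite -[LHS]mul1r -[X in X * _]s2 -mulrA; congr (_ * _).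
by rewrite -[LHS]mulr1 -[X in _ * X = _]c2 mulrA E mul1r.
Qed.

End Reciprocity.

(** The last clause is primitivity: a c that is 1 modulo k / p but has value -1 shows that psi is
    not induced from the modulus k / p. *)
Definition real_primitive (k : nat) (psi : nat -> int) : Prop :=
  [/\ (0 < k)%N,
      forall x, psi (x %% k)%N = psi x,
      forall x y, psi (x * y)%N = psi x * psi y,
      forall x, psi x = if coprime x k then psi x else 0 &
      (forall x, coprime x k -> psi x = 1 \/ psi x = -1) /\
      forall p, prime p -> (p %| k)%N ->
        exists c, [/\ coprime c k, c = 1 %[mod k %/ p] & psi c = -1]].

(** * Gauss sums of real primitive characters, and in particular of [chi8 d] *)

Section PrimitiveGauss.
Context (F : numFieldType) (k : nat) (psi : nat -> int) (w : F).
Hypothesis psiP : real_primitive k psi.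
Hypothesis pw : k.-primitive_root w.

Definition char_gauss : F := \sum_(a < k) (psi a)%:~R * w ^+ a.

Lemma char_gauss_twist h :
  \sum_(a < k) (psi a)%:~R * w ^+ (a * h) = (psi h)%:~R * char_gauss.
Proof.
case: psiP => k0 per mul nc [val prim].
have wper x : w ^+ (x %% k) = w ^+ x := prim_expr_mod pw x.
have perh (x : nat) : (psi (x %% k)%N)%:~R * w ^+ (x %% k * h) = (psi x)%:~R * w ^+ (x * h) :> F.
  by rewrite per -wper modnMml wper.
have [ch|nch] := boolP (coprime h k).
  have sq : (psi h)%:~R * (psi h)%:~R = 1 :> F.
    by case: (val h ch) => ->; rewrite ?rmorphN1 ?mulrNN mulr1.
  rewrite -[LHS]mul1r -[X in X * _ = _]sq -mulrA; congr (_ * _).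
  rewrite /char_gauss -(sum_period_scale k0 ch (f := fun a => (psi a)%:~R * w ^+ a)); last first.
    by move=> x; rewrite per wper.
  by rewrite mulr_sumr; apply: eq_bigr => a _; rewrite mul intrM mulrA mulnC.
rewrite nc (negPf nch) mul0r.
have g1 : (gcdn h k != 1)%N by [].
have gk : (1 < gcdn h k)%N by have := gcdn_gt0 h k; rewrite k0 orbT; lia.
have pp := pdiv_prime gk; set p := pdiv _ in pp.
have /andP[ph pk] : (p %| h)%N && (p %| k)%N by rewrite -dvdn_gcd pdiv_dvd.
have [c [cc c1 pc]] := prim p pp pk.
(* Since p divides h and c is 1 modulo k / p, multiplication by c does not change b h modulo k, yet
   it changes the sign of psi; the sum is therefore its own negative. *)
have aux (b : nat) : (c * b * h = b * h %[mod k])%N.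
  have [h' hE] := dvdnP ph; have [k' kE] := dvdnP pk.
  have kk : (k %/ p = k')%N by rewrite kE mulnK // prime_gt0.
  rewrite kk in c1; rewrite hE kE !mulnA -!muln_modl -!mulnA; congr (_ * _)%N.
  by rewrite -modnMml c1 modnMml mul1n.
set S := (X in X = 0).
have : S = - S.
  rewrite {1}/S -(sum_period_scale k0 cc (f := fun a => (psi a)%:~R * w ^+ (a * h))) //.
  rewrite -sumrN; apply: eq_bigr => a _; rewrite mul pc mulN1r rmorphN mulNr; congr (- (_ * _)).
  by rewrite -[LHS]wper -[RHS]wper aux.
move/eqP; rewrite -addr_eq0 -mulr2n mulrn_eq0 => /eqP //.
Qed.

(** The twisted sums psi(h) tau are summed over h against w^(-h), with [k.-1] standing for -1: read
    one way, orthogonality leaves a = 1; read the other way, the sum over h is itself a twisted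
    Gauss sum. *)
Lemma char_gauss_sqr : char_gauss ^+ 2 = (psi k.-1)%:~R * k%:R.
Proof.
case: psiP => k0 per mul nc [val prim].
have p1 : psi 1%N = 1.
  have c1 : coprime 1 k by rewrite coprime1n.
  have := mul 1%N 1%N; rewrite mul1n; case: (val 1%N c1) => -> //.
have E : \sum_(h < k) (psi h)%:~R * char_gauss * w ^+ (h * k.-1) = k%:R.
  transitivity (\sum_(h < k) \sum_(a < k) (psi a)%:~R * w ^+ (a * h) * w ^+ (h * k.-1)).
    by apply: eq_bigr => h _; rewrite -mulr_suml char_gauss_twist.
  rewrite exchange_big /=.
  transitivity (\sum_(a < k) (psi a)%:~R * (if (k %| a + k.-1)%N then k%:R else 0 : F)).
    apply: eq_bigr => a _; rewrite -(sum_prim_root _ pw) mulr_sumr; apply: eq_bigr => h _.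
    by rewrite -mulrA -exprD mulnDl [(h * _)%N]mulnC.
  have [k1|k1] := leqP k 1.
    have ke : k = 1%N by lia.
    have p0 : psi 0%N = 1 by rewrite -p1 -(per 1%N) ke modn1.
    by rewrite ke big_ord1 /= p0 mulr1.
  rewrite (bigD1 (Ordinal k1)) //= add1n prednK // dvdnn p1 mul1r big1 ?addr0 // => a.
  rewrite -val_eqE /= => a1; case: ifP => [d|]; last by rewrite mulr0.
  have := ltn_ord a; case: (posnP a) => a0; move: d.
    by rewrite a0 add0n => /dvdn_leq; lia.
  rewrite (_ : a + k.-1 = k + a.-1)%N; last by lia.
  by rewrite dvdn_addr // => /dvdn_leq; lia.
rewrite -E.
have -> : \sum_(h < k) (psi h)%:~R * char_gauss * w ^+ (h * k.-1) = char_gauss * ((psi k.-1)%:~R * char_gauss).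
  rewrite -char_gauss_twist mulr_sumr; apply: eq_bigr => h _.
  by rewrite [_ * char_gauss]mulrC mulrA.
rewrite mulrCA mulrA; have sq : (psi k.-1)%:~R * (psi k.-1)%:~R = 1 :> F.
  have ck : coprime k.-1 k by rewrite -{2}(prednK k0) coprimenS.
  by case: (val _ ck) => ->; rewrite ?rmorphN1 ?mulrNN mulr1.
by rewrite -mulrA [(psi k.-1)%:~R * (_ * _)]mulrA sq mul1r expr2.
Qed.

End PrimitiveGauss.

Lemma chi8_mul d m n : (0 < d)%N -> chi8 d (m * n) = chi8 d m * chi8 d n.
Proof.
move=> d0; have z : kronecker (8 * d)%N%:Z 0 = 0.
  by rewrite /kronecker eqxx absz_nat (_ : (8 * d == 1)%N = false) //; apply/eqP; lia.
rewrite /chi8; case: (posnP m) => [->|m0]; first by rewrite mul0n z mul0r.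
case: (posnP n) => [->|n0]; first by rewrite muln0 z mulr0.
exact: kroneckerM.
Qed.

Lemma coprime8 d n : coprime n (8 * d) = odd n && coprime n d.
Proof. by rewrite coprimeMr -[8%N]/(2 ^ 3)%N coprime_pexpr // coprimen2. Qed.

(** (8 d / n) = (2 / n) (d / n), since 4 is a square. Reciprocity then makes n the upper argument,
    so that the dependence on n modulo 8 d becomes visible. *)
Lemma chi8E (R : realType) d n : odd d -> odd n -> coprime n d ->
  chi8 d n = chi_two n * ((-1) ^+ (n./2 * d./2) * kronecker n%:Z d).
Proof.
move=> od on cnd; rewrite /chi8 (_ : 8 * d = 2 * (2 * 2 * d))%N; last by lia.
rewrite !kronecker_topM // !(kronecker_two R on).
have c2 : (chi_two n * chi_two n) = 1 by rewrite /chi_two; case: ifP.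
rewrite c2 mul1r; congr (_ * _).
have cdn : coprime d n by rewrite coprime_sym.
rewrite -(quadratic_reciprocity R on od cnd).
have sq : kronecker n%:Z d * kronecker n%:Z d = 1.
  by case: (kronecker_coprime od cnd) => ->.
by rewrite mulrAC sq mul1r.
Qed.

Lemma chi8_ncoprime d n : (0 < d)%N -> ~~ coprime n (8 * d) -> chi8 d n = 0.
Proof.
move=> d0 nc; case: (posnP n) => [->|n0].
  by rewrite /chi8 /kronecker eqxx absz_nat (_ : (8 * d == 1)%N = false) //; apply/eqP; lia.
by apply: kronecker_ncoprime => //; rewrite absz_nat coprime_sym.
Qed.

(** If every element of ['F_p] were a square, squaring would be a bijection, although 1 and -1 have
    the same square. *)
Lemma nonresidue p : prime p -> odd p -> exists c, kronecker_prime c%:Z p = -1 /\ ~~ (p %| c)%N.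
Proof.
move=> pp op; have p0 := prime_gt0 pp; have p2 := odd_prime_gt2 op pp.
have [[x xE]|H] := pselect (exists x : 'F_p, forall y : 'F_p, y ^+ 2 != x).
  have x0 : x != 0 by apply/eqP => x0; have := xE 0; rewrite x0 expr0n eqxx.
  have nd : ~~ (p %| val x)%N by rewrite -Fp_nat_eq0 // natr_Zp.
  exists (val x); split=> //; rewrite kronecker_primeE // (negPf nd).
  by case: existsP => // -[y]; rewrite natr_Zp (negPf (xE y)).
have surj (x : 'F_p) : exists y : 'F_p, y ^+ 2 == x.
  apply: contrapT => nE; apply: H; exists x => y; apply/negP => e; apply: nE; exists y; exact: e.
pose g (x : 'F_p) : 'F_p := xchoose (surj x).
have gK x : (g x) ^+ 2 = x by apply/eqP; exact: (xchooseP (surj x)).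
have ginj : injective g by move=> x y E; rewrite -(gK x) E gK.
have [h gh hg] : bijective g by apply: injF_bij.
have sinj (x y : 'F_p) : x ^+ 2 = y ^+ 2 -> x = y.
  by rewrite -(hg x) -(hg y) !gK => ->.
have : (1 : 'F_p) = -1 by apply: sinj; rewrite sqrrN.
move/eqP; rewrite -subr_eq0 opprK -[1 + 1]/(2%:R) Fp_nat_eq0 // => /dvdn_leq => /(_ isT).
by rewrite leqNgt p2.
Qed.

Lemma squarefree_coprime d p m : squarefree d -> prime p -> d = (p * m)%N -> coprime p m.
Proof.
move=> /andP[d0 /allP H] pp dE; rewrite prime_coprime //; apply/negP => /dvdnP[m' mE].
have dd : (p ^ 2 %| d)%N by rewrite dE mE mulnCA dvdn_mull // expnS expn1.
have : p \in divisors d by rewrite -dvdn_divisors // dE dvdn_mulr.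
by move/H; rewrite dd /= => /eqP p1; rewrite p1 in pp.
Qed.

(** The witness is a non-residue modulo p and 1 modulo 8 d / p; it serves for primitivity both
    modulo d and modulo 8 d. *)
Lemma kronecker_nonresidue d p : odd d -> squarefree d -> prime p -> (p %| d)%N ->
  exists c, [/\ coprime c (8 * d), c = 1 %[mod 8 * (d %/ p)] & kronecker c%:Z d = -1].
Proof.
move=> od sd pp pd; have [m mE] := dvdnP pd; rewrite mulnC in mE.
have p0 := prime_gt0 pp.
have [om op] : odd m /\ odd p by move: od; rewrite mE oddM => /andP[].
have cpm := squarefree_coprime sd pp mE.
have [a [ka na]] := nonresidue pp op.
have c8 : coprime (8 * m) p.
  by rewrite coprimeMl (coprime_sym m) cpm -[8%N]/(2 ^ 3)%N coprimeXl // coprime2n.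
pose c := chinese (8 * m) p 1 a.
have cm : (c = 1 %[mod 8 * m])%N by apply: chinese_modl.
have cp : (c = a %[mod p])%N by apply: chinese_modr.
exists c; split.
- rewrite mE (_ : 8 * (p * m) = 8 * m * p)%N; last by lia.
  rewrite coprimeMr; apply/andP; split.
    by rewrite -coprime_modl cm coprime_modl coprime1n.
  by rewrite -coprime_modl cp coprime_modl coprime_sym prime_coprime.
- by rewrite mE mulKn.
have m0 := odd_gt0 om.
rewrite mE kroneckerM // kronecker_primeP //.
have -> : kronecker_prime c%:Z p = -1.
  by rewrite -ka -!kronecker_primeP //; apply: kronecker_mod.
rewrite (@kronecker_mod c 1 m om); last by rewrite -(modn_dvdm c (dvdn_mull 8 (dvdnn m))) cm modn_dvdm ?dvdn_mull.
have k1 : kronecker 1%N%:Z m * kronecker 1%N%:Z m = kronecker 1%N%:Z m by rewrite -kronecker_topM.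
by move: k1; case: (@kronecker_coprime 1 m om (coprime1n m)) => ->.
Qed.

Lemma kronecker_real_primitive g : odd g -> squarefree g -> (1 < g)%N ->
  real_primitive g (fun x => kronecker x%:Z g).
Proof.
move=> og sg g1; have g0 := odd_gt0 og; split => //.
- by move=> x; apply: kronecker_mod; rewrite ?modn_mod.
- by move=> x y; apply: kronecker_topM.
- by move=> x; case: ifPn => // nc; apply: kronecker_ncoprime => //; rewrite absz_nat.
split=> [x cx|p pp pg]; first exact: kronecker_coprime.
have [c [cc c1 kc]] := kronecker_nonresidue og sg pp pg; exists c; split => //.
  by move: cc; rewrite coprimeMr => /andP[].
by rewrite -(modn_dvdm c (dvdn_mull 8 (dvdnn _))) c1 modn_dvdm // dvdn_mull.
Qed.

Lemma chi_two_dvd x y N : (8 %| N)%N -> (x = y %[mod N])%N -> chi_two x = chi_two y.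
Proof.
move=> d e; rewrite -chi_two_mod -[RHS]chi_two_mod; congr chi_two.
by rewrite -(modn_dvdm x d) e modn_dvdm.
Qed.

Lemma odd_half_dvd x y N : (8 %| N)%N -> (x = y %[mod N])%N -> odd x./2 = odd y./2.
Proof.
have H z : odd z./2 = odd (z %% 4)./2.
  rewrite {1}(divn_eq z 4) (_ : z %/ 4 * 4 = (z %/ 4 * 2).*2)%N; last by rewrite -muln2; lia.
  by rewrite halfD odd_double add0n doubleK oddD oddM andbF.
move=> d e; have d4 : (4 %| N)%N by apply: dvdn_trans d.
by rewrite H [RHS]H -(modn_dvdm x d4) e modn_dvdm.
Qed.

Lemma chi8_real_primitive (R : realType) d : odd d -> squarefree d ->
  real_primitive (8 * d) (chi8 d).
Proof.
move=> od sd; have d0 := odd_gt0 od; have q0 : (0 < 8 * d)%N by rewrite muln_gt0.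
have val x : coprime x (8 * d) -> chi8 d x = 1 \/ chi8 d x = -1.
  by rewrite coprime8 => /andP[ox cx]; apply: kronecker_coprime => //; rewrite coprime_sym coprime8 ox.
split => //.
- move=> x; have cE : coprime (x %% (8 * d)) (8 * d) = coprime x (8 * d) by rewrite coprime_modl.
  have [cx|nx] := boolP (coprime x (8 * d)); last by rewrite !chi8_ncoprime ?cE.
  have /andP[ox cxd] : odd x && coprime x d by rewrite -coprime8.
  have /andP[ox' cxd'] : odd (x %% (8 * d)) && coprime (x %% (8 * d)) d by rewrite -coprime8 cE.
  have e : (x %% (8 * d) = x %[mod 8 * d])%N by rewrite modn_mod.
  rewrite !(chi8E R) // (chi_two_dvd _ e) ?dvdn_mulr //.
  rewrite -signr_odd oddM (odd_half_dvd _ e) ?dvdn_mulr // -oddM signr_odd.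
  rewrite (@kronecker_mod (x %% (8 * d)) x) //.
  by rewrite modn_dvdm // dvdn_mull.
- by move=> x y; exact: chi8_mul.
- by move=> x; case: ifPn => // nc; exact: chi8_ncoprime.
split=> // p pp pq.
have [p2|p2] := eqVneq p 2%N.
  have E : (8 * d %/ p = 4 * d)%N by rewrite p2 (_ : 8 * d = 4 * d * 2)%N ?mulnK //; lia.
  have c1 : coprime (1 + 4 * d) (8 * d).
    rewrite coprime8 oddD oddM /=.
    by rewrite /coprime addnC gcdnC gcdnMDl -/(coprime d 1) coprimen1.
  (* 1 + 4 d is 1 modulo 4 d, hence modulo d, but 5 modulo 8 as d is odd, and [chi_two] is -1
     there. *)
  exists (1 + 4 * d)%N; split=> //; first by rewrite E modnDr.
  have /andP[odd1 cd1] : odd (1 + 4 * d) && coprime (1 + 4 * d) d by rewrite -coprime8.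
  rewrite (chi8E R) //.
  have -> : kronecker (1 + 4 * d)%N%:Z d = kronecker 1%N%:Z d.
    by apply: kronecker_mod => //; rewrite addnC modnMDl.
  have -> : kronecker 1%N%:Z d = 1.
    have k1 : kronecker 1%N%:Z d * kronecker 1%N%:Z d = kronecker 1%N%:Z d by rewrite -kronecker_topM.
    by move: k1; case: (@kronecker_coprime 1 d od (coprime1n d)) => ->.
  have -> : chi_two (1 + 4 * d) = -1.
    rewrite -chi_two_mod.
    have -> : ((1 + 4 * d) %% 8 = 5)%N.
      have := odd_double_half d; rewrite od => <-.
      rewrite (_ : 1 + 4 * (true + d./2.*2) = d./2 * 8 + 5)%N; last by rewrite -muln2; lia.
      by rewrite modnMDl.
    by [].
  have -> : ((1 + 4 * d)./2 = d.*2)%N by rewrite (_ : 1 + 4 * d = d.*2.*2.+1)%N /= ?uphalf_double //; rewrite -!muln2; lia.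
  by rewrite -signr_odd oddM odd_double.
have pd : (p %| d)%N.
  move: pq; rewrite Euclid_dvdM // => /orP[|//].
  by rewrite -[8%N]/(2 ^ 3)%N Euclid_dvdX // dvdn_prime2 // => /andP[/eqP]; lia.
have [c [cc c1 kc]] := kronecker_nonresidue od sd pp pd; exists c; split => //.
  by rewrite -muln_divA.
have /andP[oc ccd] : odd c && coprime c d by rewrite -coprime8.
rewrite (chi8E R) // kc (chi_two_dvd _ c1) ?dvdn_mulr //.
rewrite -signr_odd oddM (odd_half_dvd _ c1) ?dvdn_mulr //=.
Qed.

Section GaussSignChi8.
Context (R : realType).
Notation C := (complex R).
Local Notation e := (unity_root R).
Local Notation G := (gauss_sum R).

Lemma unity_root8 : e 8 = Complex (Num.sqrt 2 / 2) (Num.sqrt 2 / 2).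
Proof.
have c0 : 0 < cos (pi / 4) :> R.
  by apply: cos_gt0_pihalf; rewrite (lt_trans _ (_ : 0 < _)) ?oppr_lt0 ?divr_gt0 ?pi_gt0 //= ltr_pM2l ?pi_gt0 // ltf_pV2 ?posrE // ltr_nat.
have sc : sin (pi / 4) = cos (pi / 4) :> R.
  by rewrite -cosBpihalf -cosN; congr cos; field.
have E := cos2Dsin2 (pi / 4 : R); rewrite sc in E.
have cE : cos (pi / 4) = Num.sqrt 2 / 2 :> R.
  apply: (@pexpIrn R 2) => //; rewrite ?nnegrE ?ltW ?divr_gt0 ?sqrtr_gt0 //.
  by rewrite exprMn sqr_sqrtr // exprVn; lra.
rewrite /unity_root /cis (_ : pi *+ 2 / 8 = pi / 4); last by rewrite -mulr_natr; field.
by rewrite sc cE.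
Qed.

Lemma gauss_sum8 u : odd u -> G u 8 = 4 * e 8 ^+ u.
Proof.
move=> ou; have p8 := @unity_root_per R 8 isT.
have w4 : e 8 ^+ 4 = -1.
  rewrite unity_root8; apply/eqP; rewrite eq_complex /=.
  have := sqr_sqrtr (ler0n R 2) => s2.
  by apply/andP; split; apply/eqP; rewrite !expr2 in s2 *; nra.
have H x y : (x = y %[mod 8])%N -> e 8 ^+ x = e 8 ^+ y by move=> h; rewrite -p8 h p8.
have wu4 : e 8 ^+ (u * 4) = -1.
  by rewrite mulnC exprM w4 -signr_odd ou.
rewrite /gauss_sum !big_ord_recl big_ord0 /= /bump /=.
rewrite !(muln0, muln1, expn0, expr0) addr0.
rewrite (H (u * 3 ^ 2)%N u); last by rewrite (_ : u * 3 ^ 2 = u * 8 + u)%N ?modnMDl //; lia.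
rewrite (H (u * 5 ^ 2)%N u); last by rewrite (_ : u * 5 ^ 2 = u * 3 * 8 + u)%N ?modnMDl //; lia.
rewrite (H (u * 7 ^ 2)%N u); last by rewrite (_ : u * 7 ^ 2 = u * 6 * 8 + u)%N ?modnMDl //; lia.
rewrite (H (u * 4 ^ 2)%N 0%N); last by rewrite (_ : u * 4 ^ 2 = u * 2 * 8 + 0)%N ?modnMDl //; lia.
rewrite (H (u * 6 ^ 2)%N (u * 4)%N); last by rewrite (_ : u * 6 ^ 2 = u * 4 * 8 + u * 4)%N ?modnMDl //; lia.
rewrite wu4 expr0; ring.
Qed.

(** All quantities, among them i = w^2 and sqrt 2 = w - w^3, are integer combinations of powers of
    the eighth root of unity w, and the identity is verified for each pair of odd residues modulo
    8. *)
Lemma chi8_eighth_roots n d : (n < 8)%N -> (d < 8)%N -> odd n -> odd d ->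
  Complex (Num.sqrt 2) 0 * (chi_two n * (-1) ^+ (odd n./2 && odd d./2))%:~R =
  (1 + Complex 0 (-1) ^+ n) * ((chi_two d)%:~R * gauss_eps R d * e 8 ^+ (n * d)).
Proof.
have p8 := @unity_root_per R 8 isT.
have wi : Complex 0 1 = e 8 ^+ 2 :> C.
  rewrite unity_root8; apply/eqP; rewrite eq_complex /=.
  have := sqr_sqrtr (ler0n R 2) => s2.
  by apply/andP; split; apply/eqP; rewrite !expr2 in s2 *; nra.
have w4 : e 8 ^+ 4 = -1 by rewrite -[4%N]/(2 * 2)%N exprM -wi; exact: sqr_i.
have wN : Complex 0 (-1) = e 8 ^+ 6 :> C.
  by rewrite (exprD _ 4 2) w4 -wi mulN1r; apply/eqP; rewrite eq_complex /= oppr0 !eqxx.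
have w2 : Complex (Num.sqrt 2) 0 = e 8 - e 8 ^+ 3.
  rewrite exprS -wi unity_root8; apply/eqP; rewrite eq_complex /=.
  by apply/andP; split; apply/eqP; field.
set w := e 8 in p8 wi w4 wN w2 *.
have w5 : w ^+ 5 = - w by rewrite (exprD _ 4 1) w4 mulN1r expr1.
have w6 : w ^+ 6 = - w ^+ 2 by rewrite (exprD _ 4 2) w4 mulN1r.
have w7 : w ^+ 7 = - w ^+ 3 by rewrite (exprD _ 4 3) w4 mulN1r.
have g k : w ^+ k = nth 0 [:: 1; w; w ^+ 2; w ^+ 3; -1; - w; - w ^+ 2; - w ^+ 3] (k %% 8).
  rewrite -p8; have := ltn_pmod k (isT : (0 < 8)%N); move: (k %% 8)%N.
  do 8?[case=> [_|]//=]; rewrite ?expr0 ?expr1 ?w4 ?w5 ?w6 ?w7 //.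
have eE : gauss_eps R d = w ^+ (2 * odd d./2) by rewrite /gauss_eps wi; case: odd.
rewrite eE wN w2 -exprM.
have -> : (1 + w ^+ (6 * n)) * ((chi_two d)%:~R * w ^+ (2 * odd d./2) * w ^+ (n * d)) =
   (chi_two d)%:~R * (w ^+ (2 * odd d./2 + n * d) + w ^+ (6 * n + (2 * odd d./2 + n * d))).
  by rewrite !exprD; ring.
rewrite !(g (_ + _)%N); clear -w.
move: n d; do 8?[case=> [|]//]; do 8?[case=> [|]//] => _ _ _ _.
all: repeat match goal with |- context [modn ?a 8] =>
  let r := eval vm_compute in (modn a 8) in change (modn a 8) with r end.
all: match goal with |- _ * intmul 1 ?a = intmul 1 ?b * _ =>
  let r := eval vm_compute in a in let t := eval vm_compute in b in
  change a with r; change b with t end.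
all: rewrite /= ?(NegzE, mulrNz, mulr1z); ring.
Qed.

(** Here the character is expressed by quadratic Gauss sums modulo 8 d, whose values are known with
    their sign. The factor 1 + (-i)^n makes the right-hand side real by cancelling the argument of
    an eighth root of unity. *)
Lemma chi8_gauss_sum n d : odd n -> odd d -> coprime n d ->
  Complex (2 * Num.sqrt (8 * d)%:R) 0 * (chi8 d n)%:~R =
  (1 + Complex 0 (-1) ^+ n) * G n (8 * d).
Proof.
move=> on od cnd; have d0 := odd_gt0 od.
have c8d : coprime 8 d by rewrite -[8%N]/(2 ^ 3)%N coprime_pexpl // coprime2n.
rewrite gauss_sum_crt // gauss_sum8 ?oddM ?on //.
have c8nd : coprime (n * 8) d by rewrite coprimeMl cnd.
rewrite (gauss_sum_kronecker R od c8nd) (gauss_sum1E R od) (chi8E R) //.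
have -> : kronecker (n * 8)%N%:Z d = chi_two d * kronecker n%:Z d.
  rewrite kronecker_topM // (_ : 8 = 2 * (2 * 2))%N // !kronecker_topM // !(kronecker_two R od).
  have -> : (chi_two d * chi_two d) = 1 by rewrite /chi_two; case: ifP.
  by rewrite mulr1 mulrC.
have E := @chi8_eighth_roots (n %% 8) (d %% 8) (ltn_pmod n (isT : (0 < 8)%N)) (ltn_pmod d (isT : (0 < 8)%N)).
have oe x : odd (x %% 8) = odd x.
  by rewrite [in RHS](divn_eq x 8) oddD oddM andbF.
have he x : odd (x %% 8)./2 = odd x./2 by apply: (@odd_half_dvd _ _ 8) => //; rewrite modn_mod.
have ee : gauss_eps R (d %% 8) = gauss_eps R d by rewrite /gauss_eps he.
have p8 := @unity_root_per R 8 isT.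
rewrite !oe !he ee !chi_two_mod -p8 modnMm p8 in E.
have i4 : (Complex 0 (-1) : C) ^+ 4 = 1.
  by apply/eqP; rewrite eq_complex /=; apply/andP; split; apply/eqP; ring.
have iE : (Complex 0 (-1) : C) ^+ (n %% 8) = Complex 0 (-1) ^+ n.
  by rewrite [in RHS](divn_eq n 8) exprD mulnC (_ : 8 * _ = 4 * (2 * (n %/ 8)))%N ?exprM ?i4 ?expr1n ?mul1r //; rewrite mulnA.
rewrite iE in E; have {}E := E on od.
have s8 : Num.sqrt (8 * d)%:R = 2 * Num.sqrt 2 * Num.sqrt d%:R :> R.
  rewrite natrM (_ : 8 = 2 ^+ 2 * 2 :> R); last by ring.
  by rewrite -[X in Num.sqrt X]mulrA (sqrtrM _ (sqr_ge0 _)) sqrtr_sqr ger0_norm // (sqrtrM _ (ler0n R 2)) mulrA.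
rewrite s8 (_ : Complex _ 0 = 4 * Complex (Num.sqrt 2) 0 * Complex (Num.sqrt d%:R) 0); last first.
  apply/eqP; rewrite eq_complex /=; apply/andP; split; apply/eqP; ring.
rewrite -signr_odd oddM !intrM; rewrite intrM in E.
move: E; set s2 := Complex (Num.sqrt 2) 0; set sd := Complex (Num.sqrt d%:R) 0.
set k := (kronecker _ _)%:~R; set x := (chi_two n)%:~R; set y := (_ ^+ (_ && _))%:~R => E.
transitivity (4 * sd * k * (s2 * (x * y))); first by ring.
by rewrite E; ring.
Qed.

(** tau^2 = 8 d leaves a sign. Summing [chi8_gauss_sum] against chi over n gives 2 sqrt(q) phi(q) =
    tau A, where A sums chi(c^2) + chi(c^2 + 6 d), the shift by 6 d coming from -i = e(6 d / 8 d).
    No term of A is negative: chi(c^2) is 1 when c is prime to q, and otherwise both values vanish.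
    Hence tau > 0. *)
Lemma chi8_gauss d (od : odd d) (sd : squarefree d) :
  char_gauss (8 * d) (chi8 d) (e (8 * d)) = Complex (Num.sqrt (8 * d)%:R) 0.
Proof.
have d0 := odd_gt0 od; have q0 : (0 < 8 * d)%N by rewrite muln_gt0.
set q := (8 * d)%N in q0 *; set tau := char_gauss _ _ _.
have P := chi8_real_primitive R od sd; rewrite -/q in P.
have pw := unity_root_prim R q0.
case: (P) => _ per mul nc [val prim].
have tw := char_gauss_twist P pw; rewrite -/tau in tw.
have sqv x : chi8 d x * chi8 d x = (coprime x q)%:R.
  rewrite nc; case: ifP => // cx.
  by have := val x cx; rewrite nc cx => -[->|->].
pose phi := \sum_(n < q) (coprime n q : nat).
pose A : int := \sum_(c < q) (chi8 d (c ^ 2) + chi8 d (c ^ 2 + 6 * d)).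
have main : Complex (2 * Num.sqrt q%:R) 0 * phi%:R = tau * A%:~R.
  transitivity (\sum_(n < q) (chi8 d n)%:~R * ((1 + Complex 0 (-1) ^+ n) * G n q)).
    rewrite /phi natr_sum mulr_sumr; apply: eq_bigr => n _.
    have [cn|ncn] := boolP (coprime n q); last by rewrite nc (negPf ncn) mulr0 mul0r.
    have /andP[on cnd] : odd n && coprime n d by rewrite -coprime8.
    rewrite -(chi8_gauss_sum on od cnd) mulrCA -intrM sqv cn.
    by rewrite -/q.
  transitivity (\sum_(n < q) \sum_(c < q) ((chi8 d n)%:~R * e q ^+ (n * c ^ 2) +
     (chi8 d n)%:~R * e q ^+ (n * (c ^ 2 + 6 * d)))).
    apply: eq_bigr => n _; rewrite /gauss_sum mulr_sumr mulr_sumr; apply: eq_bigr => c _.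
    have -> : Complex 0 (-1) = e q ^+ (6 * d) :> C.
      rewrite unity_rootX /q /cis.
      have -> : pi *+ 2 * ((6 * d)%:R / (8 * d)%:R) = pi + pi / 2 :> R.
        by rewrite !natrM -mulr_natr; field; rewrite pnatr_eq0 -lt0n.
      by rewrite cosDpihalf sinDpihalf sinpi cospi oppr0.
    by rewrite -exprM mulrDl mul1r -exprD mulrDr; congr (_ + _ * e q ^+ _); lia.
  rewrite exchange_big /= /A (rmorph_sum intr) mulr_sumr; apply: eq_bigr => c _.
  by rewrite big_split /= !tw -mulrDl mulrC intrD.
have A0 : 0 <= A.
  apply: sumr_ge0 => c _; rewrite expnS expn1 mul sqv.
  have [cc|ncc] := boolP (coprime c q).
    rewrite nc; case: ifP => // cx; first by have := val _ cx; rewrite nc cx; case=> ->.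
  rewrite nc; case: ifP => // cx; exfalso; move/negP: ncc; apply.
  move: cx; rewrite /q !coprime8 oddD !oddM andbb [odd 6]/= andFb addbF => /andP[-> cd] /=.
  have : coprime (c * c + 6 * d) d := cd.
  by rewrite /coprime addnC gcdnC gcdnMDl -/(coprime d _) coprimeMr coprime_sym => /andP[].
have phi0 : (0 < phi)%N.
  have q1 : (1 < q)%N by rewrite /q; lia.
  by rewrite /phi (bigD1 (Ordinal q1)) //= coprime1n.
have ta := char_gauss_sqr P pw; rewrite -/tau in ta.
have pq1 : chi8 d q.-1 = 1.
  have oq : odd q.-1 by rewrite -subn1 /q oddB ?oddM.
  have cq : coprime q.-1 q by rewrite -{2}(prednK q0) coprimenS.
  have /andP[_ cqd] : odd q.-1 && coprime q.-1 d by rewrite -coprime8.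
  rewrite (chi8E R) //.
  have -> : kronecker (q.-1)%:Z d = kronecker (d.-1)%:Z d.
    apply: kronecker_mod => //; rewrite (_ : q.-1 = 7 * d + d.-1)%N ?modnMDl //.
    by rewrite /q; lia.
  rewrite (kronecker_pred R od) -signr_odd oddM.
  have -> : odd q.-1./2.
    have -> : (q.-1./2 = (2 * d).-1.*2.+1)%N by rewrite /q -!muln2; lia.
    by rewrite /= odd_double.
  rewrite andTb signr_odd -exprD addnn -signr_odd odd_double expr0 mulr1.
  rewrite -chi_two_mod (_ : (q.-1 %% 8 = 7)%N) //.
  by rewrite (_ : q.-1 = d.-1 * 8 + 7)%N ?modnMDl // /q; lia.
rewrite pq1 mul1r in ta.
have sq : (Complex (Num.sqrt q%:R) 0 : C) ^+ 2 = q%:R.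
  by rewrite -(rmorphXn (real_complex R)) /= sqr_sqrtr ?ler0n // rmorph_nat.
have : (tau - Complex (Num.sqrt q%:R) 0) * (tau + Complex (Num.sqrt q%:R) 0) = 0.
  by rewrite -subr_sqr ta sq subrr.
move/eqP; rewrite mulf_eq0 subr_eq0 addr_eq0 => /orP[/eqP //|/eqP tE].
exfalso; move: main; rewrite tE => main.
have main' : 2 * Num.sqrt q%:R * phi%:R = - Num.sqrt q%:R * A%:~R :> R.
  move/eqP: main; rewrite -(rmorph_nat (real_complex R) phi) -(rmorph_int (real_complex R)) eq_complex.
  by move=> /andP[/eqP + _]; rewrite /= !(mul0r, mulr0, oppr0, subr0).
have : 0 < 2 * Num.sqrt q%:R * phi%:R :> R by rewrite !mulr_gt0 ?sqrtr_gt0 ?ltr0n.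
by rewrite main' mulNr oppr_gt0 ltNge mulr_ge0 ?sqrtr_ge0 // ler0z.
Qed.

End GaussSignChi8.

(** * The functional equation of the theta function *)

Section Tannery.
Context (R : realType).

Lemma series_tail_le (u g : nat -> R) K n : (forall k, `|u k| <= g k) ->
  cvgn (series g) -> (K <= n)%N ->
  `|\sum_(K <= k < n) u k| <= limn (series g) - series g K.
Proof.
move=> ug cg Kn; have g0 k : 0 <= g k := le_trans (normr_ge0 _) (ug k).
apply: le_trans (ler_norm_sum _ _ _) _.
apply: (@le_trans _ _ (\sum_(K <= k < n) g k)); first by apply: ler_sum.
have -> : \sum_(K <= k < n) g k = series g n - series g K by rewrite sub_series_geq.
rewrite lerD2r; apply: nondecreasing_cvgn_le => //.
exact: nondecreasing_series.
Qed.

Lemma dominated_cvg_series (u g : nat -> R) : (forall k, `|u k| <= g k) ->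
  cvgn (series g) -> cvgn (series u).
Proof.
move=> ug cg; apply: normed_cvg; apply: series_le_cvg cg => [k|k|k];
  [exact: normr_ge0 | exact: le_trans (ug k) | exact: ug].
Qed.

Lemma series_lim_tail (u g : nat -> R) K : (forall k, `|u k| <= g k) ->
  cvgn (series g) -> `|limn (series u) - series u K| <= limn (series g) - series g K.
Proof.
move=> ug cg; have cu := dominated_cvg_series ug cg.
have c1 : `|series u n - series u K| @[n --> \oo] --> `|limn (series u) - series u K|.
  by apply: cvg_norm; apply: cvgB => //; exact: cvg_cst.
rewrite -(cvg_lim _ c1) //; apply: limr_le; first by apply/cvg_ex; eexists; exact: c1.
near=> n; have Kn : (K <= n)%N by near: n; exact: nbhs_infty_ge.
by rewrite sub_series_geq //; apply: series_tail_le.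
Unshelve. all: by end_near.
Qed.

Lemma tannery (f : nat -> nat -> R) (g L : nat -> R) (B : nat -> nat) :
  cvgn (series g) ->
  (\forall M \near \oo, forall k, `|f M k| <= g k) ->
  (forall M k, (B M <= k)%N -> f M k = 0) ->
  (forall k, f M k @[M --> \oo] --> L k) ->
  \sum_(k < B M) f M k @[M --> \oo] --> limn (series L).
Proof.
move=> cg fg fB fL.
have Lg k : `|L k| <= g k.
  have c1 : `|f M k| @[M --> \oo] --> `|L k| by apply: cvg_norm.
  rewrite -(cvg_lim _ c1) //; apply: limr_le; first by apply/cvg_ex; eexists; exact: c1.
  by apply: filterS fg => M; apply.
apply/cvgrPdist_lt => e e0; have e3 : 0 < e / 3 by rewrite divr_gt0.
have cg' : series g n @[n --> \oo] --> limn (series g) by exact: cg.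
move/cvgrPdist_lt: (cg') => /(_ _ e3) [K _ HK].
have {}HK := HK K (leqnn K); rewrite /= in HK.
have cK : \sum_(k < K) f M k @[M --> \oo] --> \sum_(k < K) L k.
  elim: K {HK} => [|K IH].
    under eq_fun do rewrite big_ord0; rewrite big_ord0; exact: cvg_cst.
  under eq_fun do rewrite big_ord_recr /=; rewrite big_ord_recr /=; exact: cvgD.
near=> M.
have fgM : forall k, `|f M k| <= g k by near: M.
have t1 : `|\sum_(k < K) L k - \sum_(k < K) f M k| < e / 3.
  by near: M; move/cvgrPdist_lt: cK; apply.
have t2 := series_lim_tail K Lg cg.
have -> : \sum_(k < B M) f M k = \sum_(0 <= k < maxn K (B M)) f M k.
  rewrite -(big_mkord xpredT (f M)) [RHS](big_cat_nat (leq0n _) (leq_maxr K (B M))) /=.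
  have z : \sum_(B M <= k < maxn K (B M)) f M k = 0.
    by rewrite big_nat big1 // => k /andP[h _]; exact: fB.
  by rewrite z addr0.
have t3 : `|\sum_(K <= k < maxn K (B M)) f M k| <= limn (series g) - series g K.
  by apply: series_tail_le => //; exact: leq_maxl.
rewrite (big_cat_nat (leq0n _) (leq_maxl K (B M))) /=.
have -> : \sum_(0 <= k < K) f M k = \sum_(k < K) f M k by rewrite big_mkord.
have sE : series L K = \sum_(k < K) L k by rewrite /series /= big_mkord.
rewrite sE in t2.
have e4 : limn (series g) - series g K < e / 3 by apply: le_lt_trans HK; exact: ler_norm.
set a := limn (series L) in t2 *; set b := \sum_(k < K) L k in t1 t2 *.
set c := \sum_(k < K) f M k in t1 *; set d := \sum_(K <= k < _) _ in t3 *.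
have -> : a - (c + d) = (a - b) + (b - c) - d by ring.
apply: le_lt_trans (ler_normB _ _) _.
have := ler_normD (a - b) (b - c); lra.
Unshelve. all: by end_near.
Qed.

End Tannery.

(** * Bounds for the sine, and binomial coefficients compared with exponentials *)

Section Elementary.
Context (R : realType).

Lemma sin_bounds (z : R) : 0 <= z <= pi -> z * cos z <= sin z <= z.
Proof.
move=> /andP[z0 zpi].
have [c cz E] : exists2 c : R, c \in `[0, z] & sin z - sin 0 = cos c * (z - 0).
  apply: (@MVT_segment R sin cos) => //.
  exact/continuous_subspaceT/continuous_sin.
rewrite sin0 !subr0 in E; move: cz; rewrite in_itv /= => /andP[c0 cz].
rewrite E; apply/andP; split; last by rewrite ler_piMl // cos_le1.
rewrite mulrC ler_wpM2r //; move: cz; rewrite le_eqVlt => /predU1P[->//|lt].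
by apply/ltW; rewrite ltr_cos // in_itv /= ?z0 ?c0 // (le_trans (ltW lt)).
Qed.

(** Jordan's inequality with the weaker constant 1/2, from sin y = 2 sin(y/2) cos(y/2): at y / 2 <=
    pi / 4 the squared cosine is at least 1/2. *)
Lemma jordan_sin (y : R) : 0 <= y <= pi / 2 -> y / 2 <= sin y.
Proof.
move=> /andP[y0 yp]; have p0 := pi_gt0 R.
have c4 : cos (pi / 4) ^+ 2 = 1 / 2 :> R.
  have := cos_mulr2n (pi / 4 : R); rewrite (_ : pi / 4 *+ 2 = pi / 2); last by rewrite -mulr_natr; field.
  by rewrite cos_pihalf; lra.
pose z := y / 2.
have cz : cos (pi / 4) <= cos z.
  rewrite le_eqVlt; have [->|ne] := eqVneq z (pi / 4); first by rewrite eqxx.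
  have lt : z < pi / 4 by rewrite lt_neqAle ne /z; lra.
  by rewrite ltr_cos ?lt ?orbT // in_itv /= /z; apply/andP; split; lra.
have c0 : 0 < cos (pi / 4) :> R by apply: cos_gt0_pihalf; apply/andP; split; lra.
have /andP[s1 _] : z * cos z <= sin z <= z by apply: sin_bounds; apply/andP; split; rewrite /z; lra.
have -> : y = z *+ 2 by rewrite /z -mulr_natr; field.
rewrite sin_mulr2n -[X in X / 2]mulr_natr mulfK // -mulr_natr.
have z0 : 0 <= z by rewrite /z; lra.
have : cos (pi / 4) * (z * cos (pi / 4)) <= cos z * sin z.
  apply: ler_pM; rewrite ?(ltW c0) // ?mulr_ge0 ?(ltW c0) //.
  by apply: le_trans s1; rewrite ler_wpM2l.
rewrite mulrCA -expr2 c4; lra.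
Qed.

Lemma expR_le1Bx (x : R) : 1 - x <= expR (- x).
Proof. exact: expR_ge1Dx. Qed.

Lemma expR_ge_inv (x : R) : x < 1 -> expR (- (x / (1 - x))) <= 1 - x.
Proof.
move=> x1; have p : 0 < 1 - x by lra.
rewrite expRN -[leRHS]invrK lef_pV2 ?posrE ?invr_gt0 ?expR_gt0 //.
apply: le_trans (expR_ge1Dx _); rewrite le_eqVlt; apply/orP; left; apply/eqP; field; lra.
Qed.

(** A discrete Gaussian: for k of order sqrt n this is about exp(-k^2 / n). *)
Definition bin_ratio (n k : nat) : R := 'C(n.*2, n + k)%:R / 'C(n.*2, n)%:R.

Lemma bin_ratioS n k : (k <= n)%N ->
  bin_ratio n k.+1 = bin_ratio n k * (1 - (k.*2.+1)%:R / (n + k.+1)%:R).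
Proof.
move=> kn; rewrite /bin_ratio.
have C0 : ('C(n.*2, n)%:R : R) != 0 by rewrite pnatr_eq0 -lt0n bin_gt0 -addnn leq_addl.
have n0 : ((n + k.+1)%:R : R) != 0 by rewrite pnatr_eq0 addnS.
have E : (n + k.+1)%:R * 'C(n.*2, n + k.+1)%:R = (n - k)%:R * 'C(n.*2, n + k)%:R :> R.
  rewrite -!natrM; congr (_%:R); rewrite addnS mul_bin_left; congr (_ * _)%N.
  by rewrite -addnn subnDl.
rewrite mulrAC; congr (_ / _); apply: (mulfI n0); rewrite E natrB //.
have -> : (n + k.+1)%:R * ('C(n.*2, n + k)%:R * (1 - k.*2.+1%:R / (n + k.+1)%:R)) =
  ((n + k.+1)%:R - k.*2.+1%:R) * 'C(n.*2, n + k)%:R :> R by field.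
congr (_ * _); rewrite -addnn -[(k + k).+1]addn1 -[k.+1]addn1 !natrD; ring.
Qed.

Lemma bin_ratio0 n : bin_ratio n 0 = 1.
Proof.
by rewrite /bin_ratio addn0 divff // pnatr_eq0 -lt0n bin_gt0 -addnn leq_addl.
Qed.

Lemma bin_ratio_ge0 n k : 0 <= bin_ratio n k.
Proof. by rewrite divr_ge0 // ler0n. Qed.

(** Successive ratios are 1 - (2 k + 1) / (n + k + 1), and the odd numbers add up to k^2. The
    denominator is frozen at its largest value n + K so that the induction on k closes. *)
Lemma bin_ratio_le n K k : (k <= K <= n)%N -> (0 < K)%N ->
  bin_ratio n k <= expR (- (k%:R ^+ 2 / (n + K)%:R)).
Proof.
move=> /andP[kK Kn] K0; have nK0 : 0 < ((n + K)%:R : R) by rewrite ltr0n addn_gt0 K0 orbT.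
elim: k kK => [|k IH] kK; first by rewrite bin_ratio0 expr0n /= mul0r oppr0 expR0.
rewrite bin_ratioS; last by lia.
have -> : - (k.+1%:R ^+ 2 / (n + K)%:R) = - (k%:R ^+ 2 / (n + K)%:R) + - (k.*2.+1%:R / (n + K)%:R) :> R.
  by rewrite -addnn -[k.+1]addn1 -[(k + k).+1]addn1 !natrD; field; rewrite -natrD gt_eqF.
rewrite expRD; apply: ler_pM; rewrite ?bin_ratio_ge0 ?IH ?(ltnW kK) //.
  by rewrite subr_ge0 ler_pdivrMr ?ltr0n ?addnS // mul1r ler_nat; lia.
apply: le_trans (expR_le1Bx _) _; rewrite ler_expR lerN2 ler_wpM2l // lef_pV2 ?posrE ?ltr0n ?ler_nat; lia.
Qed.

Lemma bin_ratio_ge n K k : (k <= K < n)%N ->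
  expR (- (k%:R ^+ 2 / (n - K)%:R)) <= bin_ratio n k.
Proof.
move=> /andP[kK Kn]; have nK0 : 0 < ((n - K)%:R : R) by rewrite ltr0n subn_gt0.
elim: k kK => [|k IH] kK; first by rewrite bin_ratio0 expr0n /= mul0r oppr0 expR0.
rewrite bin_ratioS; last by lia.
have -> : - (k.+1%:R ^+ 2 / (n - K)%:R) = - (k%:R ^+ 2 / (n - K)%:R) + - (k.*2.+1%:R / (n - K)%:R) :> R.
  by rewrite -addnn -[k.+1]addn1 -[(k + k).+1]addn1 !natrD; field; rewrite gt_eqF.
rewrite expRD; apply: ler_pM; rewrite ?expR_ge0 ?IH ?(ltnW kK) //.
have d0 : 0 < ((n + k.+1)%:R : R) by rewrite ltr0n addnS.
have lt1 : (k.*2.+1)%:R / (n + k.+1)%:R < 1 :> R.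
  by rewrite ltr_pdivrMr // mul1r ltr_nat; lia.
have aux (a b : R) : a != 0 -> a - b != 0 -> b / a / (1 - b / a) = b / (a - b).
  by move=> a0 ab; field; rewrite ?a0 ?ab.
apply: le_trans (expR_ge_inv lt1); rewrite ler_expR lerN2.
have -> : k.*2.+1%:R / (n + k.+1)%:R / (1 - k.*2.+1%:R / (n + k.+1)%:R) = k.*2.+1%:R / (n - k)%:R :> R.
  have -> : (n - k)%:R = (n + k.+1)%:R - k.*2.+1%:R :> R.
    by rewrite -natrB; [congr (_%:R); lia|lia].
  apply: aux; rewrite ?gt_eqF // subr_gt0 ltr_nat; lia.
by rewrite ler_wpM2l // lef_pV2 ?posrE ?ltr0n ?ler_nat ?subn_gt0; lia.
Qed.

Definition central_bin (n : nat) : R := 'C(n.*2, n)%:R / 4 ^+ n.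

Lemma central_binS n :
  central_bin n.+1 = central_bin n * ((2 * n%:R + 1) / (2 * n%:R + 2)).
Proof.
rewrite /central_bin.
have E : (n.+1 * 'C(n.+1.*2, n.+1) = 2 * (n.*2.+1 * 'C(n.*2, n)))%N.
  have e1 := mul_bin_diag n.*2.+1 n; rewrite /= in e1.
  have e2 : ('C(n.*2.+1, n.+1) = 'C(n.*2.+1, n))%N.
    by rewrite -(bin_sub (_ : n <= n.*2.+1)%N); [congr ('C(_, _)); lia|lia].
  by rewrite doubleS binS e2 mulnDr -e2 -e1; lia.
have ER : n.+1%:R * 'C(n.+1.*2, n.+1)%:R = 2 * (n.*2.+1%:R * 'C(n.*2, n)%:R) :> R.
  by rewrite -!natrM E.
have n1 : (n.+1%:R : R) != 0 by rewrite pnatr_eq0.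
apply: (mulfI n1); rewrite mulrA ER -[n.+1]addn1 -[n.*2.+1]addn1 -muln2 !natrD natrM exprD expr1.
by field; rewrite expf_neq0 ?pnatr_eq0 //= -natrM -natrD pnatr_eq0 addn2.
Qed.

Lemma central_bin_ge0 n : 0 <= central_bin n.
Proof. by rewrite divr_ge0 ?exprn_ge0. Qed.

(** With c_n for [central_bin n], the sequence n c_n^2 increases while (2 n + 1) c_n^2 decreases
    from 1. The limit stays an unknown b; [theta_fe] handles it by self-duality. *)
Lemma central_bin_cvg : exists2 b : R, 0 <= b & (n%:R * central_bin n ^+ 2) @[n --> \oo] --> b.
Proof.
have mono : {homo (fun n => n%:R * central_bin n ^+ 2) : n m / (n <= m)%N >-> n <= m}.
  apply/nondecreasing_seqP => n; rewrite central_binS.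
  have n0 : 0 <= n%:R :> R by [].
  have h : n%:R <= n.+1%:R * ((2 * n%:R + 1) / (2 * n%:R + 2)) ^+ 2 :> R.
    have -> : n.+1%:R * ((2 * n%:R + 1) / (2 * n%:R + 2)) ^+ 2 = (2 * n%:R + 1) ^+ 2 / (4 * (n%:R + 1)) :> R.
      by rewrite -[n.+1]addn1 natrD; field; rewrite !gt_eqF //; lra.
    rewrite ler_pdivlMr; nra.
  by have := ler_wpM2r (sqr_ge0 (central_bin n)) h; rewrite [X in _ -> _ <= _ * X]exprMn; lra.
have bd n : (2 * n%:R + 1) * central_bin n ^+ 2 <= 1.
  elim: n => [|n IH]; first by rewrite /central_bin bin0 expr0; lra.
  apply: le_trans IH; rewrite central_binS.
  have n0 : 0 <= n%:R :> R by [].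
  have h : (2 * n.+1%:R + 1) * ((2 * n%:R + 1) / (2 * n%:R + 2)) ^+ 2 <= 2 * n%:R + 1 :> R.
    rewrite expr_div_n mulrA ler_pdivrMr; last by nra.
    rewrite -[n.+1]addn1 natrD; nra.
  by have := ler_wpM2r (sqr_ge0 (central_bin n)) h; rewrite [X in _ -> _ * X <= _]exprMn; lra.
exists (limn (fun n => n%:R * central_bin n ^+ 2)).
  apply: limr_ge; last by apply: nearW => n; rewrite mulr_ge0 ?sqr_ge0.
  apply: nondecreasing_is_cvgn => //; exists 1 => _ [n _ <-].
  by have := bd n; have := sqr_ge0 (central_bin n); nra.
apply: nondecreasing_is_cvgn => //; exists 1 => _ [n _ <-].
by have := bd n; have := sqr_ge0 (central_bin n); nra.
Qed.

End Elementary.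

Section ThetaIdentity.
Context (R : realType) (d : nat).
Hypotheses (od : odd d) (sd : squarefree d).
Notation C := (complex R).
Local Notation e := (unity_root R).
Local Notation q := (8 * d)%N.
Local Notation chi := (chi8 d).
Local Notation "x %:rC" := (real_complex R x) (at level 2).

Lemma chi8_0 : chi 0%N = 0.
Proof.
by apply: chi8_ncoprime; rewrite ?odd_gt0 // coprime8.
Qed.

Lemma chi8_per x : chi (x %% q)%N = chi x.
Proof. by case: (chi8_real_primitive R od sd) => _ ->. Qed.

Lemma chi8_pred : chi q.-1 = 1.
Proof.
have d0 := odd_gt0 od; have q0 : (0 < q)%N by rewrite muln_gt0.
have P := chi8_real_primitive R od sd.
have := char_gauss_sqr P (unity_root_prim R q0); rewrite (chi8_gauss R od sd).
rewrite -(rmorphXn (real_complex R)) /= sqr_sqrtr ?ler0n // rmorph_nat.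
rewrite -[X in X = _]mul1r => /mulIf E.
apply: (@intr_inj C); rewrite -E //.
by rewrite pnatr_eq0 -lt0n.
Qed.

Lemma chi8_neg m n : (q %| m + n)%N -> chi m = chi n.
Proof.
move=> dv; have d0 := odd_gt0 od; have q0 : (0 < q)%N by rewrite muln_gt0.
rewrite -[LHS]mul1r -chi8_pred -chi8_mul // -[LHS]chi8_per -[RHS]chi8_per; congr chi.
by apply/eqP; rewrite -(eqn_modDl m) -mulSn prednK // modnMr eq_sym.
Qed.

(** The Fourier transform of chi over q M points: it lives on the multiples of M, where [chi8_gauss]
    makes it a positive multiple of chi itself. This self-duality is the source of the functional
    equation. *)
Lemma twisted_period_sum M m : (0 < M)%N ->
  \sum_(h < q * M) (chi h)%:~R * e (q * M) ^+ (h * m) =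
  (if (M %| m)%N then M%:R * (chi (m %/ M)%N)%:~R * (Num.sqrt q%:R)%:rC else 0) :> C.
Proof.
move=> M0; have d0 := odd_gt0 od; have q0 : (0 < q)%N by rewrite muln_gt0.
rewrite (sum_mixed (fun h => (chi h)%:~R * e (q * M) ^+ (h * m))) //.
have per (y z : nat) : chi (y + q * z)%N = chi y.
  by rewrite -chi8_per addnC mulnC modnMDl chi8_per.
have E (y : nat) : \sum_(z < M) (chi (y + q * z)%N)%:~R * e (q * M) ^+ ((y + q * z) * m) =
   (chi y)%:~R * e (q * M) ^+ (y * m) * (if (M %| m)%N then M%:R else 0) :> C.
  rewrite -sum_unity_root // mulr_sumr; apply: eq_bigr => z _.
  rewrite per mulnDl exprD.
  rewrite -(unity_root_mul R M q0) -exprM -!mulrA; congr (_ * _).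
  by congr (_ * _ ^+ _); rewrite -mulnA [(z * m)%N]mulnC.
rewrite (eq_bigr _ (fun (y : 'I_q) _ => E y)) -mulr_suml.
case: ifPn => [/dvdnP[m' ->]|_]; last by rewrite mulr0.
rewrite mulnK //.
have -> : \sum_(i < q) (chi i)%:~R * e (q * M) ^+ (i * (m' * M)) =
     \sum_(i < q) (chi i)%:~R * e q ^+ (i * m') :> C.
  apply: eq_bigr => i _; rewrite (mulnC q M) -(unity_root_mul R q M0) -exprM.
  by congr (_ * _ ^+ _); rewrite mulnA mulnC.
have P := chi8_real_primitive R od sd.
rewrite (char_gauss_twist P (unity_root_prim R q0)) (chi8_gauss R od sd).
by rewrite mulrC mulrA.
Qed.

Lemma cos_pow_expand M n (h : nat) : (0 < M)%N ->
  ((2 * cos (pi * h%:R / (q * M)%:R)) ^+ n.*2)%:rC =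
  \sum_(i < n.*2.+1) 'C(n.*2, i)%:R * e (q * M) ^+ (h * (i + n * (q * M).-1)) :> C.
Proof.
move=> M0; have d0 := odd_gt0 od.
have Q0 : (0 < q * M)%N by rewrite !muln_gt0 d0.
(* v is a square root of the root of unity [e Q ^+ h], and the doubled cosine is v + 1/v; in the
   exponents [Q.-1] stands for -1. *)
set Q := (q * M)%N in Q0 *; pose v := cis (pi * h%:R / Q%:R : R).
have vV : v * cis (- (pi * h%:R / Q%:R)) = 1 by rewrite -cisD subrr cis0.
have v2 : v ^+ 2 = e Q ^+ h.
  by rewrite cisX unity_rootX; congr cis; rewrite -[LHS]mulr_natr -mulr_natr; field; rewrite pnatr_eq0 -lt0n.
have c2 : (2 * cos (pi * h%:R / Q%:R))%:rC = v + cis (- (pi * h%:R / Q%:R)).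
  by apply/eqP; rewrite eq_complex /= cosN sinN subrr eqxx andbT; apply/eqP; ring.
have key : v ^+ n.*2 * ((2 * cos (pi * h%:R / Q%:R)) ^+ n.*2)%:rC = (1 + v ^+ 2) ^+ n.*2.
  by rewrite rmorphXn -exprMn /= c2 mulrDr vV -expr2 addrC.
have vn : v ^+ n.*2 = e Q ^+ (h * n) by rewrite -mul2n exprM v2 -exprM.
rewrite vn v2 in key.
have u0 := unity_root_neq0 R Q (h * n).
apply: (mulfI u0); rewrite key exprDn mulr_sumr; apply: eq_bigr => i _.
rewrite expr1n mul1r -exprM -mulr_natl mulrCA; congr (_ * _).
rewrite -exprD -[LHS]unity_root_per // -[RHS]unity_root_per //; congr (_ ^+ _).
have -> : (h * n + h * (i + n * Q.-1) = h * n * Q + h * i)%N.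
  by rewrite -{2}(prednK Q0); move: Q.-1 => Q'; lia.
by rewrite modnMDl.
Qed.

(* A finite form of the functional equation: expand the power of the cosine in
   exponentials and sum over a period against chi. Letting M -> oo with
   n ~ nu M^2 turns both sides into theta series. *)
Lemma theta_identity_full M n : (0 < M)%N ->
  \sum_(h < q * M) (chi h)%:~R * (2 * cos (pi * h%:R / (q * M)%:R)) ^+ n.*2 =
  M%:R * Num.sqrt q%:R *
  \sum_(i < n.*2.+1 | (M %| i + n * (q * M).-1)%N) 'C(n.*2, i)%:R * (chi ((i + n * (q * M).-1) %/ M)%N)%:~R :> R.
Proof.
move=> M0; apply: (@complexI R).
rewrite rmorph_sum /=.
transitivity (\sum_(h < q * M) \sum_(i < n.*2.+1) 'C(n.*2, i)%:R *
   ((chi h)%:~R * e (q * M) ^+ (h * (i + n * (q * M).-1))) : C).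
  apply: eq_bigr => h _; rewrite rmorphM rmorph_int /= cos_pow_expand // mulr_sumr.
  by apply: eq_bigr => i _; rewrite mulrCA.
rewrite exchange_big /= rmorphM rmorph_sum /= [in RHS]mulr_sumr [in RHS]big_mkcond /=.
apply: eq_bigr => i _; rewrite -mulr_sumr twisted_period_sum //.
case: ifP => _; last by rewrite mulr0.
rewrite !rmorphM /= !rmorph_nat rmorph_int; ring.
Qed.

End ThetaIdentity.

Lemma sum_fold (V : zmodType) (F : nat -> V) P : F 0%N = 0 -> F P = 0 ->
  (forall h, (h <= P)%N -> F (P + P - h)%N = F h) ->
  \sum_(h < P + P) F h = (\sum_(h < P) F h) *+ 2.
Proof.
move=> F0 FP Fs; rewrite -(big_mkord xpredT F) (big_cat_nat (leq0n P) (leq_addr P P)) /=.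
have -> : \sum_(P <= i < P + P) F i = \sum_(0 <= i < P) F (i + P)%N.
  by rewrite -{1}[P]add0n big_addn addnK.
rewrite [X in _ + X]big_nat_rev /= add0n mulr2n; congr (_ + _); first by rewrite big_mkord.
rewrite big_mkord; transitivity (\sum_(h < P) F h.+1).
  by apply: eq_bigr => h _; rewrite -[in RHS]Fs ?ltn_ord //; apply: congr1; have := ltn_ord h; lia.
have : \sum_(h < P.+1) F h = \sum_(h < P) F h by rewrite big_ord_recr /= FP addr0.
by rewrite big_ord_recl F0 add0r.
Qed.

Lemma sum_centered (V : zmodType) (H h : nat -> V) n : h 0%N = 0 ->
  (forall k, (k <= n)%N -> H (n + k)%N = h k) ->
  (forall k, (k <= n)%N -> H (n - k)%N = h k) ->
  \sum_(i < n.*2.+1) H i = (\sum_(k < n.+1) h k) *+ 2.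
Proof.
move=> h0 Hp Hm; rewrite -(big_mkord xpredT H).
rewrite (big_cat_nat (leq0n n) (_ : n <= n.*2.+1)%N) /=; last by lia.
rewrite mulr2n; congr (_ + _).
  rewrite big_nat_rev /= add0n big_mkord [RHS]big_ord_recl /= h0 add0r.
  by apply: eq_bigr => i _; rewrite Hm // ltn_ord.
rewrite -{1}[n]add0n big_addn (_ : n.*2.+1 - n = n.+1)%N; last by lia.
rewrite big_mkord; apply: eq_bigr => i _; rewrite addnC Hp // -ltnS ltn_ord //.
Qed.

Section ThetaFold.
Context (R : realType) (d : nat).
Hypotheses (od : odd d) (sd : squarefree d).
Local Notation q := (8 * d)%N.
Local Notation chi := (chi8 d).

(** Both sides of [theta_identity_full] are folded by the evenness of chi, and the power of 4 and
    the central binomial coefficient are divided out; on the right only the indices k = M j are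
    left. *)
Lemma theta_identity M n : (0 < M)%N -> (0 < n)%N ->
  \sum_(h < 4 * d * M) (chi h)%:~R * cos (pi * h%:R / (q * M)%:R) ^+ n.*2 =
  M%:R * central_bin R n * Num.sqrt q%:R *
    \sum_(j < n.+1) (chi j)%:~R * bin_ratio R n (M * j) :> R.
Proof.
move=> M0 n0; have d0 := odd_gt0 od.
have Q0 : (0 < q * M)%N by rewrite !muln_gt0 d0.
have Qr0 : ((q * M)%:R : R) != 0 by rewrite pnatr_eq0 -lt0n.
have := theta_identity_full R od sd n M0.
set F := fun h : nat => (chi h)%:~R * (2 * cos (pi * h%:R / (q * M)%:R)) ^+ n.*2 : R.
have PP : (q * M = 4 * d * M + 4 * d * M)%N by lia.
have fold : \sum_(h < q * M) F h = (\sum_(h < 4 * d * M) F h) *+ 2.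
  rewrite PP sum_fold //.
  - by rewrite /F (chi8_0 od) mul0r.
  - rewrite /F (_ : pi * _ / _ = pi / 2 :> R); last first.
      have dR : d%:R != 0 :> R by rewrite pnatr_eq0 -lt0n.
      have MR : M%:R != 0 :> R by rewrite pnatr_eq0 -lt0n.
      by rewrite natrM; field; rewrite ?dR ?MR.
    by rewrite cos_pihalf mulr0 expr0n double_eq0 gtn_eqF ?mulr0.
  - move=> h hP; rewrite /F; congr (_ * _).
      congr (_%:~R); apply: (chi8_neg R od sd); rewrite subnK; last by lia.
      by rewrite -PP dvdn_mulr.
    rewrite natrB; last by lia.
    rewrite (_ : pi * _ / _ = - (pi * h%:R / (q * M)%:R) + pi); last by rewrite -PP mulrBr mulrBl mulfK // addrC.
    by rewrite cosDpi cosN -mul2n !exprM mulrN sqrrN.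
move=> E0; rewrite -[LHS]/(\sum_(h < q * M) F h) fold in E0; move: E0.
set H := fun i : nat => if (M %| i + n * (q * M).-1)%N then
   'C(n.*2, i)%:R * (chi ((i + n * (q * M).-1) %/ M)%N)%:~R else 0 : R.
pose h k := if (M %| k)%N then 'C(n.*2, n + k)%:R * (chi (k %/ M)%N)%:~R else 0 : R.
rewrite [X in _ = _ * X](_ : _ = \sum_(i < n.*2.+1) H i); last by rewrite big_mkcond.
have nq : (n + n * (q * M).-1 = (n * q) * M)%N by rewrite -mulnS prednK // mulnA.
rewrite (@sum_centered _ H h); first last.
- move=> k kn; rewrite /H /h.
  have E : (n - k + n * (q * M).-1 = n * q * M - k)%N by rewrite addnBAC // nq.
  rewrite E; have le : (k <= n * q * M)%N by nia.
  rewrite dvdn_subr ?dvdn_mull //; case: ifPn => // /dvdnP[j kE].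
  rewrite -(bin_sub (_ : n - k <= n.*2)%N); last by lia.
  rewrite (_ : n.*2 - (n - k) = n + k)%N; last by lia.
  rewrite kE -mulnBl !mulnK //; congr (_ * _%:~R); apply: (chi8_neg R od sd).
  have le' : (j <= n * q)%N by move: le; rewrite kE leq_pmul2r.
  by rewrite subnK // (dvdn_mull n (dvdnn q)).
- move=> k kn; rewrite /H /h addnAC nq dvdn_addr ?dvdn_mull //; case: ifPn => // /dvdnP[j ->].
  rewrite -mulnDl !mulnK //; congr (_ * _%:~R).
  by rewrite -(chi8_per R od sd) modnMDl (chi8_per R od sd).
- by rewrite /h dvdn0 div0n (chi8_0 od) mulr0.
have -> : \sum_(k < n.+1) h k = \sum_(j < n.+1) 'C(n.*2, n + M * j)%:R * (chi j)%:~R.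
  transitivity (\sum_(k < M * n.+1) h k).
    rewrite -!(big_mkord xpredT h) [RHS](big_cat_nat (leq0n n.+1) (leq_pmull n.+1 M0)) /=.
    have z : \sum_(n.+1 <= k < M * n.+1) h k = 0.
      rewrite big_nat big1 // => k /andP[kn _]; rewrite /h bin_small ?mul0r ?if_same //; lia.
    by rewrite z addr0.
  rewrite (sum_mixed h) // (bigD1 (Ordinal M0)) //= [X in _ + X]big1 ?addr0 => [|y].
    by apply: eq_bigr => j _; rewrite /h add0n dvdn_mulr // mulKn.
  rewrite -val_eqE /= => y0; apply: big1 => z _; rewrite /h dvdn_addl ?dvdn_mulr //.
  by case: ifP => // /dvdn_leq; have := ltn_ord y; lia.
rewrite -[X in X = _]mulr_natr -[X in _ = _ * X]mulr_natr mulrA => /mulIf E.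
have {}E := E ltac:(by rewrite pnatr_eq0).
have f4 : (4 : R) ^+ n != 0 by rewrite expf_neq0 ?pnatr_eq0.
apply: (mulfI f4); rewrite mulr_sumr.
transitivity (\sum_(h < 4 * d * M) F h).
  apply: eq_bigr => k _; rewrite /F mulrCA; congr (_ * _).
  rewrite exprMn; congr (_ * _).
  by rewrite -mul2n exprM; congr (_ ^+ _); ring.
rewrite E mulrCA -!mulrA; congr (_ * _).
rewrite !mulr_sumr; apply: eq_bigr => j _.
have C0 : ('C(n.*2, n)%:R : R) != 0 by rewrite pnatr_eq0 -lt0n bin_gt0 -addnn leq_addl.
rewrite /bin_ratio /central_bin; field; rewrite C0 f4 //.
Qed.

End ThetaFold.

Section ThetaLimit.
Context (R : realType).

Lemma cvg_invn : (n%:R^-1 : R) @[n --> \oo] --> (0 : R).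
Proof.
rewrite -(cvg_shiftS (fun n => n%:R^-1 : R)); exact: cvg_harmonic.
Qed.

Lemma cvg_divn (a : R) : (a / n%:R) @[n --> \oo] --> (0 : R).
Proof. by rewrite -(mulr0 a); apply: cvgM; [exact: cvg_cst|exact: cvg_invn]. Qed.

Lemma cvg_cos_divn (a : R) : cos (a / n%:R) @[n --> \oo] --> (1 : R).
Proof.
have := cvg_comp _ _ (cvg_divn a) (@continuous_cos R 0); rewrite cos0; exact.
Qed.

Lemma near_natr_ge (A : R) : \forall n \near \oo, A <= n%:R.
Proof. by near=> n; near: n; exact: nbhs_infty_ger. Unshelve. all: by end_near. Qed.

Lemma cvg_sin_divn (a : R) : 0 <= a -> (n%:R * sin (a / n%:R)) @[n --> \oo] --> a.
Proof.
move=> a0; apply: (@squeeze_cvgr _ _ _ _ (fun n => a * cos (a / n%:R)) (fun=> a)).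
- near=> n.
  have n0 : 0 < n%:R :> R by rewrite ltr0n; near: n; exact: nbhs_infty_gt.
  have an : a / n%:R <= pi.
    rewrite ler_pdivrMr // -ler_pdivrMl ?pi_gt0 //; near: n; exact: near_natr_ge.
  have /andP[s1 s2] : a / n%:R * cos (a / n%:R) <= sin (a / n%:R) <= a / n%:R.
    by apply: sin_bounds; rewrite divr_ge0 ?(ltW n0).
  apply/andP; split.
    have := ler_wpM2l (ltW n0) s1; rewrite mulrA mulrCA divff ?mulr1 ?gt_eqF //.
  by have := ler_wpM2l (ltW n0) s2; rewrite mulrCA divff ?mulr1 ?gt_eqF.
- by rewrite -[X in _ --> X](mulr1 a); apply: cvgM; [exact: cvg_cst|exact: cvg_cos_divn].
- exact: cvg_cst.
Unshelve. all: by end_near.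
Qed.

(** The exponent n ~ nu M^2, for which both cos(a / M)^(2 n) and the binomial ratio at M j have
    Gaussian limits. *)
Definition sq_floor (nu : R) (M : nat) : nat := Num.truncn (nu * M%:R ^+ 2).

Lemma sq_floor_itv nu M : 0 <= nu ->
  (sq_floor nu M)%:R <= nu * M%:R ^+ 2 < (sq_floor nu M).+1%:R.
Proof. by move=> nu0; apply: truncn_itv; rewrite mulr_ge0 ?sqr_ge0. Qed.

Lemma cvg_sq_floor nu : 0 < nu -> ((sq_floor nu M)%:R / M%:R ^+ 2) @[M --> \oo] --> nu.
Proof.
move=> nu0; apply: (@squeeze_cvgr _ _ _ _ (fun M => nu - M%:R^-1) (fun=> nu)).
- near=> M; have M1 : (0 < M)%N by near: M; exact: nbhs_infty_gt.
  have M0 : 0 < M%:R :> R by rewrite ltr0n.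
  have M2 : 0 < M%:R ^+ 2 :> R by rewrite exprn_gt0.
  have /andP[l u] := sq_floor_itv M (ltW nu0).
  apply/andP; split; last by rewrite ler_pdivrMr.
  rewrite ler_pdivlMr // mulrBl expr2 [M%:R^-1 * _]mulrA mulVf ?gt_eqF // mul1r.
  have : (1 : R) <= M%:R by rewrite ler1n.
  by move: u; rewrite -natr1 expr2; lra.
- by rewrite -[X in _ --> X]subr0; apply: cvgB; [exact: cvg_cst|exact: cvg_invn].
- exact: cvg_cst.
Unshelve. all: by end_near.
Qed.

Lemma sq_floor_infty nu : 0 < nu -> sq_floor nu M @[M --> \oo] --> \oo.
Proof.
move=> nu0; apply/cvgnyPge => A; near=> M.
have M1 : (0 < M)%N by near: M; exact: nbhs_infty_gt.
have /andP[_ u] := sq_floor_itv M (ltW nu0).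
have : (A%:R : R) <= nu * M%:R ^+ 2.
  have h : A%:R / nu <= M%:R by near: M; exact: near_natr_ge.
  move: h; rewrite ler_pdivrMr // => h; apply: le_trans h _.
  by rewrite expr2 mulrA (mulrC nu) ler_peMr ?mulr_ge0 ?(ltW nu0) // ler1n.
by move=> h; have := le_lt_trans h u; rewrite ltr_nat ltnS.
Unshelve. all: by end_near.
Qed.

(** The power of the cosine is (1 - sin^2)^n with n sin(a / M)^2 tending to nu a^2, squeezed by
    exp(-x / (1 - x)) <= 1 - x <= exp(-x). *)
Lemma cvg_cos_pow nu (a : R) : 0 < nu -> 0 <= a ->
  (cos (a / M%:R) ^+ (sq_floor nu M).*2) @[M --> \oo] --> expR (- (nu * a ^+ 2)).
Proof.
move=> nu0 a0.
pose s M := sin (a / M%:R) ^+ 2; pose n M := (sq_floor nu M)%:R : R.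
have c2 M : cos (a / M%:R) ^+ (sq_floor nu M).*2 = (1 - s M) ^+ (sq_floor nu M).
  by rewrite -mul2n exprM cos2sin2.
have ns : (n M * s M) @[M --> \oo] --> nu * a ^+ 2.
  have : ((n M / M%:R ^+ 2) * (M%:R * sin (a / M%:R)) ^+ 2) @[M --> \oo] --> nu * a ^+ 2.
    by apply: cvgM; [exact: cvg_sq_floor|rewrite !expr2; apply: cvgM; exact: cvg_sin_divn].
  apply: cvg_trans; apply: near_eq_cvg; near=> M.
  have M0 : M%:R != 0 :> R by rewrite pnatr_eq0 -lt0n; near: M; exact: nbhs_infty_gt.
  by rewrite /s; field.
have s1 : (1 - s M) @[M --> \oo] --> (1 : R).
  rewrite -[X in _ --> X](expr1n R 2).
  have -> : (fun M => 1 - s M) = (fun M => cos (a / M%:R) ^+ 2).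
    by apply/funext => M; rewrite /s -cos2sin2.
  by rewrite !expr2; apply: cvgM; exact: cvg_cos_divn.
have cexp u l : u M @[M --> \oo] --> l -> expR (- u M) @[M --> \oo] --> expR (- l).
  by move=> ul; apply: (cvg_comp _ _ (cvgN ul)); exact: continuous_expR.
under eq_fun do rewrite c2.
apply: (@squeeze_cvgr _ _ _ _ (fun M => expR (- (n M * s M / (1 - s M)))) (fun M => expR (- (n M * s M)))).
- near=> M.
  have p : 0 < 1 - s M by near: M; exact: (cvgr_gt (1 : R)).
  apply/andP; split.
    have sl1 : s M < 1 by lra.
    have E := expR_ge_inv sl1.
    have -> : - (n M * s M / (1 - s M)) = (sq_floor nu M)%:R * - (s M / (1 - s M)) by rewrite /n; ring.
    by rewrite expRM_natl; apply: lerXn2r; rewrite ?nnegrE ?expR_ge0 // ltW.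
  have -> : - (n M * s M) = (sq_floor nu M)%:R * - s M by rewrite /n; ring.
  by rewrite expRM_natl; apply: lerXn2r; rewrite ?nnegrE ?expR_ge0 ?(ltW p) // expR_le1Bx.
- apply: cexp; rewrite -[X in _ --> X]divr1; apply: cvgM => //.
  by apply: cvgV => //; exact: oner_neq0.
- exact: cexp.
Unshelve. all: by end_near.
Qed.

Lemma cvg_bin_ratio nu j : 0 < nu -> (0 < j)%N ->
  bin_ratio R (sq_floor nu M) (M * j) @[M --> \oo] --> expR (- (j%:R ^+ 2 / nu)).
Proof.
move=> nu0 j0; pose n M := (sq_floor nu M)%:R : R.
have cexp u l : u M @[M --> \oo] --> l -> expR (- u M) @[M --> \oo] --> expR (- l).
  by move=> ul; apply: (cvg_comp _ _ (cvgN ul)); exact: continuous_expR.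
apply: (@squeeze_cvgr _ _ _ _ (fun M => expR (- (j%:R ^+ 2 / (n M / M%:R ^+ 2 - j%:R / M%:R))))
   (fun M => expR (- (j%:R ^+ 2 / (n M / M%:R ^+ 2 + j%:R / M%:R))))).
- near=> M.
  have M1 : (0 < M)%N by near: M; exact: nbhs_infty_gt.
  have M0 : M%:R != 0 :> R by rewrite pnatr_eq0 -lt0n.
  have kn : (M * j < sq_floor nu M)%N.
    rewrite -(ltr_nat R) natrM.
    have : j%:R / M%:R < n M / M%:R ^+ 2.
      have h : 0 < n M / M%:R ^+ 2 - j%:R / M%:R.
        near: M; apply: (cvgr_gt nu) => //; rewrite -[X in _ --> X]subr0.
        by apply: cvgB; [exact: cvg_sq_floor|exact: cvg_divn].
      by rewrite -subr_gt0.
    rewrite ltr_pdivlMr ?exprn_gt0 ?ltr0n // expr2 mulrA divfK //.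
    by rewrite mulrC.
  have k0 : (0 < M * j)%N by rewrite muln_gt0 M1.
  have kR : (M * j)%:R = M%:R * j%:R :> R by rewrite natrM.
  apply/andP; split.
    have := @bin_ratio_ge R (sq_floor nu M) (M * j) (M * j); rewrite leqnn kn => /(_ isT).
    apply: le_trans; rewrite le_eqVlt; apply/orP; left; apply/eqP; congr (expR (- _)).
    have h : (sq_floor nu M - M * j)%:R != 0 :> R by rewrite pnatr_eq0 -lt0n subn_gt0.
    move: h; rewrite natrB ?(ltnW kn) // kR -/(n M) => h.
    have -> : n M / M%:R ^+ 2 - j%:R / M%:R = (n M - M%:R * j%:R) / M%:R ^+ 2 by field.
    by field; rewrite h M0.
  have := @bin_ratio_le R (sq_floor nu M) (M * j) (M * j); rewrite leqnn (ltnW kn) => /(_ isT k0).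
  move=> h; apply: le_trans h _; rewrite le_eqVlt; apply/orP; left; apply/eqP; congr (expR (- _)).
  have h : (sq_floor nu M + M * j)%:R != 0 :> R by rewrite pnatr_eq0 -lt0n addn_gt0 k0 orbT.
  move: h; rewrite natrD kR -/(n M) => h.
  have -> : n M / M%:R ^+ 2 + j%:R / M%:R = (n M + M%:R * j%:R) / M%:R ^+ 2 by field.
  by field; rewrite h M0.
- apply: cexp; apply: cvgM; first exact: cvg_cst.
  rewrite -[X in X^-1]subr0; apply: cvgV; first by rewrite subr0 gt_eqF.
  by apply: cvgB; [exact: cvg_sq_floor|exact: cvg_divn].
- apply: cexp; apply: cvgM; first exact: cvg_cst.
  rewrite -[X in X^-1]addr0; apply: cvgV; first by rewrite addr0 gt_eqF.
  by apply: cvgD; [exact: cvg_sq_floor|exact: cvg_divn].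
Unshelve. all: by end_near.
Qed.

Lemma cvg_central_bin (b nu : R) : 0 < nu ->
  (n%:R * central_bin R n ^+ 2) @[n --> \oo] --> b ->
  (M%:R * central_bin R (sq_floor nu M)) @[M --> \oo] --> Num.sqrt (b / nu).
Proof.
move=> nu0 cb.
have c1 : ((sq_floor nu M)%:R * central_bin R (sq_floor nu M) ^+ 2) @[M --> \oo] --> b.
  exact: (cvg_comp _ _ (sq_floor_infty nu0) cb).
have c2 : ((sq_floor nu M)%:R * central_bin R (sq_floor nu M) ^+ 2 / ((sq_floor nu M)%:R / M%:R ^+ 2)) @[M --> \oo] --> b / nu.
  by apply: cvgM => //; apply: cvgV; [rewrite gt_eqF|exact: cvg_sq_floor].
have := cvg_comp _ _ c2 (@sqrt_continuous R (b / nu)).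
apply: cvg_trans; apply: near_eq_cvg; near=> M.
have M0 : M%:R != 0 :> R by rewrite pnatr_eq0 -lt0n; near: M; exact: nbhs_infty_gt.
have n0 : (sq_floor nu M)%:R != 0 :> R.
  rewrite pnatr_eq0 -lt0n; near: M.
  have /cvgnyPge/(_ 1%N) := sq_floor_infty nu0; exact.
rewrite /=.
have -> : (sq_floor nu M)%:R * central_bin R (sq_floor nu M) ^+ 2 / ((sq_floor nu M)%:R / M%:R ^+ 2)
  = (M%:R * central_bin R (sq_floor nu M)) ^+ 2 by field; rewrite M0 n0.
by rewrite sqrtr_sqr ger0_norm // mulr_ge0 ?central_bin_ge0.
Unshelve. all: by end_near.
Qed.

End ThetaLimit.

Section Theta.
Context (R : realType) (d : nat).
Hypotheses (od : odd d) (sd : squarefree d).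
Local Notation q := (8 * d)%N.
Local Notation chi := (chi8 d).

Definition theta (y : R) : R :=
  limn (series (fun n => (chi n)%:~R * expR (- (n%:R ^+ 2 * y)))).

Lemma chi8_norm n : `|(chi n)%:~R : R| <= 1.
Proof.
case: (chi8_real_primitive R od sd) => _ _ _ nc [val _].
have [cn|/chi8_ncoprime ->] := boolP (coprime n q); last 2 first.
- by rewrite normr0.
- exact: odd_gt0.
by case: (val n cn) => ->; rewrite ?rmorphN1 ?normrN normr1.
Qed.

Lemma is_cvg_expR_series (c : R) : 0 < c -> cvgn (series (fun n => expR (- (n%:R * c)))).
Proof.
move=> c0; have -> : (fun n => expR (- (n%:R * c))) = geometric 1 (expR (- c)).
  by apply/funext => n; rewrite /geometric /= mul1r -mulrN expRM_natl.
by apply: is_cvg_geometric_series; rewrite ger0_norm ?expR_ge0 // expR_lt1 oppr_lt0.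
Qed.

Lemma natr_le_sqr n : n%:R <= n%:R ^+ 2 :> R.
Proof. by rewrite -natrX ler_nat; case: n => // n; rewrite expnS expn1 leq_pmulr. Qed.

Lemma theta_dual (b nu : R) : 0 < nu -> 0 <= b ->
  (n%:R * central_bin R n ^+ 2) @[n --> \oo] --> b ->
  theta (pi ^+ 2 / q%:R ^+ 2 * nu) = Num.sqrt (b / nu) * Num.sqrt q%:R * theta nu^-1.
Proof.
move=> nu0 b0 cb; have d0 := odd_gt0 od.
have q0 : 0 < q%:R :> R by rewrite ltr0n muln_gt0.
have dR : d%:R != 0 :> R by rewrite pnatr_eq0 -lt0n.
pose n M := sq_floor nu M.
have ninf k : \forall M \near \oo, (k <= n M)%N.
  by have /cvgnyPge := sq_floor_infty nu0; apply.
have nlow : \forall M \near \oo, nu / 2 <= (n M)%:R / M%:R ^+ 2.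
  near=> M; apply: ltW; near: M; apply: (cvgr_gt nu); [exact: cvg_sq_floor|lra].
pose f M h := if (h < 4 * d * M)%N then (chi h)%:~R * cos (pi * h%:R / (q * M)%:R) ^+ (n M).*2 else 0 : R.
pose g M j := if (j < (n M).+1)%N then (chi j)%:~R * bin_ratio R (n M) (M * j) else 0 : R.
have Lf : \sum_(h < 4 * d * M) f M h @[M --> \oo] --> theta (pi ^+ 2 / q%:R ^+ 2 * nu).
  (* With y = pi h / (q M), [jordan_sin] and n >= nu M^2 / 2 bound cos(y)^(2 n) by exp(-n (y / 2)^2)
     <= exp(-c h^2), and h^2 >= h leaves a geometric majorant. *)
  pose c := nu * pi ^+ 2 / (8 * q%:R ^+ 2) : R.
  have c0 : 0 < c by rewrite divr_gt0 ?mulr_gt0 ?exprn_gt0 ?pi_gt0.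
  apply: (tannery (is_cvg_expR_series c0)).
  - near=> M => h.
    have M1 : (0 < M)%N by near: M; exact: nbhs_infty_gt.
    have M0 : 0 < M%:R :> R by rewrite ltr0n.
    rewrite /f; case: ifP => hP; last by rewrite normr0 expR_ge0.
    rewrite normrM; apply: le_trans (ler_piMl _ (chi8_norm h)) _ => //.
    set y := pi * h%:R / (q * M)%:R.
    have y0 : 0 <= y by rewrite divr_ge0 // mulr_ge0 ?pi_ge0.
    have QM0 : 0 < (q * M)%:R :> R by rewrite natrM mulr_gt0.
    have yp : y <= pi / 2.
      rewrite /y ler_pdivrMr // -mulrA ler_wpM2l ?pi_ge0 // mulrC ler_pdivlMr // -natrM ler_nat; lia.
    have sy : y / 2 <= sin y by apply: jordan_sin; rewrite y0.
    have s0 : 0 <= y / 2 by rewrite divr_ge0.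
    rewrite -mul2n exprM cos2sin2 ger0_norm; last first.
      by apply: exprn_ge0; rewrite -cos2sin2 sqr_ge0.
    apply: le_trans (_ : expR (- sin y ^+ 2) ^+ (n M) <= _).
      by apply: lerXn2r; rewrite ?nnegrE ?expR_ge0 ?expR_le1Bx // -cos2sin2 sqr_ge0.
    rewrite -expRM_natl ler_expR mulrN lerN2.
    have l1 : nu / 2 <= (n M)%:R / M%:R ^+ 2 by near: M.
    have s2 : (y / 2) ^+ 2 <= sin y ^+ 2 by apply: lerXn2r => //; rewrite nnegrE (le_trans s0).
    apply: le_trans (_ : (n M)%:R * (y / 2) ^+ 2 <= _); last by rewrite ler_wpM2l.
    have -> : (n M)%:R * (y / 2) ^+ 2 = ((n M)%:R / M%:R ^+ 2) * (pi ^+ 2 / (4 * q%:R ^+ 2)) * h%:R ^+ 2.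
      by rewrite /y natrM; field; rewrite ?dR ?gt_eqF.
    have -> : h%:R * c = nu / 2 * (pi ^+ 2 / (4 * q%:R ^+ 2)) * h%:R by rewrite /c; field; rewrite ?dR ?gt_eqF.
    have p0 : 0 <= pi ^+ 2 / (4 * q%:R ^+ 2) :> R by rewrite divr_ge0 ?sqr_ge0 // mulr_ge0 ?sqr_ge0.
    apply: ler_pM => //; last exact: natr_le_sqr.
      by rewrite mulr_ge0 // divr_ge0 // ltW.
    by apply: ler_pM => //; rewrite divr_ge0 // ltW.
  - by move=> M k le; rewrite /f ltnNge le.
  - move=> h; have a0 : 0 <= pi * h%:R / q%:R :> R by rewrite divr_ge0 ?mulr_ge0 ?pi_ge0.
    have : ((chi h)%:~R * cos (pi * h%:R / q%:R / M%:R) ^+ (n M).*2) @[M --> \oo] -->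
       (chi h)%:~R * expR (- (nu * (pi * h%:R / q%:R) ^+ 2)).
      by apply: cvgM; [exact: cvg_cst|exact: cvg_cos_pow].
    rewrite (_ : nu * _ ^+ 2 = h%:R ^+ 2 * (pi ^+ 2 / q%:R ^+ 2 * nu)); last by field; rewrite ?dR ?gt_eqF.
    apply: cvg_trans; apply: near_eq_cvg; near=> M.
    have M1 : (0 < M)%N by near: M; exact: nbhs_infty_gt.
    have hM : (h < M)%N by near: M; exact: nbhs_infty_gt.
    rewrite /f (_ : (h < 4 * d * M)%N); last by nia.
    by rewrite (natrM _ q M) invfM mulrA.
have Lg : \sum_(j < (n M).+1) g M j @[M --> \oo] --> theta nu^-1.
  (* [bin_ratio_le] with K = n bounds the ratio by exp(-(M j)^2 / (2 n)), and n <= nu M^2. *)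
  have c0 : 0 < (2 * nu)^-1 by rewrite invr_gt0 mulr_gt0.
  apply: (tannery (is_cvg_expR_series c0)).
  - have n1 := ninf 1%N; near=> M => j.
    have M1 : (0 < M)%N by near: M; exact: nbhs_infty_gt.
    have M0 : 0 < M%:R :> R by rewrite ltr0n.
    rewrite /g; case: ifP => jn; last by rewrite normr0 expR_ge0.
    rewrite normrM; apply: le_trans (ler_piMl _ (chi8_norm j)) _ => //.
    rewrite ger0_norm ?bin_ratio_ge0 //.
    have [le|gt] := leqP (M * j) (n M); last first.
      by rewrite /bin_ratio bin_small ?mul0r ?expR_ge0 //; lia.
    have n0 : (0 < n M)%N by near: M.
    have := @bin_ratio_le R (n M) (n M) (M * j); rewrite le leqnn => /(_ isT n0) h.
    apply: le_trans h _; rewrite ler_expR lerN2.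
    have /andP[nu1 _] := sq_floor_itv M (ltW nu0).
    have nn0 : 0 < (n M + n M)%:R :> R by rewrite ltr0n addn_gt0 n0.
    rewrite ler_pdivlMr // natrD natrM.
    apply: le_trans (_ : j%:R / (2 * nu) * (2 * (nu * M%:R ^+ 2)) <= _).
      by rewrite ler_wpM2l ?divr_ge0 ?mulr_ge0 ?(ltW nu0) //; move: nu1; rewrite /n; lra.
    rewrite (_ : _ * _ = j%:R * M%:R ^+ 2); last by field; rewrite ?dR ?gt_eqF.
    by rewrite exprMn mulrC ler_wpM2l ?sqr_ge0 // natr_le_sqr.
  - by move=> M k le; rewrite /g ltnNge le.
  - move=> j; have [->|j0] := posnP j.
      rewrite (chi8_0 od) mul0r; have -> : (fun M => g M 0%N) = fun=> 0.
        by apply/funext => M; rewrite /g (chi8_0 od) mul0r.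
      exact: cvg_cst.
    have : ((chi j)%:~R * bin_ratio R (n M) (M * j)) @[M --> \oo] --> (chi j)%:~R * expR (- (j%:R ^+ 2 / nu)).
      by apply: cvgM; [exact: cvg_cst|exact: cvg_bin_ratio].
    apply: cvg_trans; apply: near_eq_cvg; near=> M.
    have jn : (j <= n M)%N by near: M; exact: (ninf j).
    by rewrite /g ltnS jn.
have E : \forall M \near \oo, M%:R * central_bin R (n M) * Num.sqrt q%:R * \sum_(j < (n M).+1) g M j
    = \sum_(h < 4 * d * M) f M h.
  near=> M.
  have M1 : (0 < M)%N by near: M; exact: nbhs_infty_gt.
  have n0 : (0 < n M)%N by near: M; exact: (ninf 1%N).
  have := @theta_identity R d od sd M (n M) M1 n0.
  rewrite (eq_bigr (fun h : 'I_(4 * d * M) => f M h)); last by move=> h _; rewrite /f ltn_ord.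
  rewrite [in RHS](eq_bigr (fun j : 'I_(n M).+1 => g M j)); last by move=> j _; rewrite /g ltn_ord.
  by [].
have L2 : (M%:R * central_bin R (n M) * Num.sqrt q%:R * \sum_(j < (n M).+1) g M j) @[M --> \oo] -->
   Num.sqrt (b / nu) * Num.sqrt q%:R * theta nu^-1.
  apply: cvgM => //; apply: cvgM; last exact: cvg_cst.
  exact: cvg_central_bin.
have L1 : (M%:R * central_bin R (n M) * Num.sqrt q%:R * \sum_(j < (n M).+1) g M j) @[M --> \oo] -->
   theta (pi ^+ 2 / q%:R ^+ 2 * nu).
  by apply: cvg_trans Lf; apply: near_eq_cvg; apply: filterS E => M ->.
exact: (cvg_unique _ L1 L2).
Unshelve. all: by end_near.
Qed.

(** [theta_dual] contains the unevaluated factor c = sqrt(b pi). Used at z and at 1/z it gives theta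
    = c^2 theta, so either c = 1 or theta vanishes on the positive reals, and the equation holds in
    both cases. *)
Lemma theta_fe (x : R) : 0 < x ->
  theta (pi / q%:R * x) = (Num.sqrt x)^-1 * theta (pi / q%:R / x).
Proof.
have d0 := odd_gt0 od; have q0 : 0 < q%:R :> R by rewrite ltr0n muln_gt0.
have dR : d%:R != 0 :> R by rewrite pnatr_eq0 -lt0n.
have p0 := pi_gt0 R.
have aux1 (p Q z : R) : 0 < p -> 0 < Q -> 0 < z -> p ^+ 2 / Q ^+ 2 * (Q * z / p) = p / Q * z.
  by move=> p1 Q1 z1; field; rewrite (gt_eqF p1) (gt_eqF Q1).
have aux2 (p Q z : R) : 0 < p -> 0 < Q -> 0 < z -> (Q * z / p)^-1 = p / Q / z.
  by move=> p1 Q1 z1; field; rewrite (gt_eqF p1) (gt_eqF Q1) (gt_eqF z1).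
have aux3 (t p Q z : R) : 0 < p -> 0 < Q -> 0 < z -> t * (p / Q / z) * Q = t * p * z^-1.
  by move=> p1 Q1 z1; field; rewrite ?(gt_eqF Q1) ?(gt_eqF z1).
have [b b0 cb] := central_bin_cvg R.
pose c := Num.sqrt (b * pi).
have c0 : 0 <= c by exact: sqrtr_ge0.
have fe z : 0 < z -> theta (pi / q%:R * z) = c * (Num.sqrt z)^-1 * theta (pi / q%:R / z).
  move=> z0; have nu0 : 0 < q%:R * z / pi by rewrite divr_gt0 ?mulr_gt0.
  have := theta_dual nu0 b0 cb.
  rewrite (_ : pi ^+ 2 / q%:R ^+ 2 * (q%:R * z / pi) = pi / q%:R * z); last exact: aux1.
  rewrite (_ : (q%:R * z / pi)^-1 = pi / q%:R / z); last exact: aux2.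
  have t0 : 0 <= b * (pi / q%:R / z) by rewrite mulr_ge0 // !divr_ge0 // ltW.
  move=> ->; congr (_ * _); rewrite -sqrtrM //.
  rewrite (_ : b * (pi / q%:R / z) * q%:R = b * pi * z^-1); last exact: aux3.
  by rewrite sqrtrM ?mulr_ge0 ?(ltW p0) // sqrtrV // ltW.
move=> x0; have [c1|c1] := eqVneq c 1; first by rewrite fe // c1 mul1r.
have th0 z : 0 < z -> theta (pi / q%:R * z) = 0.
  move=> z0; have := fe z z0.
  have zi0 : 0 < z^-1 by rewrite invr_gt0.
  rewrite (fe z^-1 zi0) invrK sqrtrV ?(ltW z0) // invrK.
  have s0 : Num.sqrt z != 0 by rewrite gt_eqF // sqrtr_gt0.
  rewrite (_ : _ * _ = c ^+ 2 * theta (pi / q%:R * z)); last by field.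
  move=> /eqP; rewrite -subr_eq0 -{1}[theta _]mul1r -mulrBl mulf_eq0 => /orP[|/eqP //].
  rewrite -{1}(expr1n R 2) subr_sqr mulf_eq0 subr_eq0 eq_sym (negPf c1) /= addr_eq0 => /eqP h.
  by move: c0; rewrite -[c]opprK -h; lra.
by rewrite !th0 ?mulr0 // invr_gt0.
Qed.

End Theta.

(** * The approximate functional equation *)

Section RealIntegral.
Context (R : realType).
Notation mu := (@lebesgue_measure R).

Definition summable_on_line (f : R -> R) := mu.-integrable setT (EFin \o f).
Definition integral_line (f : R -> R) : R := \int[mu]_(x in setT) f x.
Local Notation intg := summable_on_line.
Local Notation I := integral_line.

Lemma intg_measurable f : intg f -> measurable_fun setT f.
Proof. by move=> /integrableP[/measurable_EFinP]. Qed.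

Lemma intg_le (f g : R -> R) : measurable_fun setT f -> (forall x, `|f x| <= g x) -> intg g -> intg f.
Proof.
move=> mf fg; apply: le_integrable => //; first exact/measurable_EFinP.
move=> x _ /=; rewrite lee_fin; apply: le_trans (fg x) _; exact: ler_norm.
Qed.

Lemma intgD (f g : R -> R) : intg f -> intg g -> intg (fun x => f x + g x).
Proof. by move=> fi gi; have := integrableD measurableT fi gi; apply: eq_integrable. Qed.

Lemma intgZ (k : R) (f : R -> R) : intg f -> intg (fun x => k * f x).
Proof. by move=> fi; have := integrableZl measurableT k fi; apply: eq_integrable. Qed.

Lemma intg_ext (f g : R -> R) : f =1 g -> intg f -> intg g.
Proof. by move=> /funext ->. Qed.

Lemma intg_sum (J : Type) (s : seq J) (P : pred J) (f : J -> R -> R) :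
  (forall j, intg (f j)) -> intg (fun x => \sum_(j <- s | P j) f j x).
Proof.
move=> fi; elim: s => [|j s IH].
  apply: (@intg_ext (fun=> 0)); first by move=> x; rewrite big_nil.
  exact: integrable0.
case Pj : (P j).
  apply: (@intg_ext (fun x => f j x + \sum_(j <- s | P j) f j x)); first by move=> x; rewrite big_cons Pj.
  exact: intgD.
by apply: (intg_ext _ IH) => x; rewrite big_cons Pj.
Qed.

Lemma ilD (f g : R -> R) : intg f -> intg g -> I (fun x => f x + g x) = I f + I g.
Proof. by move=> fi gi; rewrite /I RintegralD. Qed.

Lemma ilZ (k : R) (f : R -> R) : intg f -> I (fun x => k * f x) = k * I f.
Proof. by move=> fi; rewrite /I RintegralZl. Qed.

Lemma il_ext (f g : R -> R) : f =1 g -> I f = I g.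
Proof. by move=> /funext ->. Qed.

Lemma il_sum (J : Type) (s : seq J) (P : pred J) (f : J -> R -> R) :
  (forall j, intg (f j)) -> I (fun x => \sum_(j <- s | P j) f j x) = \sum_(j <- s | P j) I (f j).
Proof.
move=> fi; elim: s => [|j s IH].
  rewrite big_nil (@il_ext _ (fun=> 0)) => [|x]; last by rewrite big_nil.
  by rewrite /I Rintegral_cst // mul0r.
rewrite big_cons; case Pj : (P j).
  rewrite -IH -ilD //; last exact: intg_sum.
  by apply: il_ext => x; rewrite big_cons Pj.
by rewrite -IH; apply: il_ext => x; rewrite big_cons Pj.
Qed.

Lemma il_le (f g : R -> R) : intg f -> intg g -> (forall x, f x <= g x) -> I f <= I g.
Proof. by move=> fi gi fg; apply: le_Rintegral. Qed.

Lemma il_norm (f g : R -> R) : intg f -> intg g -> (forall x, `|f x| <= g x) -> `|I f| <= I g.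
Proof.
move=> fi gi fg; rewrite ler_norml; apply/andP; split.
  have := @il_le (fun x => -1 * g x) f (intgZ _ gi) fi; rewrite ilZ // mulN1r; apply => x.
  by have := fg x; rewrite ler_norml mulN1r => /andP[].
by apply: il_le => // x; apply: le_trans (fg x); exact: ler_norm.
Qed.

Lemma il_dominated (f_ : nat -> R -> R) (f g : R -> R) :
  (forall n, measurable_fun setT (f_ n)) -> (forall x, f_ n x @[n --> \oo] --> f x) ->
  intg g -> (forall n x, `|f_ n x| <= g x) ->
  intg f /\ I (f_ n) @[n --> \oo] --> I f.
Proof.
move=> mf cf gi fg.
have mff : measurable_fun setT f by apply: (measurable_fun_cvg mf) => x _; exact: cf.
have mfE n : measurable_fun setT (EFin \o f_ n) by exact/measurable_EFinP.
have mE : measurable_fun setT (EFin \o f) by exact/measurable_EFinP.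
have cE : {ae mu, forall x, setT x -> (EFin \o f_ n) x @[n --> \oo] --> (EFin \o f) x}.
  by apply: aeW => x _; apply/fine_cvgP; split; [exact: nearW|exact: cf].
have dE : {ae mu, forall x n, setT x -> (`|(EFin \o f_ n) x| <= (EFin \o g) x)%E}.
  by apply: aeW => x n _; rewrite /= lee_fin.
have [fi _ H] := @dominated_convergence _ (measurableTypeR R) R mu setT measurableT
  (fun n => EFin \o f_ n) (EFin \o f) (EFin \o g) mfE mE cE gi dE.
split=> //.
have fin := integrable_fin_num measurableT fi.
rewrite /I /Rintegral; apply: fine_cvg; rewrite fineK //.
Qed.

(** Meant for the translations and for x -> -x, which preserve Lebesgue measure. *)
Lemma il_pushforward (phi : R -> R) (f : R -> R) :
  measurable_fun setT phi ->
  (forall A : set R, measurable A -> mu (phi @^-1` A) = mu A) ->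
  intg f -> intg (f \o phi) /\ I (f \o phi) = I f.
Proof.
move=> mphi muphi fi.
have E (g : R -> \bar R) : measurable_fun setT g -> (forall x, 0 <= g x)%E ->
    (\int[mu]_x (g (phi x)) = \int[mu]_x g x)%E.
  move=> mg g0; have := @ge0_integral_pushforward _ _ (measurableTypeR R) (measurableTypeR R) R phi mphi mu setT g measurableT mg (fun y _ => g0 y).
  rewrite preimage_setT => <-.
  by apply: eq_measure_integral => A mA _; exact: muphi.
have mf := intg_measurable fi.
have fiphi : intg (f \o phi).
  apply/integrableP; split; first by apply/measurable_EFinP; exact: measurableT_comp.
  have Ea : (\int[mu]_x `|f (phi x)|%:E = \int[mu]_x `|f x|%:E)%E.
    apply: (E (fun x => `|f x|%:E)%E) => [|x]; last by rewrite lee_fin.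
    by apply/measurable_EFinP; exact: measurableT_comp.
  have : (\int[mu]_x `|f (phi x)|%:E < +oo)%E by rewrite Ea; move/integrableP: fi => [].
  by [].
split=> //.
have := @integral_pushforward _ _ (measurableTypeR R) (measurableTypeR R) R phi mphi mu setT (EFin \o f) ((@measurable_EFinP _ _ _ _ _).2 mf).
rewrite preimage_setT => /(_ fiphi measurableT) H.
rewrite /I /Rintegral; congr fine; rewrite -[LHS]H.
by apply: eq_measure_integral => A mA _; exact: muphi.
Qed.

Lemma il_shift (c : R) (f : R -> R) : intg f ->
  intg (fun x => f (x + c)) /\ I (fun x => f (x + c)) = I f.
Proof.
move=> fi; apply: (@il_pushforward (fun x => x + c)) => //.
  by apply: measurable_funD.
have mphi : measurable_fun setT (fun x : measurableTypeR R => x + c : measurableTypeR R).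
  by apply: measurable_funD.
move=> A mA; apply/esym.
pose nu := pushforward mu (fun x : measurableTypeR R => x + c : measurableTypeR R).
apply: (@lebesgue_measure_unique R nu) => //= _ [[a b]] _ <-.
rewrite /nu /pushforward.
have -> : (fun x : R => x + c) @^-1` `]a, b] = `]a - c, b - c]%classic.
  by apply/seteqP; split=> x /=; rewrite !in_itv /= ltrBlDr lerBrDr.
rewrite /= !lebesgue_measure_itv /= !lte_fin ltrD2r.
by case: ifP => // _; rewrite -!EFinD; congr EFin; ring.
Qed.

Lemma il_opp (f : R -> R) : intg f -> intg (fun x => f (- x)) /\ I (fun x => f (- x)) = I f.
Proof.
move=> fi; have mo : measurable_fun setT (fun x : R => - x).
  by apply: continuous_measurable_fun => x; exact: opp_continuous.
apply: (@il_pushforward (fun x => - x)) => //.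
by move=> A mA; have := @lebesgue_measureN R A mA; rewrite /pushforward.
Qed.

Lemma il_point (c : R) : intg (fun x => if x == 0 then c else 0) /\ I (fun x => if x == 0 then c else 0) = 0.
Proof.
have E : (fun x : R => if x == 0 then c else 0) = (fun x => c * \1_(`[0, 0]%classic) x).
  apply/funext => x; rewrite indicE; case: (boolP (x \in _)).
    by rewrite inE /= in_itv /= -eq_le => /eqP <-; rewrite eqxx mulr1.
  rewrite notin_setE /= in_itv /= => /negP; rewrite -eq_le mulr0 eq_sym.
  by case: eqP.
have i1 : intg (\1_(`[0, 0]%classic) : R -> R) by exact: (@integrable_indic_itv R 0 0 true false).
split; first by rewrite E; exact: intgZ.
rewrite E ilZ // /I /Rintegral integral_indic //= setIT lebesgue_measure_itv /= lte_fin ltxx.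
by rewrite mulr0.
Qed.

Lemma intg_exp_abs (a : R) : 0 < a -> intg (fun x => expR (- (a * `|x|))).
Proof.
move=> a0; have e1 : intg (exponential_pdf a) by exact: integrable_exponential_pdf.
have [e2 _] := il_opp e1.
apply: (@intg_le _ (fun x => a^-1 * (exponential_pdf a x + exponential_pdf a (- x)))); last first.
  exact/intgZ/intgD.
  move=> x; rewrite ger0_norm ?expR_ge0 // [leRHS]mulrC ler_pdivlMr //.
  have H y : 0 <= y -> exponential_pdf a y = a * expR (- (a * y)).
    by move=> y0; rewrite exponential_pdfE // mulNr.
  have [x0|x0] := leP 0 x.
    by rewrite ger0_norm // H // mulrC lerDl exponential_pdf_ge0 // ltW.
  rewrite ltr0_norm // (H (- x)) ?oppr_ge0 ?(ltW x0) // mulrC lerDr.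
  by rewrite exponential_pdf_ge0 // ltW.
have -> : (fun x : R => expR (- (a * `|x|))) = (fun x => expR (- a * `|x|)) by apply/funext => x; rewrite mulNr.
apply: (measurableT_comp (@measurable_expR R)); exact: measurable_funM.
Qed.

Lemma expR_ge1_of (y : R) : 0 <= y -> 1 <= expR y.
Proof. by move=> y0; rewrite -expR0 ler_expR. Qed.

Lemma expR_le1_of (y : R) : y <= 0 -> expR y <= 1.
Proof. by move=> y0; rewrite -[leRHS]expR0 ler_expR. Qed.

(* y^(1/4) exp (-y) in the variable t = ln y. *)
Definition kern (t : R) := expR (t / 4) * expR (- expR t).

Lemma kern_gt0 t : 0 < kern t.
Proof. by rewrite mulr_gt0 ?expR_gt0. Qed.

Lemma measurable_kern : measurable_fun setT kern.
Proof.
apply: measurable_funM; apply: (measurableT_comp (@measurable_expR R)).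
  exact: measurable_funM.
by apply: measurableT_comp => //; exact: measurable_expR.
Qed.

(** The factor (1 + e^(t/2))^4 is room for the powers of u = [tau t] in the error terms of the
    moment. *)
Lemma kern_bound : exists2 C : R, 0 < C &
  forall t, kern t * (1 + expR (t / 2)) ^+ 4 <= C * expR (- (4^-1 * `|t|)).
Proof.
(* 96 is 6 times 16, from exp(-y) <= 6 / y^3 with y = e^t, and (1 + x)^4 <= 16 x^4 for x >= 1. *)
exists 96 => // t; rewrite /kern.
have p (y : R) : 0 <= y -> y ^+ 3 / 6 <= expR y.
  move=> y0; have := @expR_ge1Dxn R y 2 y0; rewrite -[3`!]/6%N; lra.
have [t0|t0] := leP 0 t.
  rewrite ger0_norm //.
  have e0 : 0 < expR t by exact: expR_gt0.
  have h1 : (1 + expR (t / 2)) ^+ 4 <= 16 * expR t ^+ 2.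
    have -> : expR t ^+ 2 = expR (t / 2) ^+ 4 by rewrite -!expRM_natl; congr expR; field.
    have : 1 <= expR (t / 2) by apply: expR_ge1_of; lra.
    move: (expR (t / 2)) => y y1.
    have : (1 + y) ^+ 4 <= (2 * y) ^+ 4 by apply: lerXn2r; rewrite ?nnegrE; lra.
    by rewrite exprMn; lra.
  have h2 : expR (- expR t) <= 6 / expR t ^+ 3.
    rewrite expRN -[6 / _]invf_div lef_pV2 ?posrE ?expR_gt0 ?divr_gt0 ?exprn_gt0 //.
    by apply: p; exact: ltW.
  have h3 : kern t * (1 + expR (t / 2)) ^+ 4 <= expR (t / 4) * (6 / expR t ^+ 3) * (16 * expR t ^+ 2).
    rewrite /kern; apply: ler_pM; rewrite ?mulr_ge0 ?expR_ge0 ?exprn_ge0 ?addr_ge0 ?expR_ge0 //.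
    by rewrite ler_wpM2l ?expR_ge0.
  apply: le_trans h3 _.
  have -> : expR (t / 4) * (6 / expR t ^+ 3) * (16 * expR t ^+ 2) = 96 * (expR (t / 4) / expR t) by field; rewrite gt_eqF.
  rewrite -expRN -expRD.
  have : expR (t / 4 - t) <= expR (- (4^-1 * t)) by rewrite ler_expR; lra.
  have := expR_ge0 (- (4^-1 * t)); lra.
rewrite ltr0_norm //.
have h1 : (1 + expR (t / 2)) ^+ 4 <= 16.
  have : expR (t / 2) <= 1 by apply: expR_le1_of; lra.
  have := expR_ge0 (t / 2); move: (expR (t / 2)) => y y0 y1.
  have : (1 + y) ^+ 4 <= 2 ^+ 4 by apply: lerXn2r; rewrite ?nnegrE; lra.
  by lra.
have h2 : expR (- expR t) <= 1 by apply: expR_le1_of; rewrite oppr_le0 expR_ge0.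
have h3 : kern t * (1 + expR (t / 2)) ^+ 4 <= expR (t / 4) * 1 * 16.
  rewrite /kern; apply: ler_pM; rewrite ?mulr_ge0 ?expR_ge0 ?exprn_ge0 ?addr_ge0 ?expR_ge0 //.
  by rewrite ler_wpM2l ?expR_ge0.
apply: le_trans h3 _; rewrite (_ : - (4^-1 * - t) = t / 4); last by field.
have := expR_ge0 (t / 4); lra.
Qed.

Lemma intg_kernM (f : R -> R) (C : R) : measurable_fun setT f ->
  (forall t, `|f t| <= C * (1 + expR (t / 2)) ^+ 4) -> intg (fun t => kern t * f t).
Proof.
move=> mf fC; have [B B0 HB] := kern_bound.
have C0 : 0 <= C.
  have := le_trans (normr_ge0 _) (fC 0); rewrite mul0r expR0 addrC pmulr_lge0 // exprn_gt0 // addr_gt0.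

apply: (@intg_le _ (fun t => C * B * expR (- (4^-1 * `|t|)))).
- by apply: measurable_funM => //; exact: measurable_kern.
- move=> t; rewrite normrM ger0_norm ?(ltW (kern_gt0 t)) //.
  apply: le_trans (ler_wpM2l (ltW (kern_gt0 t)) (fC t)) _.
  by rewrite mulrCA -mulrA ler_wpM2l.
by apply: intgZ; apply: intg_exp_abs; rewrite invr_gt0.
Qed.

(** In the variable y = e^t this is the integral for Gamma(1/4), the gamma factor of an even
    character at s = 1/2. *)
Definition kernI := I kern.

Lemma intg_kern : intg kern.
Proof.
apply: (@intg_ext (fun t => kern t * 1)); first by move=> t; rewrite mulr1.
apply: (@intg_kernM _ 1) => // t.
by rewrite normr1 mul1r exprn_ege1 // lerDl expR_ge0.
Qed.

Lemma kernI_gt0 : 0 < kernI.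
Proof.
pose g (x : R) : R := expR (- expR 1) * (\1_(`[0, 1]%classic) x).
have gi : intg g by apply/intgZ; exact: (@integrable_indic_itv R 0 1 true false).
have le : I g <= kernI.
  apply: il_le => //; first exact: intg_kern.
  move=> x; rewrite /g indicE; case: (boolP (x \in _)) => [|_]; last by rewrite mulr0 ltW // kern_gt0.
  rewrite inE /= in_itv /= => /andP[x0 x1]; rewrite mulr1 /kern.
  rewrite -[leLHS]mul1r; apply: ler_pM => //; rewrite ?expR_ge0 //.
    by apply: expR_ge1_of; lra.
  by rewrite ler_expR lerN2 ler_expR.
apply: lt_le_trans le; rewrite /I.
rewrite -/(I g) /g ilZ; last exact: (@integrable_indic_itv R 0 1 true false).
rewrite mulr_gt0 ?expR_gt0 // /I /Rintegral.
rewrite integral_indic //= setIT lebesgue_measure_itv /= lte_fin ltr01 /=; lra.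
Qed.

End RealIntegral.

Section Abel.
Context (R : realType).

Lemma abel_bound (u c : nat -> R) (B : R) N :
  (forall n, `|\sum_(k < n) u k| <= B) -> (forall k, 0 <= c k.+1 <= c k) ->
  `|\sum_(k < N) u k * c k| <= B * c 0%N.
Proof.
move=> uB cm; pose U n := \sum_(k < n) u k.
have id n : \sum_(k < n) u k * c k = U n * c n + \sum_(k < n) U k.+1 * (c k - c k.+1).
  elim: n => [|n IH]; first by rewrite !big_ord0 /U big_ord0 mul0r add0r.
  rewrite !big_ord_recr /= IH /U big_ord_recr /=; ring.
have B0 : 0 <= B := le_trans (normr_ge0 _) (uB 0%N).
have cpos n : 0 <= c n by case/andP: (cm n) => a b; exact: le_trans b.
rewrite id; apply: le_trans (ler_normD _ _) _.
apply: (@le_trans _ _ (B * c N + \sum_(k < N) B * (c k - c k.+1))).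
  apply: lerD; first by rewrite normrM (ger0_norm (cpos N)); apply: ler_wpM2r => //; exact: (uB N).
  apply: le_trans (ler_norm_sum _ _ _) _; apply: ler_sum => k _.
  have h : 0 <= c k - c k.+1 by rewrite subr_ge0; case/andP: (cm k).
  by rewrite normrM (ger0_norm h); apply: ler_wpM2r => //; exact: (uB k.+1).
rewrite -mulr_sumr -mulrDr ler_wpM2l //.
have -> : \sum_(k < N) (c k - c k.+1) = c 0%N - c N.
  elim: (N) => [|n IH]; first by rewrite big_ord0 subrr.
  by rewrite big_ord_recr /= IH; ring.
lra.
Qed.

Definition Spart (chi : nat -> int) (x : R) : R :=
  \sum_(1 <= n < (Num.truncn x).+1) (chi n)%:~R / Num.sqrt n%:R.

(** Chosen so that n <= tau(t) sqrt d is the same as pi n^2 / (8 d) <= e^t. *)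
Definition tau (t : R) : R := Num.sqrt (8 / pi) * expR (t / 2).

Lemma tau_gt0 t : 0 < tau t.
Proof. by rewrite mulr_gt0 ?expR_gt0 // sqrtr_gt0 divr_gt0 ?pi_gt0. Qed.

Lemma sqrt_expR (x : R) : Num.sqrt (expR x) = expR (x / 2).
Proof.
have -> : expR x = expR (x / 2) ^+ 2 by rewrite -expRM_natl; congr expR; field.
by rewrite sqrtr_sqr ger0_norm ?expR_ge0.
Qed.

End Abel.

Section AFE.
Context (R : realType) (d : nat).
Hypotheses (od : odd d) (sd : squarefree d).
Local Notation q := (8 * d)%N.
Local Notation chi := (chi8 d).
Local Notation intg := (@summable_on_line R).
Local Notation I := (@integral_line R).
Local Notation kern := (@kern R).

Let d0 : (0 < d)%N. Proof. exact: odd_gt0. Qed.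
Let qn0 : (0 < q)%N. Proof. by rewrite muln_gt0. Qed.
Let A : R := pi / q%:R.
Let A0 : 0 < A. Proof. by rewrite divr_gt0 ?pi_gt0 ?ltr0n. Qed.

Lemma chi8_sum_period : \sum_(a < q) (chi a)%:~R = 0 :> R.
Proof.
have P := chi8_real_primitive R od sd.
have := char_gauss_twist P (unity_root_prim R qn0) 0.
rewrite (chi8_0 od) mul0r => E.
apply: (@complexI R); rewrite rmorph_sum /= -[RHS]E; apply: eq_bigr => a _.
by rewrite muln0 expr0 mulr1 rmorph_int.
Qed.

Lemma chi8_partial_sum n : `|\sum_(k < n) (chi k.+1)%:~R| <= (q%:R : R).
Proof.
have E m : \sum_(k < m) (chi k)%:~R = \sum_(k < m %% q) (chi k)%:~R :> R.
  suff H j r0 : \sum_(k < (r0 + j * q)%N) (chi k)%:~R = \sum_(k < r0) (chi k)%:~R :> R.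
    by rewrite -[RHS](H (m %/ q)%N) addnC -divn_eq.
  elim: j => [|j IH]; first by rewrite mul0n addn0.
  rewrite mulSn addnCA -[RHS]IH; set r := (r0 + j * q)%N.
  rewrite -(big_mkord xpredT (fun k => (chi k)%:~R : R)) (big_cat_nat (leq0n q) (leq_addr r q)) /=.
  rewrite big_mkord chi8_sum_period add0r -{1}[q]add0n big_addn addKn big_mkord.
  apply: eq_bigr => k _; rewrite -[chi (k + q)%N](chi8_per R od sd).
  by rewrite modnDr (chi8_per R od sd).
have -> : \sum_(k < n) (chi k.+1)%:~R = \sum_(k < n.+1) (chi k)%:~R :> R.
  by rewrite big_ord_recl /= (chi8_0 od) add0r.
rewrite E; apply: le_trans (ler_norm_sum _ _ _) _.
apply: (@le_trans _ _ (\sum_(k < n.+1 %% q) 1)); first by apply: ler_sum => k _; exact: chi8_norm.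
by rewrite sumr_const card_ord ler_nat ltnW // ltn_pmod.
Qed.

Let a (k : nat) : R := (chi k.+1)%:~R / Num.sqrt k.+1%:R.
(** Translation by [c k] multiplies y = e^t by pi (k + 1)^2 / q, as in the theta series; the index k
    stands for n = k + 1. *)
Let c (k : nat) : R := 2 * ln k.+1%:R + ln A.

Lemma expR_c k : expR (c k) = k.+1%:R ^+ 2 * A.
Proof.
rewrite /c expRD lnK ?posrE // -[2 * _]/(2%:R * _) expRM_natl lnK // posrE ltr0n //.
Qed.

Lemma kern_c k v : a k * kern (v + c k) =
  expR ((v + ln A) / 4) * ((chi k.+1)%:~R * expR (- (k.+1%:R ^+ 2 * (A * expR v)))).
Proof.
rewrite /kern expRD expR_c /a.
have -> : (v + c k) / 4 = (v + ln A) / 4 + ln k.+1%:R / 2 by rewrite /c; field.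
rewrite expRD -sqrt_expR lnK ?posrE ?ltr0n // mulrCA.
have s0 : Num.sqrt k.+1%:R != 0 :> R by rewrite gt_eqF // sqrtr_gt0.
rewrite (_ : expR v * _ = k.+1%:R ^+ 2 * (A * expR v)); last by ring.
by move: (expR (- _)) => E; field.
Qed.

Let T N v := \sum_(k < N) a k * kern (v + c k).
Let H v := expR ((v + ln A) / 4) * theta d (A * expR v).

Lemma T_cvg v : T N v @[N --> \oo] --> H v.
Proof.
have -> : (fun N => T N v) = (fun N => expR ((v + ln A) / 4) *
   series (fun n => (chi n)%:~R * expR (- (n%:R ^+ 2 * (A * expR v)))) N.+1).
  apply/funext => N; rewrite /T /series /= big_mkord big_ord_recl /= (chi8_0 od) mul0r add0r mulr_sumr.
  by apply: eq_bigr => k _; rewrite kern_c.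
apply: cvgM; first exact: cvg_cst.
have y0 : 0 < A * expR v by rewrite mulr_gt0 ?expR_gt0.
rewrite (cvg_shiftS (series (fun n => (chi n)%:~R * expR (- (n%:R ^+ 2 * (A * expR v)))))).
apply: (dominated_cvg_series _ (is_cvg_expR_series y0)) => k.
rewrite normrM (ger0_norm (expR_ge0 _)); apply: le_trans (ler_wpM2r (expR_ge0 _) (chi8_norm R od sd k)) _.
by rewrite mul1r ler_expR lerN2 ler_wpM2r ?(ltW y0) // natr_le_sqr.
Qed.

(** The integrals of the single terms have size 1 / sqrt k and are not absolutely summable. Abel
    summation, with the bounded partial sums of chi and the decreasing exponentials, gives an
    integrable majorant that does not depend on N. *)
Lemma T_bound N v : `|T N v| <= q%:R * kern (v + ln A).
Proof.
rewrite /T (eq_bigr _ (fun (k : 'I_N) _ => kern_c k v)) -mulr_sumr normrM ger0_norm ?expR_ge0 //.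
have -> : q%:R * kern (v + ln A) = expR ((v + ln A) / 4) * (q%:R * expR (- (1%:R ^+ 2 * (A * expR v)))).
  rewrite /kern expRD lnK ?posrE // expr1n mul1r mulrCA [A * _]mulrC //.
rewrite ler_wpM2l ?expR_ge0 //.
apply: (@abel_bound _ (fun k => (chi k.+1)%:~R) (fun k => expR (- (k.+1%:R ^+ 2 * (A * expR v))))).
  exact: chi8_partial_sum.
move=> k; rewrite expR_ge0 ler_expR lerN2 ler_wpM2r //.
  by rewrite mulr_ge0 ?(ltW A0) ?expR_ge0.
by apply: lerXn2r; rewrite ?nnegrE // ler_nat.
Qed.

Lemma measurable_T N : measurable_fun setT (T N).
Proof.
apply: measurable_sum => k; apply: measurable_funM => //.
apply: (measurableT_comp (@measurable_kern R)).
by apply: measurable_funD.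
Qed.

Lemma il_T N : I (T N) = kernI R * \sum_(k < N) a k.
Proof.
rewrite /T il_sum; last by move=> k; apply: intgZ; exact: (il_shift (c k) (intg_kern R)).1.
rewrite mulr_sumr; apply: eq_bigr => k _; rewrite ilZ; last exact: (il_shift (c k) (intg_kern R)).1.
by rewrite (il_shift (c k) (intg_kern R)).2 mulrC.
Qed.

Lemma intg_H : intg H /\ I (T N) @[N --> \oo] --> I H.
Proof.
apply: (@il_dominated _ T H (fun v => q%:R * kern (v + ln A))).
- exact: measurable_T.
- exact: T_cvg.
- by apply: intgZ; exact: (il_shift (ln A) (intg_kern R)).1.
- exact: T_bound.
Qed.

(** Translation does not change the mass of the kernel, so the partial sums of the Dirichlet series
    are the integrals of [T N] divided by [kernI], and they converge because these integrals do. *)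
Lemma dirichletL_half : dirichletL chi (2^-1 : R) = I H / kernI R.
Proof.
have k0 := kernI_gt0 R.
apply: cvg_lim => //.
have -> : (fun N => \sum_(1 <= n < N.+1) (chi n)%:~R / n%:R `^ 2^-1) = (fun N => I (T N) / kernI R).
  apply/funext => N; rewrite il_T mulrC mulKf ?gt_eqF // big_add1 /= big_mkord.
  by apply: eq_bigr => k _; rewrite /a powR12_sqrt.
by apply: cvgM; [exact: intg_H.2|exact: cvg_cst].
Qed.

Lemma H_sym v : H (- v) = H v.
Proof.
rewrite /H; have e0 := expR_gt0 v.
rewrite [theta d (A * expR v)](theta_fe od sd e0) -/A sqrt_expR expRN.
rewrite mulrA; congr (_ * _).
by rewrite -expRN -expRD; congr expR; field.
Qed.

Let ind (v : R) : R := \1_(`[0, +oo[%classic) v.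

Lemma indE (v : R) : ind v = (0 <= v)%R%:R.
Proof. by rewrite /ind indicE mem_setE /= in_itv /= andbT. Qed.

Lemma measurable_ind_itv (f : R -> R) (i : interval R) : measurable_fun setT f ->
  measurable_fun setT (fun v => f v * \1_([set` i]) v).
Proof. by move=> mf; apply: measurable_funM => //; apply: measurable_indic. Qed.

Lemma intg_ind (f : R -> R) (i : interval R) : intg f -> intg (fun v => f v * \1_([set` i]) v).
Proof.
move=> fi; apply: (@intg_le _ _ (fun v => `|f v|)).
- by apply: measurable_ind_itv; exact: intg_measurable.
- move=> v; rewrite normrM ler_piMr // indicE; case: (_ \in _); rewrite ?normr1 ?normr0 //.
- exact: (integrable_norm fi).
Qed.

(** Evenness of [H]. The point 0 belongs to only one of the two half-lines and is dealt with by
    [il_point]. *)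
Lemma il_H_half : I H = 2 * I (fun v => H v * ind v).
Proof.
have hi := intg_H.1.
pose P v := H v * \1_(`]0, +oo[%classic) v.
pose Nn v := H v * \1_(`]-oo, 0[%classic) v.
have iP : intg P by exact: intg_ind.
have iN : intg Nn by exact: intg_ind.
have [iz z0] := il_point (H 0).
have E1 : I (fun v => H v * ind v) = I P.
  rewrite -[RHS]addr0 -z0 -ilD //; apply: il_ext => v.
  rewrite indE /P indicE mem_setE /= in_itv /= andbT.
  by case: (ltrgt0P v) => [|_|->]; rewrite ?mulr1 ?mulr0 ?addr0 ?add0r.
have E2 : I Nn = I P.
  rewrite -(il_opp iP).2; apply: il_ext => v.
  by rewrite /Nn /P H_sym !indicE !mem_setE /= !in_itv /= andbT oppr_gt0.
have ii : intg (fun v => H v * ind v) by exact: intg_ind.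
have -> : I H = I (fun v => H v * ind v) + I Nn.
  rewrite -ilD //; apply: il_ext => v.
  rewrite indE /Nn indicE mem_setE /= in_itv /=.
  by case: (lerP 0 v) => _; rewrite ?mulr1 ?mulr0 ?addr0 ?add0r.
rewrite E1 E2; lra.
Qed.

Lemma Spart_tau t : \forall N \near \oo,
  \sum_(k < N) a k * ind (t - c k) = Spart chi (tau t * Num.sqrt d%:R).
Proof.
set x := tau t * _; have x0 : 0 < x by rewrite mulr_gt0 ?tau_gt0 // sqrtr_gt0 ltr0n.
have key k : (0 <= t - c k) = (k.+1 <= Num.truncn x)%N.
  rewrite subr_ge0 -ler_expR expR_c truncn_ge_nat ?(ltW x0) //.
  have -> : (k.+1%:R ^+ 2 * A <= expR t) = (k.+1%:R ^+ 2 <= x ^+ 2).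
    rewrite -ler_pdivlMr //; congr (_ <= _).
    rewrite /x exprMn sqr_sqrtr // /tau exprMn sqr_sqrtr; last by rewrite divr_ge0 ?pi_ge0.
    have -> : expR (t / 2) ^+ 2 = expR t by rewrite -expRM_natl; congr expR; field.
    have dr : d%:R != 0 :> R by rewrite pnatr_eq0 -lt0n.
    have p0 : (pi : R) != 0 by rewrite gt_eqF ?pi_gt0.
    rewrite /A natrM; move: (pi : R) p0 (d%:R : R) dr (expR t) => p p0 w w0 e; field.
    by rewrite w0 p0.
  by rewrite ler_pXn2r // nnegrE // ltW.
near=> N; have Nx : (Num.truncn x <= N)%N by near: N; exact: nbhs_infty_ge.
rewrite /Spart big_add1 /= -(big_mkord xpredT (fun k => a k * ind (t - c k))).
rewrite (big_cat_nat (leq0n _) Nx) /=.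
rewrite [X in _ + X]big_nat [X in _ + X]big1 ?addr0 => [|k /andP[le _]].
  rewrite big_nat [RHS]big_nat; apply: eq_bigr => k /andP[_ lt].
  by rewrite indE key lt mulr1.
by rewrite indE key leqNgt ltnS le mulr0.
Unshelve. all: by end_near.
Qed.

(* H is the theta function on a logarithmic scale, even by the functional
   equation, with integral kernI * L(1/2, chi). Its integral over the half line,
   taken term by term, is an average of sharp partial sums. *)
Lemma L_half_integral :
  intg (fun t => kern t * Spart chi (tau t * Num.sqrt d%:R)) /\
  dirichletL chi (2^-1 : R) =
    2 / kernI R * I (fun t => kern t * Spart chi (tau t * Num.sqrt d%:R)).
Proof.
pose U N t := kern t * \sum_(k < N) a k * ind (t - c k).
pose S t := kern t * Spart chi (tau t * Num.sqrt d%:R).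
have mU N : measurable_fun setT (U N).
  apply: measurable_funM; first exact: measurable_kern.
  apply: measurable_sum => k; apply: measurable_funM => //.
  apply: (@measurableT_comp _ _ _ _ _ _ ind); first exact: measurable_indic.
  exact: measurable_funB.
have bU N t : `|U N t| <= q%:R * kern t.
  rewrite /U normrM (ger0_norm (ltW (kern_gt0 t))) mulrC ler_wpM2r ?(ltW (kern_gt0 t)) //.
  have -> : \sum_(k < N) a k * ind (t - c k) = \sum_(k < N) (chi k.+1)%:~R * (ind (t - c k) / Num.sqrt k.+1%:R).
    by apply: eq_bigr => k _; rewrite /a; ring.
  apply: le_trans (@abel_bound _ (fun k => (chi k.+1)%:~R) (fun k => ind (t - c k) / Num.sqrt k.+1%:R) q%:R N _ _) _.
  - exact: chi8_partial_sum.
  - move=> k; rewrite !indE divr_ge0 //=; apply: ler_pM => //.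
      rewrite ler_nat; case: (lerP 0 (t - c k.+1)) => // h.
      have -> : 0 <= t - c k; last by [].
      apply: le_trans h _; rewrite lerD2l lerN2 -ler_expR !expR_c ler_wpM2r ?(ltW A0) //.
      by apply: lerXn2r; rewrite ?nnegrE // ler_nat.
    by rewrite lef_pV2 ?posrE ?sqrtr_gt0 // ler_wsqrtr // ler_nat.
  - rewrite sqrtr1 divr1 indE; case: (0 <= _) => /=; rewrite ?mulr1 ?mulr0 //.
have iqk : intg (fun t => q%:R * kern t) by exact/intgZ/intg_kern.
have [iS cS] : intg S /\ I (U N) @[N --> \oo] --> I S.
  apply: (@il_dominated _ U S (fun t => q%:R * kern t)) => //.
  move=> t; apply: cvg_near_cst; apply: filterS (Spart_tau t) => N E.
  by rewrite /U /S E.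
split=> //.
have TU N : I (fun v => T N v * ind v) = I (U N).
  have i1 k : intg (fun v => a k * (kern (v + c k) * ind v)).
    by apply/intgZ/intg_ind; exact: (il_shift (c k) (intg_kern R)).1.
  have i2 k : intg (fun t => kern t * ind (t - c k)).
    have : intg (fun v => kern (v + c k) * ind v) by apply/intg_ind; exact: (il_shift (c k) (intg_kern R)).1.
    move=> /(il_shift (- c k)) [h _]; apply: intg_ext h => t.
    by rewrite subrK.
  transitivity (\sum_(k < N) I (fun v => a k * (kern (v + c k) * ind v))).
    rewrite -il_sum //; apply: il_ext => v; rewrite /T mulr_suml.
    by apply: eq_bigr => k _; rewrite mulrA.
  transitivity (\sum_(k < N) I (fun t => a k * (kern t * ind (t - c k)))); last first.
    rewrite -il_sum; last by move=> k; exact: intgZ.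
    by apply: il_ext => t; rewrite /U mulr_sumr; apply: eq_bigr => k _; rewrite mulrCA.
  apply: eq_bigr => k _; rewrite !ilZ //; last by apply/intg_ind; exact: (il_shift (c k) (intg_kern R)).1.
  congr (_ * _); rewrite -[LHS](il_shift (- c k) _).2; last by apply/intg_ind; exact: (il_shift (c k) (intg_kern R)).1.
  by apply: il_ext => t; rewrite subrK.
have cT : I (fun v => T N v * ind v) @[N --> \oo] --> I (fun v => H v * ind v).
  apply: (@il_dominated _ (fun N v => T N v * ind v) _ (fun v => q%:R * kern (v + ln A)) _ _ _ _).2.
  - by move=> N; apply: measurable_ind_itv; exact: measurable_T.
  - by move=> v; apply: cvgM; [exact: T_cvg|exact: cvg_cst].
  - by apply: intgZ; exact: (il_shift (ln A) (intg_kern R)).1.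
  - move=> N v; rewrite normrM; apply: le_trans (T_bound N v).
    by rewrite ler_piMr // indE; case: (0 <= v); rewrite ?normr1 ?normr0.
have E : I (fun v => H v * ind v) = I S.
  apply: (cvg_unique _ cT) => //; rewrite (_ : (fun N => _) = fun N => I (U N)) //.
  by apply/funext => N; exact: TU.
by rewrite dirichletL_half il_H_half E; field; rewrite gt_eqF ?kernI_gt0.
Qed.

End AFE.

(** * Character sums and the first moment of the partial sums *)

Section PolyaVinogradov.
Context (R : realType).
Local Notation C := (complex R).
Local Notation e := (unity_root R).

Lemma cis_sub1 (x : R) : cis x - 1 = Complex (- (2 * sin (x / 2) ^+ 2)) (2 * sin (x / 2) * cos (x / 2)).
Proof.
rewrite /cis {1 2}(_ : x = x / 2 + x / 2); last by field.
rewrite cosD sinD; have := cos2Dsin2 (x / 2); move: (cos _) (sin _) => c s h.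
apply/eqP; rewrite eq_complex /=; apply/andP; split; apply/eqP; last by ring.
have -> : c * c = 1 - s ^+ 2 by rewrite -h; ring.
ring.
Qed.

Lemma norm_cis_sub1 (x : R) : `|cis x - 1| = (2 * `|sin (x / 2)|)%:C%C.
Proof.
have E : `|cis x - 1| ^+ 2 = (2 * `|sin (x / 2)|)%:C%C ^+ 2.
  rewrite sqr_normc cis_sub1; have := cos2Dsin2 (x / 2); move: (cos _) (sin _) => c s h.
  rewrite -rmorphXn exprMn real_normK ?num_real //=.
  apply/eqP; rewrite eq_complex /=; apply/andP; split; apply/eqP; last by ring.
  have -> : - (2 * s ^+ 2) * - (2 * s ^+ 2) - 2 * s * c * - (2 * s * c) = 4 * s ^+ 2 * (c ^+ 2 + s ^+ 2) by ring.
  rewrite h; ring.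
by move/eqP: E; rewrite eqrXn2 // => [/eqP|]; rewrite ?lecR ?mulr_ge0.
Qed.

Lemma norm_unity_root n k : (0 < n)%N -> `|e n ^+ k| = 1.
Proof.
move=> n0; have : `|e n ^+ k| ^+ n = 1.
  by rewrite -normrX -exprM mulnC exprM (prim_expr_order (unity_root_prim R n0)) expr1n normr1.
by move/eqP; rewrite -[X in _ == X](expr1n _ n) eqrXn2 // => /eqP.
Qed.

(** The modulus of the geometric sum is at most 1 / |sin(pi a / n)|, to which [jordan_sin] applies
    with a or with n - a, whichever is at most n / 2; adding both reciprocals covers the two
    cases. *)
Lemma geom_unity_root n a Y : (0 < a < n)%N ->
  `|\sum_(h < Y) e n ^+ (a * h)| <= (n%:R / a%:R + n%:R / (n - a)%:R : R)%:C%C.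
Proof.
move=> /andP[a0 an]; have n0 : (0 < n)%N by lia.
set z := e n ^+ a.
have zE : z = cis (2 * (pi * (a%:R / n%:R))) by rewrite /z unity_rootX; congr cis; ring.
have nr : (n%:R : R) > 0 by rewrite ltr0n.
have ar : (a%:R : R) > 0 by rewrite ltr0n.
have nar : ((n - a)%:R : R) > 0 by rewrite ltr0n subn_gt0.
have p0 := pi_gt0 R; have p2 : 2 <= (pi : R) by exact: pi_ge2.
have sinb : (pi : R) / (n%:R / a%:R + n%:R / (n - a)%:R) / 2 <= `|sin (pi * (a%:R / n%:R))|.
  have main b : (0 < b)%N -> (b.*2 <= n)%N -> (pi : R) / (n%:R / b%:R) / 2 <= `|sin (pi * (b%:R / n%:R))|.
    move=> b0 bn; have br : (b%:R : R) > 0 by rewrite ltr0n.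
    have h : 0 <= (pi : R) * (b%:R / n%:R) <= (pi : R) / 2.
      apply/andP; split; first by rewrite mulr_ge0 ?divr_ge0 ?ltW.
      rewrite ler_pM2l // ler_pdivrMr // mulrC ler_pdivlMr //.
      by rewrite -natrM muln2 ler_nat.
    apply: le_trans (ler_norm _); apply: le_trans (jordan_sin h).
    by rewrite invf_div.
  have bd b : (0 < b)%N -> 0 < (n%:R / b%:R : R) by move=> b0; rewrite divr_gt0 ?ltr0n.
  case: (leqP a.*2 n) => h.
    apply: le_trans (main a a0 h); rewrite ler_wpM2r // ler_wpM2l ?(ltW p0) //.
    by rewrite lef_pV2 ?posrE ?addr_gt0 ?divr_gt0 // lerDl ltW ?divr_gt0.
  have -> : sin ((pi : R) * (a%:R / n%:R)) = sin ((pi : R) * ((n - a)%:R / n%:R)) :> R.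
    rewrite -[RHS]opprK -sinN -[in RHS](sinDpi) natrB ?(ltnW an) //.
    rewrite (_ : - (pi * _) + pi = pi * (a%:R / n%:R)); last by field; rewrite gt_eqF.
    by [].
  have h2 : ((n - a).*2 <= n)%N by lia.
  have h3 : (0 < n - a)%N by lia.
  apply: le_trans (main _ h3 h2); rewrite ler_wpM2r // ler_wpM2l ?(ltW p0) //.
  by rewrite lef_pV2 ?posrE ?addr_gt0 ?divr_gt0 // lerDr ltW ?divr_gt0.
set B := n%:R / _ + _ in sinb *; have B0 : 0 < B by rewrite addr_gt0 ?divr_gt0.
have s0 : 0 < `|sin (pi * (a%:R / n%:R)) : R| by apply: lt_le_trans sinb; rewrite !divr_gt0.
have z1 : `|z - 1| = (2 * `|sin (pi * (a%:R / n%:R))|)%:C%C.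
  by rewrite zE norm_cis_sub1; congr (2 * `|sin _|)%:C%C; field; rewrite gt_eqF.
have G : (z - 1) * \sum_(h < Y) e n ^+ (a * h) = z ^+ Y - 1.
  rewrite [RHS]subrX1; congr (_ * _); apply: eq_bigr => h _; by rewrite /z exprM.
have nG : `|\sum_(h < Y) e n ^+ (a * h)| * `|z - 1| <= 2.
  rewrite mulrC -normrM G; apply: le_trans (ler_normB _ _) _.
  by rewrite /z -exprM norm_unity_root // normr1 lexx.
have zp : 0 < `|z - 1| by rewrite z1 ltcR mulr_gt0.
rewrite -(ler_pM2r zp); apply: le_trans nG _.
rewrite z1 -rmorphM (_ : 2 = (2%:R : R)%:C%C); last by rewrite rmorph_nat.
rewrite lecR; move: sinb; rewrite ler_pdivrMr // ler_pdivrMr //; nra.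
Qed.

Lemma inv_le_lnB n : (0 < n)%N -> (n.+1%:R : R)^-1 <= ln n.+1%:R - ln n%:R.
Proof.
move=> n0; have nr : (n%:R : R) > 0 by rewrite ltr0n.
have n1 : (n.+1%:R : R) > 0 by rewrite ltr0n.
have : ln (n%:R / n.+1%:R) <= - (n.+1%:R : R)^-1.
  rewrite (_ : n%:R / n.+1%:R = 1 + (- n.+1%:R^-1)).
    by apply: le_ln1Dx; rewrite ltrN2 invf_lt1 // ltr1n ltnS.
  by rewrite -natr1; field; rewrite natr1 gt_eqF.
by rewrite ln_div ?posrE // -lerN2 opprK opprB.
Qed.

Lemma harmonic_le n : (0 < n)%N -> \sum_(k < n) (k.+1%:R : R)^-1 <= 1 + ln n%:R.
Proof.
case: n => // n _; elim: n => [|n IH]; first by rewrite big_ord1 invr1 ln1 addr0.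
rewrite big_ord_recr /=; apply: le_trans (lerD IH (@inv_le_lnB n.+1 isT)) _.
by rewrite -addrA [X in _ + X](_ : _ = ln n.+2%:R) // addrC subrK.
Qed.

(** Expanding psi by its Gauss sum, of modulus sqrt k, leaves geometric sums bounded by k / a + k /
    (k - a), whose total is a harmonic sum. *)
Lemma polya_vinogradov k psi Y : (1 < k)%N -> real_primitive k psi ->
  `|\sum_(h < Y) (psi h)%:~R| <= 2 * Num.sqrt k%:R * (1 + ln k%:R) :> R.
Proof.
move=> k1 P; have k0 : (0 < k)%N by lia.
have [_ _ _ nc [cop _]] := P.
have w := unity_root_prim R k0; set t := char_gauss k psi (e k).
have psi_norm x : `|(psi x)%:~R : C| <= 1.
  rewrite nc; case: ifP => [/cop [] ->|_]; rewrite ?normr0 ?normr1 ?ler01 //.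
  by rewrite rmorphN1 normrN1.
have kr : (0 : R) < k%:R by rewrite ltr0n.
have tn : `|t| = (Num.sqrt k%:R)%:C%C.
  have : `|t| ^+ 2 = (Num.sqrt (k%:R : R))%:C%C ^+ 2.
    rewrite -normrX (char_gauss_sqr P w) normrM -rmorphXn sqr_sqrtr ?ler0n //.
    rewrite rmorph_nat normr_nat.
    have ck : coprime k.-1 k by rewrite -{2}(prednK k0) coprimenS.
    by case: (cop _ ck) => ->; rewrite ?normr1 ?mul1r // rmorphN1 normrN1 mul1r.
  have sq0 : 0 <= (Num.sqrt (k%:R : R))%:C%C by rewrite lecR sqrtr_ge0.
  by move/eqP; rewrite (eqrXn2 _ (normr_ge0 t) sq0) // => /eqP.
have E : (\sum_(h < Y) (psi h)%:~R) * t = \sum_(a < k) (psi a)%:~R * \sum_(h < Y) e k ^+ (a * h).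
  rewrite mulr_suml; under eq_bigr => h _ do rewrite -(char_gauss_twist P w).
  by rewrite exchange_big /=; apply: eq_bigr => a _; rewrite mulr_sumr.
have B : `|(\sum_(h < Y) (psi h)%:~R) * t| <= (2 * k%:R * (1 + ln k%:R) : R)%:C%C.
  rewrite E; apply: le_trans (ler_norm_sum _ _ _) _.
  apply: (@le_trans _ _ (\sum_(a < k) ((if (a == 0 :> nat) then 0 else k%:R / a%:R + k%:R / (k - a)%:R : R))%:C%C)).
    apply: ler_sum => a _; rewrite normrM; case: eqP => [->|/eqP a0].
      have -> : psi 0%N = 0 by rewrite nc /coprime gcd0n; case: eqP => // h; move: k1; rewrite h.
      by rewrite normr0 mul0r.
    apply: le_trans (ler_wpM2r (normr_ge0 _) (psi_norm a)) _; rewrite mul1r.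
    by apply: geom_unity_root; rewrite lt0n a0 ltn_ord.
  rewrite -rmorph_sum lecR /=; case: k k0 k1 {P nc cop w t psi_norm kr tn E} => // k _ k1.
  rewrite big_ord_recl /= add0r.
  have -> : \sum_(i < k) (if bump 0 i == 0%N then 0 else (k.+1%:R / (bump 0 i)%:R + k.+1%:R / (k.+1 - bump 0 i)%:R))
     = k.+1%:R * (2 * \sum_(i < k) (i.+1%:R : R)^-1).
    rewrite [2 * _]mulr_natl mulr2n mulrDr.
    rewrite -{2}(big_mkord xpredT (fun i => (i.+1%:R : R)^-1)) big_nat_rev /= big_mkord !mulr_sumr -big_split /=.
    apply: eq_bigr => i _; rewrite /bump leq0n add1n /=; congr (_ / _ + _ / _%:R).
    by have := ltn_ord i; lia.
  rewrite mulrCA mulrA ler_pM2l ?mulr_gt0 ?ltr0n //.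
  apply: le_trans (@harmonic_le k _) _ => //; rewrite lerD2l ler_ln ?posrE ?ltr0n ?ler_nat //.
have s0 : 0 < Num.sqrt (k%:R : R) by rewrite sqrtr_gt0.
rewrite -(ler_pM2r s0).
have -> : 2 * Num.sqrt k%:R * (1 + ln k%:R) * Num.sqrt k%:R = 2 * k%:R * (1 + ln k%:R) :> R.
  have := sqr_sqrtr (ltW kr); move: (Num.sqrt _) (ln _) => u v; rewrite expr2 => <-; ring.
rewrite -lecR; apply: le_trans B; rewrite normrM tn rmorphM; apply: ler_wpM2r.
  by rewrite lecR ltW.
have -> : \sum_(h < Y) (psi h)%:~R = (\sum_(h < Y) (psi h)%:~R : R)%:C%C.
  by rewrite rmorph_sum; apply: eq_bigr => h _; rewrite rmorph_int.
by rewrite normc_def /= expr0n addr0 sqrtr_sqr.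
Qed.

(** Induction on s, one prime p of s at a time: the multiples of p contribute psi(p) times a shorter
    sum of the same kind. Each step at most doubles the bound, and 2 <= p. *)
Lemma coprime_sum_bound (psi : nat -> int) (B : R) s :
  (forall x y, psi (x * y)%N = psi x * psi y) -> (forall x, `|(psi x)%:~R : R| <= 1) ->
  (forall Y, `|\sum_(h < Y) (psi h)%:~R| <= B :> R) -> (0 < s)%N ->
  forall Y, `|\sum_(h < Y | coprime h s) (psi h)%:~R| <= s%:R * B :> R.
Proof.
move=> mul nrm HB; elim/ltn_ind: s => s IH s0 Y.
have B0 : 0 <= B := le_trans (normr_ge0 _) (HB 0%N).
case: (leqP s 1) => s1.
  have -> : s = 1%N by lia.
  rewrite mul1r; apply: le_trans (HB Y); rewrite le_eqVlt; apply/orP; left; apply/eqP; congr `|_|.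
  by apply: eq_bigl => i; rewrite coprimen1.
set p := pdiv s; have pp : prime p := pdiv_prime s1.
have sE : s = (p * (s %/ p))%N by rewrite mulnC divnK // pdiv_dvd.
set s' := (s %/ p)%N in sE; have s'0 : (0 < s')%N by move: s0; rewrite sE muln_gt0 => /andP[].
have p1 := prime_gt1 pp.
have ls : (s' < s)%N by rewrite sE; nia.
have IH' := IH _ ls s'0.
have split : \sum_(h < Y | coprime h s) (psi h)%:~R =
   \sum_(h < Y | coprime h s') (psi h)%:~R - \sum_(h < Y | coprime h s' && (p %| h)%N) (psi h)%:~R :> R.
  apply/eqP; rewrite eq_sym subr_eq addrC; apply/eqP.
  rewrite (bigID (fun h : 'I_Y => (p %| h)%N)) /=; congr (_ + _).
  apply: eq_bigl => h; by rewrite sE coprimeMr [coprime h p]coprime_sym (prime_coprime _ pp) andbC.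
have mult : `|\sum_(h < Y | coprime h s' && (p %| h)%N) (psi h)%:~R| <= s'%:R * B :> R.
  (* Z is Y / p rounded up, obtained by induction on Y. *)
  have [Z [_ ->]] : exists Z, (Y <= p * Z < Y + p)%N /\
      \sum_(h < Y | coprime h s' && (p %| h)%N) (psi h)%:~R =
      \sum_(h < Z | coprime (p * h) s') (psi (p * h)%N)%:~R :> R.
    elim: (Y) => [|y [Z [/andP[Z1 Z2] EZ]]]; first by exists 0%N; split; [lia|rewrite !big_ord0].
    rewrite big_mkcond big_ord_recr /= -big_mkcond /= EZ.
    case: (boolP (p %| y)%N) => py; last first.
      exists Z; rewrite andbF addr0; split=> //; apply/andP; split; last by lia.
      by rewrite ltn_neqAle Z1 andbT; apply: contra py => /eqP ->; exact: dvdn_mulr.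
    have yE : y = (p * Z)%N.
      have yd : y = (p * (y %/ p))%N by rewrite mulnC divnK.
      move: Z1 Z2; rewrite yd leq_pmul2l ?(ltnW p1) // -mulnSr ltn_pmul2l ?(ltnW p1) // => h1 h2.
      by congr (_ * _)%N; lia.
    exists Z.+1; split; first by rewrite mulnS -yE; lia.
    by rewrite andbT [RHS]big_mkcond big_ord_recr /= -big_mkcond /= -yE.
  under eq_bigl => h do rewrite coprimeMl.
  case: (coprime p s') => /=; last by rewrite big_pred0 // normr0 mulr_ge0.
  under eq_bigr => h _ do rewrite mul intrM.
  rewrite -mulr_sumr normrM; apply: le_trans (IH' Z).
  by rewrite ler_piMl.
rewrite split; apply: le_trans (ler_normB _ _) _; apply: le_trans (lerD (IH' Y) mult) _.
rewrite -mulrDl ler_wpM2r // -natrD ler_nat sE; nia.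
Qed.

Lemma squarefree_decomp n : (0 < n)%N -> exists g s, [/\ squarefree g, (0 < s)%N & n = (g * s ^ 2)%N].
Proof.
move=> n0.
have ex : exists s, (0 < s)%N && (s ^ 2 %| n)%N by exists 1%N; rewrite dvd1n.
have bd s : (0 < s)%N && (s ^ 2 %| n)%N -> (s <= n)%N.
  by move=> /andP[s0 /(dvdn_leq n0)]; nia.
case: (ex_maxnP ex bd) => s /andP[s0 sd] smax.
exists (n %/ s ^ 2)%N, s; split=> //; last by rewrite divnK.
have g0 : (0 < n %/ s ^ 2)%N by rewrite divn_gt0 ?expn_gt0 ?s0 // dvdn_leq.
rewrite /squarefree g0; apply/allP => e; rewrite -dvdn_divisors // => _; apply/implyP => ed.
have : ((s * e) ^ 2 %| n)%N by rewrite -(divnK sd) mulnC expnMn dvdn_pmul2r ?expn_gt0 ?s0 // dvdn_mul.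
have e0 : (0 < e)%N by case: (e) ed => //; rewrite dvd0n => /eqP h; move: g0; rewrite h.
move=> h; have := smax (s * e)%N; rewrite muln_gt0 s0 e0 h => /(_ isT) => le.
apply/eqP; nia.
Qed.

Definition is_square (n : nat) : bool := [exists s : 'I_n.+1, (s * s)%N == n].

Lemma is_squareP n : reflect (exists s, n = s ^ 2)%N (is_square n).
Proof.
apply: (iffP existsP) => [[s /eqP E]|[s E]]; first by exists s; rewrite -mulnn.
have h : (s < n.+1)%N by rewrite ltnS E; nia.
by exists (Ordinal h); rewrite /= E mulnn.
Qed.

(** Writing m = g s^2 with g square-free, the symbol is the primitive character modulo g restricted
    to the h prime to s, and g > 1 as m is not a square. *)
Lemma kronecker_sum_bound m Y : odd m -> ~~ is_square m ->
  `|\sum_(h < Y) (kronecker h%:Z m)%:~R| <= 2 * Num.sqrt m%:R * (1 + ln m%:R) :> R.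
Proof.
move=> om nsq; have m0 := odd_gt0 om.
have [g [s [sg s0 mE]]] := squarefree_decomp m0.
have [og os] : odd g /\ odd s by move: om; rewrite mE oddM oddX /= => /andP.
have g0 := odd_gt0 og.
have g1 : (1 < g)%N.
  case: (ltngtP 1 g) => // h; first by lia.
  by move: nsq; rewrite mE -h mul1n; case: is_squareP => // -[]; exists s.
pose psi x := kronecker x%:Z g.
have P : real_primitive g psi := kronecker_real_primitive og sg g1.
have [_ _ mul nc [cop _]] := P.
have E h : kronecker h%:Z m = if coprime h s then psi h else 0.
  rewrite mE kroneckerM ?expn_gt0 ?s0 // -/(psi h); case: ifP => hs; last first.
    by rewrite (@kronecker_ncoprime h%:Z (s ^ 2)) ?mulr0 ?expn_gt0 ?s0 // coprime_pexpr ?hs.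
  rewrite expnS expn1 kroneckerM //; by case: (kronecker_coprime os hs) => ->; rewrite ?mulr1 // mulrNN mulr1.
under eq_bigr => h _ do rewrite E.
rewrite (eq_bigr (fun h : 'I_Y => if coprime h s then (psi h)%:~R else 0)); last by move=> h _; case: ifP.
rewrite -big_mkcond.
have gr : 0 < (g%:R : R) by rewrite ltr0n.
apply: le_trans (@coprime_sum_bound psi (2 * Num.sqrt g%:R * (1 + ln g%:R)) s mul _ _ s0 Y) _.
- move=> x; rewrite nc; case: ifP => [/cop [] ->|_]; rewrite ?normr0 ?normr1 ?ler01 //.
  by rewrite rmorphN1 normrN1.
- by move=> Z; exact: polya_vinogradov.
have -> : Num.sqrt (m%:R : R) = Num.sqrt g%:R * s%:R.
  by rewrite mE natrM natrX sqrtrM ?ler0n // sqrtr_sqr ger0_norm ?ler0n.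
have lg : ln (g%:R : R) <= ln m%:R.
  rewrite ler_ln ?posrE ?ltr0n // ler_nat mE; nia.
have u0 := sqrtr_ge0 (g%:R : R); move: (Num.sqrt (g%:R : R)) u0 => u u0.
rewrite [leLHS](_ : _ = 2 * (u * s%:R) * (1 + ln g%:R)); last by ring.
by rewrite ler_wpM2l ?lerD2l // !mulr_ge0.
Qed.

End PolyaVinogradov.

(** * Moments of the sharply cut sums over all d *)

Section SecondMoment.
Context (R : realType).

Lemma kronecker_norm a n : `|(kronecker a n)%:~R| <= 1 :> R.
Proof.
rewrite /kronecker; case: eqP => _; first by case: (_ == _); rewrite ?normr1 ?normr0.
rewrite rmorph_prod normr_prod.
apply: (@le_trans _ _ (\prod_(p <- primes n) 1)); last by rewrite big1_eq.
apply: ler_prod => p _; rewrite normr_ge0 rmorphXn normrX exprn_ile1 //.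
have := kronecker_prime_val a p; rewrite !inE => /or3P[] /eqP ->; rewrite ?normr0 ?normr1 ?ler01 //.
by rewrite rmorphN1 normrN1.
Qed.

(** A condition that persists as d grows selects a final segment, hence a difference of two initial
    ones. This removes the cut n <= u sqrt d from sums over d. *)
Lemma upper_sum_bound (f : nat -> R) (P : pred nat) (B : R) Y :
  (forall Z, (Z <= Y)%N -> `|\sum_(d < Z) f d| <= B) -> (forall d, P d -> P d.+1) ->
  `|\sum_(d < Y | P d) f d| <= 2 * B.
Proof.
move=> HB mono.
have [Z [ZY ->]] : exists Z, (Z <= Y)%N /\ \sum_(d < Y | P d) f d = \sum_(d < Y) f d - \sum_(d < Z) f d.
  elim: Y {HB} => [|y [Z [Zy IH]]]; first by exists 0%N; rewrite !big_ord0 subrr.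
  case: (boolP (P y)) => Py.
    exists Z; split; first exact: leqW.
    by rewrite big_mkcond !big_ord_recr /= -big_mkcond Py IH; ring.
  exists y.+1; split=> //; rewrite subrr big1 // => -[d /= dy] Pd.
  case/negP: Py; move: dy; rewrite ltnS => /subnK <-.
  by elim: (y - d)%N => [|k]; rewrite ?add0n // addSn => /mono.
apply: le_trans (ler_normB _ _) _; have := HB Y (leqnn Y); have := HB Z ZY; lra.
Qed.

Definition cut (u : R) (d n : nat) : bool := (0 < n)%N && (n%:R <= u * Num.sqrt d%:R).

Lemma cut_mono u d n : 0 <= u -> cut u d n -> cut u d.+1 n.
Proof.
move=> u0 /andP[n0 le]; rewrite /cut n0 /=; apply: le_trans le _.
by rewrite ler_wpM2l // ler_wsqrtr // ler_nat.
Qed.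

Lemma Spart_cut (chi : nat -> int) u d M : 0 <= u -> u * Num.sqrt d%:R <= M%:R ->
  Spart chi (u * Num.sqrt d%:R) = \sum_(n < M.+1 | cut u d n) (chi n)%:~R / Num.sqrt n%:R.
Proof.
move=> u0 le; have x0 : 0 <= u * Num.sqrt (d%:R : R) by rewrite mulr_ge0 ?sqrtr_ge0.
rewrite /Spart /cut; set x := u * _ in le x0 *.
have tM : (Num.truncn x <= M)%N.
  by rewrite -(@ler_nat R); apply: le_trans le; have := truncn_itv x0; case/andP.
rewrite -(big_mkord (fun n => (0 < n)%N && (n%:R <= x)) (fun n => (chi n)%:~R / Num.sqrt n%:R : R)).
rewrite [RHS]big_ltn_cond //=.
have tM1 : ((Num.truncn x).+1 <= M.+1)%N by [].
rewrite [RHS](big_cat_nat (ltn0Sn _ : (1 <= (Num.truncn x).+1)%N) tM1) /=.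
rewrite [X in _ = _ + X]big_nat_cond [X in _ = _ + X]big1 ?addr0.
  rewrite big_nat_cond [RHS]big_nat_cond; apply: eq_bigl => n.
  case: (posnP n) => [->|n1] //; rewrite andbT /=.
  case: (ltnP n) => //= nx; rewrite -truncn_ge_nat //.
by move=> n /andP[/andP[nx _]] /andP[_]; rewrite -truncn_ge_nat // leqNgt nx.
Qed.

Lemma chi8_twist d m : odd m -> chi8 d m = chi8 1 m * kronecker d%:Z m.
Proof. by move=> om; rewrite /chi8 muln1 kronecker_topM. Qed.

Lemma chi8_even d m : (0 < m)%N -> ~~ odd m -> chi8 d m = 0.
Proof.
move=> m0 em; apply: kronecker_ncoprime => //=.
apply/negP => c; have : coprime (2 * (4 * d)) m by rewrite mulnA.
by rewrite coprimeMl coprime2n (negbTE em).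
Qed.

Lemma chi8_cut_bound (u : R) m n D : 0 <= u -> (0 < m)%N -> (0 < n)%N -> ~~ is_square (m * n) ->
  `|\sum_(d < D | cut u d m && cut u d n) (chi8 d (m * n))%:~R| <=
   4 * Num.sqrt (m * n)%:R * (1 + ln (m * n)%:R) :> R.
Proof.
move=> u0 m0 n0 nsq; have mn0 : (0 < m * n)%N by rewrite muln_gt0 m0.
have r0 : 0 <= 4 * Num.sqrt (m * n)%:R * (1 + ln (m * n)%:R) :> R.
  by rewrite !mulr_ge0 ?sqrtr_ge0 // addr_ge0 ?ln_ge0 // ler1n.
case: (boolP (odd (m * n))) => o; last first.
  by rewrite big1 ?normr0 // => d _; rewrite chi8_even.
under eq_bigr => d _ do rewrite (chi8_twist _ o) intrM.
rewrite -mulr_sumr normrM; apply: le_trans (ler_piMl (normr_ge0 _) (kronecker_norm _ _)) _.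
rewrite (_ : 4 * _ * _ = 2 * (2 * Num.sqrt (m * n)%:R * (1 + ln (m * n)%:R)) :> R); last by ring.
apply: (upper_sum_bound (f := fun d => (kronecker d%:Z (m * n))%:~R) (P := fun d => cut u d m && cut u d n)).
  by move=> Z _; exact: kronecker_sum_bound.
by move=> d /andP[] /(cut_mono u0) -> /(cut_mono u0) ->.
Qed.

Lemma squarefree_gt0 n : squarefree n -> (0 < n)%N.
Proof. by case/andP. Qed.

Lemma squarefreeP n : (0 < n)%N -> reflect (forall e, (e ^ 2 %| n)%N -> e = 1%N) (squarefree n).
Proof.
move=> n0; rewrite /squarefree n0 /=; apply: (iffP allP) => [H e ed|H e _].
  apply/eqP; have := H e; rewrite ed; apply; rewrite -dvdn_divisors //.
  by apply: dvdn_trans ed; exact: dvdn_mulr.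
by apply/implyP => /H ->.
Qed.

Lemma squarefree_dvd_sqr g t : squarefree g -> (g %| t ^ 2)%N -> (g %| t)%N.
Proof.
move=> sg gt; have g0 := squarefree_gt0 sg.
have H := elimT (squarefreeP g0) sg.
apply/dvdn_partP => // p; rewrite mem_primes => /and3P[pp _ pg].
suff -> : (g`_p = p)%N by have := dvdn_trans pg gt; rewrite Euclid_dvdX // => /andP[].
rewrite p_part; have l0 : (0 < logn p g)%N by rewrite logn_gt0 mem_primes pp g0.
case: (ltnP (logn p g) 2) => l2; first by rewrite (_ : logn p g = 1%N) //; lia.
have := H p; rewrite pfactor_dvdn // => /(_ l2) p1; by rewrite p1 in pp.
Qed.

Lemma square_mulP m n : (0 < m)%N -> (0 < n)%N -> is_square (m * n) ->
  exists g a b, [/\ (0 < g)%N, (0 < a)%N, (0 < b)%N, m = (g * a ^ 2)%N & n = (g * b ^ 2)%N].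
Proof.
move=> m0 n0 /is_squareP[s sE].
have [g [a [sg a0 mE]]] := squarefree_decomp m0.
have [h [b [sh b0 nE]]] := squarefree_decomp n0.
have g0 := squarefree_gt0 sg; have h0 := squarefree_gt0 sh.
have ab0 : (0 < a * b)%N by rewrite muln_gt0 a0.
have E : (g * h * (a * b) ^ 2 = s ^ 2)%N by rewrite -sE mE nE; ring.
have : (a * b %| s)%N by rewrite -(@dvdn_pexp2r _ _ 2) // -E dvdn_mull.
case/dvdnP => t tE.
have gh : (g * h = t ^ 2)%N.
  by apply/eqP; rewrite -(@eqn_pmul2r ((a * b) ^ 2)) ?expn_gt0 ?ab0 // E tE expnMn.
have /dvdnP[k kE] : (g %| t)%N by apply: squarefree_dvd_sqr => //; rewrite -gh dvdn_mulr.
have hE : h = (g * k ^ 2)%N.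
  by apply/eqP; rewrite -(@eqn_pmul2l g) // gh kE; apply/eqP; ring.
have k1 : k = 1%N by apply: (elimT (squarefreeP h0) sh); rewrite hE dvdn_mull.
by exists g, a, b; split=> //; rewrite nE hE k1 muln1.
Qed.

Lemma fiber_sum_le (I J : finType) (A : pred I) (f : I -> R) (F : J -> R) (r : I -> J -> bool) :
  (forall j, 0 <= F j) -> (forall i, A i -> exists2 j, r i j & f i <= F j) ->
  (forall i i' j, r i j -> r i' j -> i = i') ->
  \sum_(i | A i) f i <= \sum_j F j.
Proof.
move=> F0 ex inj; apply: (@le_trans _ _ (\sum_i \sum_(j | r i j) F j)).
  rewrite big_mkcond; apply: ler_sum => i _; case: ifP => [Ai|_]; last by apply: sumr_ge0.
  have [j rij le] := ex i Ai; rewrite (bigD1 j) //= -[f i]addr0; apply: lerD => //.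
  exact: sumr_ge0.
rewrite (exchange_big_dep xpredT) //=; apply: ler_sum => j _.
have [/existsP[i ri]|] := boolP [exists i, r i j].
  rewrite (bigD1 i) //= big1 ?addr0 // => i' /andP[ri' /eqP ne].
  by case: ne; exact: inj ri' ri.
by rewrite negb_exists => /forallP h; rewrite big1 // => i ri; move: (h i); rewrite ri.
Qed.

(** When m n is a square, m = g a^2 and n = g b^2 by [square_mulP], and the weight is 1 / (g a
    b). *)
Lemma sum_square_le M : \sum_(m < M.+1 | (0 < m)%N) \sum_(n < M.+1 | (0 < n)%N && is_square (m * n))
   (Num.sqrt (m * n)%:R)^-1 <= (\sum_(k < M) (k.+1%:R)^-1) ^+ 3 :> R.
Proof.
pose F (q : 'I_M * ('I_M * 'I_M)) : R := (q.1.+1%:R)^-1 * ((q.2.1.+1%:R)^-1 * (q.2.2.+1%:R)^-1).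
have -> : (\sum_(k < M) (k.+1%:R)^-1) ^+ 3 = \sum_q F q.
  rewrite !exprS expr0 mulr1 -(pair_big_dep xpredT (fun _ _ => true) (fun g q => F (g, q))) /=.
  rewrite mulr_suml; apply: eq_bigr => g _; rewrite /F /= -mulr_sumr; congr (_ * _).
  rewrite -(pair_big_dep xpredT (fun _ _ => true) (fun a b : 'I_M => (a.+1%:R)^-1 * (b.+1%:R)^-1)) /=.
  by rewrite mulr_suml; apply: eq_bigr => a _; rewrite mulr_sumr.
rewrite pair_big_dep /=.
pose r (p : 'I_M.+1 * 'I_M.+1) (q : 'I_M * ('I_M * 'I_M)) :=
  (p.1 == q.1.+1 * q.2.1.+1 ^ 2 :> nat)%N && (p.2 == q.1.+1 * q.2.2.+1 ^ 2 :> nat)%N.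
apply: (@fiber_sum_le _ _ _ _ _ r).
- by move=> q; rewrite !mulr_ge0 ?invr_ge0.
- move=> [m n] /= /andP[m0 /andP[n0 sq]].
  have [g [a [b [g0 a0 b0 mE nE]]]] := square_mulP m0 n0 sq.
  have mM := ltn_ord m; have nM := ltn_ord n.
  have gM : (g.-1 < M)%N by move: mM; rewrite mE; nia.
  have aM : (a.-1 < M)%N by move: mM; rewrite mE; nia.
  have bM : (b.-1 < M)%N by move: nM; rewrite nE; nia.
  exists (Ordinal gM, (Ordinal aM, Ordinal bM)); first by rewrite /r /= !prednK // -mE -nE !eqxx.
  rewrite /F /= !prednK // mE nE.
  have -> : (g * a ^ 2 * (g * b ^ 2) = (g * (a * b)) ^ 2)%N by ring.
  by rewrite natrX sqrtr_sqr ger0_norm // !natrM !invfM.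
- move=> [m n] [m' n'] q /andP[/= /eqP h1 /eqP h2] /andP[/= /eqP h3 /eqP h4].
  by congr pair; apply: val_inj => /=; rewrite ?h1 ?h2 ?h3 ?h4.
Qed.

(** Opening the square, the pairs with m n a square contribute D times the cube of a logarithm. For
    the others the character sum, of size sqrt(m n) up to a logarithm, is balanced by the weight 1 /
    sqrt(m n), so each pair costs a logarithm. *)
Lemma Spart_second_moment (u : R) D M : 0 <= u -> u * Num.sqrt D%:R <= M%:R -> (0 < M)%N ->
  \sum_(d < D.+1 | (0 < d)%N) (Spart (chi8 d) (u * Num.sqrt d%:R)) ^+ 2 <=
   D%:R * (1 + ln M%:R) ^+ 3 + 4 * M%:R ^+ 2 * (1 + 2 * ln M%:R).
Proof.
move=> u0 uM M0.
have l0 : 0 <= ln (M%:R : R) by rewrite ln_ge0 // ler1n.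
pose c m n : R := (Num.sqrt (m * n)%:R)^-1.
pose T m n : R := \sum_(d < D.+1 | (0 < d)%N && (cut u d m && cut u d n)) (chi8 d (m * n))%:~R.
have -> : \sum_(d < D.+1 | (0 < d)%N) (Spart (chi8 d) (u * Num.sqrt d%:R)) ^+ 2 =
  \sum_(m < M.+1 | (0 < m)%N) \sum_(n < M.+1 | (0 < n)%N) c m n * T m n.
  transitivity (\sum_(d < D.+1 | (0 < d)%N) \sum_(m < M.+1 | (0 < m)%N) \sum_(n < M.+1 | (0 < n)%N)
      if cut u d m && cut u d n then c m n * (chi8 d (m * n))%:~R else 0).
    apply: eq_bigr => d d0; rewrite (@Spart_cut _ u d M) //; last first.
      apply: le_trans uM; rewrite ler_wpM2l // ler_wsqrtr // ler_nat -ltnS //.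
    rewrite expr2 big_mkcond mulr_suml [RHS]big_mkcond; apply: eq_bigr => m _.
    rewrite /cut; case: (posnP m) => m0 /=; first by rewrite mul0r.
    case: ifP => hm; last by rewrite mul0r big1 // => n _.
    rewrite big_mkcond mulr_sumr [RHS]big_mkcond; apply: eq_bigr => n _.
    case: (posnP n) => n0 /=; first by rewrite mulr0.
    case: ifP => hn; last by rewrite mulr0.
    rewrite chi8_mul // intrM /c natrM sqrtrM // invfM; ring.
  rewrite exchange_big; apply: eq_bigr => m m0; rewrite exchange_big; apply: eq_bigr => n n0.
  by rewrite /T mulr_sumr -big_mkcondr.
have H m n : (0 < m < M.+1)%N -> (0 < n < M.+1)%N ->
  c m n * T m n <= (if is_square (m * n) then c m n * D%:R else 0) + 4 * (1 + 2 * ln M%:R).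
  move=> /andP[m0 mM] /andP[n0 nM]; have mn0 : (0 < m * n)%N by rewrite muln_gt0 m0.
  have s0 : 0 < Num.sqrt ((m * n)%:R : R) by rewrite sqrtr_gt0 ltr0n.
  have c0 : 0 <= c m n by rewrite invr_ge0 ltW.
  have L : ln ((m * n)%:R : R) <= 2 * ln M%:R.
    rewrite mulr_natl -lnXn ?ltr0n // ler_ln ?posrE ?exprn_gt0 ?ltr0n // -natrX ler_nat.
    by rewrite -mulnn leq_mul.
  case: ifP => sq.
    apply: ler_wpDr; first by rewrite mulr_ge0 ?addr_ge0 ?mulr_ge0.
    rewrite ler_wpM2l //; apply: le_trans (ler_norm _) _; apply: le_trans (ler_norm_sum _ _ _) _.
    apply: (@le_trans _ _ (\sum_(d < D.+1 | (0 < d)%N) 1)).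
      rewrite [leLHS]big_mkcond [leRHS]big_mkcond; apply: ler_sum => d _.
      case: (0 < d)%N => //=; case: ifP => // _; exact: kronecker_norm.
    by rewrite big_mkcond big_ord_recl /= add0r sumr_const card_ord.
  rewrite add0r mulrC ler_pdivrMr //; apply: le_trans (ler_norm _) _.
  apply: (@le_trans _ _ `|\sum_(d < D.+1 | cut u d m && cut u d n) (chi8 d (m * n))%:~R|).
    rewrite /T le_eqVlt; apply/orP; left; apply/eqP; congr `|_|; apply: eq_bigl => d.
    case: (posnP d) => // d0; rewrite /cut m0 n0 d0 sqrtr0 mulr0 lern0.
    by case: (m) m0.
  apply: le_trans (chi8_cut_bound D.+1 u0 m0 n0 (negbT sq)) _.
  rewrite mulrAC; apply: ler_wpM2r; first exact: ltW.
  by rewrite ler_wpM2l // lerD2l.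
apply: (@le_trans _ _ (\sum_(m < M.+1 | (0 < m)%N) \sum_(n < M.+1 | (0 < n)%N)
   ((if is_square (m * n) then c m n * D%:R else 0) + 4 * (1 + 2 * ln M%:R)))).
  by apply: ler_sum => m m0; apply: ler_sum => n n0; apply: H; rewrite ?m0 ?n0 ltn_ord.
under eq_bigr => m _ do rewrite big_split /=.
rewrite big_split /=; apply: lerD.
  under eq_bigr => m _ do rewrite -big_mkcondr /= -mulr_suml.
  rewrite -mulr_suml mulrC ler_wpM2l //; apply: le_trans (sum_square_le M) _.
  apply: lerXn2r; rewrite ?nnegrE ?addr_ge0 //; last exact: harmonic_le.
  by apply: sumr_ge0 => k _; rewrite invr_ge0.
rewrite (eq_bigr (fun=> M%:R * (4 * (1 + 2 * ln M%:R)))); last first.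
  by move=> m _; rewrite big_mkcond big_ord_recl /= add0r sumr_const card_ord -[LHS]mulr_natl.
rewrite big_mkcond big_ord_recl /= add0r sumr_const card_ord -mulr_natl.
rewrite le_eqVlt; apply/orP; left; apply/eqP; ring.
Qed.

(** |s| <= 1 + s^2 passes to the second moment, with M at most (1 + u) sqrt D, so that M^2 is of the
    order of D. *)
Lemma Spart_first_moment (u : R) D : 0 < u -> (0 < D)%N ->
  \sum_(d < D.+1 | (0 < d)%N) `|Spart (chi8 d) (u * Num.sqrt d%:R)| <=
   100 * D%:R * (1 + ln D%:R) ^+ 3 * (1 + u) ^+ 3.
Proof.
move=> u0 D0; pose M := (Num.truncn (u * Num.sqrt D%:R)).+1.
have x0 : 0 <= u * Num.sqrt (D%:R : R) by rewrite mulr_ge0 ?sqrtr_ge0 ?ltW.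
have /andP[M1 M2] := truncn_itv x0; rewrite -/M in M2.
have D1 : 1 <= (D%:R : R) by rewrite ler1n.
have lD : 0 <= ln (D%:R : R) by rewrite ln_ge0.
have sD : 1 <= Num.sqrt (D%:R : R) by rewrite -[leLHS]sqrtr1 ler_wsqrtr.
have sD2 : Num.sqrt (D%:R : R) ^+ 2 = D%:R by rewrite sqr_sqrtr.
have M3 : (M%:R : R) <= (1 + u) * Num.sqrt D%:R.
  rewrite /M -natr1; nra.
have M0 : (0 < M%:R :> R) by rewrite ltr0n.
have lM : ln (M%:R : R) <= u + ln D%:R.
  apply: (@le_trans _ _ (ln ((1 + u) * Num.sqrt D%:R))).
    by rewrite ler_ln ?posrE // mulr_gt0 ?addr_gt0 // (lt_le_trans ltr01).
  rewrite lnM ?posrE ?addr_gt0 ?(lt_le_trans ltr01 sD) //; apply: lerD.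
    by apply: le_ln1Dx; rewrite (lt_trans _ u0) // ltrN10.
  rewrite ler_ln ?posrE ?(lt_le_trans ltr01) //; nra.
have l0 : 0 <= ln (M%:R : R) by rewrite ln_ge0 // ler1n.
have := @Spart_second_moment u D M (ltW u0) (ltW M2) isT.
set S2 := \sum_(d < D.+1 | _) _ => h.
apply: (@le_trans _ _ (\sum_(d < D.+1 | (0 < d)%N) (1 + (Spart (chi8 d) (u * Num.sqrt d%:R)) ^+ 2))).
  apply: ler_sum => d _; set s := Spart _ _; rewrite -real_normK ?num_real //.
  have := normr_ge0 s; have := sqr_ge0 (`|s| - 1); move: `|s| => y; nra.
rewrite big_split /= -/S2 big_mkcond big_ord_recl /= add0r sumr_const card_ord.
apply: le_trans (lerD (lexx _) h) _.
set L := 1 + ln D%:R; have L1 : 1 <= L by rewrite lerDl.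
set v := 1 + u; have v1 : 1 <= v by rewrite lerDl ltW.
have lM' : 1 + ln (M%:R : R) <= L * v by rewrite /L /v; nra.
have b1 : (1 + ln (M%:R : R)) ^+ 3 <= (L * v) ^+ 3 by apply: lerXn2r; rewrite ?nnegrE ?addr_ge0 // mulr_ge0 // (le_trans ler01).
have b2 : (M%:R : R) ^+ 2 <= v ^+ 2 * D%:R.
  rewrite -sD2 -exprMn; apply: lerXn2r; rewrite ?nnegrE // mulr_ge0 ?(le_trans ler01) //.
have Dp : 0 <= (D%:R : R) by [].
have LL : 1 <= L ^+ 2 by rewrite exprn_ege1.
have Lp : 0 <= L := le_trans ler01 L1.
have vp : 0 <= v := le_trans ler01 v1.
have b3 : D%:R * (1 + ln (M%:R : R)) ^+ 3 <= D%:R * L ^+ 3 * v ^+ 3.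
  by rewrite -mulrA -exprMn ler_wpM2l.
have b4 : 4 * (M%:R : R) ^+ 2 * (1 + 2 * ln M%:R) <= 8 * (D%:R * L ^+ 3 * v ^+ 3).
  apply: (@le_trans _ _ (4 * (v ^+ 2 * D%:R) * (2 * (L * v)))).
    by apply: ler_pM; rewrite ?mulr_ge0 ?addr_ge0 ?mulr_ge0 ?exprn_ge0 // ?ler_wpM2l //; lra.
  have -> : 4 * (v ^+ 2 * D%:R) * (2 * (L * v)) = 8 * (D%:R * (L * 1) * v ^+ 3) by ring.
  by rewrite ler_wpM2l // ler_wpM2r ?exprn_ge0 // ler_wpM2l // (exprS L 2) ler_wpM2l.
have b5 : D%:R <= D%:R * L ^+ 3 * v ^+ 3.
  by rewrite -mulrA ler_peMr // mulr_ege1 // exprn_ege1.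
rewrite -[D%:R * L ^+ 3 * v ^+ 3]mulrA in b3 b4 b5 *; rewrite -!mulrA; move: (D%:R * _) b3 b4 b5 => W; lra.
Qed.

End SecondMoment.

(** * Mertens' theorems *)

Section LogSeries.
Context (R : realType).

Lemma is_derive_log_remainder (K : nat) (x : R) : x < 1 ->
  is_derive x 1 (fun y : R => ln (1 - y) + \sum_(k < K) y ^+ k.+1 / k.+1%:R) (- (x ^+ K / (1 - x))).
Proof.
move=> x1; have p : 0 < 1 - x by lra.
elim: K => [|K IH].
  rewrite expr0 mul1r; under eq_fun do rewrite big_ord0 addr0.
  have -> : - (1 - x)^-1 = (1 - x)^-1 * -1 by rewrite mulrN1.
  apply: (@is_derive1_comp R (@ln R) (fun y => 1 - y) x (1 - x)^-1 (-1)); first exact: is_derive1_ln.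
  have := @is_deriveB R R R (cst 1) id x 1 0 1 (is_derive_cst _ _ _) (is_derive_id _ _).
  by rewrite sub0r.
have -> : (fun y : R => ln (1 - y) + \sum_(k < K.+1) y ^+ k.+1 / k.+1%:R) =
  (fun y : R => ln (1 - y) + \sum_(k < K) y ^+ k.+1 / k.+1%:R) + (K.+1%:R^-1 \*: (id ^+ K.+1)).
  apply/funext => y; rewrite big_ord_recr /= addrA; congr (_ + _).
  by rewrite mulrC /GRing.scale_fun /= exprfctE.
have -> : - (x ^+ K.+1 / (1 - x)) = - (x ^+ K / (1 - x)) + K.+1%:R^-1 *: ((K.+1%:R * x ^+ K) *: (1 : R)) :> R.
  rewrite -[X in _ = _ + X]/(K.+1%:R^-1 * (K.+1%:R * x ^+ K * 1)) mulr1 mulrA mulVf ?pnatr_eq0 // mul1r exprS.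
  field; lra.
by apply: is_deriveD; apply: is_deriveZ.
Qed.

Lemma ln_series_bound (K : nat) (x : R) : `|x| < 1 ->
  `|ln (1 - x) + \sum_(k < K) x ^+ k.+1 / k.+1%:R| <= `|x| ^+ K.+1 / (1 - `|x|).
Proof.
move=> x1; pose F (y : R) := ln (1 - y) + \sum_(k < K) y ^+ k.+1 / k.+1%:R.
have F0 : F 0 = 0.
  by rewrite /F subr0 ln1 add0r big1 // => k _; rewrite expr0n mul0r.
have [c c1 E] : exists2 c : R, `|c| <= `|x| & F x = - (c ^+ K / (1 - c)) * x.
  have lt1 y : `|y| <= `|x| -> y < 1.
    by move=> yx; apply: le_lt_trans (ler_norm y) (le_lt_trans yx x1).
  have D a b : (forall y, y \in `[a, b] -> `|y| <= `|x|) -> a <= b ->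
      exists2 c, c \in `[a, b] & F b - F a = - (c ^+ K / (1 - c)) * (b - a).
    move=> ab le; apply: (@MVT_segment R F (fun y => - (y ^+ K / (1 - y)))) => //.
      move=> y yab; apply: is_derive_log_remainder; apply: lt1; apply: ab.
      by move: yab; rewrite !in_itv /= => /andP[/ltW -> /ltW].
    apply: derivable_within_continuous => y /ab /lt1 h.
    by have := is_derive_log_remainder K h => -[].
  have [x0|x0] := leP 0 x.
    have := D 0 x; rewrite F0 !subr0 => H; have [y|c cx E] := H _ x0.
      by rewrite in_itv /= => /andP[y0 yx]; rewrite !ger0_norm.
    by exists c => //; move: cx; rewrite in_itv /= => /andP[y0 yx]; rewrite !ger0_norm.
  have := D x 0; rewrite F0 !sub0r => H; have [y|c cx E] := H _ (ltW x0).
    by rewrite in_itv /= => /andP[y0 yx]; rewrite !ler0_norm ?lerN2 // ltW.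
  exists c; first by move: cx; rewrite in_itv /= => /andP[y0 yx]; rewrite !ler0_norm ?lerN2 // ltW.
  by apply: oppr_inj; rewrite E; ring.
rewrite -/(F x) E normrM normrN normrM normrX normfV exprS mulrC -mulrA.
apply: ler_wpM2l => //.
have c2 : 0 < 1 - `|x| by lra.
have c3 : 1 - `|x| <= `|1 - c|.
  apply: le_trans (ler_norm _); have := ler_norm c; lra.
apply: ler_pM; rewrite ?exprn_ge0 ?invr_ge0 //.
  by apply: lerXn2r; rewrite ?nnegrE.
by rewrite lef_pV2 ?posrE // (lt_le_trans c2).
Qed.

Lemma ln_bound1 (x : R) : `|x| <= 2^-1 -> `|ln (1 - x) + x| <= 2 * x ^+ 2.
Proof.
move=> x2; have x1 : `|x| < 1 by lra.
have := ln_series_bound 1 x1; rewrite big_ord1 divr1 expr1 real_normK ?num_real //.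
move/le_trans; apply; rewrite mulrC; apply: ler_wpM2r; first exact: sqr_ge0.
by rewrite invf_ple ?posrE; lra.
Qed.

Lemma log_series_cvg (x : R) : `|x| < 1 ->
  (\sum_(k < n) x ^+ k.+1 / k.+1%:R) @[n --> \oo] --> - ln (1 - x).
Proof.
move=> x1.
suff c0 : (ln (1 - x) + \sum_(k < n) x ^+ k.+1 / k.+1%:R) @[n --> \oo] --> 0.
  rewrite -[- _]add0r (_ : (fun n => _) = (fun n : nat => (ln (1 - x) + \sum_(k < n) x ^+ k.+1 / k.+1%:R) - ln (1 - x))).
    by apply: cvgB => //; exact: cvg_cst.
  by apply/funext => n; rewrite addrAC subrr add0r.
apply: norm_cvg0; apply: (@squeeze_cvgr _ _ _ _ (fun=> 0) (fun n => `|x| * `|x| ^+ n / (1 - `|x|))).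
- by near=> n; rewrite normr_ge0 /= -exprS; exact: ln_series_bound.
- exact: cvg_cst.
- rewrite [X in _ --> X](_ : 0 = `|x| * 0 / (1 - `|x|)); last by rewrite mulr0 mul0r.
  apply: cvgM; last exact: cvg_cst; apply: cvgM; first exact: cvg_cst.
  by apply: cvg_expr; rewrite normr_id.
Unshelve. all: by end_near.
Qed.

Lemma ln_le_sub1 (x : R) : 0 < x -> ln x <= x - 1.
Proof. by move=> x0; rewrite -{1}[x](subrKC 1); apply: le_ln1Dx; lra. Qed.

Lemma inv_ge_lnB n : (0 < n)%N -> ln n.+1%:R - ln n%:R <= (n%:R : R)^-1.
Proof.
move=> n0; have nr : (n%:R : R) > 0 by rewrite ltr0n.
have n1 : (n.+1%:R : R) > 0 by rewrite ltr0n.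
rewrite -ln_div ?posrE //; apply: le_trans (ln_le_sub1 _) _; first by rewrite divr_gt0.
rewrite le_eqVlt; apply/orP; left; apply/eqP; rewrite -natr1; move: nr; move: (n%:R : R) => a a0; field.
lra.
Qed.

Lemma ln_le_harmonic n : ln n.+1%:R <= series harmonic n :> R.
Proof.
elim: n => [|n IH]; first by rewrite /series /= big_geq // ln1.
rewrite /series /= big_nat_recr //= -/(series harmonic n) -lerBlDl.
by apply: le_trans (inv_ge_lnB _) => //; rewrite lerD2l lerN2.
Qed.

Lemma cvg_euler_gamma : (series harmonic n - ln n%:R : R) @[n --> \oo] --> euler_gamma R.
Proof.
suff c : cvgn (fun n => series harmonic n.+1 - ln n.+1%:R : R).
  have c2 : cvgn (fun n => series harmonic n - ln n%:R : R).
    move/cvg_ex: c => [l cl]; apply/cvg_ex; exists l.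
    by rewrite -(cvg_shiftS (fun n => series harmonic n - ln n%:R : R)).
  exact: c2.
apply: nonincreasing_is_cvgn.
  apply/nonincreasing_seqP => n; rewrite (_ : series harmonic n.+2 = series harmonic n.+1 + n.+2%:R^-1 :> R); last first.
    by rewrite /series /= big_nat_recr.
  by have := @inv_le_lnB R n.+1 isT; rewrite -addrA lerD2l lerBlDr addrC.
exists 0 => _ [n _ <-]; rewrite subr_ge0; apply: le_trans (ln_le_harmonic n) _.
by rewrite /series /= big_nat_recr //= lerDl invr_ge0.
Qed.

End LogSeries.

Section Chebyshev.
Context (R : realType).

Lemma ln_nat_ge0 n : 0 <= ln (n%:R : R).
Proof. by case: (posnP n) => [->|h]; [rewrite ln0|rewrite ln_ge0 ?ler1n]. Qed.

Lemma ln_prod (I : Type) (r : seq I) (P : pred I) (f : I -> R) : (forall i, P i -> 0 < f i) ->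
  ln (\prod_(i <- r | P i) f i) = \sum_(i <- r | P i) ln (f i).
Proof.
move=> f0; suff [] : 0 < \prod_(i <- r | P i) f i /\ ln (\prod_(i <- r | P i) f i) = \sum_(i <- r | P i) ln (f i) by [].
elim/big_rec2: _ => [|i x y Pi [y0 <-]]; first by rewrite ln1.
by split; rewrite ?mulr_gt0 ?f0 // lnM // posrE ?f0.
Qed.

Lemma ln_logn_sum n B : (0 < n < B)%N ->
  ln n%:R = \sum_(p < B | prime p) (logn p n)%:R * ln p%:R :> R.
Proof.
case/andP => n0; case: B => // B; rewrite ltnS => nB.
rewrite -{1}(partnT n0) (widen_partn _ nB) big_mkord natr_prod ln_prod; last first.
  by move=> i _; rewrite ltr0n expn_gt0 /logn; case: posnP => //= ->; rewrite eqxx.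
rewrite [RHS]big_mkcond; apply: eq_bigr => p _; case: ifP => pp.
  by rewrite natrX lnXn ?ltr0n ?prime_gt0 // mulr_natl.
by rewrite lognE pp expn0 ln1.
Qed.

Lemma logn_fact_small p n : prime p -> (n < p)%N -> logn p n`! = 0%N.
Proof.
move=> pp np; rewrite logn_fact // big_nat big1 // => k /andP[k0 _].
by rewrite divn_small // (leq_trans np) // -{1}[p]expn1 leq_pexp2l // prime_gt0.
Qed.

Lemma ln_fact_ge n : (0 < n)%N -> n%:R * ln n%:R - n%:R <= ln n`!%:R :> R.
Proof.
case: n => // n _; have f0 : (0 : R) < n.+1`!%:R by rewrite ltr0n fact_gt0.
have n0 : (0 : R) < n.+1%:R by rewrite ltr0n.
have h := @expR_ge1Dxn R n.+1%:R n (ltW n0).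
have {h} h : n.+1%:R ^+ n.+1 / n.+1`!%:R <= expR n.+1%:R :> R by apply: le_trans h; rewrite lerDr.
have : ln (n.+1%:R ^+ n.+1 / n.+1`!%:R) <= n.+1%:R :> R.
  by rewrite -[leRHS]expRK ler_ln ?posrE ?divr_gt0 ?exprn_gt0 ?expR_gt0.
by rewrite ln_div ?posrE ?exprn_gt0 // lnXn // -mulr_natl; lra.
Qed.

(** Chebyshev's argument: the primes between m and 2 m divide the binomial coefficient C(2 m, m) <=
    4^m. *)
Lemma theta_dyadic_block m : (0 < m)%N ->
  \sum_(m.+1 <= p < m.*2.+1 | prime p) ln p%:R <= 2 * m%:R * ln 2 :> R.
Proof.
move=> m0; pose c := 'C(m.*2, m).
have c0 : (0 < c)%N by rewrite bin_gt0 -addnn leq_addr.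
have c4 : (c <= 4 ^ m)%N.
  rewrite -[4%N]/(2 ^ 2)%N -expnM mul2n -[2%N in X in (_ <= X)%N]/(1 + 1)%N expnDn.
  under eq_bigr => i _ do rewrite !exp1n !muln1.
  have h : (m < m.*2.+1)%N by lia.
  by rewrite (bigD1 (Ordinal h)) //= leq_addr.
apply: (@le_trans _ _ (ln c%:R)); last first.
  apply: (@le_trans _ _ (ln (4 ^ m)%:R)); first by rewrite ler_ln ?posrE ?ltr0n ?expn_gt0 // ler_nat.
  rewrite natrX lnXn // (_ : 4 = 2 ^+ 2 :> R); last by rewrite -natrX.
  by rewrite lnXn // -mulr_natl -mulr_natl; lra.
pose B := (maxn c m.*2).+1.
rewrite (@ln_logn_sum c B); last by rewrite c0 ltnS leq_maxl.
rewrite -(big_mkord prime (fun p => (logn p c)%:R * ln p%:R)).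
rewrite (@big_cat_nat _ _ _ m.*2.+1 0 B) //=; last by rewrite ltnS leq_maxr.
rewrite (@big_cat_nat _ _ _ m.+1 0 m.*2.+1) //=; last by rewrite ltnS -addnn leq_addr.
have nn p : 0 <= (logn p c)%:R * ln p%:R :> R.
  by rewrite mulr_ge0 // ln_nat_ge0.
apply: ler_wpDr; first exact: sumr_ge0.
apply: ler_wpDl; first exact: sumr_ge0.
rewrite big_nat_cond [leRHS]big_nat_cond; apply: ler_sum => p /andP[/andP[mp pm] pp].
rewrite ler_peMl ?ln_nat_ge0 // ler1n logn_gt0 mem_primes pp c0 /=.
have pf : (p %| m.*2`!)%N by rewrite dvdn_fact // prime_gt0.
have E : (c * (m`! * m`!) = m.*2`!)%N.
  have := @bin_fact m.*2 m; rewrite -addnn addnK leq_addr => /(_ isT) <-.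
  by rewrite /c -addnn.
have npm : ~~ (p %| m`!)%N.
  by have := logn_gt0 p m`!; rewrite logn_fact_small // mem_primes pp fact_gt0 /= => <-.
by move: pf; rewrite -E !Euclid_dvdM // (negbTE npm) !orbF.
Qed.

Lemma theta_dyadic K : \sum_(p < (2 ^ K).+1 | prime p) ln p%:R <= 2 * (2 ^ K)%:R * ln 2 :> R.
Proof.
have l2 : 0 <= ln 2 :> R by rewrite ln_ge0 // ler1n.
elim: K => [|K IH].
  by rewrite expn0 big_mkcond !big_ord_recl big_ord0 /= !addr0 !mulr_ge0.
rewrite -(big_mkord prime (fun p => ln p%:R)) (@big_cat_nat _ _ _ (2 ^ K).+1) //=; last first.
  by rewrite ltnS leq_exp2l.
rewrite big_mkord expnS mul2n; have := @theta_dyadic_block (2 ^ K)%N; rewrite expn_gt0 => /(_ isT).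
rewrite -mul2n natrM; move=> h; apply: le_trans (lerD IH h) _.
rewrite le_eqVlt; apply/orP; left; apply/eqP; move: ((2 ^ K)%N%:R : R) (ln 2) => x y; ring.
Qed.

Lemma sum_ln_div_le M : \sum_(2 <= m < M.+1) ln m%:R / (m * m.-1)%:R <= 2 :> R.
Proof.
(* The subtracted quantity (2 + ln M) / M decreases by at least the next term of the sum, which lets
   the induction close. *)
suff : \sum_(2 <= m < M.+1) ln m%:R / (m * m.-1)%:R <= 2 - (if M is 0 then 0 else (2 + ln M%:R) / M%:R) :> R.
  move/le_trans; apply; rewrite gerBl; case: M => // M.
  by rewrite divr_ge0 ?addr_ge0 ?ln_nat_ge0.
elim: M => [|[|M] IH]; first by rewrite big_geq // subr0.
  by rewrite big_geq // ln1 addr0 divr1 subrr.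
rewrite big_nat_recr //=; apply: le_trans (lerD IH (lexx _)) _.
have := @inv_ge_lnB R M.+1 isT.
have m1 : (1 : R) <= M.+1%:R by rewrite ler1n.
have E : M.+2%:R = M.+1%:R + 1 :> R by rewrite -natr1.
rewrite natrM E; move: (ln M.+1%:R) (ln (M.+1%:R + 1)) => a b; move: (M.+1%:R : R) m1 => x x1 h.
rewrite -subr_ge0.
have -> : 2 - (2 + b) / (x + 1) - (2 - (2 + a) / x + b / ((x + 1) * x)) = (2 + a * (x + 1) - b * x - b) / ((x + 1) * x).
  field; apply/andP; split; lra.
apply: divr_ge0; last by nra.
have : b - a <= 1 / x by rewrite div1r.
rewrite ler_pdivlMr; nra.
Qed.

(** Compares ln n! = n ln n + O(n), for n = 2^K, with the factorization of n!: replacing the integer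
    part of n / p by n / p costs a Chebyshev sum, and the higher powers of p cost the convergent sum
    of ln p / (p (p - 1)). *)
Lemma mertens_first : exists2 C : R, 0 < C & forall K,
  `|\sum_(p < (2 ^ K).+1 | prime p) ln p%:R / p%:R - K%:R * ln 2| <= C.
Proof.
exists 4 => // K; set n := (2 ^ K)%N; have n0 : (0 < n)%N by rewrite expn_gt0.
have nr : (0 : R) < n%:R by rewrite ltr0n.
have lnn : ln n%:R = K%:R * ln 2 :> R by rewrite natrX lnXn // mulr_natl.
have l2 : ln 2 <= 1 :> R by have := @ln_le_sub1 R 2; lra.
have lp := ln_nat_ge0.
pose S : R := \sum_(p < n.+1 | prime p) ln p%:R / p%:R; rewrite -/S -lnn.
have F : ln n`!%:R = \sum_(p < n.+1 | prime p) (logn p n`!)%:R * ln p%:R :> R.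
  rewrite (@ln_logn_sum _ n`!.+1); last by rewrite fact_gt0 /=.
  rewrite -(big_mkord prime (fun p => (logn p n`!)%:R * ln p%:R)).
  rewrite (@big_cat_nat _ _ _ n.+1) //=; last by rewrite ltnS fact_geq.
  rewrite big_mkord [X in _ + X]big_nat_cond [X in _ + X]big1 ?addr0 // => p /andP[/andP[np _] pp].
  by rewrite logn_fact_small // mul0r.
have lo : n%:R * S - 2 * n%:R * ln 2 <= ln n`!%:R.
  rewrite F lerBlDr; apply: le_trans (lerD (lexx _) (theta_dyadic K)); rewrite -big_split /= mulr_sumr.
  apply: ler_sum => p pp; rewrite -[X in _ <= _ + X]mul1r -mulrDl.
  rewrite [ln p%:R / _]mulrC mulrA; apply: ler_wpM2r => //.
  rewrite ler_pdivrMr ?ltr0n ?prime_gt0 //.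
  have pn : (p <= n)%N by rewrite -ltnS.
  have h : (n %/ p <= logn p n`!)%N.
    by rewrite logn_fact // big_ltn ?ltnS // expn1 leq_addr.
  have : (n <= (n %/ p).+1 * p)%N by apply: ltnW; exact: ltn_ceil (prime_gt0 pp).
  move=> h2; rewrite natr1 -natrM ler_nat; apply: leq_trans h2 _.
  by rewrite leq_mul.
have hi : ln n`!%:R <= n%:R * S + n%:R * 2.
  rewrite F; apply: (@le_trans _ _ (n%:R * \sum_(p < n.+1 | prime p) (ln p%:R / p%:R + ln p%:R / (p * p.-1)%:R))).
    rewrite mulr_sumr; apply: ler_sum => p pp.
    have p1 := prime_gt1 pp; have pr : (1 : R) < p%:R by rewrite ltr1n.
    have pred : p.-1%:R = p%:R - 1 :> R by rewrite -subn1 natrB // prime_gt0.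
    rewrite natrM pred.
    have -> : n%:R * (ln p%:R / p%:R + ln p%:R / (p%:R * (p%:R - 1))) = (n%:R / (p%:R - 1)) * ln p%:R :> R.
      field; apply/andP; split; lra.
    apply: ler_wpM2r => //; rewrite logn_fact //.
    have : forall m, (\sum_(1 <= k < m.+1) n %/ p ^ k)%:R <= n%:R / (p%:R - 1) - n%:R / (p%:R - 1) / p%:R ^+ m :> R.
      elim=> [|m IH]; first by rewrite big_geq // expr0 divr1 subrr.
      rewrite big_nat_recr //= natrD; apply: le_trans (lerD IH (_ : _ <= n%:R / p%:R ^+ m.+1)) _.
        by rewrite ler_pdivlMr ?exprn_gt0 ?(lt_trans ltr01) // -natrX -natrM ler_nat leq_trunc_div.
      rewrite exprS; have : 0 < p%:R ^+ m :> R by rewrite exprn_gt0 // (lt_trans ltr01).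
      move: (p%:R ^+ m) => w w0; rewrite le_eqVlt; apply/orP; left; apply/eqP; field.
      apply/and3P; split; lra.
    move/(_ n)/le_trans; apply; rewrite gerBl !divr_ge0 ?exprn_ge0 //; lra.
  rewrite -mulrDr ler_pM2l // big_split lerD2l /=.
  apply: le_trans (sum_ln_div_le n).
  rewrite -(big_mkord prime (fun p => ln p%:R / (p * p.-1)%:R)).
  rewrite big_mkcond; case: (n) n0 => // k _; rewrite big_ltn // big_ltn //= !add0r.
  by apply: ler_sum => p _; case: ifP => // _; rewrite divr_ge0.
have f1 := ln_fact_ge n0.
have f2 : ln n`!%:R <= n%:R * ln n%:R :> R.
  rewrite mulr_natl -lnXn // ler_ln ?posrE ?exprn_gt0 ?ltr0n ?fact_gt0 // -natrX ler_nat.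
  by elim: (n) => // k IH; rewrite factS expnS leq_mul // (leq_trans IH) //; case: (k) => // j; rewrite leq_exp2r.
rewrite ler_norml; apply/andP; split.
  rewrite -(ler_pM2l nr); lra.
rewrite -(ler_pM2l nr); nra.
Qed.

End Chebyshev.

Lemma cvgn_le (R : realType) (u : nat -> R) (l c : R) : u n @[n --> \oo] --> l ->
  (forall n, u n <= c) -> l <= c.
Proof.
move=> ul uc; rewrite -(cvg_lim _ ul) //; apply: limr_le; first by apply/cvg_ex; exists l.
by near=> n; exact: uc.
Unshelve. all: by end_near.
Qed.

Lemma cvgn_ge (R : realType) (u : nat -> R) (l c : R) : u n @[n --> \oo] --> l ->
  (forall n, c <= u n) -> c <= l.
Proof.
move=> ul uc; rewrite -(cvg_lim _ ul) //; apply: limr_ge; first by apply/cvg_ex; exists l.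
by near=> n; exact: uc.
Unshelve. all: by end_near.
Qed.

Lemma sum_multiples (V : nmodType) (f : nat -> V) (P : pred nat) p N : (0 < p)%N ->
  \sum_(1 <= n < N.+1 | (p %| n)%N && P n) f n = \sum_(1 <= k < (N %/ p).+1 | P (p * k)%N) f (p * k)%N.
Proof.
move=> p0; elim: N => [|N IH]; first by rewrite div0n !big_geq.
rewrite big_mkcond big_nat_recr //= -big_mkcond IH divnS //.
case: (boolP (p %| N.+1)%N) => pN /=; last by rewrite addr0.
rewrite [RHS]big_mkcond add1n big_nat_recr //= -big_mkcond /=.
suff -> : (p * (N %/ p).+1 = N.+1)%N by [].
by rewrite -[RHS](divnK pN) divnS // pN mulnC.
Qed.

(** * The zeta function at 1 + s and its Euler product *)

Section Zeta.
Context (R : realType) (s : R).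
Hypotheses (s0 : 0 < s).

(** [v n] is n^(-s) and [a n] is n^(-1-s), so [Z] below is zeta(1 + s). *)
Let v (n : nat) : R := expR (- (s * ln n%:R)).
Let a (n : nat) : R := v n / n%:R.
Let q : R := expR (- (s * ln 2)).

Let l2 : 0 < ln 2 :> R. Proof. by rewrite ln_gt0 // ltr1n. Qed.
Let q01 : 0 < q < 1. Proof. by rewrite expR_gt0 expR_lt1 oppr_lt0 mulr_gt0. Qed.

Let v0 n : 0 < v n. Proof. exact: expR_gt0. Qed.
Let v1 : v 1 = 1. Proof. by rewrite /v ln1 mulr0 oppr0 expR0. Qed.
Let a0 n : 0 <= a n. Proof. by rewrite divr_ge0 // ltW. Qed.
Let vM m n : (0 < m)%N -> (0 < n)%N -> v (m * n) = v m * v n.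
Proof. by move=> m0 n0; rewrite /v -expRD natrM lnM ?posrE ?ltr0n // mulrDr opprD. Qed.
Let aM m n : (0 < m)%N -> (0 < n)%N -> a (m * n) = a m * a n.
Proof. by move=> m0 n0; rewrite /a vM // natrM invfM mulrACA. Qed.
Let v2X K : v (2 ^ K) = q ^+ K.
Proof. by rewrite /v /q natrX lnXn // -expRM_natl; congr expR; rewrite -[_ *+ K]mulr_natl; ring. Qed.

Lemma zeta_term_le n : (0 < n)%N -> s * a n.+1 <= v n - v n.+1.
Proof.
move=> n0; have nr : (0 : R) < n.+1%:R by rewrite ltr0n.
have -> : v n = v n.+1 * expR (s * (ln n.+1%:R - ln n%:R)).
  by rewrite /v -expRD; congr expR; ring.
have := expR_ge1Dx (s * (ln n.+1%:R - ln n%:R)).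
have := @inv_le_lnB R n n0; move: (ln _ - ln _) => x h1 h2.
have : s / n.+1%:R <= expR (s * x) - 1 by apply: le_trans (_ : s * x <= _); rewrite ?ler_pM2l //; lra.
move=> h; rewrite /a -[leRHS](_ : v n.+1 * (expR (s * x) - 1) = _); last by ring.
by rewrite mulrCA ler_wpM2l // ltW.
Qed.

Lemma zeta_term_ge n : (0 < n)%N -> v n - v n.+1 <= s * a n.
Proof.
move=> n0; have nr : (0 : R) < n%:R by rewrite ltr0n.
have -> : v n.+1 = v n * expR (- (s * (ln n.+1%:R - ln n%:R))).
  by rewrite /v -expRD; congr expR; ring.
have := expR_ge1Dx (- (s * (ln n.+1%:R - ln n%:R))).
have := @inv_ge_lnB R n n0; move: (ln _ - ln _) => x h1 h2.
have h : 1 - expR (- (s * x)) <= s / n%:R by apply: le_trans (_ : s * x <= _); rewrite ?ler_pM2l //; lra.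
rewrite /a -[leLHS](_ : v n * (1 - expR (- (s * x))) = _); last by ring.
by rewrite mulrCA ler_wpM2l // ltW.
Qed.

(** The part of the zeta sum up to N over the n without prime factor below P; P = 0 gives the full
    partial sum. *)
Let G P N := \sum_(1 <= n < N.+1 | all (fun p => prime p ==> ~~ (p %| n)%N) (iota 0 P)) a n.

Lemma zeta_tail M N : (0 < M)%N -> \sum_(M.+1 <= n < N.+1) a n <= s^-1 * v M.
Proof.
move=> M0; case: (leqP M N) => MN; last by rewrite big_geq ?ltnS 1?ltnW // mulr_ge0 ?invr_ge0 ?ltW.
suff : \sum_(M.+1 <= n < N.+1) a n <= s^-1 * (v M - v N).
  by move/le_trans; apply; rewrite ler_wpM2l ?invr_ge0 ?(ltW s0) // gerBl ltW.
move: MN => /subnK <-; elim: (N - M)%N => [|k IH]; first by rewrite add0n big_geq // subrr mulr0.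
rewrite addSn big_nat_recr //= ?ltnS ?leq_addl //; apply: le_trans (lerD IH (lexx _)) _.
have := @zeta_term_le (k + M)%N; rewrite addn_gt0 M0 orbT => /(_ isT) h.
rewrite -lerBrDl -mulrBr mulrC ler_pdivlMr // mulrC; apply: le_trans h _.
by rewrite le_eqVlt; apply/orP; left; apply/eqP; ring.
Qed.

Lemma zeta_partial_ge N : s^-1 * (1 - v N.+1) <= G 0 N.
Proof.
elim: N => [|N IH]; first by rewrite v1 subrr mulr0 /G big_geq.
rewrite /G big_nat_recr //=; apply: le_trans (lerD IH (lexx _)).
rewrite -lerBlDl -mulrBr mulrC ler_pdivrMr // mulrC; apply: le_trans (@zeta_term_ge N.+1 isT).
by rewrite le_eqVlt; apply/orP; left; apply/eqP; ring.
Qed.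

Let Z := limn (G 0).

Lemma G_ge1 P N : (0 < N)%N -> 1 <= G P N.
Proof.
move=> N0; rewrite /G big_mkcond big_ltn // (_ : all _ _ = true); last first.
  by apply/allP => p _; apply/implyP => pp; rewrite dvdn1 neq_ltn prime_gt1 ?orbT.
rewrite /a v1 divr1 /= -[X in X <= _]addr0; apply: lerD => //.
by apply: sumr_ge0 => n _; case: ifP => // _; exact: a0.
Qed.

Lemma G0_cvg : G 0 N @[N --> \oo] --> Z.
Proof.
apply: nondecreasing_is_cvgn.
  by apply/nondecreasing_seqP => N; rewrite /G [leRHS]big_nat_recr //= lerDl.
exists (1 + s^-1) => _ [N _ <-]; case: N => [|N]; first by rewrite /G big_geq // addr_ge0 // invr_ge0 ltW.
rewrite /G big_ltn // lerD //; first by rewrite /a v1 divr1.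
by apply: le_trans (zeta_tail N.+1 (isT : (0 < 1)%N)) _; rewrite v1 mulr1.
Qed.

(** Eratosthenes: the multiples of a prime P among the remaining n contribute [a P] times the same
    sum up to N / P. *)
Lemma G_cvg P : G P N @[N --> \oo] --> Z * \prod_(p < P | prime p) (1 - a p).
Proof.
elim: P => [|P IH]; first by rewrite big_ord0 mulr1; exact: G0_cvg.
have ext N : G P.+1 N = \sum_(1 <= n < N.+1 | all (fun p => prime p ==> ~~ (p %| n)%N) (iota 0 P) && (prime P ==> ~~ (P %| n)%N)) a n.
  by apply: eq_bigl => n; rewrite -addn1 iotaD all_cat /= andbT.
rewrite big_mkcond big_ord_recr /= -big_mkcond /=; case: (boolP (prime P)) => pP; last first.
  rewrite mulr1; rewrite (_ : G P.+1 = G P) //; apply/funext => N; rewrite ext /G; apply: eq_bigl => n.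
  by rewrite (negbTE pP) andbT.
have P0 := prime_gt0 pP.
have -> : G P.+1 = (fun N => G P N - a P * G P (N %/ P)%N).
  apply/funext => N; rewrite ext pP /= [G P N](bigID (fun n => (P %| n)%N)) /= addrAC.
  rewrite (_ : \sum_(_ <= _ < _ | _ && (P %| _)%N) _ = a P * G P (N %/ P)%N) ?subrr ?add0r //.
  under eq_bigl => n do rewrite andbC.
  rewrite sum_multiples // /G mulr_sumr big_nat_cond [RHS]big_nat_cond; apply: eq_big => [n|n /andP[/andP[n0 _] _]].
    congr (_ && _); apply: eq_in_all => p; rewrite mem_iota add0n => /andP[_ pP'].
    case: (boolP (prime p)) => //= pp; rewrite Euclid_dvdM // (_ : (p %| P)%N = false) //.
    by rewrite dvdn_prime2 // ltn_eqF.
  by rewrite aM.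
rewrite mulrA mulrBr mulr1; apply: cvgB => //; rewrite mulrC; apply: cvgM; first exact: cvg_cst.
apply: (cvg_comp (fun N => N %/ P)%N (G P) _ IH).
by move=> S [A _ SA]; exists (A * P)%N => // N /= AN; apply: SA; rewrite /= leq_divRL.
Qed.

Lemma zeta_bounds : 1 <= s * Z <= 1 + s.
Proof.
have [q0 q1] := andP q01.
have qc : q ^+ K @[K --> \oo] --> 0 by apply: cvg_expr; rewrite ger0_norm // ltW.
apply/andP; split.
  rewrite -ler_pdivrMl // mulr1.
  have c1 : s^-1 * (1 - q ^+ K) @[K --> \oo] --> s^-1.
    rewrite -[X in _ --> X]mulr1 -[X in _ * X](subr0 1); apply: cvgM; first exact: cvg_cst.
    by apply: cvgB => //; exact: cvg_cst.
  apply: (ler_cvg_to c1 (_ : G 0 (2 ^ K).-1 @[K --> \oo] --> Z)).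
    apply: (cvg_comp (fun K => (2 ^ K).-1) (G 0) _ G0_cvg).
    move=> S [A _ SA]; exists A => // N /= AN; apply: SA => /=.
    by have := ltn_expl N (isT : (1 < 2)%N); lia.
  near=> K; rewrite -v2X; have := zeta_partial_ge (2 ^ K).-1; rewrite prednK ?expn_gt0 //.
rewrite -ler_pdivlMl //; apply: (cvgn_le G0_cvg) => -[|N].
  by rewrite /G big_geq // mulr_ge0 ?invr_ge0 ?addr_ge0 ?(ltW s0).
rewrite mulrDr mulr1 mulVf ?gt_eqF // addrC /G big_ltn //; apply: lerD; first by rewrite /a v1 divr1.
by apply: le_trans (zeta_tail N.+1 (isT : (0 < 1)%N)) _; rewrite v1 mulr1.
Unshelve. all: by end_near.
Qed.

(** Apart from 1, an integer without prime factor up to M exceeds M, so the sifted sum is bounded by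
    the tail of the series. With [rough_sum_ge] this makes the Euler product converge. *)
Lemma rough_sum_le M : (0 < M)%N -> Z * \prod_(p < M.+1 | prime p) (1 - a p) <= 1 + s^-1 * v M.
Proof.
move=> M0.
have key n : (1 < n)%N -> (n < M.+1)%N -> all (fun p => prime p ==> ~~ (p %| n)%N) (iota 0 M.+1) = false.
  move=> n1 nM; apply/allP => /(_ (pdiv n)); rewrite mem_iota (pdiv_prime n1) pdiv_dvd => H.
  by have := H (leq_ltn_trans (pdiv_leq (ltnW n1)) nM).
apply: (cvgn_le (@G_cvg M.+1)) => -[|N].
  by rewrite /G big_geq // addr_ge0 // mulr_ge0 ?invr_ge0 // ltW.
rewrite /G big_mkcond big_ltn //; apply: lerD; first by case: ifP => _ //; rewrite /a v1 divr1.
have [MN|NM] := leqP M N.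
  apply: le_trans (zeta_tail N.+1 M0); set S := \sum_(_ <= _ < _) a _.
  rewrite (@big_cat_nat _ _ _ M.+1) ?ltnS //; last exact: leqW.
  rewrite -[S]add0r.
  apply: lerD; last by apply: ler_sum => n _; case: ifP.
  by rewrite big_nat big1 // => n /andP[n1 nM]; rewrite key.
rewrite big_nat big1; first by rewrite mulr_ge0 ?invr_ge0 // ltW.
by move=> n /andP[n1 nM]; rewrite key // (leq_trans nM).
Qed.

Lemma rough_sum_ge P : 1 <= Z * \prod_(p < P | prime p) (1 - a p).
Proof.
apply: (cvgn_ge (_ : G P n.+1 @[n --> \oo] --> _)).
  by rewrite (cvg_shiftS (G P)); exact: G_cvg.
by move=> n; exact: G_ge1.
Qed.

Lemma zeta_gt0 : 0 < Z.
Proof. by have := rough_sum_ge 0; rewrite big_ord0 mulr1; apply: lt_le_trans. Qed.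

Lemma a_lt1 p : prime p -> 0 < 1 - a p.
Proof.
move=> pp; have p1 : (1 : R) < p%:R by rewrite ltr1n prime_gt1.
rewrite subr_gt0 /a ltr_pdivrMr ?(lt_trans ltr01) // mul1r; apply: le_lt_trans p1.
by rewrite /v expR_le1 oppr_le0 mulr_ge0 ?(ltW s0) // ln_nat_ge0.
Qed.

Lemma log_euler_product :
  \sum_(p < (2 ^ K).+1 | prime p) - ln (1 - a p) @[K --> \oo] --> ln Z.
Proof.
have [q0 q1] := andP q01; have z0 := zeta_gt0.
have qc : q ^+ K @[K --> \oo] --> 0 by apply: cvg_expr; rewrite ger0_norm // ltW.
pose W K := \prod_(p < (2 ^ K).+1 | prime p) (1 - a p).
have W0 K : 0 < W K by apply: prodr_gt0 => p; exact: a_lt1.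
have E K : \sum_(p < (2 ^ K).+1 | prime p) - ln (1 - a p) = ln Z - ln (Z * W K).
  rewrite lnM ?posrE // opprD addrA subrr add0r /W ln_prod; last by move=> p; exact: a_lt1.
  by rewrite sumrN.
under eq_fun do rewrite E.
suff h : ln Z - ln (Z * W K) @[K --> \oo] --> ln Z - 0 by rewrite subr0 in h.
apply: cvgB; first exact: cvg_cst.
apply: (@squeeze_cvgr _ _ _ _ (fun=> 0) (fun K => s^-1 * q ^+ K)).
- near=> K; rewrite ln_ge0 ?rough_sum_ge //= -v2X.
  apply: le_trans (ln_le_sub1 _) _; first by rewrite mulr_gt0.
  by rewrite lerBlDl; apply: rough_sum_le; rewrite expn_gt0.
- exact: cvg_cst.
- by rewrite -[X in _ --> X](mulr0 s^-1); apply: cvgM => //; exact: cvg_cst.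
Unshelve. all: by end_near.
Qed.

Lemma zeta_exists : exists z : R, [/\ 0 < z, 1 <= s * z <= 1 + s &
  \sum_(p < (2 ^ K).+1 | prime p) - ln (1 - expR (- (s * ln p%:R)) / p%:R) @[K --> \oo] --> ln z].
Proof. by exists Z; split; [exact: zeta_gt0|exact: zeta_bounds|exact: log_euler_product]. Qed.

End Zeta.

Lemma cvg_eq (R : realType) (T : Type) (F : set_system T) (u : T -> R) (a b : R) :
  u x @[x --> F] --> a -> a = b -> u x @[x --> F] --> b.
Proof. by move=> h <-. Qed.

Lemma cvg_near_eq (R : realType) (T : Type) (F : set_system T) (FF : Filter F) (u w : T -> R) (a : R) :
  u x @[x --> F] --> a -> (\forall x \near F, u x = w x) -> w x @[x --> F] --> a.
Proof. by move=> ua uw; apply: (cvg_trans _ ua); apply: near_eq_cvg; apply: filterS uw. Qed.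

(* T is the sequence of partial sums of beta k - 1/k, where beta k sums
   - ln (1 - 1/p) over 2^k < p <= 2^(k+1); it converges by Mertens' first theorem.
   The limit is found by comparing ln (zeta (1 + s)) with
   - ln (1 - 2^(-s)) = sum_k 2^(-ks)/k as s -> 0. *)
Section Mertens.
Context (R : realType).

Definition dyad (k : nat) (f : nat -> R) : R := \sum_((2 ^ k).+1 <= p < (2 ^ k.+1).+1 | prime p) f p.

Lemma dyad_sum (f : nat -> R) K : \sum_(k < K) dyad k f = \sum_(p < (2 ^ K).+1 | prime p) f p.
Proof.
elim: K => [|K IH].
  by rewrite big_ord0 expn0 big_mkcond !big_ord_recl big_ord0 /= !addr0.
rewrite big_ord_recr /= IH -!(big_mkord prime f) [RHS](@big_cat_nat _ _ _ (2 ^ K).+1) //=.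
by rewrite ltnS leq_exp2l.
Qed.

Lemma dyad_le k (f g : nat -> R) : (forall p, prime p -> (2 ^ k < p <= 2 ^ k.+1)%N -> f p <= g p) ->
  dyad k f <= dyad k g.
Proof.
move=> fg; rewrite /dyad big_nat_cond [leRHS]big_nat_cond; apply: ler_sum => p /andP[/andP[h1 h2] pp].
by apply: fg => //; rewrite h1 -ltnS.
Qed.

Lemma dyadZ k c (f : nat -> R) : dyad k (fun p => c * f p) = c * dyad k f.
Proof. by rewrite /dyad mulr_sumr. Qed.

Lemma dyadD k (f g : nat -> R) : dyad k (fun p => f p + g p) = dyad k f + dyad k g.
Proof. exact: big_split. Qed.

Lemma dyadB k (f g : nat -> R) : dyad k (fun p => f p - g p) = dyad k f - dyad k g.
Proof. by rewrite /dyad big_split /= sumrN. Qed.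

Lemma dyad_norm k (f : nat -> R) : `|dyad k f| <= dyad k (fun p => `|f p|).
Proof. exact: ler_norm_sum. Qed.

Let L k := dyad k (fun p => ln p%:R / p%:R).
Let l2 : 0 < ln 2 :> R. Proof. by rewrite ln_gt0 // ltr1n. Qed.

Lemma dyad_log_bound : exists2 C : R, 0 < C & forall k, L k <= C.
Proof.
have [C C0 H] := mertens_first R; exists (2 * C + ln 2) => [|k]; first by rewrite addr_gt0 ?mulr_gt0.
have h1 := H k; have h2 := H k.+1; rewrite -!(dyad_sum (fun p => ln p%:R / p%:R)) in h1 h2.
rewrite big_ord_recr /= -/(L k) -[k.+1%:R]natr1 in h2.
move: h1 h2; rewrite !ler_norml => /andP[a1 a2] /andP[b1 b2]; lra.
Qed.

Lemma sqr_le_exp2 k : (k.+1 ^ 2 <= 4 * 2 ^ k)%N.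
Proof.
elim: k => [|[|[|k]] IH] //.
apply: (@leq_trans (2 * k.+3 ^ 2)%N); first by rewrite -!mulnn; nia.
by rewrite [(2 ^ k.+3)%N]expnS mulnCA leq_pmul2l.
Qed.

Lemma dyad_inv_sqr k : dyad k (fun p => (p%:R ^+ 2)^-1) <= 4 / k.+1%:R ^+ 2.
Proof.
have e0 : (0 : R) < (2 ^ k)%N%:R by rewrite ltr0n expn_gt0.
apply: (@le_trans _ _ (dyad k (fun=> (((2 ^ k)%N%:R : R) ^+ 2)^-1))).
  apply: dyad_le => p pp /andP[h _]; rewrite lef_pV2 ?posrE ?exprn_gt0 //; last by rewrite ltr0n prime_gt0.
  by apply: lerXn2r; rewrite ?nnegrE // ler_nat ltnW.
rewrite /dyad big_mkcond; apply: (@le_trans _ _ (\sum_((2 ^ k).+1 <= p < (2 ^ k.+1).+1) (((2 ^ k)%N%:R : R) ^+ 2)^-1)).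
  by apply: ler_sum => p _; case: ifP.
rewrite sumr_const_nat subSS expnS mul2n -addnn addnK -[leLHS]mulr_natl.
have -> : (2 ^ k)%N%:R * (((2 ^ k)%N%:R : R) ^+ 2)^-1 = ((2 ^ k)%N%:R)^-1.
  by move: ((2 ^ k)%N%:R : R) e0 => x x0; field; rewrite gt_eqF.
rewrite -[leRHS]invf_div lef_pV2 ?posrE ?divr_gt0 ?exprn_gt0 // ler_pdivrMr // mulrC.
by rewrite -natrX -natrM ler_nat sqr_le_exp2.
Qed.

Lemma ler_ln_nat m n : (0 < m)%N -> (m <= n)%N -> ln m%:R <= ln n%:R :> R.
Proof. by move=> m0 mn; rewrite ler_ln ?posrE ?ltr0n ?ler_nat // (leq_trans m0). Qed.

Lemma ln_dyad k p : prime p -> (2 ^ k < p <= 2 ^ k.+1)%N ->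
  [/\ k%:R * ln 2 <= ln p%:R :> R, ln p%:R <= k.+1%:R * ln 2 :> R & k.+1%:R * ln 2 <= 2 * ln p%:R :> R].
Proof.
move=> pp /andP[h1 h2]; have p0 : (0 : R) < p%:R by rewrite ltr0n prime_gt0.
have lX j : j%:R * ln 2 = ln (2 ^ j)%N%:R :> R by rewrite natrX lnXn // mulr_natl.
have a1 : k%:R * ln 2 <= ln (p%:R : R).
  by rewrite lX; apply: ler_ln_nat; rewrite ?expn_gt0 // ltnW.
have a2 : ln 2 <= ln (p%:R : R) by apply: ler_ln_nat => //; exact: prime_gt1.
split=> //; first by rewrite lX; apply: ler_ln_nat => //; exact: prime_gt0.
by rewrite -natr1 mulrDl; lra.
Qed.

Lemma dyad_inv : exists2 C : R, 0 < C & forall k, dyad k (fun p => (p%:R)^-1) <= C / k.+1%:R.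
Proof.
have [C C0 H] := dyad_log_bound; exists (2 * C / ln 2) => [|k]; first by rewrite divr_gt0 ?mulr_gt0.
have k0 : (0 : R) < k.+1%:R by [].
apply: (@le_trans _ _ (dyad k (fun p => 2 / (k.+1%:R * ln 2) * (ln p%:R / p%:R)))).
  apply: dyad_le => p pp hp; have [_ _ h] := ln_dyad pp hp.
  have p0 : (0 : R) < p%:R by rewrite ltr0n prime_gt0.
  rewrite mulrA -[leLHS]mul1r; apply: ler_wpM2r; first by rewrite invr_ge0.
  by rewrite mulrAC ler_pdivlMr ?mul1r // mulr_gt0.
rewrite dyadZ; apply: le_trans (ler_wpM2l _ (H k)) _; first by rewrite divr_ge0 // mulr_ge0 ?ltW.
rewrite le_eqVlt; apply/orP; left; apply/eqP; field.
by rewrite !gt_eqF.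
Qed.

Definition log_factor (p : nat) : R := - ln (1 - p%:R^-1).

Lemma log_factor_bound p (y : R) : prime p -> 0 <= y <= 1 ->
  `|- ln (1 - y / p%:R) - y / p%:R| <= 2 / p%:R ^+ 2.
Proof.
move=> pp /andP[y0 y1]; have p2 : (2 : R) <= p%:R by rewrite ler_nat prime_gt1.
have p0 : (0 : R) < p%:R by lra.
have x0 : 0 <= y / p%:R by rewrite divr_ge0 // ltW.
have h : `|y / p%:R| <= 2^-1.
  rewrite ger0_norm // ler_pdivrMr //; lra.
rewrite -opprD normrN; apply: le_trans (ln_bound1 h) _.
rewrite ler_pM2l // expr_div_n ler_pdivrMr ?exprn_gt0 // mulVf ?gt_eqF ?exprn_gt0 //.
by rewrite exprn_ile1.
Qed.

Let beta k := dyad k log_factor.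
Let c k := beta k - k%:R^-1.
Let T K := \sum_(k < K) c k.

(** In the k-th block ln p is k ln 2 up to a bounded error, so [beta k] is L k / (k ln 2) + O(1 /
    k^2), the terms beyond 1 / p of the logarithms included. *)
Lemma beta_norm : exists2 C : R, 0 < C & forall k,
  `|c k - (L k / ln 2 - 1) / k%:R| <= C / k.+1%:R ^+ 2.
Proof.
have [C C0 H] := dyad_log_bound.
exists (8 + 4 * C / ln 2 + `|beta 0|) => [|k]; first by rewrite ltr_wpDr // addr_gt0 // divr_gt0 ?mulr_gt0.
(* For k = 0 the inverse of 0 is 0, so [c 0] is [beta 0], which has been put into the constant. *)
case: k => [|k]; first by rewrite /c invr0 mulr0 !subr0 expr1n divr1 lerDr addr_ge0 // divr_ge0 ?mulr_ge0 // ltW.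
have k0 : (0 : R) < k.+1%:R by [].
have -> : c k.+1 - (L k.+1 / ln 2 - 1) / k.+1%:R = dyad k.+1 (fun p => log_factor p - (k.+1%:R * ln 2)^-1 * (ln p%:R / p%:R)).
  rewrite dyadB dyadZ -/(beta _) -/(L _) /c; field; by rewrite !gt_eqF.
apply: le_trans (dyad_norm _ _) _.
apply: (@le_trans _ _ (dyad k.+1 (fun p => 2 * (p%:R ^+ 2)^-1 + (k.+1%:R ^+ 2 * ln 2)^-1 * (ln p%:R / p%:R)))).
  apply: dyad_le => p pp hp; have [h1 h2 _] := ln_dyad pp hp.
  have p0 : (0 : R) < p%:R by rewrite ltr0n prime_gt0.
  have := @log_factor_bound p 1 pp; rewrite ler01 lexx => /(_ isT); rewrite div1r -/(log_factor p) => h3.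
  have -> : log_factor p - (k.+1%:R * ln 2)^-1 * (ln p%:R / p%:R) =
     (log_factor p - p%:R^-1) + (p%:R^-1 - (k.+1%:R * ln 2)^-1 * (ln p%:R / p%:R)) by ring.
  apply: le_trans (ler_normD _ _) _; apply: lerD => //.
  rewrite ler0_norm; last first.
    rewrite subr_le0 mulrA -[leLHS]mul1r; apply: ler_wpM2r; first by rewrite invr_ge0 ltW.
    by rewrite mulrC ler_pdivlMr ?mul1r // mulr_gt0.
  rewrite opprB lerBlDr.
  have -> : (k.+1%:R * ln 2)^-1 * (ln p%:R / p%:R) = ln p%:R / (k.+1%:R * ln 2) * p%:R^-1 :> R by ring.
  rewrite [X in _ <= X + _](_ : _ = (ln p%:R / (k.+1%:R ^+ 2 * ln 2)) * p%:R^-1); last by ring.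
  rewrite -[X in _ <= _ + X]mul1r -mulrDl; apply: ler_wpM2r; first by rewrite invr_ge0 ltW.
  rewrite ler_pdivrMr ?mulr_gt0 // mulrDl mul1r.
  have -> : ln p%:R / (k.+1%:R ^+ 2 * ln 2) * (k.+1%:R * ln 2) = ln p%:R / k.+1%:R :> R.
    by field; rewrite !gt_eqF.
  move: h2; rewrite -natr1 mulrDl mul1r => h2.
  have h4 : ln 2 <= ln p%:R / k.+1%:R :> R by rewrite ler_pdivlMr // mulrC.
  by apply: le_trans h2 _; rewrite addrC lerD.
rewrite dyadD !dyadZ -/(L _).
have k2 : (k.+2%:R : R) ^+ 2 <= 4 * k.+1%:R ^+ 2.
  rewrite -!natrX -natrM ler_nat; nia.
have b1 := dyad_inv_sqr k.+1.
have b2 : (k.+1%:R ^+ 2 * ln 2)^-1 * L k.+1 <= 4 * C / ln 2 / k.+2%:R ^+ 2.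
  apply: le_trans (ler_wpM2l _ (H _)) _; first by rewrite invr_ge0 mulr_ge0 ?exprn_ge0 // ltW.
  rewrite [leLHS](_ : _ = C / ln 2 * (k.+1%:R ^+ 2)^-1); last by rewrite invfM; ring.
  rewrite [leRHS](_ : _ = C / ln 2 * (4 / k.+2%:R ^+ 2)); last by ring.
  apply: ler_wpM2l; first by rewrite divr_ge0 // ltW.
  rewrite -[leRHS]invf_div lef_pV2 ?posrE ?divr_gt0 ?exprn_gt0 //.
  by rewrite ler_pdivrMr // mulrC.
have z0 : 0 <= (k.+2%:R ^+ 2)^-1 :> R by rewrite invr_ge0 exprn_ge0.
have := mulr_ge0 (normr_ge0 (beta 0)) z0.
move: (4 * C / ln 2) (`|beta 0| : R) (dyad _ _) (_ * L _) ((k.+2%:R ^+ 2)^-1 : R) b1 b2 {z0}.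
by move=> W N X Y z x1 x2; lra.
Qed.

(** By [beta_norm] it remains to sum (L k / ln 2 - 1) / k; the numerators have bounded partial sums
    by Mertens' first theorem, and Abel summation yields O(1 / m). *)
Lemma T_cauchy : exists2 C : R, 0 < C & forall m n, (0 < m)%N -> (m <= n)%N -> `|T n - T m| <= C / m%:R.
Proof.
have [C1 C10 H1] := beta_norm; have [C2 C20 H2] := mertens_first R.
exists (C1 + 2 * (C2 / ln 2)) => [|m n m0 mn]; first by rewrite addr_gt0 ?mulr_gt0 ?invr_gt0.
have mr : (0 : R) < m%:R by rewrite ltr0n.
pose u k := L k / ln 2 - 1.
have uS N : `|\sum_(k < N) u k| <= C2 / ln 2.
  have -> : \sum_(k < N) u k = (\sum_(p < (2 ^ N).+1 | prime p) ln p%:R / p%:R - N%:R * ln 2) / ln 2.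
    rewrite -(dyad_sum (fun p => ln p%:R / p%:R)) mulrBl mulfK ?gt_eqF // big_split /= sumrN sumr_const card_ord mulr_suml.
    by [].
  by rewrite normrM [`|_^-1|]gtr0_norm ?invr_gt0 // ler_pM2r ?invr_gt0.
have -> : T n - T m = \sum_(k < n - m) (c (m + k)%N - u (m + k)%N / (m + k)%:R) + \sum_(k < n - m) u (m + k)%N * (m + k)%:R^-1.
  rewrite -big_split /= -{1}(subnKC mn) /T big_split_ord /= addrAC subrr add0r.
  by apply: eq_bigr => k _; rewrite subrK.
apply: le_trans (ler_normD _ _) _; rewrite mulrDl; apply: lerD.
  apply: le_trans (ler_norm_sum _ _ _) _.
  apply: (@le_trans _ _ (C1 * (m%:R^-1 - n%:R^-1))); last first.
    by rewrite ler_pM2l // gerBl invr_ge0.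
  suff H3 k : \sum_(i < k) `|c (m + i)%N - u (m + i)%N / (m + i)%:R| <= C1 * (m%:R^-1 - (m + k)%:R^-1).
    by have := H3 (n - m)%N; rewrite subnKC.
  elim: k => [|k IH]; first by rewrite big_ord0 addn0 subrr mulr0.
  rewrite big_ord_recr /=; apply: le_trans (lerD IH (H1 _)) _.
  have : (0 : R) < (m + k)%:R by rewrite ltr0n addn_gt0 m0.
  rewrite addnS -[(m + k).+1%:R]natr1; move: (m + k)%:R => x x0.
  rewrite -mulrDr ler_pM2l // -subr_ge0.
  have -> : m%:R^-1 - (x + 1)^-1 - (m%:R^-1 - x^-1 + ((x + 1) ^+ 2)^-1) = (x * (x + 1) ^+ 2)^-1 :> R.
    by move: (m%:R^-1) => z; field; lra.
  by rewrite invr_ge0 mulr_ge0 ?exprn_ge0 //; lra.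
have := @abel_bound R (fun k => u (m + k)%N) (fun k => (m + k)%:R^-1) (2 * (C2 / ln 2)) (n - m).
rewrite addn0; apply.
  move=> N; have -> : \sum_(k < N) u (m + k)%N = \sum_(k < m + N) u k - \sum_(k < m) u k.
    by rewrite big_split_ord /= addrAC subrr add0r.
  apply: le_trans (ler_normB _ _) _; have := uS (m + N)%N; have := uS m; lra.
move=> k; rewrite invr_ge0 ler0n /= lef_pV2 ?posrE ?ltr0n ?addn_gt0 ?m0 // ler_nat leq_add2l //.
Qed.

Lemma T_cvg_rate : exists l C : R, [/\ 0 < C, (forall m, `|T m.+1 - l| <= C / m.+1%:R) & T n @[n --> \oo] --> l].
Proof.
have [C C0 H] := T_cauchy.
have cT : cvgn (series c).
  apply: cauchy_cvg; apply/cauchy_seriesP => e e0.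
  pose N := (Num.truncn (C / e)).+1.
  have N0 : C / N%:R < e.
    rewrite ltr_pdivrMr ?ltr0n // mulrC -ltr_pdivrMr //.
    by have /andP[_] := truncn_itv (ltW (divr_gt0 C0 e0)).
  exists ([set n | (N <= n)%N], [set n | (N <= n)%N]) => [|[m n] /= [Nm Nn]].
    by split; exists N.
  case: (leqP n m) => mn; first by rewrite big_geq // normr0.
  have -> : \sum_(m <= k < n) c k = T n - T m.
    by rewrite /T -!(big_mkord xpredT c) (big_cat_nat (leq0n m) (ltnW mn)) /= addrAC subrr add0r.
  apply: le_lt_trans (H m n _ (ltnW mn)) _; first exact: leq_trans Nm.
  apply: le_lt_trans N0; rewrite ler_pM2l // lef_pV2 ?posrE ?ltr0n ?ler_nat //.
  exact: leq_trans Nm.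
have TE : T = series c by apply/funext => n; rewrite /series /= big_mkord.
rewrite -TE in cT; exists (limn T), C; split=> // m.
rewrite distrC; have c1 : `|T (n + m.+1)%N - T m.+1| @[n --> \oo] --> `|limn T - T m.+1|.
  apply: cvg_norm; apply: cvgB; last exact: cvg_cst.
  by rewrite (cvg_shiftn m.+1 T).
by apply: (cvgn_le c1) => n; apply: H => //; exact: leq_addl.
Qed.

(** The k-th block of ln zeta(1 + s). With [q s] = 2^(-s), the factors p^(-s) in this block lie
    between q^(k+1) and q^k. *)
Let D (s : R) k := dyad k (fun p => - ln (1 - expR (- (s * ln p%:R)) / p%:R)).
Let q (s : R) : R := expR (- (s * ln 2)).

(** x^k (1 - x) is the least of the k + 1 numbers x^j (1 - x), j <= k, whose sum is at most 1. *)
Lemma geom_step_le (x : R) k : 0 <= x <= 1 -> x ^+ k * (1 - x) <= k.+1%:R^-1.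
Proof.
move=> /andP[x0 x1]; rewrite -[leRHS]div1r ler_pdivlMr ?ltr0n // mulrC.
have : \sum_(j < k.+1) x ^+ j * (1 - x) <= 1.
  have : (x - 1) * \sum_(j < k.+1) x ^+ j = x ^+ k.+1 - 1 by rewrite [RHS]subrX1.
  rewrite -mulr_suml => h; rewrite mulrC.
  have := exprn_ge0 k.+1 x0; lra.
apply: le_trans; rewrite mulr_natl -[k.+1 in leLHS]card_ord -sumr_const; apply: ler_sum => j _.
rewrite ler_wpM2r ?subr_ge0 //; apply: ler_wiXn2l => //; by rewrite -ltnS.
Qed.

Lemma expR_ln_dyad s k p : 0 < s -> prime p -> (2 ^ k < p <= 2 ^ k.+1)%N ->
  q s ^+ k.+1 <= expR (- (s * ln p%:R)) <= q s ^+ k.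
Proof.
move=> s0 pp hp; have [h1 h2 _] := ln_dyad pp hp.
rewrite /q -!expRM_natl !ler_expR !mulrN !lerN2 ![_ * (s * _)]mulrCA !ler_pM2l //.
by rewrite h1 h2.
Qed.

Lemma q_itv s : 0 < s -> 0 < q s < 1.
Proof. by move=> s0; rewrite expR_gt0 expR_lt1 oppr_lt0 mulr_gt0. Qed.

(** Uniform in s, which provides the summable majorant for [tannery]; [D_close_beta] complements it
    with the limit s -> 0 for each fixed k. *)
Lemma D_close : exists2 C : R, 0 < C & forall s k, 0 < s ->
  `|D s k - q s ^+ k * beta k| <= C / k.+1%:R ^+ 2.
Proof.
have [C C0 H] := dyad_inv; exists (16 + C) => [|s k s0]; first by rewrite addr_gt0.
have /andP[q0 q1] := q_itv s0.
have k0 : (0 : R) < k.+1%:R by [].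
rewrite /D -dyadZ -dyadB; apply: le_trans (dyad_norm _ _) _.
apply: (@le_trans _ _ (dyad k (fun p => 4 * (p%:R ^+ 2)^-1 + k.+1%:R^-1 * p%:R^-1))); last first.
  rewrite dyadD !dyadZ [leRHS]mulrDl; apply: lerD.
    apply: le_trans (ler_wpM2l _ (dyad_inv_sqr k)) _ => //.
    by rewrite mulrA -natrM.
  apply: le_trans (ler_wpM2l _ (H k)) _; first by rewrite invr_ge0.
  by rewrite expr2 invfM mulrCA.
apply: dyad_le => p pp hp; have p0 : (0 : R) < p%:R by rewrite ltr0n prime_gt0.
have := expR_ln_dyad s0 pp hp; set y := expR _ => /andP[y1 y2].
have qk1 : q s ^+ k <= 1 by apply: exprn_ile1; rewrite ?ltW.
have y0 : 0 <= y by exact: expR_ge0.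
have y11 : 0 <= y <= 1 by rewrite y0 (le_trans y2).
have b1 := log_factor_bound pp y11.
have := @log_factor_bound p 1 pp; rewrite ler01 lexx => /(_ isT); rewrite div1r -/(log_factor p) => b2.
have b3 : `|y - q s ^+ k| <= k.+1%:R^-1.
  rewrite ler0_norm ?subr_le0 // opprB; apply: le_trans (@geom_step_le (q s) k _); last by rewrite !ltW.
  by rewrite mulrBr mulr1 -exprSr lerD2l lerN2.
have -> : - ln (1 - y / p%:R) - q s ^+ k * log_factor p =
  (- ln (1 - y / p%:R) - y / p%:R) + (y - q s ^+ k) * p%:R^-1 - q s ^+ k * (log_factor p - p%:R^-1) by ring.
apply: le_trans (ler_normB _ _) _.
have b4 : `|q s ^+ k * (log_factor p - p%:R^-1)| <= 2 / p%:R ^+ 2.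
  by rewrite normrM; apply: le_trans b2; rewrite ler_piMl // ger0_norm ?exprn_ge0 ?(ltW q0).
apply: le_trans (lerD (ler_normD _ _) b4) _.
rewrite [X in _ + X + _]normrM [`|p%:R^-1|]gtr0_norm ?invr_gt0 //.
have b5 : `|y - q s ^+ k| * p%:R^-1 <= k.+1%:R^-1 * p%:R^-1 by rewrite ler_pM2r // invr_gt0.
apply: le_trans (lerD (lerD b1 b5) (lexx _)) _.
by rewrite addrAC -mulrDl -natrD.
Qed.

Lemma D_close_beta s k : 0 < s -> `|D s k - beta k| <= dyad k (fun=> 1) * (1 - q s ^+ k.+1).
Proof.
move=> s0; rewrite /D -dyadB; apply: le_trans (dyad_norm _ _) _; rewrite mulrC -dyadZ.
apply: dyad_le => p pp hp; have p0 : (0 : R) < p%:R by rewrite ltr0n prime_gt0.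
have p2 : (2 : R) <= p%:R by rewrite ler_nat prime_gt1.
have := expR_ln_dyad s0 pp hp; set y := expR _ => /andP[y1 y2].
have /andP[q0 q1] := q_itv s0.
have y3 : y <= 1 by apply: le_trans y2 _; apply: exprn_ile1; rewrite ?ltW.
have w0 : 0 < 1 - p%:R^-1 :> R by rewrite subr_gt0 invf_lt1 //; lra.
have wy : 1 - p%:R^-1 <= 1 - y / p%:R by rewrite lerD2l lerN2 ler_piMl // invr_ge0 ltW.
rewrite /log_factor mulr1 opprK addrC ler0_norm; last first.
  by rewrite subr_le0 ler_ln ?posrE // (lt_le_trans w0).
rewrite opprB -ln_div ?posrE ?(lt_le_trans w0 wy) //.
apply: le_trans (ln_le_sub1 _) _; first by rewrite divr_gt0 // (lt_le_trans w0 wy).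
have -> : (1 - y / p%:R) / (1 - p%:R^-1) - 1 = (1 - y) / (p%:R - 1) by field; apply/andP; split; lra.
apply: le_trans (_ : 1 - y <= _); last by rewrite lerD2l lerN2.
by rewrite ler_pdivrMr ?ler_peMr ?subr_ge0 //; lra.
Qed.

Lemma mertens_constant : T n @[n --> \oo] --> ln (ln 2).
Proof.
have [l [C [C0 HT cT]]] := T_cvg_rate; have [C' C'0 HD] := D_close.
suff <- : l = ln (ln 2) by [].
pose s n : R := n.+1%:R^-1; have s0 n : 0 < s n by rewrite invr_gt0.
have sc : s n @[n --> \oo] --> 0 by exact: cvg_harmonic.
have ec (c0 : R) : expR (- (s n * c0)) @[n --> \oo] --> (1 : R).
  rewrite -(@expR0 R); apply: (cvg_comp (fun n => - (s n * c0)) (@expR R) _ (@continuous_expR R 0)).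
  have := cvgN (cvgM sc (cvg_cst c0)); rewrite mul0r oppr0; apply.
have qc k : q (s n) ^+ k @[n --> \oo] --> (1 : R).
  by under eq_fun do rewrite /q -expRM_natl mulrN mulrCA; exact: ec.
have qc1 : q (s n) @[n --> \oo] --> (1 : R) by exact: ec.
(* By summation by parts the series of [h n k] over k is ln zeta(1 + s) + ln(1 - 2^(-s)) - l. Each
   summand tends to 0 with s under a majorant of order 1 / k^2, so the series does too; since zeta(1
   + s) (1 - 2^(-s)) tends to ln 2, this determines l. *)
pose h n k := D (s n) k - q (s n) ^+ k * beta k + q (s n) ^+ k * (1 - q (s n)) * (T k.+1 - l).
have [z Hz] := choice (fun n => zeta_exists (s0 n)).
pose target n := ln (z n) + ln (1 - q (s n)) - l.
have hK n : \sum_(k < K) h n k @[K --> \oo] --> target n.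
  have /andP[q0 q1] := q_itv (s0 n); have [z0 _ zc] := Hz n.
  have E K : \sum_(k < K) h n k = \sum_(p < (2 ^ K).+1 | prime p) - ln (1 - expR (- (s n * ln p%:R)) / p%:R)
     - \sum_(k < K) q (s n) ^+ k / k%:R - q (s n) ^+ K * T K - l * (1 - q (s n) ^+ K).
    rewrite -(dyad_sum (fun p => - ln (1 - expR (- (s n * ln p%:R)) / p%:R))); elim: K => [|K IH]; first by rewrite !big_ord0 /T big_ord0; ring.
    rewrite !big_ord_recr /= IH /h /T big_ord_recr /= -/(T K) /c -/(D (s n) K) exprS.
    by move: (_ ^+ K) (K%:R^-1) => x y; ring.
  under eq_fun do rewrite E.
  have qK : q (s n) ^+ K @[K --> \oo] --> (0 : R) by apply: cvg_expr; rewrite ger0_norm // ltW.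
  apply: (@cvg_eq _ _ _ _ (ln (z n) - (- ln (1 - q (s n))) - 0 * l - l * (1 - 0))); last by rewrite /target opprK mul0r !subr0 mulr1.
  apply: cvgB; last by apply: cvgM; [exact: cvg_cst|apply: cvgB => //; exact: cvg_cst].
  apply: cvgB; last exact: cvgM.
  apply: cvgB => //; rewrite -(cvg_shiftS (fun K => \sum_(k < K) q (s n) ^+ k / k%:R)).
  under eq_fun do rewrite big_ord_recl invr0 mulr0 add0r.
  by apply: log_series_cvg; rewrite ger0_norm // ltW.
(* [tannery] is about finite sums, so the series is cut at some [B n] with an error at most
   [s n]. *)
have exB n : exists K, `|target n - \sum_(k < K) h n k| <= s n.
  have /cvgrPdist_le /(_ _ (s0 n)) [K _ HK] := hK n.
  by exists K; apply: HK => /=.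
have [B HB] := choice exB.
pose g k := (C' + C) / k.+1%:R ^+ 2.
have hg n k : `|h n k| <= g k.
  have /andP[q0 q1] := q_itv (s0 n); have k0 : (0 : R) < k.+1%:R by [].
  rewrite /h /g mulrDl; apply: le_trans (ler_normD _ _) _; apply: lerD; first exact: HD.
  rewrite normrM expr2 invfM mulrCA; apply: ler_pM; rewrite ?normr_ge0 //.
  rewrite ger0_norm ?mulr_ge0 ?exprn_ge0 ?subr_ge0 ?(ltW q0) ?(ltW q1) //.
  by apply: geom_step_le; rewrite !ltW.
have cg : cvgn (series g).
  have -> : g = (C' + C) *: (fun k => (k.+1%:R ^+ 2)^-1) by apply/funext.
  apply: is_cvg_seriesZ; apply: nondecreasing_is_cvgn.
    by apply: nondecreasing_series => k _ _; rewrite invr_ge0 exprn_ge0.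
  exists 2 => _ [n _ <-]; rewrite /series /=.
  case: n => [|n]; first by rewrite big_geq.
  suff : \sum_(0 <= k < n.+1) (k.+1%:R ^+ 2)^-1 <= 2 - n.+1%:R^-1 :> R.
    by move/le_trans; apply; rewrite gerBl invr_ge0.
  elim: n => [|n IH]; first by rewrite big_nat1 expr1n !invr1; lra.
  rewrite big_nat_recr //=; apply: le_trans (lerD IH (lexx _)) _.
  have : (0 : R) < n.+1%:R by [].
  rewrite -[n.+2%:R]natr1; move: (n.+1%:R : R) => x x0; rewrite -subr_ge0.
  have -> : 2 - (x + 1)^-1 - (2 - x^-1 + ((x + 1) ^+ 2)^-1) = (x * (x + 1) ^+ 2)^-1 by field; lra.
  by rewrite invr_ge0 mulr_ge0 ?exprn_ge0 //; lra.
have h0 k : h n k @[n --> \oo] --> (0 : R).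
  apply: (@cvg_eq _ _ _ _ (0 + 0)); last exact: addr0.
  apply: cvgD.
    apply: norm_cvg0; apply: (@squeeze_cvgr _ _ _ _ (fun=> 0)
       (fun n => dyad k (fun=> 1) * (1 - q (s n) ^+ k.+1) + (1 - q (s n) ^+ k) * `|beta k|)).
    - near=> n; have /andP[q0 q1] := q_itv (s0 n).
      have qk1 : q (s n) ^+ k <= 1 by apply: exprn_ile1; rewrite ?ltW.
      rewrite normr_ge0 /=.
      have -> : D (s n) k - q (s n) ^+ k * beta k = (D (s n) k - beta k) + (1 - q (s n) ^+ k) * beta k by ring.
      apply: le_trans (ler_normD _ _) _; apply: lerD; first exact: D_close_beta.
      by rewrite normrM ger0_norm // subr_ge0.
    - exact: cvg_cst.
    - apply: (@cvg_eq _ _ _ _ (dyad k (fun=> 1) * (1 - 1) + (1 - 1) * `|beta k|)); last by rewrite subrr mulr0 mul0r addr0.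
      by apply: cvgD; apply: cvgM => //; try exact: cvg_cst; apply: cvgB => //; exact: cvg_cst.
  apply: (@cvg_eq _ _ _ _ (1 * (1 - 1) * (T k.+1 - l))); last by rewrite subrr mulr0 mul0r.
  apply: cvgM; last exact: cvg_cst; apply: cvgM => //; apply: cvgB => //; exact: cvg_cst.
have lim0 : \sum_(k < B n) h n k @[n --> \oo] --> (0 : R).
  have := @tannery R (fun n k => if (k < B n)%N then h n k else 0) g (fun=> 0) B cg.
  have -> : limn (series (fun=> 0 : R)) = 0.
    by apply: cvg_lim => //; rewrite (_ : series _ = fun=> 0); [exact: cvg_cst|apply/funext => n; rewrite /series /= big1].
  rewrite (_ : (fun M => \sum_(k < B M) (if (k < B M)%N then h M k else 0)) = (fun M => \sum_(k < B M) h M k)); last first.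
    by apply/funext => n; apply: eq_bigr => k _; rewrite ltn_ord.
  apply.
  - near=> n => k; case: ifP => _ //; rewrite normr0.
    by apply: le_trans (hg 0%N k).
  - by move=> n k; rewrite leqNgt => /negbTE ->.
  - move=> k; apply: norm_cvg0; apply: (@squeeze_cvgr _ _ _ _ (fun=> 0) (fun n => `|h n k|)).
    + by near=> n; rewrite normr_ge0 /=; case: ifP => _ //; rewrite normr0.
    + exact: cvg_cst.
    + by apply: (@cvg_eq _ _ _ _ `|0 : R|); [apply: cvg_norm; exact: h0|rewrite normr0].
have t0 : target n @[n --> \oo] --> (0 : R).
  rewrite (_ : target = (fun n => (target n - \sum_(k < B n) h n k) + \sum_(k < B n) h n k)); last first.
    by apply/funext => n; rewrite subrK.
  apply: (@cvg_eq _ _ _ _ (0 + 0)); last exact: addr0.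
  apply: cvgD => //; apply: norm_cvg0.
  apply: (@squeeze_cvgr _ _ _ _ (fun=> 0) s) => //; last exact: cvg_cst.
  by near=> n; rewrite normr_ge0 HB.
have w n : 0 < 1 - q (s n) by have /andP[_ ?] := q_itv (s0 n); rewrite subr_gt0.
have zw : z n * (1 - q (s n)) @[n --> \oo] --> ln 2.
  (* From 1 <= s zeta(1 + s) <= 1 + s, and from x / (1 + x) <= 1 - e^(-x) <= x at x = s ln 2. *)
  apply: (@squeeze_cvgr _ _ _ _ (fun n => ln 2 / (1 + s n * ln 2)) (fun n => (1 + s n) * ln 2)).
  - near=> n; have [z0 /andP[z1 z2] _] := Hz n; have sn := s0 n.
    have e1 := expR_ge1Dx (- (s n * ln 2)); have e2 := expR_ge1Dx (s n * ln 2).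
    have qe : q (s n) * expR (s n * ln 2) = 1 by rewrite /q -expRD addNr expR0.
    have x0 : 0 < s n * ln 2 by rewrite mulr_gt0.
    have /andP[q0 q1] := q_itv (s0 n).
    rewrite -/(q (s n)) in e1; apply/andP; split.
      rewrite ler_pdivrMr; last by lra.
      rewrite -(ler_pM2l sn) [leRHS](_ : _ = (s n * z n) * ((1 - q (s n)) * (1 + s n * ln 2))); last by ring.
      have : s n * ln 2 <= (1 - q (s n)) * (1 + s n * ln 2) by nra.
      move=> h1; apply: le_trans h1 _; rewrite ler_peMl // mulr_ge0 ?(ltW (w n)) //; lra.
    rewrite -(ler_pM2l sn) mulrA [leRHS](_ : _ = (1 + s n) * (s n * ln 2)); last by ring.
    apply: ler_pM => //; rewrite ?(ltW (w n)) //; lra.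
  - have c1 : 1 + s n * ln 2 @[n --> \oo] --> (1 + 0 * ln 2 : R).
      by apply: cvgD; [exact: cvg_cst|apply: cvgM => //; exact: cvg_cst].
    apply: (@cvg_eq _ _ _ _ (ln 2 * 1^-1)); last by rewrite invr1 mulr1.
    apply: cvgM; first exact: cvg_cst.
    apply: cvgV; first by rewrite oner_neq0.
    by move: c1; rewrite mul0r addr0.
  - apply: (@cvg_eq _ _ _ _ ((1 + 0) * ln 2)); last by rewrite addr0 mul1r.
    by apply: cvgM; last exact: cvg_cst; apply: cvgD => //; exact: cvg_cst.
have lz : ln (z n * (1 - q (s n))) @[n --> \oo] --> ln (ln 2).
  by apply: (cvg_comp (fun n => z n * (1 - q (s n))) (@ln R) zw); exact: continuous_ln.
apply: (cvg_unique _ _ lz) => //.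
apply: (@cvg_eq _ _ _ _ (0 + l)); last exact: add0r.
rewrite (_ : (fun n => _) = (fun n => target n + l)); last first.
  apply/funext => n; rewrite /target subrK lnM ?posrE //; have [z0 _ _] := Hz n => //.
by apply: cvgD => //; exact: cvg_cst.
Unshelve. all: by end_near.
Qed.

Definition prime_sieve (n : nat) : R := \prod_(p < n.+1 | prime p) (1 - p%:R^-1).

Lemma prime_sieve_gt0 n : 0 < prime_sieve n.
Proof.
by apply: prodr_gt0 => p pp; rewrite subr_gt0 invf_lt1 ?ltr1n ?ltr0n ?prime_gt1 ?prime_gt0.
Qed.

Lemma prime_sieve_mono m n : (m <= n)%N -> prime_sieve n <= prime_sieve m.
Proof.
move=> /subnK <-; elim: (n - m)%N => [|k IH] //; apply: le_trans IH; rewrite addSn.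
rewrite {1}/prime_sieve big_mkcond big_ord_recr -big_mkcond /= -/(prime_sieve (k + m)).
by rewrite ler_piMr ?(ltW (prime_sieve_gt0 _)) //; case: ifP => // _; rewrite gerBl invr_ge0.
Qed.

(** The product up to 2^K is exp(-T) times exp(-(1 + 1/2 + ... + 1/(K - 1))): the harmonic sum of
    the block numbers brings in Euler's constant, and the limit ln (ln 2) of T cancels the factor ln
    2. *)
Lemma prime_sieve_dyadic : prime_sieve (2 ^ K) * (K%:R * ln 2) @[K --> \oo] --> expR (- euler_gamma R).
Proof.
rewrite -(cvg_shiftS (fun K => prime_sieve (2 ^ K) * (K%:R * ln 2))).
have E K : prime_sieve (2 ^ K.+1) * (K.+1%:R * ln 2) =
   expR (- T K.+1) * expR (- (series harmonic K.+1 - ln K.+1%:R)) * expR (K.+1%:R^-1) * ln 2.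
  have k0 : (0 : R) < K.+1%:R by [].
  rewrite -[K.+1%:R in LHS](lnK (_ : K.+1%:R \in Num.pos)) ?posrE // mulrA; congr (_ * _).
  rewrite -[prime_sieve _]lnK ?posrE ?prime_sieve_gt0 // -!expRD; congr expR.
  rewrite /prime_sieve ln_prod; last by move=> p pp; rewrite subr_gt0 invf_lt1 ?ltr1n ?ltr0n ?prime_gt1 ?prime_gt0.
  have -> : \sum_(i < (2 ^ K.+1).+1 | prime i) ln (1 - i%:R^-1) = - \sum_(k < K.+1) beta k :> R.
    by rewrite /beta dyad_sum /log_factor sumrN opprK.
  have -> : series harmonic K.+1 = \sum_(k < K.+1) k%:R^-1 + K.+1%:R^-1 :> R.
    by rewrite /series /= big_mkord -[RHS](big_ord_recr K.+1 (fun k => k%:R^-1 : R)) [RHS]big_ord_recl /= invr0 add0r.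
  rewrite /T /c big_split /= sumrN; ring.
under eq_fun do rewrite E.
have -> : expR (- euler_gamma R) = expR (- ln (ln 2)) * expR (- euler_gamma R) * expR 0 * ln 2 :> R.
  by rewrite expR0 mulr1 mulrAC [expR (- ln _)]expRN lnK ?posrE // mulVf ?gt_eqF // mul1r.
have ce (u : nat -> R) a : u n @[n --> \oo] --> a -> expR (u n) @[n --> \oo] --> expR a.
  by move=> ua; apply: (cvg_comp u (@expR R) ua); exact: continuous_expR.
apply: cvgM; last exact: cvg_cst; apply: cvgM; last by apply: ce; exact: cvg_harmonic.
apply: cvgM; apply: ce; apply: cvgN; first by rewrite (cvg_shiftS T); exact: mertens_constant.
rewrite (cvg_shiftS (fun K => series harmonic K - ln K%:R : R)); exact: cvg_euler_gamma.
Qed.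

(** Between consecutive powers of 2 both the product and ln x are monotone, which costs only a
    factor (K + 1) / K tending to 1. *)
Theorem mertens : prime_sieve (Num.truncn x) * ln x @[x --> +oo] --> expR (- euler_gamma R).
Proof.
pose K (x : R) := trunc_log 2 (Num.truncn x).
have cK : K x @[x --> +oo] --> \oo.
  move=> S [A _ SA]; exists (2 ^ A)%N%:R; split; first exact: num_real.
  move=> x Ax; apply: SA => /=; rewrite /K; apply: trunc_log_max => //.
  by rewrite truncn_ge_nat ?(ltW Ax) // (le_trans _ (ltW Ax)).
have cS := prime_sieve_dyadic.
have r1 : (K.+1%:R / K%:R : R) @[K --> \oo] --> (1 : R).
  rewrite -(cvg_shiftS (fun K => K.+1%:R / K%:R : R)).
  have -> : (fun n => n.+2%:R / n.+1%:R) = (fun n => 1 + harmonic n : R).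
    by apply/funext => n; rewrite /harmonic /= -[n.+2%:R]natr1 mulrDl mulfV ?pnatr_eq0 // mul1r.
  apply: (@cvg_eq _ _ _ _ (1 + 0)); last exact: addr0.
  apply: cvgD; [exact: cvg_cst|exact: cvg_harmonic].
have up : prime_sieve (2 ^ K) * (K.+1%:R * ln 2) @[K --> \oo] --> expR (- euler_gamma R).
  have h : prime_sieve (2 ^ k) * (k%:R * ln 2) * (k.+1%:R / k%:R) @[k --> \oo] --> expR (- euler_gamma R).
    by apply: (@cvg_eq _ _ _ _ (expR (- euler_gamma R) * 1)); [exact: cvgM|exact: mulr1].
  apply: (cvg_near_eq _ h).
  near=> k; have k0 : (0 < k)%N by near: k; exact: nbhs_infty_gt.
  have k1 : (k%:R : R) != 0 by rewrite pnatr_eq0 -lt0n.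
  move: (k%:R : R) (k.+1%:R : R) k1 => a b a0; field.
  by [].
have lo : prime_sieve (2 ^ K.+1) * (K%:R * ln 2) @[K --> \oo] --> expR (- euler_gamma R).
  have cS1 : prime_sieve (2 ^ k.+1) * (k.+1%:R * ln 2) @[k --> \oo] --> expR (- euler_gamma R).
    by rewrite (cvg_shiftS (fun K => prime_sieve (2 ^ K) * (K%:R * ln 2))).
  have h : prime_sieve (2 ^ k.+1) * (k.+1%:R * ln 2) * (k.+1%:R / k%:R)^-1 @[k --> \oo] --> expR (- euler_gamma R).
    apply: (@cvg_eq _ _ _ _ (expR (- euler_gamma R) * 1^-1)); last by rewrite invr1 mulr1.
    by apply: cvgM => //; apply: cvgV => //; exact: oner_neq0.
  apply: (cvg_near_eq _ h).
  near=> k.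
  have k1 : (k.+1%:R : R) != 0 by rewrite pnatr_eq0.
  rewrite invf_div; move: (k%:R : R) (k.+1%:R : R) k1 => a b a0; field.
  by [].
apply: (@squeeze_cvgr _ _ _ _ (fun x => prime_sieve (2 ^ (K x).+1) * ((K x)%:R * ln 2)) (fun x => prime_sieve (2 ^ K x) * ((K x).+1%:R * ln 2))).
- near=> x; have x1 : 1 <= x by near: x; exact: nbhs_pinfty_ge.
  have n0 : (0 < Num.truncn x)%N by rewrite truncn_gt0.
  have x0 : 0 <= x by rewrite (le_trans ler01).
  have /andP[t1 t2] := truncn_itv x0.
  have /andP[k1 k2] := trunc_log_bounds (isT : (1 < 2)%N) n0.
  have lX j : j%:R * ln 2 = ln (2 ^ j)%N%:R :> R by rewrite natrX lnXn // mulr_natl.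
  have l1 : (K x)%:R * ln 2 <= ln x.
    rewrite lX ler_ln ?posrE ?ltr0n ?expn_gt0 ?(lt_le_trans ltr01) //.
    by apply: le_trans t1; rewrite ler_nat.
  have l3 : ln x <= (K x).+1%:R * ln 2.
    rewrite lX ler_ln ?posrE ?ltr0n ?expn_gt0 ?(lt_le_trans ltr01) //.
    by apply: le_trans (ltW t2) _; rewrite ler_nat.
  apply/andP; split; apply: ler_pM; rewrite ?(ltW (prime_sieve_gt0 _)) ?mulr_ge0 ?(ltW l2) ?ln_ge0 //.
    by apply: prime_sieve_mono; exact: ltnW.
  exact: prime_sieve_mono.
- exact: (cvg_comp K _ cK lo).
- exact: (cvg_comp K _ cK up).
Unshelve. all: by end_near.
Qed.

End Mertens.

(** * Counting odd square-free integers *)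

Section SetExpansion.
Context (R : realType).

(** Such sets index the terms when a product over the primes below B is expanded. *)
Definition prime_sets (B : nat) : pred {set 'I_B} := fun J => [forall p in J, prime p].

Lemma prod_one_sub (B : nat) (g : nat -> R) :
  \prod_(p < B | prime p) (1 - g p) = \sum_(J : {set 'I_B} | prime_sets J) (-1) ^+ #|J| * \prod_(p in J) g p.
Proof.
rewrite big_mkcond (eq_bigr (fun p : 'I_B => (if prime p then - g p else 0) + 1)); last first.
  by move=> p _; case: ifP => _; rewrite ?add0r // addrC.
rewrite bigA_distr [RHS]big_mkcond; apply: eq_bigr => J _.
rewrite -big_mkcond /=; case: ifP => [/forall_inP H|/negbT].
  rewrite -prodrN; apply: eq_bigr => p pJ; by rewrite H.
rewrite negb_forall_in => /exists_inP[p pJ pp].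
by rewrite (bigD1 p) //= (negbTE pp) mul0r.
Qed.

Lemma prod_one_add (B : nat) (g : nat -> R) :
  \prod_(p < B | prime p) (1 + g p) = \sum_(J : {set 'I_B} | prime_sets J) \prod_(p in J) g p.
Proof.
have := prod_one_sub B (fun p => - g p).
under eq_bigr => p _ do rewrite opprK.
move=> ->; apply: eq_bigr => J _.
by rewrite prodrN mulrA -exprMn mulrNN mulr1 expr1n mul1r.
Qed.

End SetExpansion.

Lemma coprime_prod_dvd (I : finType) (P : pred I) (F : I -> nat) n :
  (forall i j, P i -> P j -> i != j -> coprime (F i) (F j)) -> (forall i, P i -> (F i %| n)%N) ->
  (\prod_(i | P i) F i %| n)%N.
Proof.
move=> cop dv; suff : forall s : seq I, uniq s -> (\prod_(p <- s | P p) F p %| n)%N.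
  by apply; exact: index_enum_uniq.
elim=> [|p s IH] /=; first by rewrite big_nil dvd1n.
move=> /andP[ps us]; rewrite big_cons; case: ifP => Pp; last exact: IH.
rewrite Gauss_dvd; first by rewrite dv // IH.
rewrite big_seq_cond; elim/big_ind: _ => [|x y|q /andP[qs Pq]]; rewrite ?coprimen1 //.
  by move=> hx hy; rewrite coprimeMr hx.
by apply: cop => //; apply: contraNneq ps => ->.
Qed.

Section Sieve.
Context (R : realType).

(* d is square-free and prime to M exactly when no sieve_mod M p divides d. *)
Definition sieve_mod (M p : nat) : nat := if (p %| M)%N then p else (p ^ 2)%N.

Lemma sieve_mod_gt0 M p : prime p -> (0 < sieve_mod M p)%N.
Proof. by move=> pp; rewrite /sieve_mod; case: ifP; rewrite ?expn_gt0 prime_gt0. Qed.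

Lemma sieve_mod_coprime M p q : prime p -> prime q -> p != q -> coprime (sieve_mod M p) (sieve_mod M q).
Proof.
move=> pp qp ne; have c : coprime p q by rewrite prime_coprime // dvdn_prime2.
by rewrite /sieve_mod; do 2 case: ifP => _; rewrite ?coprimeXl ?coprimeXr.
Qed.

Definition sieve_prod (B M : nat) (J : {set 'I_B}) : nat := \prod_(p in J) sieve_mod M p.

Lemma sieve_prod_gt0 B M (J : {set 'I_B}) : prime_sets J -> (0 < sieve_prod M J)%N.
Proof.
by move=> /forall_inP H; apply: prodn_cond_gt0 => p /H; exact: sieve_mod_gt0.
Qed.

Lemma sieve_prod_dvd B M (J : {set 'I_B}) d : prime_sets J ->
  \prod_(p in J) (sieve_mod M p %| d)%:R = (sieve_prod M J %| d)%:R :> R.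
Proof.
move=> /forall_inP H.
have -> : \prod_(p in J) (sieve_mod M p %| d)%:R = [forall p in J, sieve_mod M p %| d]%N%:R :> R.
  case: (boolP [forall p in J, _]) => [/forall_inP h|]; first by rewrite big1 // => p /h ->.
  by rewrite negb_forall_in => /exists_inP[p pJ /negbTE h]; rewrite (bigD1 p) //= h mul0r.
congr (_%:R); congr nat_of_bool; apply/forall_inP/idP => [h|h p pJ]; last first.
  by apply: dvdn_trans h; rewrite /sieve_prod (bigD1 p) //= dvdn_mulr.
apply: coprime_prod_dvd => [p q pJ qJ ne|]; last exact: h.
by apply: sieve_mod_coprime; rewrite ?H.
Qed.

(** The condition d < B guarantees that a prime violating square-freeness or coprimality occurs in
    the product and annihilates it. *)
Lemma sieve_indicator M d B : (0 < d < B)%N ->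
  (squarefree d && coprime d M)%:R = \prod_(p < B | prime p) (1 - (sieve_mod M p %| d)%:R) :> R.
Proof.
case/andP => d0 dB; case: (boolP (squarefree d && coprime d M)) => [/andP[sf cop]|].
  rewrite big1 // => p pp; have -> : (sieve_mod M p %| d)%N = false; last by rewrite subr0.
  apply/negP; rewrite /sieve_mod; case: ifP => pM pd.
    have : (p %| gcdn d M)%N by rewrite dvdn_gcd pd.
    by rewrite (eqP cop) dvdn1 => /eqP p1; rewrite p1 in pp.
  by have p1 := elimT (squarefreeP d0) sf _ pd; rewrite p1 in pp.
have key p : prime p -> (p %| d)%N -> ((p ^ 2 %| d)%N || (p %| M)%N) ->
    \prod_(q < B | prime q) (1 - (sieve_mod M q %| d)%:R) = 0 :> R.
  move=> pp pd h; have pB : (p < B)%N by apply: leq_ltn_trans (dvdn_leq d0 pd) dB.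
  rewrite (bigD1 (Ordinal pB)) //= /sieve_mod; case: ifP h => pM h; rewrite ?pd ?orbF /= in h *; rewrite ?h subrr mul0r //.
rewrite negb_and => /orP[/negP nsf|ncop].
  have [e ed e1] : exists2 e, (e ^ 2 %| d)%N & e <> 1%N.
    apply: contrapT => H; apply: nsf; apply/(squarefreeP d0) => e ed.
    by apply: contrapT => e1; apply: H; exists e.
  have e0 : (0 < e)%N by case: (e) ed => //; rewrite exp0n // dvd0n => /eqP h; rewrite h in d0.
  have pe : prime (pdiv e) by apply: pdiv_prime; case: (e) e0 e1 => [|[|]].
  have pd2 : (pdiv e ^ 2 %| d)%N by apply: dvdn_trans ed; rewrite dvdn_exp2r // pdiv_dvd.
  by rewrite (key _ pe) ?pd2 //; apply: dvdn_trans pd2; rewrite -mulnn dvdn_mulr.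
have g1 : (1 < gcdn d M)%N by rewrite ltn_neqAle eq_sym ncop gcdn_gt0 d0.
have pg := pdiv_dvd (gcdn d M); have pp := pdiv_prime g1.
rewrite (key _ pp) //; first exact: dvdn_trans pg (dvdn_gcdl _ _).
by apply/orP; right; exact: dvdn_trans pg (dvdn_gcdr _ _).
Qed.

Lemma sieve_sum M (F : nat -> R) Y B : (Y <= B)%N ->
  \sum_(1 <= d < Y | squarefree d && coprime d M) F d =
  \sum_(J : {set 'I_B} | prime_sets J) (-1) ^+ #|J| * \sum_(1 <= d < Y | (sieve_prod M J %| d)%N) F d.
Proof.
move=> YB; rewrite (eq_bigr (fun J : {set 'I_B} => \sum_(1 <= d < Y) (-1) ^+ #|J| * (sieve_prod M J %| d)%:R * F d)); last first.
  move=> J _; rewrite mulr_sumr big_mkcond; apply: eq_bigr => d _.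
  by case: (_ %| d)%N; rewrite ?mulr1 ?mulr0 ?mul0r.
rewrite exchange_big /= big_mkcond big_nat [RHS]big_nat; apply: eq_bigr => d /andP[d1 dY].
rewrite -mulr_suml; have := @sieve_indicator M d B; rewrite d1 (leq_trans dY) // => /(_ isT).
rewrite (prod_one_sub B (fun p => (sieve_mod M p %| d)%:R)) (eq_bigr (fun J : {set 'I_B} => (-1) ^+ #|J| * (sieve_prod M J %| d)%:R)); last first.
  by move=> J HJ; rewrite sieve_prod_dvd.
by move=> <-; case: (_ && _); rewrite ?mul1r ?mul0r.
Qed.

Lemma powR_expR (x r : R) : 0 < x -> x `^ r = expR (r * ln x).
Proof. by move=> x0; rewrite /powR gt_eqF. Qed.

Lemma min_le_powR (x a b : R) : 0 < a -> 0 < b -> x <= a -> x <= b -> x <= a `^ (2 / 5) * b `^ (3 / 5).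
Proof.
move=> a0 b0 xa xb; have [x0|x0] := leP x 0.
  by apply: le_trans x0 _; rewrite mulr_ge0 ?powR_ge0.
have -> : x = x `^ (2 / 5) * x `^ (3 / 5).
  rewrite -powRD ?gt_eqF ?implybT // (_ : 2 / 5 + 3 / 5 = 1 :> R) ?powRr1 ?ltW //; lra.
have h (y : R) : x <= y -> 0 < y -> forall r, 0 <= r -> x `^ r <= y `^ r.
  by move=> xy y0 r r0; apply: ge0_ler_powR => //; rewrite nnegrE ltW.
by apply: ler_pM; rewrite ?powR_ge0 //; apply: h => //; lra.
Qed.

(** Inclusion-exclusion over all sets of primes below B. The error at the modulus E is at most A and
    at most Y / E, hence at most A^(2/5) (Y / E)^(3/5); the power 3/5 > 1/2 makes the sum over the
    moduli p^2 converge, while Y only enters to the power 3/5. *)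
Lemma sieve_estimate M (F : nat -> R) (A Mn : R) Y : (0 < Y)%N -> 0 < A ->
  (forall E, (0 < E)%N -> `|\sum_(1 <= d < Y | (E %| d)%N) F d - Mn / E%:R| <= A) ->
  (forall E, (0 < E)%N -> `|\sum_(1 <= d < Y | (E %| d)%N) F d - Mn / E%:R| <= Y%:R / E%:R) ->
  forall B, (Y <= B)%N ->
  `|\sum_(1 <= d < Y | squarefree d && coprime d M) F d - Mn * \prod_(p < B | prime p) (1 - (sieve_mod M p)%:R^-1)| <=
   A `^ (2 / 5) * Y%:R `^ (3 / 5) * \prod_(p < B | prime p) (1 + (sieve_mod M p)%:R `^ (- (3 / 5))).
Proof.
move=> Y0 A0 H1 H2 B YB; rewrite (sieve_sum M F YB).
rewrite (prod_one_sub B (fun p => (sieve_mod M p)%:R^-1)) (prod_one_add B (fun p => (sieve_mod M p)%:R `^ (- (3 / 5)))) !mulr_sumr -sumrB.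
apply: le_trans (ler_norm_sum _ _ _) _; apply: ler_sum => J HJ.
have E0 := sieve_prod_gt0 M HJ.
have -> : \prod_(p in J) (sieve_mod M p)%:R^-1 = (sieve_prod M J)%:R^-1 :> R.
  by rewrite /sieve_prod natr_prod prodfV.
have -> : \prod_(p in J) (sieve_mod M p)%:R `^ (- (3 / 5)) = (sieve_prod M J)%:R `^ (- (3 / 5)) :> R.
  rewrite /sieve_prod; elim/big_rec2: _ => [|p y1 y2 pJ ->]; first by rewrite powR1.
  by rewrite natrM powRM.
rewrite mulrCA -mulrBr normrM normrX normrN1 expr1n mul1r.
have -> : A `^ (2 / 5) * Y%:R `^ (3 / 5) * (sieve_prod M J)%:R `^ (- (3 / 5)) =
   A `^ (2 / 5) * (Y%:R / (sieve_prod M J)%:R) `^ (3 / 5) :> R.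
  rewrite -mulrA; congr (_ * _).
  by rewrite !powR_expR ?divr_gt0 ?ltr0n // ln_div ?posrE ?ltr0n // -expRD; congr expR; ring.
by apply: min_le_powR; rewrite ?divr_gt0 ?ltr0n //; [exact: H1|exact: H2].
Qed.

Lemma prod_inv_powR_le (s : R) B (P : pred nat) : 0 < s ->
  \prod_(p < B | prime p && P p) (1 + p%:R `^ (- (1 + s))) <= expR (s^-1).
Proof.
move=> s0; apply: (@le_trans _ _ (\prod_(p < B | prime p && P p) expR (p%:R `^ (- (1 + s))))).
  by apply: ler_prod => p _; rewrite addr_ge0 ?powR_ge0 //= expR_ge1Dx.
rewrite -expR_sum ler_expR.
have := @zeta_tail R s s0 1 B isT; rewrite ln1 mulr0 oppr0 expR0 mulr1; apply: le_trans.
rewrite -(big_mkord (fun p => prime p && P p) (fun p => p%:R `^ (- (1 + s)))) big_mkcond.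
have -> : \sum_(2 <= n < B.+1) expR (- (s * ln n%:R)) / n%:R = \sum_(2 <= n < B.+1) n%:R `^ (- (1 + s)) :> R.
  rewrite big_nat [RHS]big_nat; apply: eq_bigr => n /andP[n2 _].
  have n0 : (0 : R) < n%:R by rewrite ltr0n (leq_trans _ n2).
  by rewrite powR_expR // -[X in _ / X]lnK ?posrE // -expRN -expRD; congr expR; ring.
case: B => [|[|B]]; first by rewrite big_geq // sumr_ge0 // => n _; exact: powR_ge0.
  by rewrite big_nat1 /= sumr_ge0 // => n _; exact: powR_ge0.
rewrite big_ltn // big_ltn //= !add0r [leRHS]big_nat_recr //= -[leLHS]addr0; apply: lerD; last exact: powR_ge0.
by apply: ler_sum => p _; case: ifP => // _; exact: powR_ge0.
Qed.

Lemma prod_dvd_two_le M B : (0 < M)%N -> \prod_(p < B | prime p && (p %| M)%N) (2 : R) <= M%:R.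
Proof.
move=> M0; apply: (@le_trans _ _ (\prod_(p < B | prime p && (p %| M)%N) p%:R)).
  by apply: ler_prod => p /andP[pp _]; rewrite ler0n ler_nat prime_gt1.
rewrite -natr_prod ler_nat; apply: dvdn_leq => //.
apply: coprime_prod_dvd => [p q /andP[pp _] /andP[qp _] ne|p /andP[] //].
by rewrite prime_coprime // dvdn_prime2.
Qed.

(** For p not dividing M the modulus p^2 gives p^(-(1 + 1/5)), whence the constant exp 5; a prime p
    dividing M costs a factor at most 2 <= p. *)
Lemma sieve_error_le : exists2 C : R, 0 < C & forall M B, (0 < M)%N ->
  \prod_(p < B | prime p) (1 + (sieve_mod M p)%:R `^ (- (3 / 5))) <= C * M%:R :> R.
Proof.
exists (expR 5) => [|M B M0]; first exact: expR_gt0.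
rewrite (bigID (fun p : 'I_B => (p %| M)%N)) /= mulrC; apply: ler_pM.
- by apply: prodr_ge0 => p _; rewrite addr_ge0 ?powR_ge0.
- by apply: prodr_ge0 => p _; rewrite addr_ge0 ?powR_ge0.
- have := @prod_inv_powR_le 5^-1 B (fun p => ~~ (p %| M)%N); rewrite invr_gt0 invrK ltr0n => /(_ isT).
  apply: le_trans; apply: ler_prod => p /andP[pp npM].
  rewrite addr_ge0 ?powR_ge0 //= /sieve_mod (negbTE npM) natrX lerD2l.
  rewrite -powR_mulrn // -powRrM (_ : 2%:R * - (3 / 5) = - (1 + 5^-1) :> R) //; lra.
- apply: le_trans (prod_dvd_two_le B M0); apply: ler_prod => p /andP[pp pM].
  rewrite addr_ge0 ?powR_ge0 //= /sieve_mod pM (natrD _ 1 1) lerD2l.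
  rewrite powR_expR ?ltr0n ?prime_gt0 // expR_le1 mulNr oppr_le0 mulr_ge0 ?ln_nat_ge0 //; lra.
Qed.

Definition sieve_density B M : R := \prod_(p < B | prime p) (1 - (sieve_mod M p)%:R^-1).

(** The density of the odd square-free integers, that is, 4 / pi^2. *)
Definition flat_density : R := limn (fun B => sieve_density B 2).

Lemma sieve_density_le B M : sieve_density B.+1 M <= sieve_density B M.
Proof.
rewrite /sieve_density big_mkcond big_ord_recr -big_mkcond /= ler_piMr //.
  apply: prodr_ge0 => p pp; rewrite subr_ge0 invf_le1 ?ltr0n ?sieve_mod_gt0 // ler1n.
  exact: sieve_mod_gt0.
by case: ifP => // _; rewrite gerBl invr_ge0.
Qed.

(** Telescoping: (1 + 1/n) (1 - 1/(n + 1)^2) = 1 + 1/(n + 1), so that replacing the odd primes by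
    all integers from 3 on keeps a positive lower bound. *)
Lemma sieve_density_ge B : 3^-1 <= sieve_density B 2.
Proof.
suff H n : 3^-1 * (1 + n.+2%:R^-1) <= sieve_density n.+3 2.
  have h1 : sieve_density B.+3 2 <= sieve_density B 2 by do 3 apply: le_trans (sieve_density_le _ _) _.
  by apply: le_trans h1; apply: le_trans (H B); rewrite ler_peMr // lerDl invr_ge0.
elim: n => [|n IH].
  rewrite /sieve_density big_mkcond !big_ord_recl big_ord0 /= /bump /= /sieve_mod /= !mul1r mulr1.
  by rewrite (_ : 1 + 1 = 2)%N //; lra.
rewrite /sieve_density big_mkcond big_ord_recr -big_mkcond /= -/(sieve_density n.+3 2).
have x0 : (2 : R) <= n.+2%:R by rewrite ler_nat.
have e : 1 + n.+3%:R^-1 = (1 + n.+2%:R^-1) * (1 - (n.+3%:R ^+ 2)^-1) :> R.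
  by rewrite -[n.+3%:R]natr1; move: (n.+2%:R : R) x0 => x x0; field; lra.
rewrite e mulrA; apply: ler_pM => //.
  by rewrite subr_ge0 invf_le1 ?exprn_gt0 // exprn_ege1 // ler1n.
case: ifP => pp; last by rewrite gerBl invr_ge0 exprn_ge0.
by rewrite /sieve_mod dvdn_prime2 //= natrX.
Qed.

Lemma flat_density_cvg : sieve_density B 2 @[B --> \oo] --> flat_density.
Proof.
apply: nonincreasing_is_cvgn; first by apply/nonincreasing_seqP => n; exact: sieve_density_le.
by exists 3^-1 => _ [n _ <-]; exact: sieve_density_ge.
Qed.

Lemma flat_density_gt0 : 0 < flat_density.
Proof. by apply: lt_le_trans (cvgn_ge flat_density_cvg sieve_density_ge). Qed.

(** p / (p + 1) = (1 - 1/p) / (1 - 1/p^2) is the probability that an odd square-free d is prime to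
    p. The prime 2 is left out since d is odd. *)
Definition coprime_weight (m : nat) : R := \prod_(p < m.+1 | prime p && (odd p && (p %| m)%N)) (p%:R / (p%:R + 1)).

Lemma coprime_weight_ext m B : (0 < m < B)%N ->
  coprime_weight m = \prod_(p < B | prime p && (odd p && (p %| m)%N)) (p%:R / (p%:R + 1)).
Proof.
case/andP=> m0 mB; rewrite /coprime_weight.
rewrite -!(big_mkord (fun p => prime p && (odd p && (p %| m)%N)) (fun p => p%:R / (p%:R + 1) : R)).
rewrite [RHS](@big_cat_nat _ _ _ m.+1) //= [X in _ = _ * X]big_nat_cond [X in _ = _ * X]big1 ?mulr1 //.
move=> p /andP[/andP[mp _] /and3P[_ _ pm]]; have := dvdn_leq m0 pm; rewrite leqNgt mp //.
Qed.

Lemma coprime_weight_itv m : 0 <= coprime_weight m <= 1.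
Proof.
apply/andP; split; first by apply: prodr_ge0 => p _; rewrite divr_ge0 // addr_ge0.
rewrite /coprime_weight; apply: (@le_trans _ _ (\prod_(p < m.+1 | prime p && (odd p && (p %| m)%N)) 1)); last by rewrite big1_eq.
apply: ler_prod => p _; rewrite divr_ge0 ?addr_ge0 //= ler_pdivrMr ?ltr_wpDl // mul1r lerDl //.
Qed.

Lemma sieve_density_weight m B : (0 < m < B)%N -> sieve_density B (2 * m) = sieve_density B 2 * coprime_weight m.
Proof.
move=> mB; rewrite (coprime_weight_ext mB) big_mkcondr /sieve_density -big_split /=.
apply: eq_bigr => p pp; have p0 : (0 : R) < p%:R by rewrite ltr0n prime_gt0.
rewrite /sieve_mod Euclid_dvdM // dvdn_prime2 //; case: (even_prime pp) => [->|op] //=.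
  by rewrite mulr1.
rewrite op (_ : (p == 2 :> nat) = false) /=; last by apply/negbTE; apply: contraTneq op => ->.
case: ifP => _; last by rewrite mulr1.
by rewrite natrX; move: (p%:R : R) p0 => x x0; field; lra.
Qed.

Definition flat (d : nat) : bool := odd d && squarefree d.

Lemma flatE m d : squarefree d && coprime d (2 * m) = flat d && coprime d m.
Proof. by rewrite coprimeMr coprimen2 /flat andbA [squarefree d && _]andbC. Qed.

Lemma flat_count : exists2 C : R, 0 < C & forall m Y, (0 < m)%N ->
  `|\sum_(1 <= d < Y | flat d && coprime d m) 1 - flat_density * coprime_weight m * Y%:R| <= C * (Y%:R `^ (3 / 5) * m%:R).
Proof.
have [C C0 H] := sieve_error_le; exists (C * 2) => [|m Y m0]; first by rewrite mulr_gt0.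
case: Y => [|Y]; first by rewrite big_geq // mulr0 subrr normr0 !mulr_ge0 ?powR_ge0 ?(ltW C0).
set S := \sum_(1 <= d < _ | _) _.
have step B : `|S - sieve_density (B + (maxn Y m).+1) 2 * coprime_weight m * Y.+1%:R| <= C * 2 * (Y.+1%:R `^ (3 / 5) * m%:R).
  have mB : (0 < m < B + (maxn Y m).+1)%N by rewrite m0; lia.
  have m20 : (0 < 2 * m)%N by rewrite muln_gt0.
  rewrite -sieve_density_weight // mulrC.
  have -> : S = \sum_(1 <= d < Y.+1 | squarefree d && coprime d (2 * m)) 1 by apply: eq_bigl => d; rewrite flatE.
  have cnt E : (0 < E)%N -> \sum_(1 <= d < Y.+1 | (E %| d)%N) 1 = (Y %/ E)%:R :> R.
    move=> E0; under eq_bigl => d do rewrite -[(E %| d)%N]andbT.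
    by rewrite (sum_multiples _ (fun=> true)) // sumr_const_nat subn1.
  have lo E : (0 < E)%N -> (Y %/ E)%:R <= Y.+1%:R / E%:R :> R.
    by move=> E0; rewrite ler_pdivlMr ?ltr0n // -natrM ler_nat; apply: leq_trans (leq_trunc_div _ _) _.
  have hi E : (0 < E)%N -> Y.+1%:R / E%:R <= (Y %/ E)%:R + 1 :> R.
    by move=> E0; rewrite ler_pdivrMr ?ltr0n // natr1 -natrM ler_nat; exact: ltn_ceil.
  have YB : (Y.+1 <= B + (maxn Y m).+1)%N by lia.
  apply: le_trans (@sieve_estimate (2 * m) (fun=> 1) 1 Y.+1%:R Y.+1 isT ltr01 _ _ _ YB) _.
  - move=> E E0; rewrite (cnt _ E0) ler_norml; have := lo E E0; have := hi E E0; lra.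
  - move=> E E0; rewrite (cnt _ E0) ler_norml; have := lo E E0; have := hi E E0.
    have : 0 <= (Y %/ E)%:R :> R by []. 
    lra.
  rewrite powR1 mul1r mulrC; apply: le_trans (ler_wpM2r (powR_ge0 _ _) (H _ _ m20)) _.
  rewrite natrM le_eqVlt; apply/orP; left; apply/eqP; ring.
have c1 : `|S - sieve_density (B + (maxn Y m).+1) 2 * coprime_weight m * Y.+1%:R| @[B --> \oo] -->
    `|S - flat_density * coprime_weight m * Y.+1%:R|.
  apply: cvg_norm; apply: cvgB; first exact: cvg_cst.
  apply: cvgM; last exact: cvg_cst; apply: cvgM; last exact: cvg_cst.
  by rewrite (cvg_shiftn (maxn Y m).+1 (fun B => sieve_density B 2)); exact: flat_density_cvg.
exact: (cvgn_le c1 step).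
Qed.

Lemma cut_homo (u : R) d d' n : 0 <= u -> (d <= d')%N -> cut u d n -> cut u d' n.
Proof. by move=> u0 /subnK <-; elim: (d' - d)%N => [|k IH] // /IH; exact: (@cut_mono R). Qed.

(** The sieve with main term 0. On the multiples E k of E the cut is still monotone in k, and the
    character is [kronecker k m] up to a factor of modulus at most 1, so the Polya-Vinogradov bound
    is uniform in E. *)
Lemma flat_sum_nonsquare : exists2 C : R, 0 < C & forall (u : R) m n Y, 0 <= u -> odd m -> ~~ is_square m ->
  `|\sum_(1 <= d < Y | flat d && cut u d n) (chi8 d m)%:~R| <=
   C * (Num.sqrt m%:R * (1 + ln m%:R)) `^ (2 / 5) * Y%:R `^ (3 / 5) :> R.
Proof.
have [C C0 H] := sieve_error_le; exists (C * 2 * 4 `^ (2 / 5)) => [|u m n Y u0 om nsq].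
  by rewrite !mulr_gt0 ?powR_gt0.
case: Y => [|Y]; first by rewrite big_geq // normr0 !mulr_ge0 ?powR_ge0 ?(ltW C0).
have m0 := odd_gt0 om.
pose A : R := Num.sqrt m%:R * (1 + ln m%:R).
have A0 : 0 < A by rewrite mulr_gt0 ?sqrtr_gt0 ?ltr0n // ltr_wpDr // ln_nat_ge0.
pose F d : R := if cut u d n then (chi8 d m)%:~R else 0.
have -> : \sum_(1 <= d < Y.+1 | flat d && cut u d n) (chi8 d m)%:~R = \sum_(1 <= d < Y.+1 | squarefree d && coprime d 2) F d.
  rewrite big_mkcondr; apply: eq_bigl => d; by rewrite -[2%N]muln1 flatE coprimen1 andbT.
have F1 d : `|F d| <= 1 by rewrite /F; case: ifP => _; rewrite ?normr0 // kronecker_norm.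
have E1 E : (0 < E)%N -> `|\sum_(1 <= d < Y.+1 | (E %| d)%N) F d| <= 4 * A.
  move=> E0; under eq_bigl => d do rewrite -[(E %| d)%N]andbT.
  rewrite (sum_multiples _ (fun=> true)) //.
  have -> : \sum_(1 <= k < (Y %/ E).+1) F (E * k)%N =
     (chi8 1 m * kronecker E%:Z m)%:~R * \sum_(k < (Y %/ E).+1 | cut u (E * k) n) (kronecker k%:Z m)%:~R.
    rewrite mulr_sumr -(big_mkord (fun k => cut u (E * k) n) (fun k => (chi8 1 m * kronecker E%:Z m)%:~R * (kronecker k%:Z m)%:~R)).
    rewrite [RHS]big_ltn_cond //= muln0 (_ : cut u 0 n = false); last first.
      by rewrite /cut sqrtr0 mulr0 lern0; case: (n).
    rewrite [RHS]big_mkcond; apply: eq_bigr => k _; rewrite /F; case: ifP => // _.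
    by rewrite chi8_twist // kronecker_topM // -intrM mulrA.
  rewrite normrM; apply: le_trans (ler_piMl (normr_ge0 _) _) _.
    by rewrite intrM normrM mulr_ile1 ?normr_ge0 ?kronecker_norm.
  rewrite (_ : 4 * A = 2 * (2 * Num.sqrt m%:R * (1 + ln m%:R))); last by rewrite /A; ring.
  apply: (upper_sum_bound (f := fun d => (kronecker d%:Z m)%:~R) (P := fun k => cut u (E * k) n)).
    by move=> Z _; exact: kronecker_sum_bound.
  by move=> k; apply: cut_homo => //; rewrite leq_mul.
have E2 E : (0 < E)%N -> `|\sum_(1 <= d < Y.+1 | (E %| d)%N) F d| <= Y.+1%:R / E%:R.
  move=> E0; apply: le_trans (ler_norm_sum _ _ _) _.
  apply: (@le_trans _ _ (\sum_(1 <= d < Y.+1 | (E %| d)%N) 1)); first by apply: ler_sum => d _.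
  under eq_bigl => d do rewrite -[(E %| d)%N]andbT.
  rewrite (sum_multiples _ (fun=> true)) // sumr_const_nat subn1 /=.
  by rewrite ler_pdivlMr ?ltr0n // -natrM ler_nat; apply: leq_trans (leq_trunc_div _ _) _.
have A4 : 0 < 4 * A by rewrite mulr_gt0.
have := @sieve_estimate 2 F (4 * A) 0 Y.+1 isT A4 _ _ Y.+1 (leqnn _).
rewrite mul0r subr0 => h; apply: le_trans (h _ _) _.
- by move=> E E0; rewrite mul0r subr0; exact: E1.
- by move=> E E0; rewrite mul0r subr0; exact: E2.
apply: le_trans (ler_wpM2l _ (H 2 Y.+1 isT)) _; first by rewrite mulr_ge0 ?powR_ge0.
rewrite powRM ?(ltW A0) // -/A le_eqVlt; apply/orP; left; apply/eqP; ring.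
Qed.

End Sieve.

(** * The moment twisted by a fixed character value *)

Section OddHarmonic.
Context (R : realType).

Definition odd_harmonic (n : nat) : R := \sum_(1 <= k < n.+1 | odd k) k%:R^-1.

Lemma harmonic_bounds n : (0 < n)%N -> ln (n%:R : R) <= \sum_(1 <= k < n.+1) (k%:R : R)^-1 <= 1 + ln (n%:R : R).
Proof.
move=> n0; rewrite big_add1 /= big_mkord harmonic_le // andbT.
have := @ln_le_harmonic R n; rewrite /series /= big_mkord; apply: le_trans.
exact: ler_ln_nat.
Qed.

Lemma odd_harmonic_bound n : (0 < n)%N -> `|odd_harmonic n - 2^-1 * ln n%:R| <= 2.
Proof.
move=> n0; have E : odd_harmonic n = \sum_(1 <= k < n.+1) k%:R^-1 - 2^-1 * \sum_(1 <= k < (n %/ 2).+1) k%:R^-1.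
  apply/eqP; rewrite eq_sym subr_eq; apply/eqP; rewrite (bigID odd) /=; congr (_ + _).
  under eq_bigl => k do rewrite -dvdn2 -[(2 %| k)%N]andbT.
  rewrite (sum_multiples _ (fun=> true)) // mulr_sumr; apply: eq_bigr => k _.
  by rewrite natrM invfM.
rewrite E; have := harmonic_bounds n0; have l2 := @ln_le_sub1 R 2; have l3 := @ln_le_sub1 R 3.
case: (posnP (n %/ 2)) => h.
  have -> : n = 1%N by move: h => /eqP; rewrite -leqn0 leqNgt divn_gt0 //; lia.
  rewrite (_ : 1 %/ 2 = 0)%N // [\sum_(1 <= _ < 1) _]big_geq // ln1 !mulr0 !subr0 addr0 => /andP[a b].
  by rewrite ler_norml; lra.
have := harmonic_bounds h.
have u1 : ln (n %/ 2)%:R <= ln n%:R :> R by apply: ler_ln_nat => //; exact: leq_div.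
have u2 : ln n%:R <= ln (n %/ 2)%:R + ln 3 :> R.
  rewrite -lnM ?posrE ?ltr0n // -natrM ler_ln ?posrE ?ltr0n ?muln_gt0 ?h // ler_nat.
  by have := ltn_ceil n (isT : (0 < 2)%N); lia.
move: (\sum_(_ <= _ < n.+1) _) (\sum_(_ <= _ < _) _) => x y /andP[a b] /andP[c d].
rewrite ler_norml; lra.
Qed.

(** The error ln e also covers e > X, where the sum is empty and ln X <= ln e. *)
Lemma odd_harmonic_floor (X : R) e : 1 <= X -> (0 < e)%N ->
  `|odd_harmonic (Num.truncn X %/ e) - 2^-1 * ln X| <= 3 + ln e%:R.
Proof.
move=> X1 e0; have X0 : 0 < X by lra.
have /andP[t1 t2] := truncn_itv (ltW X0); set N := Num.truncn X in t1 t2 *.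
have er : (0 : R) < e%:R by rewrite ltr0n.
have le0 := @ln_nat_ge0 R e; have l2 := @ln_le_sub1 R 2.
have lX : 0 <= ln X by rewrite ln_ge0.
case: (posnP (N %/ e)) => h.
  rewrite h /odd_harmonic big_geq // sub0r normrN ger0_norm ?mulr_ge0 //.
  suff : ln X <= ln e%:R by lra.
  rewrite ler_ln ?posrE //; apply: le_trans (ltW t2) _; rewrite ler_nat.
  by move: h => /eqP; rewrite -leqn0 leqNgt divn_gt0 // -ltnNge.
have hb := odd_harmonic_bound h.
have u1 : ln (N %/ e)%:R <= ln X :> R.
  rewrite ler_ln ?posrE ?ltr0n //; apply: le_trans t1; rewrite ler_nat; exact: leq_div.
have u2 : ln X <= ln (N %/ e)%:R + ln 2 + ln e%:R :> R.
  rewrite -!lnM ?posrE ?mulr_gt0 ?ltr0n // -!natrM ler_ln ?posrE ?ltr0n ?muln_gt0 ?h ?e0 //.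
  apply: le_trans (ltW t2) _; rewrite ler_nat; apply: leq_trans (ltn_ceil N e0) _.
  by rewrite leq_mul2r; apply/orP; right; move: h; case: (N %/ e)%N => // m _; rewrite muln2 -addnn addSn ltnS leq_addl.
have -> : odd_harmonic (N %/ e) - 2^-1 * ln X =
  (odd_harmonic (N %/ e) - 2^-1 * ln (N %/ e)%:R) + 2^-1 * (ln (N %/ e)%:R - ln X) by ring.
apply: le_trans (ler_normD _ _) _; rewrite normrM (ger0_norm (_ : 0 <= 2^-1)) // [X in _ + _ * X]ler0_norm; lra.
Qed.

(** Expanding the product over sets J of primes leaves sums over the odd multiples of e = [e J]. The
    error 3 + ln e is at most 3 sqrt e, and the resulting sum over J is bounded by the product of
    the 1 + p^(-3/2), which is at most exp 2. *)
Lemma weighted_odd_harmonic : exists2 C : R, 0 < C & forall (l P : nat) (X : R), 1 <= X ->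
  `|\sum_(1 <= k < (Num.truncn X).+1 | odd k)
      \prod_(p < P | prime p) (1 - ([&& odd p, ~~ (p %| l) & p %| k]%N)%:R / (p%:R + 1)) / k%:R
    - 2^-1 * ln X * \prod_(p < P | prime p) (1 - (odd p && ~~ (p %| l)%N)%:R / (p%:R * (p%:R + 1)))| <= C.
Proof.
exists (3 * expR 2) => [|l P X X1]; first by rewrite mulr_gt0 ?expR_gt0.
pose t (p : nat) : R := (odd p && ~~ (p %| l)%N)%:R / (p%:R + 1).
pose e (J : {set 'I_P}) := (\prod_(p in J) p)%N.
have e0 J : prime_sets J -> (0 < e J)%N.
  by move=> /forall_inP H; apply: prodn_cond_gt0 => p /H; exact: prime_gt0.
have edvd J k : prime_sets J -> \prod_(p in J) (p %| k)%:R = (e J %| k)%:R :> R.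
  move=> HJ; have := @sieve_prod_dvd R P (e J) J k HJ; rewrite /sieve_prod.
  have E p : p \in J -> sieve_mod (e J) p = p.
    by move=> pJ; rewrite /sieve_mod /e (bigD1 p) //= dvdn_mulr.
  rewrite (eq_bigr (fun p : 'I_P => (p %| k)%:R)); last by move=> p pJ; rewrite E.
  by rewrite (eq_bigr (fun p : 'I_P => p : nat)) // => p pJ; rewrite E.
have t0 p : 0 <= t p by rewrite divr_ge0 // addr_ge0.
have T0 (J : {set 'I_P}) : 0 <= \prod_(p in J) t p :> R by apply: prodr_ge0.
have expand k : \prod_(p < P | prime p) (1 - ([&& odd p, ~~ (p %| l) & p %| k]%N)%:R / (p%:R + 1)) =
    \sum_(J : {set 'I_P} | prime_sets J) (-1) ^+ #|J| * (\prod_(p in J) t p) * (e J %| k)%:R :> R.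
  rewrite (prod_one_sub P (fun p => ([&& odd p, ~~ (p %| l) & p %| k]%N)%:R / (p%:R + 1))).
  apply: eq_bigr => J HJ; rewrite -mulrA -edvd // -big_split /=; congr (_ * _); apply: eq_bigr => p _.
  by rewrite /t mulrAC -natrM mulnb andbA.
under eq_bigr => k _ do rewrite expand mulr_suml.
rewrite exchange_big /=.
rewrite (eq_bigr (fun J : {set 'I_P} => (-1) ^+ #|J| * ((\prod_(p in J) t p / (e J)%:R) * odd_harmonic (Num.truncn X %/ e J)))); last first.
  move=> J HJ; rewrite (eq_bigr (fun k => ((-1) ^+ #|J| * \prod_(p in J) t p) * ((e J %| k)%:R / k%:R))); last first.
    by move=> k _; rewrite !mulrA.
  rewrite -mulr_sumr -!mulrA; congr (_ * _).
  case: (boolP [forall p in J, odd p]) => [/forall_inP oJ|]; last first.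
    rewrite negb_forall_in => /exists_inP[p pJ /negbTE op].
    by rewrite (bigD1 p) //= /t op !mul0r.
  congr (_ * _).
  have oe : odd (e J) by rewrite /e; elim/big_ind: _ => // x y; rewrite oddM => -> ->.
  transitivity (\sum_(1 <= k < (Num.truncn X).+1 | (e J %| k)%N && odd k) k%:R^-1 : R).
    rewrite [LHS]big_mkcond [RHS]big_mkcond; apply: eq_bigr => k _.
    by case: (odd k); case: (_ %| _)%N; rewrite ?mul1r ?mul0r.
  rewrite sum_multiples ?e0 // /odd_harmonic mulr_sumr.
  under eq_bigl => k do rewrite oddM oe /=.
  by apply: eq_bigr => k _; rewrite natrM invfM.
rewrite (prod_one_sub P (fun p => (odd p && ~~ (p %| l)%N)%:R / (p%:R * (p%:R + 1)))) mulr_sumr -sumrB.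
apply: le_trans (ler_norm_sum _ _ _) _.
apply: (@le_trans _ _ (\sum_(J : {set 'I_P} | prime_sets J) 3 * \prod_(p in J) p%:R `^ (- (1 + 2^-1)))); last first.
  rewrite -mulr_sumr ler_pM2l // -(prod_one_add P (fun p => p%:R `^ (- (1 + 2^-1)))).
  have := @prod_inv_powR_le R 2^-1 P xpredT; rewrite invrK invr_gt0 ltr0n => /(_ isT).
  by under eq_bigl => p do rewrite andbT.
apply: ler_sum => J HJ; have E0 := e0 J HJ; have er : (0 : R) < (e J)%:R by rewrite ltr0n.
have -> : \prod_(p in J) ((odd p && ~~ (p %| l)%N)%:R / (p%:R * (p%:R + 1))) = \prod_(p in J) t p / (e J)%:R :> R.
  rewrite /e natr_prod -prodf_div; apply: eq_bigr => p _; rewrite /t invfM; ring.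
rewrite [X in _ - X]mulrCA -mulrBr normrM normrX normrN1 expr1n mul1r.
rewrite [2^-1 * ln X * _]mulrC -mulrBr normrM ger0_norm; last by rewrite divr_ge0.
apply: le_trans (ler_wpM2l _ (odd_harmonic_floor X1 E0)) _; first by rewrite divr_ge0.
have s0 : 0 < Num.sqrt ((e J)%:R : R) by rewrite sqrtr_gt0.
have h1 : 3 + ln (e J)%:R <= 3 * Num.sqrt (e J)%:R :> R.
  have := ln_le_sub1 s0; have E1 : (1 : R) <= Num.sqrt (e J)%:R by rewrite -[leLHS]sqrtr1 ler_wsqrtr // ler1n.
  have -> : ln (e J)%:R = 2 * ln (Num.sqrt (e J)%:R) :> R.
    by rewrite -{1}(sqr_sqrtr (ltW er)) lnXn // mulr_natl.
  lra.
apply: le_trans (ler_wpM2l _ h1) _; first by rewrite divr_ge0.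
rewrite mulrCA ler_pM2l //.
have -> : \prod_(p in J) p%:R `^ (- (1 + 2^-1)) = (e J)%:R^-1 / (e J)%:R * Num.sqrt (e J)%:R :> R.
  have -> : \prod_(p in J) p%:R `^ (- (1 + 2^-1)) = (e J)%:R `^ (- (1 + 2^-1)) :> R.
    rewrite /e; elim/big_rec2: _ => [|p y1 y2 pJ ->]; first by rewrite powR1.
    by rewrite natrM powRM.
  rewrite -powR12_sqrt ?ler0n // !powR_expR // -[X in X^-1 / _]lnK ?posrE // -[X in _ / X * _]lnK ?posrE //.
  by rewrite -!expRN -!expRD; congr expR; lra.
rewrite ler_pM2r // ler_pM2r ?invr_gt0 // /e natr_prod -prodfV.
apply: ler_prod => p pJ; rewrite t0 /= /t.
have p0 : (0 : R) < p%:R by rewrite ltr0n prime_gt0 //; move/forall_inP: HJ; apply.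
rewrite ler_pdivrMr ?addr_gt0 // mulrDr mulVf ?gt_eqF // mulr1.
apply: (@le_trans _ _ 1); first by case: (_ && _).
by rewrite lerDl invr_ge0 ltW.
Qed.

End OddHarmonic.

Section TwistedMoment.
Context (R : realType).

Lemma powR_mono (x y r : R) : 0 <= x -> x <= y -> 0 <= r -> x `^ r <= y `^ r.
Proof. by move=> x0 xy r0; apply: ge0_ler_powR; rewrite ?nnegrE // (le_trans x0). Qed.

Lemma powR_succ_le Z D : (0 < D)%N -> (Z <= D.+1)%N -> Z%:R `^ (3 / 5) <= 2 * D%:R `^ (3 / 5) :> R.
Proof.
move=> D0 ZD; apply: (@le_trans _ _ ((2 * D%:R) `^ (3 / 5))).
  by apply: powR_mono => //; rewrite -natrM ler_nat; lia.
rewrite powRM //; apply: ler_wpM2r; first exact: powR_ge0.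
by rewrite -[leRHS]powRr1 // ler_powR //; lra.
Qed.

Lemma square_class l1 l2 n : squarefree l1 -> (0 < l2)%N -> is_square (l1 * l2 ^ 2 * n) ->
  exists k, n = (l1 * k ^ 2)%N.
Proof.
move=> sf l20 /is_squareP[s E]; have l10 := squarefree_gt0 sf.
have /dvdnP[t tE] : (l2 %| s)%N by rewrite -(@dvdn_pexp2r _ _ 2) // -E mulnAC dvdn_mull.
have E2 : (l1 * n = t ^ 2)%N.
  by apply/eqP; rewrite -(@eqn_pmul2r (l2 ^ 2)) ?expn_gt0 ?l20 // mulnAC E tE expnMn.
have /dvdnP[r rE] : (l1 %| t)%N by apply: squarefree_dvd_sqr => //; rewrite -E2 dvdn_mulr.
exists r; apply/eqP; rewrite -(@eqn_pmul2l l1) // E2 rE; apply/eqP; ring.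
Qed.

Lemma sum_square_reindex (f : nat -> R) l1 l2 N : odd l1 -> squarefree l1 -> (0 < l2)%N ->
  \sum_(1 <= n < N.+1 | odd n && is_square (l1 * l2 ^ 2 * n)) f n =
  \sum_(1 <= k < N.+1 | odd k && (l1 * k ^ 2 <= N)%N) f (l1 * k ^ 2)%N.
Proof.
move=> ol1 sf l20; have l10 := squarefree_gt0 sf.
transitivity (\sum_(1 <= n < N.+1) \sum_(1 <= k < N.+1) if odd k && (n == l1 * k ^ 2)%N then f n else 0).
  rewrite big_mkcond big_nat [RHS]big_nat; apply: eq_bigr => n /andP[n1 nN].
  case: ifP => [/andP[on sq]|H].
    have [k kE] := square_class sf l20 sq.
    have ok : odd k by move: on; rewrite kE oddM oddX ol1.
    have kr : k \in index_iota 1 N.+1.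
      rewrite mem_index_iota odd_gt0 //=; apply: leq_ltn_trans nN.
      by rewrite kE -mulnn mulnA leq_pmull // muln_gt0 l10 odd_gt0.
    rewrite (bigD1_seq k) ?iota_uniq //= ok -kE eqxx /= big1 ?addr0 // => k' /negP kk'.
    case: ifP => // /andP[_ /eqP E]; case: kk'; move: E; rewrite kE => /eqP.
    by rewrite eqn_pmul2l // eqn_exp2r // eq_sym.
  rewrite big1 // => k _; case: ifP => // /andP[ok /eqP E]; case/negP: (negbT H).
  rewrite E oddM oddX ol1 ok orbT /=; apply/is_squareP; exists (l1 * l2 * k)%N; ring.
rewrite exchange_big /= [RHS]big_mkcond big_nat [RHS]big_nat; apply: eq_bigr => k /andP[k1 kN].
case: ifP => [/andP[ok le]|H].
  have kr : (l1 * k ^ 2)%N \in index_iota 1 N.+1 by rewrite mem_index_iota muln_gt0 l10 expn_gt0 k1 ltnS.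
  rewrite (bigD1_seq (l1 * k ^ 2)%N) ?iota_uniq //= ok eqxx /= big1 ?addr0 // => n /negbTE ->.
  by [].
rewrite big_nat big1 // => n /andP[_ nN]; case: ifP => // /andP[ok /eqP E].
by move: H; rewrite ok -E -ltnS nN.
Qed.

Lemma chi8_square d s : flat d -> odd s -> chi8 d (s ^ 2) = (coprime d s)%:Z.
Proof.
move=> /andP[od sd] os; have d0 := odd_gt0 od.
have [_ _ _ _ [cop _]] := chi8_real_primitive R od sd.
rewrite -mulnn chi8_mul //; case: (boolP (coprime d s)) => c.
  have c8 : coprime s (8 * d) by rewrite coprime8 os coprime_sym.
  by case: (cop _ c8) => ->.
by rewrite chi8_ncoprime // coprime8 os coprime_sym.
Qed.

(* The terms n of the partial sum for which l1 l2^2 n is a square, namely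
   n = l1 k^2. *)
Definition square_part (u : R) (l1 l2 N d : nat) : R :=
  \sum_(1 <= k < N.+1 | odd k && cut u d (l1 * k ^ 2)) coprime_weight R (l1 * l2 * k) / Num.sqrt (l1 * k ^ 2)%:R.

Lemma sum_inv_sqrt_le N : \sum_(1 <= n < N.+1) (Num.sqrt n%:R)^-1 <= 2 * Num.sqrt N%:R :> R.
Proof.
elim: N => [|N IH]; first by rewrite big_geq // mulr_ge0 ?sqrtr_ge0.
rewrite big_nat_recr //=; apply: le_trans (lerD IH (lexx _)) _.
have x0 := sqrtr_ge0 (N%:R : R); have y0 : 0 < Num.sqrt (N.+1%:R : R) by rewrite sqrtr_gt0.
have e : Num.sqrt (N.+1%:R : R) ^+ 2 = Num.sqrt (N%:R : R) ^+ 2 + 1 by rewrite !sqr_sqrtr // natr1.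
rewrite -(ler_pM2r y0) mulrDl mulVf ?gt_eqF //; nra.
Qed.

Lemma log_power_le (m : nat) : (0 < m)%N -> (Num.sqrt m%:R * (1 + ln m%:R)) `^ (2 / 5) <= 8 * m%:R `^ 4^-1 :> R.
Proof.
move=> m0; have mr : (0 : R) < m%:R by rewrite ltr0n.
have h : 1 + ln m%:R <= 8 * m%:R `^ 8^-1 :> R.
  have p0 : 0 < (m%:R : R) `^ 8^-1 by rewrite powR_gt0.
  have := ln_le_sub1 p0; rewrite ln_powR => h1; lra.
apply: (@le_trans _ _ ((8 * m%:R `^ (5 / 8)) `^ (2 / 5))).
  apply: ge0_ler_powR; rewrite ?nnegrE ?mulr_ge0 ?sqrtr_ge0 ?powR_ge0 ?addr_ge0 ?ln_nat_ge0 //.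
  apply: le_trans (ler_wpM2l (sqrtr_ge0 _) h) _; rewrite -powR12_sqrt ?ler0n // mulrCA ler_pM2l //.
  by rewrite -powRD ?gt_eqF ?implybT // (_ : 2^-1 + 8^-1 = 5 / 8 :> R) //; lra.
rewrite powRM ?powR_ge0 // -powRrM (_ : 5 / 8 * (2 / 5) = 4^-1 :> R); last by field.
apply: ler_wpM2r; first exact: powR_ge0.
by rewrite -[leRHS]powRr1 // ler_powR //; lra.
Qed.

Lemma flat_density_le1 : flat_density R <= 1.
Proof.
apply: (cvgn_le (@flat_density_cvg R)); elim=> [|B IH]; first by rewrite /sieve_density big_ord0.
exact: le_trans (sieve_density_le R B 2) IH.
Qed.

(** The cut selects a final segment of the d, so [upper_sum_bound] applies to the indicator minus
    its mean; [flat_count] controls the initial segments. *)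
Lemma flat_cut_count : exists2 C : R, 0 < C & forall (u : R) m n D, 0 <= u -> (0 < m)%N -> (0 < D)%N ->
  `|\sum_(1 <= d < D.+1 | flat d && coprime d m && cut u d n) 1
    - flat_density R * coprime_weight R m * \sum_(1 <= d < D.+1 | cut u d n) 1| <= C * (D%:R `^ (3 / 5) * m%:R).
Proof.
have [C C0 H] := flat_count R; exists (2 * (C * 2 + 1)) => [|u m n D u0 m0 D0]; first by rewrite mulr_gt0 // addr_gt0 ?mulr_gt0.
set kw := flat_density R * coprime_weight R m.
have kw0 : 0 <= kw <= 1.
  have /andP[w0 w1] := coprime_weight_itv R m; have k0 := flat_density_gt0 R.
  by rewrite mulr_ge0 ?(ltW k0) //= mulr_ile1 ?(ltW k0) // flat_density_le1.
pose f (d : nat) : R := if (d == 0)%N then 0 else (flat d && coprime d m)%:R - kw.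
have -> : \sum_(1 <= d < D.+1 | flat d && coprime d m && cut u d n) 1 - kw * \sum_(1 <= d < D.+1 | cut u d n) 1 =
    \sum_(d < D.+1 | cut u d n) f d.
  rewrite -(big_mkord (fun d => cut u d n) f) [RHS]big_ltn_cond // {2}/f /= add0r if_same.
  transitivity (\sum_(1 <= d < D.+1 | cut u d n) ((flat d && coprime d m)%:R - kw)).
    rewrite sumrB mulr_sumr; congr (_ - _); last by apply: eq_bigr => d _; rewrite mulr1.
    by rewrite big_mkcondl; apply: eq_bigr => d _; case: (_ && _).
  rewrite big_mkcond [RHS]big_mkcond; apply: eq_big_nat => d /andP[d1 _].
  by rewrite /f gtn_eqF.
rewrite -mulrA; apply: (upper_sum_bound (f := f) (P := fun d => cut u d n)); last first.
  by move=> d; exact: cut_mono.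
have p1 : 1 <= D%:R `^ (3 / 5) * m%:R :> R.
  rewrite mulr_ege1 ?ler1n // -[leLHS](powRr0 D%:R) ler_powR ?ler1n //; lra.
case=> [|Z] ZD; first by rewrite big_ord0 normr0 mulr_ge0 ?(le_trans ler01 p1) // addr_ge0 ?mulr_ge0 ?(ltW C0).
have -> : \sum_(d < Z.+1) f d = (\sum_(1 <= d < Z.+1 | flat d && coprime d m) 1 - kw * Z.+1%:R) + kw.
  rewrite -(big_mkord xpredT f) big_ltn // {1}/f /= add0r.
  have -> : \sum_(1 <= d < Z.+1) f d = \sum_(1 <= d < Z.+1) ((flat d && coprime d m)%:R - kw).
    by rewrite big_nat [RHS]big_nat; apply: eq_bigr => d /andP[d1 _]; rewrite /f gtn_eqF.
  rewrite sumrB sumr_const_nat subn1 /= -natr1 [X in _ = X - _ + _]big_mkcond mulrDr mulr1 opprD addrA subrK.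
  congr (_ - _); last by rewrite mulr_natr.
  by apply: eq_bigr => d _; case: (_ && _).
apply: le_trans (ler_normD _ _) _; rewrite mulrDl mul1r; apply: lerD; last first.
  by have /andP[a b] := kw0; rewrite ger0_norm // (le_trans b).
apply: le_trans (H m Z.+1 m0) _; rewrite -!mulrA ler_pM2l // mulrA; apply: ler_wpM2r => //.
exact: powR_succ_le.
Qed.

(** When l1 l2^2 n is not a square, [flat_sum_nonsquare] gives D^(3/5) N^(1/4) up to a factor
    depending on l1 l2^2. With the weights 1 / sqrt n the sum over n <= N yields N^(3/4), where N is
    of order sqrt D; this is the exponent 3/5 + 3/8 = 39/40. *)
Lemma twisted_moment : exists2 C : R, 0 < C & forall (u : R) l1 l2 D N,
  0 < u -> odd l1 -> odd l2 -> squarefree l1 -> (0 < D)%N -> N = (Num.truncn (u * Num.sqrt D%:R)).+1 ->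
  `|\sum_(1 <= d < D.+1 | flat d) (chi8 d (l1 * l2 ^ 2))%:~R * Spart (chi8 d) (u * Num.sqrt d%:R)
    - flat_density R * \sum_(1 <= d < D.+1) square_part u l1 l2 N d| <=
   C * ((l1 * l2 ^ 2)%:R * (1 + u) * D%:R `^ (39 / 40)).
Proof.
have [C1 C10 H1] := flat_sum_nonsquare R; have [C2 C20 H2] := flat_cut_count.
exists (C1 * 32 + C2) => [|u l1 l2 D N u0 ol1 ol2 sf D0 NE]; first by rewrite addr_gt0 ?mulr_gt0.
set l := (l1 * l2 ^ 2)%N; have ol : odd l by rewrite /l oddM oddX ol1 ol2 orbT.
have l0 := odd_gt0 ol; have l10 := odd_gt0 ol1; have l20 := odd_gt0 ol2.
have lr : (1 : R) <= l%:R by rewrite ler1n.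
have Dr : (1 : R) <= D%:R by rewrite ler1n.
have x0 : 0 <= u * Num.sqrt (D%:R : R) by rewrite mulr_ge0 ?sqrtr_ge0 ?ltW.
have /andP[t1 t2] := truncn_itv x0; rewrite -NE in t2.
have s1 : 1 <= Num.sqrt (D%:R : R) by rewrite -[leLHS]sqrtr1 ler_wsqrtr.
have NU : (N%:R : R) <= (1 + u) * Num.sqrt D%:R by rewrite NE -natr1; nra.
have N0 : (0 < N)%N by rewrite NE.
have cutN d n : (d <= D)%N -> cut u d n -> (n <= N)%N.
  move=> dD /andP[_ le]; rewrite -(ler_nat R); apply: le_trans le (le_trans _ (ltW t2)).
  by rewrite ler_wpM2l ?(ltW u0) // ler_wsqrtr // ler_nat.
pose S n : R := \sum_(1 <= d < D.+1 | flat d && cut u d n) (chi8 d (l * n))%:~R.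
have LE : \sum_(1 <= d < D.+1 | flat d) (chi8 d l)%:~R * Spart (chi8 d) (u * Num.sqrt d%:R) =
    \sum_(1 <= n < N.+1) S n / Num.sqrt n%:R.
  transitivity (\sum_(1 <= d < D.+1) \sum_(1 <= n < N.+1) (if flat d && cut u d n then (chi8 d (l * n))%:~R / Num.sqrt n%:R else 0 : R)).
    rewrite big_mkcond big_nat [RHS]big_nat; apply: eq_bigr => d /andP[d1 dD].
    case: (flat d) => /=; last by rewrite big1.
    rewrite (@Spart_cut _ _ u d N) ?(ltW u0) //; last first.
      by apply: le_trans (ltW t2); rewrite ler_wpM2l ?(ltW u0) // ler_wsqrtr // ler_nat -ltnS.
    rewrite -(big_mkord (fun n => cut u d n) (fun n => (chi8 d n)%:~R / Num.sqrt n%:R)) big_ltn_cond // /cut /=.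
    rewrite mulr_sumr big_mkcond; apply: eq_bigr => n _; case: ifP => // _.
    by rewrite chi8_mul // intrM mulrA.
  rewrite exchange_big; apply: eq_bigr => n _; rewrite /S mulr_suml [RHS]big_mkcond.
  by apply: eq_bigr => d _; case: ifP.
rewrite LE (bigID (fun n => odd n && is_square (l * n))) /=.
rewrite (sum_square_reindex (fun n => S n / Num.sqrt n%:R) N ol1 sf l20).
have SE k : odd k -> S (l1 * k ^ 2)%N = \sum_(1 <= d < D.+1 | flat d && coprime d (l1 * l2 * k) && cut u d (l1 * k ^ 2)) 1.
  move=> ok; rewrite /S big_mkcond [RHS]big_mkcond; apply: eq_bigr => d _.
  have -> : (l * (l1 * k ^ 2) = (l1 * l2 * k) ^ 2)%N by rewrite /l; ring.
  case: (boolP (flat d)) => //= fd; rewrite chi8_square ?oddM ?ol1 ?ol2 //.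
  by case: (coprime _ _); case: (cut _ _ _).
have RE : flat_density R * \sum_(1 <= d < D.+1) square_part u l1 l2 N d =
   \sum_(1 <= k < N.+1 | odd k && (l1 * k ^ 2 <= N)%N)
     (flat_density R * coprime_weight R (l1 * l2 * k) * \sum_(1 <= d < D.+1 | cut u d (l1 * k ^ 2)) 1) / Num.sqrt (l1 * k ^ 2)%:R.
  transitivity (flat_density R * \sum_(1 <= d < D.+1) \sum_(1 <= k < N.+1)
      (if odd k && (l1 * k ^ 2 <= N)%N && cut u d (l1 * k ^ 2) then coprime_weight R (l1 * l2 * k) / Num.sqrt (l1 * k ^ 2)%:R else 0 : R)).
    congr (_ * _); rewrite big_nat [RHS]big_nat; apply: eq_bigr => d /andP[_ dD].
    rewrite /square_part big_mkcond; apply: eq_bigr => k _.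
    case: (odd k) => //=; case: (boolP (cut u d _)) => c; last by rewrite andbF.
    by rewrite (cutN d) // -ltnS.
  rewrite exchange_big mulr_sumr [RHS]big_mkcond /=; apply: eq_bigr => k _.
  case: (odd k && _) => /=; last by rewrite big1 ?mulr0.
  rewrite -big_mkcond /= -[\sum_(_ <= _ < _ | _) _]mulr1 mulr_suml.
  rewrite (eq_bigr (fun=> coprime_weight R (l1 * l2 * k) / Num.sqrt (l1 * k ^ 2)%:R * 1)) // -mulr_sumr.
  ring.
rewrite RE addrAC -sumrB.
apply: le_trans (ler_normD _ _) _; rewrite addrC mulrDl; apply: lerD.
  have b n : (0 < n < N.+1)%N -> ~~ (odd n && is_square (l * n)) ->
      `|S n| <= C1 * 8 * l%:R * N%:R `^ 4^-1 * (2 * D%:R `^ (3 / 5)).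
    move=> /andP[n0 nN] H; case: (boolP (odd n)) H => on H; last first.
      have ln0 : (0 < l * n)%N by rewrite muln_gt0 l0.
      have en : ~~ odd (l * n) by rewrite oddM ol.
      rewrite /S big1 ?normr0; last by move=> d _; rewrite (chi8_even _ ln0 en).
      by rewrite !mulr_ge0 ?powR_ge0 ?(ltW C10).
    have oln : odd (l * n) by rewrite oddM ol.
    apply: le_trans (H1 u _ n D.+1 (ltW u0) oln H) _.
    apply: ler_pM; rewrite ?mulr_ge0 ?powR_ge0 ?(ltW C10) //.
      rewrite -!mulrA ler_pM2l //; apply: le_trans (log_power_le (odd_gt0 oln)) _.
      rewrite ler_pM2l // natrM powRM //; apply: ler_pM; rewrite ?powR_ge0 //.
        by rewrite -[leRHS]powRr1 // ler_powR //; lra.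
      by apply: ge0_ler_powR; rewrite ?nnegrE // ler_nat.
    exact: powR_succ_le.
  apply: le_trans (ler_norm_sum _ _ _) _.
  apply: (@le_trans _ _ (\sum_(1 <= n < N.+1) C1 * 8 * l%:R * N%:R `^ 4^-1 * (2 * D%:R `^ (3 / 5)) * (Num.sqrt n%:R)^-1)).
    rewrite big_mkcond big_nat [leRHS]big_nat; apply: ler_sum => n hn; case: ifP => [H|_]; last first.
      by rewrite !mulr_ge0 ?powR_ge0 ?(ltW C10) ?invr_ge0 ?sqrtr_ge0.
    rewrite normrM [`|_^-1|]ger0_norm ?invr_ge0 ?sqrtr_ge0 // ler_wpM2r ?invr_ge0 ?sqrtr_ge0 //.
    exact: b.
  rewrite -mulr_sumr; apply: le_trans (ler_wpM2l _ (sum_inv_sqrt_le N)) _.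
    by rewrite !mulr_ge0 ?powR_ge0 ?(ltW C10).
  have Nr : (1 : R) <= N%:R by rewrite ler1n.
  have N34 : N%:R `^ 4^-1 * Num.sqrt N%:R <= (1 + u) * D%:R `^ (3 / 8) :> R.
    rewrite -powR12_sqrt // -powRD; last by rewrite (gt_eqF (lt_le_trans ltr01 Nr)) implybT.
    apply: (@le_trans _ _ (((1 + u) * Num.sqrt D%:R) `^ (3 / 4))).
      rewrite (_ : 4^-1 + 2^-1 = 3 / 4 :> R); last by field.
      by apply: ge0_ler_powR; rewrite ?nnegrE ?mulr_ge0 ?sqrtr_ge0 ?addr_ge0 ?(ltW u0).
    rewrite powRM ?sqrtr_ge0 ?addr_ge0 ?(ltW u0) // -powR12_sqrt // -powRrM (_ : 2^-1 * (3 / 4) = 3 / 8 :> R); last by field.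
    apply: ler_wpM2r; first exact: powR_ge0.
    rewrite -[leRHS]powRr1 ?addr_ge0 ?(ltW u0) // ler_powR //; lra.
  rewrite [leLHS](_ : _ = C1 * 32 * l%:R * D%:R `^ (3 / 5) * (N%:R `^ 4^-1 * Num.sqrt N%:R)); last by ring.
  apply: le_trans (ler_wpM2l _ N34) _; first by rewrite !mulr_ge0 ?powR_ge0 ?(ltW C10).
  have -> : D%:R `^ (39 / 40) = D%:R `^ (3 / 5) * D%:R `^ (3 / 8) :> R.
    rewrite -powRD; last by rewrite (gt_eqF (lt_le_trans ltr01 Dr)) implybT.
    by congr (_ `^ _); field.
  by rewrite le_eqVlt; apply/orP; left; apply/eqP; ring.
apply: le_trans (ler_norm_sum _ _ _) _.
apply: (@le_trans _ _ (\sum_(1 <= k < N.+1 | odd k && (l1 * k ^ 2 <= N)%N) C2 * (D%:R `^ (3 / 5) * l%:R))).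
  rewrite big_nat_cond [leRHS]big_nat_cond; apply: ler_sum => k /andP[/andP[k0 kN] /andP[ok le]].
  have m0 : (0 < l1 * l2 * k)%N by rewrite !muln_gt0 l10 l20.
  rewrite SE // -mulrBl normrM [`|_^-1|]ger0_norm ?invr_ge0 ?sqrtr_ge0 //.
  have q0 : 0 < Num.sqrt ((l1 * k ^ 2)%:R : R) by rewrite sqrtr_gt0 ltr0n muln_gt0 l10 expn_gt0 k0.
  rewrite ler_pdivrMr //; apply: le_trans (H2 u _ _ D (ltW u0) m0 D0) _.
  rewrite -!mulrA ler_pM2l // ler_wpM2l ?powR_ge0 //.
  have -> : (l1 * l2 * k)%:R = (l1 * l2)%:R * k%:R :> R by rewrite natrM.
  have -> : Num.sqrt ((l1 * k ^ 2)%:R : R) = Num.sqrt l1%:R * k%:R.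
    by rewrite natrM natrX sqrtrM // sqrtr_sqr ger0_norm.
  rewrite mulrA; apply: ler_wpM2r => //; apply: le_trans (_ : l%:R * 1 <= _).
    by rewrite mulr1 ler_nat /l leq_mul2l -mulnn leq_pmulr // orbT.
  by rewrite ler_wpM2l // -[leLHS]sqrtr1 ler_wsqrtr // ler1n.
have cnt : \sum_(1 <= k < N.+1 | odd k && (l1 * k ^ 2 <= N)%N) (1 : R) <= Num.sqrt N%:R.
  have /andP[c1 c2] := truncn_itv (sqrtr_ge0 (N%:R : R)); set K := Num.truncn _ in c1 c2.
  apply: le_trans c1; apply: (@le_trans _ _ (\sum_(1 <= k < K.+1) (1 : R))); last by rewrite sumr_const_nat subn1.
  have KN : (K.+1 <= N.+1)%N.
    rewrite ltnS /K -(ler_nat R); have /andP[h _] := truncn_itv (sqrtr_ge0 (N%:R : R)); apply: le_trans h _.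
    have Nr : (1 : R) <= N%:R by rewrite ler1n.
    have h2 : 1 <= Num.sqrt (N%:R : R) by rewrite -[leLHS]sqrtr1 ler_wsqrtr.
    by rewrite -[leRHS](sqr_sqrtr (ler0n _ N)) expr2 ler_peMr // (le_trans ler01).
  rewrite big_mkcond (big_cat_nat (_ : 1 <= K.+1)%N KN) //= -[leRHS]addr0; apply: lerD.
    by apply: ler_sum => k _; case: ifP.
  rewrite big_nat big1 // => k /andP[Kk _]; case: ifP => // /andP[_ le].
  have : (k%:R : R) <= Num.sqrt N%:R.
    rewrite -(ger0_norm (ler0n R k)) -sqrtr_sqr ler_wsqrtr // -natrX ler_nat; apply: leq_trans le.
    by rewrite leq_pmull.
  move/le_lt_trans/(_ c2); rewrite ltr_nat ltnS leqNgt Kk //.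
rewrite -[X in \sum_(_ <= _ < _ | _) X]mulr1 -mulr_sumr; apply: le_trans (ler_wpM2l _ cnt) _.
  by rewrite !mulr_ge0 ?powR_ge0 ?(ltW C20).
have sN : Num.sqrt (N%:R : R) <= (1 + u) * D%:R `^ (3 / 8).
  apply: (@le_trans _ _ (Num.sqrt ((1 + u) * Num.sqrt D%:R))); first by rewrite ler_wsqrtr.
  rewrite sqrtrM ?addr_ge0 ?(ltW u0) //; apply: ler_pM; rewrite ?sqrtr_ge0 //.
    have h : 1 <= Num.sqrt (1 + u) by rewrite -[leLHS]sqrtr1 ler_wsqrtr // lerDl ltW.
    by rewrite -[leRHS](sqr_sqrtr (_ : 0 <= 1 + u)) ?addr_ge0 ?(ltW u0) // expr2 ler_peMr // (le_trans ler01).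
  by rewrite -!powR12_sqrt ?powR_ge0 // -powRrM ler_powR //; lra.
have -> : D%:R `^ (39 / 40) = D%:R `^ (3 / 5) * D%:R `^ (3 / 8) :> R.
  rewrite -powRD; last by rewrite (gt_eqF (lt_le_trans ltr01 Dr)) implybT.
  by congr (_ `^ _); field.
apply: le_trans (ler_wpM2l _ sN) _; first by rewrite !mulr_ge0 ?powR_ge0 ?(ltW C20).
by rewrite le_eqVlt; apply/orP; left; apply/eqP; ring.
Qed.

End TwistedMoment.

(** * Evaluation of the square terms *)

Section MainTerm.
Context (R : realType).

Definition odd_density (P : nat) : R := \prod_(p < P | prime p && odd p) (1 - (p%:R * (p%:R + 1))^-1).

Definition odd_constant : R := limn odd_density.

(** p^2 / (p^2 + p - 1) is p / (p + 1) divided by 1 - 1 / (p (p + 1)): the effect on the Euler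
    product [odd_density] of a prime that divides m. *)
Definition main_weight (m : nat) : R :=
  \prod_(p < m.+1 | prime p && (odd p && (p %| m)%N)) (p%:R ^+ 2 / (p%:R ^+ 2 + p%:R - 1)).

Lemma odd_density_factor p : prime p -> 0 < (1 - (p%:R * (p%:R + 1))^-1 : R) < 1.
Proof.
move=> pp; have p1 : (1 : R) < p%:R by rewrite ltr1n prime_gt1.
have h : 0 < p%:R * (p%:R + 1) :> R by rewrite mulr_gt0 //; lra.
rewrite subr_gt0 invf_lt1 // gtrBl invr_gt0 h andbT; nra.
Qed.

Lemma odd_density_le P : odd_density P.+1 <= odd_density P.
Proof.
rewrite /odd_density big_mkcond big_ord_recr -big_mkcond /= ler_piMr //.
  by apply: prodr_ge0 => p /andP[pp _]; have /andP[/ltW] := odd_density_factor pp.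
by case: ifP => // /andP[pp _]; have /andP[_ /ltW] := odd_density_factor pp.
Qed.

Lemma odd_density_ge P : 3^-1 <= odd_density P.
Proof.
apply: le_trans (sieve_density_ge R P) _; rewrite /sieve_density (bigID (fun p : 'I_P => odd p)) /=.
rewrite -[leRHS]mulr1; apply: ler_pM.
- by apply: prodr_ge0 => p /andP[pp _]; rewrite subr_ge0 invf_le1 ?ltr0n ?sieve_mod_gt0 // ler1n sieve_mod_gt0.
- by apply: prodr_ge0 => p /andP[pp _]; rewrite subr_ge0 invf_le1 ?ltr0n ?sieve_mod_gt0 // ler1n sieve_mod_gt0.
- apply: ler_prod => p /andP[pp op]; rewrite subr_ge0 invf_le1 ?ltr0n ?sieve_mod_gt0 // ler1n sieve_mod_gt0 //=.
  have p1 : (1 : R) < p%:R by rewrite ltr1n prime_gt1.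
  rewrite /sieve_mod ifF; last by rewrite dvdn_prime2 //; apply: contraTF op => /eqP ->.
  rewrite lerD2l lerN2 natrX lef_pV2 ?posrE ?mulr_gt0 ?exprn_gt0 //; nra.
- apply: (@le_trans _ _ (\prod_(p < P | prime p && ~~ odd p) 1)); last by rewrite big1_eq.
  apply: ler_prod => p /andP[pp _]; rewrite subr_ge0 invf_le1 ?ltr0n ?sieve_mod_gt0 // ler1n sieve_mod_gt0 //=.
Qed.

Lemma odd_density_cvg : odd_density P @[P --> \oo] --> odd_constant.
Proof.
apply: nonincreasing_is_cvgn; first by apply/nonincreasing_seqP => n; exact: odd_density_le.
by exists 3^-1 => _ [n _ <-]; exact: odd_density_ge.
Qed.

Lemma odd_constant_gt0 : 0 < odd_constant.
Proof. by apply: lt_le_trans (cvgn_ge odd_density_cvg odd_density_ge). Qed.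

Lemma prod_dvd_ext (f : nat -> R) m B : (0 < m < B)%N ->
  \prod_(p < m.+1 | prime p && (odd p && (p %| m)%N)) f p = \prod_(p < B | prime p && (odd p && (p %| m)%N)) f p.
Proof.
case/andP=> m0 mB; rewrite -!(big_mkord (fun p => prime p && (odd p && (p %| m)%N)) f).
rewrite [RHS](@big_cat_nat _ _ _ m.+1) //= [X in _ = _ * X]big_nat_cond [X in _ = _ * X]big1 ?mulr1 //.
by move=> p /andP[/andP[mp _] /and3P[_ _ pm]]; have := dvdn_leq m0 pm; rewrite leqNgt mp.
Qed.

Let partial_density (P m : nat) : R := \prod_(p < P | prime p) (1 - (odd p && ~~ (p %| m)%N)%:R / (p%:R * (p%:R + 1))).

Lemma partial_density_weight P m : (0 < m < P)%N ->
  coprime_weight R m * partial_density P m = odd_density P * main_weight m.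
Proof.
move=> mP; rewrite (coprime_weight_ext R mP) /main_weight (prod_dvd_ext (fun p => p%:R ^+ 2 / (p%:R ^+ 2 + p%:R - 1)) mP) /partial_density /odd_density.
rewrite !big_mkcondr -!big_split /=; apply: eq_bigr => p pp.
have p1 : (1 : R) < p%:R by rewrite ltr1n prime_gt1.
case: (odd p) => /=; last by rewrite mul0r subr0.
case: (p %| m)%N => /=; rewrite ?mul0r ?subr0 ?mulr1 ?mul1r //.
move: (p%:R : R) p1 => x x1; field; apply/andP; split; last lra.
have : 0 < x ^+ 2 by rewrite exprn_gt0 //; lra.
by move=> x2; rewrite gt_eqF //; lra.
Qed.

Lemma partial_density_itv P m : 0 <= partial_density P m <= 1.
Proof.
have h p : prime p -> 0 <= (1 - (odd p && ~~ (p %| m)%N)%:R / (p%:R * (p%:R + 1)) : R) <= 1.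
  move=> pp; have /andP[/ltW a /ltW b] := odd_density_factor pp.
  by case: (odd p && _); rewrite ?mul0r ?mul1r ?subr0 ?ler01 ?lexx // a b.
apply/andP; split; first by apply: prodr_ge0 => p /h /andP[].
apply: (@le_trans _ _ (\prod_(p < P | prime p) 1)); last by rewrite big1_eq.
by apply: ler_prod => p pp; apply: h.
Qed.

Lemma coprime_weightM m k P : (0 < m)%N -> (0 < k)%N -> (m * k < P)%N ->
  coprime_weight R (m * k) = coprime_weight R m *
    \prod_(p < P | prime p) (1 - ([&& odd p, ~~ (p %| m) & p %| k]%N)%:R / (p%:R + 1)).
Proof.
move=> m0 k0 mkP; have mP : (0 < m < P)%N by rewrite m0; apply: leq_ltn_trans mkP; exact: leq_pmulr.
have mkP' : (0 < m * k < P)%N by rewrite muln_gt0 m0 k0.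
rewrite (coprime_weight_ext R mP) (coprime_weight_ext R mkP') [LHS]big_mkcondr [X in X * _]big_mkcondr -big_split /=.
apply: eq_bigr => p pp; have p1 : (1 : R) < p%:R by rewrite ltr1n prime_gt1.
rewrite Euclid_dvdM //; case: (odd p) => /=; last by rewrite mul0r subr0 mulr1.
case: (p %| m)%N => /=; first by rewrite mul0r subr0 mulr1.
case: (p %| k)%N; rewrite ?mul0r ?subr0 ?mulr1 // mul1r div1r.
by move: (p%:R : R) p1 => x x1; field; lra.
Qed.

Lemma square_part_asymp : exists2 C : R, 0 < C & forall (u : R) l1 l2 N d P,
  0 < u -> (0 < l1)%N -> (0 < l2)%N -> (0 < d)%N -> u * Num.sqrt d%:R <= N%:R -> (l1 * l2 * N < P)%N -> (l1 * l2 < P)%N ->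
  `|square_part u l1 l2 N d - coprime_weight R (l1 * l2) / Num.sqrt l1%:R * (4^-1 * (ln u + 2^-1 * ln d%:R)) * partial_density P (l1 * l2)| <=
   C / Num.sqrt l1%:R * (1 + ln l1%:R + `|ln u|).
Proof.
have [C C0 H] := weighted_odd_harmonic R; exists (C + 1) => [|u l1 l2 N d P u0 l10 l20 d0 uN mNP mP]; first by rewrite addr_gt0.
set m := (l1 * l2)%N in mNP mP *; have m0 : (0 < m)%N by rewrite muln_gt0 l10.
have s0 : 0 < Num.sqrt (l1%:R : R) by rewrite sqrtr_gt0 ltr0n.
have sd0 : 0 < Num.sqrt (d%:R : R) by rewrite sqrtr_gt0 ltr0n.
have l1r : (0 : R) < l1%:R by rewrite ltr0n.
(* l1 k^2 <= u sqrt d means k <= X. The half of ln X given by [weighted_odd_harmonic] is a quarter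
   of ln(u sqrt d / l1), and ln l1 goes into the error. *)
pose X : R := Num.sqrt (u * Num.sqrt d%:R / l1%:R).
have y0 : 0 < u * Num.sqrt d%:R / l1%:R by rewrite divr_gt0 // mulr_gt0.
have X0 : 0 < X by rewrite sqrtr_gt0.
have lX : ln X = 2^-1 * (ln u + 2^-1 * ln d%:R - ln l1%:R).
  have lsq (z : R) : 0 < z -> ln (Num.sqrt z) = 2^-1 * ln z.
    move=> z0; have : ln z = 2 * ln (Num.sqrt z) by rewrite -{1}(sqr_sqrtr (ltW z0)) lnXn ?sqrtr_gt0 // mulr_natl.
    by move=> ->; rewrite mulrA mulVf // mul1r.
  by rewrite /X lsq // ln_div ?posrE ?mulr_gt0 // lnM ?posrE // lsq ?ltr0n.
have cutE k : (0 < k)%N -> cut u d (l1 * k ^ 2) = (k <= Num.truncn X)%N.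
  move=> k0; rewrite truncn_ge_nat ?(ltW X0) // /cut muln_gt0 l10 expn_gt0 k0 /= natrM natrX mulrC -ler_pdivlMr //.
  rewrite /X -[in RHS](ger0_norm (ler0n R k)) -sqrtr_sqr ler_sqrt //; exact: ltW.
have /andP[t1 t2] := truncn_itv (ltW X0); set K := Num.truncn X in cutE t1 t2.
have KN : (K <= N)%N.
  case: (posnP K) => [->//|K0]; have : cut u d (l1 * K ^ 2) by rewrite cutE.
  case/andP=> _ le; rewrite -(ler_nat R); apply: le_trans (le_trans le uN); rewrite ler_nat -mulnn mulnA.
  by rewrite leq_pmull // muln_gt0 l10.
have SE : square_part u l1 l2 N d = coprime_weight R m / Num.sqrt l1%:R *
    \sum_(1 <= k < K.+1 | odd k) \prod_(p < P | prime p) (1 - ([&& odd p, ~~ (p %| m) & p %| k]%N)%:R / (p%:R + 1)) / k%:R.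
  have K1 : (K.+1 <= N.+1)%N by [].
  rewrite /square_part (big_cat_nat (_ : 1 <= K.+1)%N K1) //= [X in _ + X]big_nat_cond [X in _ + X]big1 ?addr0; last first.
    by move=> k /andP[/andP[Kk _] /andP[_]]; rewrite cutE ?(leq_trans _ Kk) // leqNgt Kk.
  rewrite mulr_sumr big_nat_cond [RHS]big_nat_cond.
  apply: eq_big => [k|k /andP[/andP[k0 kK] _]].
    by case: (ltnP 0 k) => //= k0; case: (ltnP k K.+1) => //= kK; rewrite cutE // -ltnS kK andbT.
  rewrite (coprime_weightM m0 k0 (P := P)); last by apply: leq_ltn_trans mNP; rewrite leq_mul2l (leq_trans _ KN) ?orbT.
  rewrite natrM natrX sqrtrM // sqrtr_sqr ger0_norm // invfM; ring.
set S := \sum_(_ <= _ < _ | _) _ in SE.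
have -> : square_part u l1 l2 N d - coprime_weight R m / Num.sqrt l1%:R * (4^-1 * (ln u + 2^-1 * ln d%:R)) * partial_density P m =
  coprime_weight R m * ((S - 4^-1 * (ln u + 2^-1 * ln d%:R) * partial_density P m) / Num.sqrt l1%:R) by rewrite SE; ring.
have /andP[w0 w1] := coprime_weight_itv R m.
rewrite normrM (ger0_norm w0); apply: le_trans (ler_piMl (normr_ge0 _) w1) _.
rewrite normrM (ger0_norm (_ : 0 <= (Num.sqrt l1%:R)^-1)) ?invr_ge0 ?(ltW s0) //.
rewrite -[leRHS]mulrA [leRHS]mulrCA [leRHS]mulrC; apply: ler_wpM2r; first by rewrite invr_ge0 ltW.
have /andP[r0 r1] := partial_density_itv P m.
have ll0 : 0 <= ln (l1%:R : R) by apply: ln_nat_ge0.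
set rho := partial_density P m in r0 r1 *.
set A := ln u + 2^-1 * ln d%:R in lX *.
have u1 : - `|ln u| <= ln u by rewrite lerNl -normrN ler_norm.
have u2 := normr_ge0 (ln u).
have d1 : 0 <= ln (d%:R : R) by apply: ln_nat_ge0.
case: (lerP 1 X) => [X1|X1].
  have := H m P X X1; rewrite -/K -/(partial_density P m) -/rho -/S lX => HS.
  have -> : S - 4^-1 * A * rho = (S - 2^-1 * (2^-1 * (A - ln l1%:R)) * rho) - 4^-1 * (ln l1%:R * rho) by lra.
  apply: le_trans (ler_normB _ _) _.
  have lr : 0 <= ln (l1%:R : R) * rho <= ln l1%:R by rewrite mulr_ge0 //= ler_piMr.
  rewrite (ger0_norm (_ : 0 <= 4^-1 * (ln l1%:R * rho))); last by lra.
  by nra.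
(* For X < 1 the sum is empty, and u sqrt d < l1 makes the claimed main term no larger than the
   error. *)
have K0 : K = 0 by apply/eqP; rewrite -leqn0 -ltnS -(ltr_nat R); exact: le_lt_trans t1 X1.
have -> : S = 0 by rewrite /S K0 big_geq.
have : ln X < 0 by rewrite ln_lt0 // X0.
rewrite lX sub0r normrN normrM (ger0_norm r0) => A1.
have A2 : `|4^-1 * A| <= ln l1%:R + `|ln u| by rewrite ler_norml /A in A1 *; lra.
apply: le_trans (ler_piMr (normr_ge0 _) r1) _; apply: le_trans A2 _; nra.
Qed.

Lemma main_weight_itv m : 0 <= main_weight m <= 1.
Proof.
have h p : prime p -> 0 <= (p%:R ^+ 2 / (p%:R ^+ 2 + p%:R - 1) : R) <= 1.
  move=> pp; have p1 : (1 : R) < p%:R by rewrite ltr1n prime_gt1.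
  have p2 : 0 < p%:R ^+ 2 + p%:R - 1 :> R by have : 0 <= p%:R ^+ 2 :> R := sqr_ge0 _; lra.
  by rewrite divr_ge0 ?sqr_ge0 ?(ltW p2) //= ler_pdivrMr // mul1r; lra.
apply/andP; split; first by apply: prodr_ge0 => p /andP[/h /andP[]].
apply: (@le_trans _ _ (\prod_(p < m.+1 | prime p && (odd p && (p %| m)%N)) 1)); last by rewrite big1_eq.
by apply: ler_prod => p /andP[/h].
Qed.

(** The sum of ln d over d <= D is ln D!, which is D ln D up to D, and 1/8 is half of the 1/4 of
    [square_part_asymp] because ln(sqrt d) is half of ln d. The estimate is proved with finite
    products over p < n + P0, and n then tends to infinity. *)
Lemma square_part_sum : exists2 C : R, 0 < C & forall (u : R) l1 l2 N D,
  0 < u -> (0 < l1)%N -> (0 < l2)%N -> (0 < D)%N -> u * Num.sqrt D%:R <= N%:R ->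
  `|\sum_(1 <= d < D.+1) square_part u l1 l2 N d - odd_constant * (8^-1 * (D%:R * ln D%:R) * (main_weight (l1 * l2) / Num.sqrt l1%:R))| <=
   C * (D%:R / Num.sqrt l1%:R * (1 + ln l1%:R + `|ln u|)).
Proof.
have [C C0 H] := square_part_asymp; exists (C + 1) => [|u l1 l2 N D u0 l10 l20 D0 uN]; first by rewrite addr_gt0.
set m := (l1 * l2)%N; set c : R := 8^-1 * _ * _.
have m0 : (0 < m)%N by rewrite muln_gt0 l10.
have s0 : 0 < Num.sqrt (l1%:R : R) by rewrite sqrtr_gt0 ltr0n.
set S : R := \sum_(_ <= _ < _) _; set B := (X in _ <= X).
pose P0 := (m * N + m).+1.
have key n : `|S - odd_density (n + P0) * c| <= B.
  set P := (n + P0)%N; have mNP : (m * N < P)%N by rewrite /P /P0 addnS ltnS addnCA leq_addr.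
  have mP : (m < P)%N by rewrite /P /P0 addnS ltnS !addnA leq_addl.
  set g := coprime_weight R m / Num.sqrt l1%:R.
  have H1 : `|S - \sum_(1 <= d < D.+1) g * (4^-1 * (ln u + 2^-1 * ln d%:R)) * partial_density P m| <=
      D%:R * (C / Num.sqrt l1%:R * (1 + ln l1%:R + `|ln u|)).
    rewrite /S -sumrB; apply: le_trans (ler_norm_sum _ _ _) _.
    apply: (@le_trans _ _ (\sum_(1 <= d < D.+1) (C / Num.sqrt l1%:R * (1 + ln l1%:R + `|ln u|)))).
      apply: ler_sum_nat => d /andP[d0 dD]; apply: H => //; apply: le_trans uN.
      by rewrite ler_wpM2l ?(ltW u0) // ler_wsqrtr // ler_nat -ltnS.
    by rewrite sumr_const_nat subn1 mulr_natl.
  have gpd : g * partial_density P m = odd_density P * (main_weight m / Num.sqrt l1%:R).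
    by rewrite /g mulrAC partial_density_weight ?m0 // mulrA.
  have lnf : ln D`!%:R = \sum_(1 <= d < D.+1) ln (d%:R : R).
    rewrite fact_prod natr_prod [in LHS]big_nat_cond ln_prod => [|d]; first by rewrite -big_nat_cond.
    by case/andP=> /andP[d0 _] _; rewrite ltr0n.
  have HS : \sum_(1 <= d < D.+1) g * (4^-1 * (ln u + 2^-1 * ln d%:R)) * partial_density P m =
      g * partial_density P m * (4^-1 * (D%:R * ln u) + 8^-1 * ln D`!%:R).
    rewrite lnf.
    rewrite mulrDr !mulr_sumr (_ : D%:R * ln u = \sum_(1 <= d < D.+1) ln u); last first.
      by rewrite sumr_const_nat subn1 mulr_natl.
    rewrite !mulr_sumr -big_split /=; apply: eq_bigr => d _; by field.
  have gp : 0 <= g * partial_density P m <= (Num.sqrt l1%:R)^-1.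
    have /andP[w0 w1] := coprime_weight_itv R m; have /andP[q0 q1] := partial_density_itv P m.
    have i0 : 0 <= (Num.sqrt l1%:R : R)^-1 by rewrite invr_ge0 ltW.
    rewrite mulr_ge0 ?divr_ge0 ?(ltW s0) //= /g mulrAC.
    by rewrite ler_piMl // mulr_ile1.
  have Dr : (0 : R) < D%:R by rewrite ltr0n.
  have f1 : ln D`!%:R <= D%:R * ln D%:R :> R.
    rewrite lnf (_ : D%:R * ln D%:R = \sum_(1 <= d < D.+1) ln D%:R); last by rewrite sumr_const_nat subn1 mulr_natl.
    by apply: ler_sum_nat => d /andP[d0 dD]; rewrite ler_ln ?posrE ?ltr0n // ler_nat -ltnS.
  have f2 := ln_fact_ge R D0.
  have ll : 0 <= ln (l1%:R : R) by apply: ln_nat_ge0.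
  have -> : S - odd_density P * c = (S - \sum_(1 <= d < D.+1) g * (4^-1 * (ln u + 2^-1 * ln d%:R)) * partial_density P m) +
      g * partial_density P m * (4^-1 * (D%:R * ln u) + 8^-1 * (ln D`!%:R - D%:R * ln D%:R)).
    by rewrite HS gpd /c; ring.
  apply: le_trans (ler_normD _ _) _; rewrite /B mulrDl mul1r; apply: lerD.
    apply: le_trans H1 _; rewrite le_eqVlt; apply/orP; left; apply/eqP; ring.
  rewrite normrM (ger0_norm (proj1 (andP gp))).
  have u1 : - `|ln u| <= ln u by rewrite lerNl -normrN ler_norm.
  have u2 := ler_norm (ln u).
  have [gp0 gp1] := andP gp.
  rewrite [leRHS](_ : _ = (Num.sqrt l1%:R)^-1 * (D%:R * (1 + ln l1%:R + `|ln u|))); last by rewrite [_ / _]mulrC mulrA.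
  apply: ler_pM; [exact: gp0|exact: normr_ge0|exact: gp1|].
  rewrite ler_norml.
  have v1 : D%:R * - `|ln u| <= D%:R * ln u by rewrite ler_pM2l.
  have v2 : D%:R * ln u <= D%:R * `|ln u| by rewrite ler_pM2l.
  have v3 : 0 <= D%:R * ln (l1%:R : R) by rewrite mulr_ge0 // ltW.
  lra.
apply: (cvgn_le (u := fun n => `|S - odd_density (n + P0) * c|)) => //.
apply: cvg_norm; apply: cvgB; first exact: cvg_cst.
by apply: cvgMl; rewrite cvg_shiftn; exact: odd_density_cvg.
Qed.

Lemma twisted_main : exists2 C : R, 0 < C & forall (u : R) l1 l2 D,
  0 < u -> odd l1 -> odd l2 -> squarefree l1 -> (0 < D)%N ->
  `|\sum_(1 <= d < D.+1 | flat d) (chi8 d (l1 * l2 ^ 2))%:~R * Spart (chi8 d) (u * Num.sqrt d%:R)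
    - flat_density R * odd_constant / 8 * (D%:R * ln D%:R) * (main_weight (l1 * l2) / Num.sqrt l1%:R)| <=
  C * (D%:R / Num.sqrt l1%:R * (1 + ln l1%:R + `|ln u|) + (l1 * l2 ^ 2)%:R * (1 + u) * D%:R `^ (39 / 40)).
Proof.
have [C1 C10 H1] := twisted_moment R; have [C2 C20 H2] := square_part_sum.
exists (C1 + C2) => [|u l1 l2 D u0 ol1 ol2 sf D0]; first by rewrite addr_gt0.
pose N := (Num.truncn (u * Num.sqrt (D%:R : R))).+1.
have uN : u * Num.sqrt (D%:R : R) <= N%:R by apply: ltW; rewrite truncnS_gt.
have h1 := H1 u l1 l2 D N u0 ol1 ol2 sf D0 erefl.
have h2 := H2 u l1 l2 N D u0 (odd_gt0 ol1) (odd_gt0 ol2) D0 uN.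
set T := \sum_(_ <= _ < _ | _) _ in h1 *; set S := \sum_(_ <= _ < _) _ in h1 h2.
set E1 := _ * (1 + u) * _ in h1 *; set E2 := _ / _ * _ in h2 *.
have E10 : 0 <= E1 by rewrite !mulr_ge0 ?powR_ge0 // addr_ge0 // ltW.
have E20 : 0 <= E2 by rewrite mulr_ge0 ?divr_ge0 ?sqrtr_ge0 // !addr_ge0 // ln_nat_ge0.
have -> : T - flat_density R * odd_constant / 8 * (D%:R * ln D%:R) * (main_weight (l1 * l2) / Num.sqrt l1%:R) =
  (T - flat_density R * S) + flat_density R * (S - odd_constant * (8^-1 * (D%:R * ln D%:R) * (main_weight (l1 * l2) / Num.sqrt l1%:R))) by ring.
apply: le_trans (ler_normD _ _) _; rewrite [X in _ + X]normrM (ger0_norm (ltW (flat_density_gt0 R))).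
have := ler_wpM2r (normr_ge0 (S - odd_constant * (8^-1 * (D%:R * ln D%:R) * (main_weight (l1 * l2) / Num.sqrt l1%:R)))) (flat_density_le1 R).
rewrite mul1r => h3; have := mulr_ge0 (ltW C10) E20; have := mulr_ge0 (ltW C20) E10; lra.
Qed.

End MainTerm.

(** * Expansion of the Euler product *)

Section EulerFactor.
Context (R : realType).

Lemma expR_taylor (m : nat) (x : R) : `|x| <= 1 ->
  `|expR x - \sum_(k < m) x ^+ k / k`!%:R| <= expR 1 * `|x| ^+ m.
Proof.
move=> x1; have cx := is_cvg_series_exp_coeff x; have c1 := is_cvg_series_exp_coeff (1 : R).
apply: (cvgn_le (u := fun n => `|series (exp_coeff x) (n + m) - \sum_(k < m) x ^+ k / k`!%:R|)).
  by apply: cvg_norm; apply: cvgB; [rewrite cvg_shiftn; exact: cx|exact: cvg_cst].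
move=> n; rewrite /series /= -(big_mkord xpredT (fun k => x ^+ k / k`!%:R)) (big_cat_nat (leq0n m) (leq_addl n m)) /=.
rewrite [_ + _ - _]addrC addKr; apply: le_trans (ler_norm_sum _ _ _) _.
apply: (@le_trans _ _ (\sum_(m <= k < n + m) `|x| ^+ m * (1 ^+ k / k`!%:R))).
  apply: ler_sum_nat => k /andP[mk _]; rewrite /exp_coeff /= normrM normrX (ger0_norm (_ : 0 <= k`!%:R^-1)) ?invr_ge0 // expr1n mul1r mulrC [leRHS]mulrC.
  by apply: ler_wpM2l; rewrite ?invr_ge0 // -(subnK mk) exprD ler_piMl ?exprn_ge0 // exprn_ile1.
rewrite -mulr_sumr mulrC; apply: ler_wpM2r; first exact: exprn_ge0.
have h : series (exp_coeff (1 : R)) (n + m) <= expR 1.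
  apply: nondecreasing_cvgn_le => //; apply/nondecreasing_seqP => k.
  by rewrite /series /= big_nat_recr //= lerDl /exp_coeff divr_ge0 // exprn_ge0.
apply: le_trans h; rewrite /series /= [leRHS](big_cat_nat (leq0n m) (leq_addl n m)) /= lerDr.
by apply: sumr_ge0 => k _; rewrite divr_ge0 // exprn_ge0.
Qed.

(** The contribution of the powers of p to ln P_X(chi) when chi(p) = s and N is the integer part of
    X, since Lambda(p^k) / ln(p^k) = 1/k. *)
Definition prime_log (N p : nat) (s : R) : R :=
  \sum_(1 <= k < N.+1 | (p ^ k <= N)%N) s ^+ k / (k%:R * Num.sqrt p%:R ^+ k).

Lemma prime_logE N p s : (1 < p)%N -> (0 < N)%N ->
  prime_log N p s = \sum_(k < trunc_log p N) (s / Num.sqrt p%:R) ^+ k.+1 / k.+1%:R.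
Proof.
move=> p1 N0; have p0 := ltnW p1.
have KN : (trunc_log p N <= N)%N by apply: leq_trans (trunc_logP p1 N0); apply: ltnW; exact: ltn_expl.
rewrite /prime_log big_add1 /= (big_cat_nat (leq0n _) KN) /= [X in _ + X]big_nat_cond [X in _ + X]big1 ?addr0.
  rewrite big_mkord big_mkcond /=; apply: eq_bigr => k _.
  have -> : (p ^ k.+1 <= N)%N by apply: leq_trans (trunc_logP p1 N0); rewrite leq_exp2l.
  by rewrite exprMn exprVn invfM; ring.
move=> k /andP[/andP[Kk _] h]; have := leq_trans (trunc_log_ltn N p1) (_ : _ <= p ^ k.+1)%N.
by rewrite leq_exp2l // ltnS => /(_ Kk); rewrite ltnNge h.
Qed.

Definition local_factor (N p : nat) (s : R) : R := expR (- prime_log N p s).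

Lemma inv_sqrt_prime p : prime p -> odd p ->
  [/\ 0 < (Num.sqrt p%:R)^-1 :> R, (Num.sqrt p%:R)^-1 <= 3 / 5 :> R & (Num.sqrt p%:R)^-1 ^+ 2 = p%:R^-1 :> R].
Proof.
move=> pp op; have p0 : (0 : R) < p%:R by rewrite ltr0n prime_gt0.
have p3 : (3 : R) <= p%:R by rewrite ler_nat; case: p pp op {p0} => [|[|[|]]].
have s0 : 0 < Num.sqrt (p%:R : R) by rewrite sqrtr_gt0.
have s2 := sqr_sqrtr (ltW p0); split; first by rewrite invr_gt0.
- rewrite -[leRHS]invrK lef_pV2 ?posrE ?invr_gt0 ?divr_gt0 // invf_div.
  by rewrite -(@ler_pXn2r _ 2) ?nnegrE ?(ltW s0) ?divr_ge0 // s2; lra.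
- by rewrite exprVn s2.
Qed.

(** With the complete series in the exponent the factor would be exactly 1 - s / sqrt p; stopping at
    the last power p^K <= N changes it by the order of the first omitted term. *)
Lemma local_factor_bound N p (s : R) : prime p -> odd p -> (p <= N)%N -> `|s| <= 1 ->
  `|local_factor N p s - (1 - s * (Num.sqrt p%:R)^-1)| <= 4 * expR 1 * (Num.sqrt p%:R)^-1 ^+ (trunc_log p N).+1.
Proof.
move=> pp op pN s1; have [] := inv_sqrt_prime pp op; set y := (Num.sqrt p%:R)^-1 => y0 y1 y2.
set K := trunc_log p N; have N0 : (0 < N)%N by apply: leq_trans pN; exact: prime_gt0.
have K1 : (0 < K)%N by rewrite trunc_log_gt0 prime_gt1 // -ltnS prednK ?prime_gt0.
have sy : `|s * y| <= y by rewrite normrM (gtr0_norm y0) ler_piMl // ltW.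
have := @ln_series_bound R K (s * y); rewrite -prime_logE ?prime_gt1 // => /(_ (le_lt_trans sy _)) H.
(* 5/2 is 1 / (1 - 3/5), where 3/5 bounds 1 / sqrt p for p >= 3. *)
have {H} : `|ln (1 - s * y) + prime_log N p s| <= 5 / 2 * y ^+ K.+1.
  apply: (le_trans (H _)); first lra.
  rewrite mulrC; apply: ler_pM; rewrite ?invr_ge0 ?exprn_ge0 //; first lra.
    rewrite -[leRHS]invrK invf_div lef_pV2 ?posrE; lra.
  by apply: lerXn2r; rewrite ?nnegrE // ltW.
set t := ln _ + _ => Ht.
have yK : y ^+ K.+1 <= y ^+ 2 by apply: ler_wiXn2l; lra || by rewrite ltnS.
have t1 : `|t| <= 1 by nra.
have FE : local_factor N p s = (1 - s * y) * expR (- t).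
  rewrite /local_factor (_ : - prime_log N p s = ln (1 - s * y) - t); last by rewrite /t; ring.
  by rewrite expRD lnK // posrE; move: sy; rewrite ler_norml => /andP[]; lra.
have := @expR_taylor 1 (- t); rewrite normrN big_ord1 expr0 expr1 divr1 => /(_ t1) Ht1.
rewrite FE -{2}[1 - s * y]mulr1 -mulrBr normrM.
have -> : 4 * expR 1 * y ^+ K.+1 = (8 / 5) * (expR 1 * (5 / 2 * y ^+ K.+1)) :> R by field.
apply: ler_pM => //; first by move: sy; rewrite !ler_norml => /andP[]; lra.
by apply: le_trans Ht1 _; rewrite ler_pM2l ?expR_gt0.
Qed.

(* local_factor N p s = 1 + coef1 s + coef2 s^2 for s = 0, 1, -1 and odd p. The
   coefficients vanish at p = 2, where chi8 d is 0. *)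
Definition coef1 (N p : nat) : R := if odd p then (local_factor N p 1 - local_factor N p (-1)) / 2 else 0.
Definition coef2 (N p : nat) : R := if odd p then (local_factor N p 1 + local_factor N p (-1)) / 2 - 1 else 0.

Lemma coef_bound N p : prime p -> odd p -> (p <= N)%N ->
  `|coef1 N p + (Num.sqrt p%:R)^-1| <= 4 * expR 1 * (Num.sqrt p%:R)^-1 ^+ (trunc_log p N).+1 /\
  `|coef2 N p| <= 4 * expR 1 * (Num.sqrt p%:R)^-1 ^+ (trunc_log p N).+1.
Proof.
move=> pp op pN; rewrite /coef1 /coef2 op.
have := @local_factor_bound N p 1 pp op pN; rewrite normr1 => /(_ (lexx _)); rewrite ler_norml.
have := @local_factor_bound N p (-1) pp op pN; rewrite normrN1 => /(_ (lexx _)); rewrite ler_norml.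
by move=> /andP[h1 h2] /andP[h3 h4]; rewrite !ler_norml; split; apply/andP; split; lra.
Qed.

Lemma expR1_le4 : expR 1 <= 4 :> R.
Proof.
have h := @expR_ge1Dx R (- 2^-1); have e0 := expR_gt0 (2^-1 : R).
rewrite (_ : 1 = 2^-1 + 2^-1) ?expRD; last by field.
have : expR (2^-1 : R) <= 2.
  by rewrite -[leLHS]invrK -expRN -[leRHS]invrK lef_pV2 ?posrE ?expR_gt0 //; lra.
by nra.
Qed.

Lemma coef1_le N p : prime p -> (p <= N)%N -> `|coef1 N p| <= 16 * (Num.sqrt p%:R)^-1.
Proof.
move=> pp pN; case op: (odd p); last by rewrite /coef1 op normr0 mulr_ge0 // invr_ge0 sqrtr_ge0.
have [h _] := coef_bound pp op pN; have [] := inv_sqrt_prime pp op; move: h; set y := (Num.sqrt p%:R)^-1 => h y0 y1 y2.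
have K1 : (0 < trunc_log p N)%N by rewrite trunc_log_gt0 prime_gt1 // -ltnS prednK ?prime_gt0.
have yK : y ^+ (trunc_log p N).+1 <= y ^+ 2 by apply: ler_wiXn2l; lra || by rewrite ltnS.
have e4 := expR1_le4; have e0 := expR_gt0 (1 : R).
have h2 : 4 * expR 1 * y ^+ (trunc_log p N).+1 <= 16 * (y * (3 / 5)).
  apply: (@le_trans _ _ (16 * y ^+ 2)); last by rewrite ler_pM2l // expr2 ler_pM2l.
  have : 0 <= y ^+ (trunc_log p N).+1 by apply: exprn_ge0; lra.
  by nra.
by move: h; rewrite !ler_norml => /andP[]; lra.
Qed.

Lemma coef2_le N p : prime p -> (p <= N)%N -> `|coef2 N p| <= 16 * p%:R^-1.
Proof.
move=> pp pN; case op: (odd p); last by rewrite /coef2 op normr0 mulr_ge0 // invr_ge0.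
have [_ h] := coef_bound pp op pN; have [] := inv_sqrt_prime pp op; move: h; set y := (Num.sqrt p%:R)^-1 => h y0 y1 <-.
have K1 : (0 < trunc_log p N)%N by rewrite trunc_log_gt0 prime_gt1 // -ltnS prednK ?prime_gt0.
have yK : y ^+ (trunc_log p N).+1 <= y ^+ 2 by apply: ler_wiXn2l; lra || by rewrite ltnS.
have e4 := expR1_le4; have e0 := expR_gt0 (1 : R).
have : 0 <= y ^+ (trunc_log p N).+1 by apply: exprn_ge0; lra.
by move=> ?; apply: (le_trans h); nra.
Qed.

(** The local factor of [main_coefficient] multiplied by that of [odd_density], as
    [main_coefficient_factor] shows. *)
Definition main_factor (N p : nat) : R :=
  (1 - (p%:R * (p%:R + 1))^-1) + (coef1 N p / Num.sqrt p%:R + coef2 N p) * (p%:R / (p%:R + 1)).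

(* If p^2 > N, only the first power of p occurs in P_X, and main_factor is
   1 - 1/(2p) + O(1/p^2) instead of close to 1 - 1/p. *)
Definition sieve_factor (N p : nat) : R :=
  if (p ^ 2 <= N)%N then 1 - p%:R^-1 else Num.sqrt (1 - p%:R^-1).

Lemma main_factor_small N p : prime p -> odd p -> (p ^ 2 <= N)%N ->
  `|main_factor N p - (1 - p%:R^-1)| <= 32 * (Num.sqrt p%:R)^-1 ^+ (trunc_log p N).+1.
Proof.
move=> pp op pN; have p0 : (0 : R) < p%:R by rewrite ltr0n prime_gt0.
have pN1 : (p <= N)%N by apply: leq_trans pN; rewrite leq_pmulr // prime_gt0.
have [] := coef_bound pp op pN1; have [] := inv_sqrt_prime pp op; rewrite /main_factor; set y := (Num.sqrt p%:R)^-1.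
set e := _ ^+ (trunc_log p N).+1; set a := coef1 N p; set b := coef2 N p => y0 y1 y2 ha hb.
have e0 : 0 <= e by apply: exprn_ge0; lra.
have -> : 1 - (p%:R * (p%:R + 1))^-1 + (a * y + b) * (p%:R / (p%:R + 1)) - (1 - p%:R^-1) =
   ((a + y) * y + b) * (p%:R / (p%:R + 1)).
  rewrite (_ : (a + y) * y + b = a * y + b + p%:R^-1); last by rewrite -y2; ring.
  by field; apply/andP; split; lra.
rewrite normrM; have h : `|p%:R / (p%:R + 1)| <= 1 :> R.
  by rewrite ger0_norm ?divr_ge0 ?addr_ge0 ?(ltW p0) // ler_pdivrMr; lra.
apply: le_trans (ler_piMr (normr_ge0 _) h) _; apply: le_trans (ler_normD _ _) _.
rewrite normrM (gtr0_norm y0).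
have e4 : 4 * expR 1 * e <= 16 * e by apply: ler_wpM2r => //; have := expR1_le4; lra.
have : `|a + y| * y <= (16 * e) * (3 / 5) by apply: ler_pM => //; [exact: ltW|exact: le_trans e4].
by lra.
Qed.

(** Here the local factor is exp(-s y) with y = 1 / sqrt p, so the two coefficients are -sinh y and
    cosh y - 1. Expansion to fourth order gives 1 - y^2 / 2 + O(y^4), which agrees with the square
    root of 1 - y^2. *)
Lemma main_factor_large N p : prime p -> odd p -> (p <= N < p ^ 2)%N ->
  `|main_factor N p - Num.sqrt (1 - p%:R^-1)| <= 32 * (p%:R^-1) ^+ 2.
Proof.
move=> pp op /andP[pN Np]; have p0 : (0 : R) < p%:R by rewrite ltr0n prime_gt0.
have N0 : (0 < N)%N by apply: leq_trans pN; exact: prime_gt0.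
have K1 : trunc_log p N = 1%N by apply: trunc_log_eq; rewrite ?prime_gt1 // expn1 pN.
have [] := inv_sqrt_prime pp op; rewrite /main_factor /coef1 /coef2 op /local_factor !prime_logE ?prime_gt1 // K1 !big_ord1 !expr1 !divr1 mul1r mulN1r.
set y := (Num.sqrt p%:R)^-1 => y0 y1 y2.
have e4 := expR1_le4; have e0 := expR_gt0 (1 : R).
have T (x : R) : `|x| <= 1 -> `|expR x - (1 + x + x ^+ 2 / 2 + x ^+ 3 / 6)| <= expR 1 * `|x| ^+ 4.
  move/(expR_taylor 4); rewrite (_ : \sum_(k < 4) _ = 1 + x + x ^+ 2 / 2 + x ^+ 3 / 6) //.
  by rewrite !big_ord_recr big_ord0 /= !factS fact0; field.
have := T (- y); have := T y; rewrite normrN gtr0_norm // opprK => /(_ _) h1 /(_ _) h2.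
have {}h1 := h1 (ltac:(lra)); have {}h2 := h2 (ltac:(lra)).
have -> : (p%:R : R) = (y ^+ 2)^-1 by rewrite y2 invrK.
rewrite invrK.
have -> : (1 - ((y ^+ 2)^-1 * ((y ^+ 2)^-1 + 1))^-1 + ((expR (- y) - expR y) / 2 * y + ((expR (- y) + expR y) / 2 - 1)) * ((y ^+ 2)^-1 / ((y ^+ 2)^-1 + 1))) =
  1 - y ^+ 2 / 2 + ((expR (- y) - expR y) / 2 * y + ((expR (- y) + expR y) / 2 - 1) + y ^+ 2 / 2 - y ^+ 4 / 2) / (1 + y ^+ 2).
  field; have : 0 < y ^+ 2 by rewrite exprn_gt0.
  by move=> ?; apply/andP; split; lra.
set w := Num.sqrt _; set A := _ + y ^+ 2 / 2 - _.
have z0 : 0 < y ^+ 2 by rewrite exprn_gt0.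
have z1 : y ^+ 2 <= 9 / 25 by nra.
have z4 : (y ^+ 2) ^+ 2 = y ^+ 4 by rewrite -exprM.
have A1 : `|A| <= 8 * y ^+ 4.
  have h4 : expR 1 * y ^+ 4 <= 4 * y ^+ 4 by apply: ler_wpM2r; [rewrite -z4 sqr_ge0|lra].
  move: h1 h2 => /le_trans/(_ h4) h1 /le_trans/(_ h4) h2.
  rewrite /A; set r1 := expR y - _ in h1; set r2 := expR (- y) - _ in h2.
  have -> : (expR (- y) - expR y) / 2 * y + ((expR (- y) + expR y) / 2 - 1) + y ^+ 2 / 2 - y ^+ 4 / 2 =
    - (2 / 3) * y ^+ 4 + ((r2 - r1) * y + (r1 + r2)) / 2 by rewrite /r1 /r2; field.
  have h3 : `|(r2 - r1) * y| <= (8 * y ^+ 4) * (3 / 5).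
    rewrite normrM (gtr0_norm y0); apply: ler_pM => //; first exact: ltW.
    by apply: le_trans (ler_normB _ _) _; lra.
  move: h1 h2 h3; rewrite !ler_norml => /andP[? ?] /andP[? ?] /andP[? ?]; apply/andP; split; lra.
have A2 : `|A / (1 + y ^+ 2)| <= 8 * y ^+ 4.
  apply: le_trans A1; rewrite normrM ler_piMr // ger0_norm ?invr_ge0 ?invf_le1; lra.
have w0 : 0 <= w := sqrtr_ge0 _.
have w2 : w ^+ 2 = 1 - y ^+ 2 by rewrite sqr_sqrtr //; lra.
rewrite z4; move: (y ^+ 2) (y ^+ 4) z0 z1 z4 A2 w2 => z _ z0 z1 <- A2 w2.
have w3 : w <= 1 - z / 2 by rewrite -(@ler_pXn2r _ 2) ?nnegrE //; [rewrite w2; nra|lra].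
have w4 : 1 - z / 2 - z ^+ 2 <= w.
  by rewrite -(@ler_pXn2r _ 2) ?nnegrE //; [rewrite w2; nra|nra].
by move: A2; rewrite !ler_norml => /andP[? ?]; apply/andP; split; nra.
Qed.

(** The exponents are balanced at p^3 ~ N, the worst case: there p^(-3/2) = N^(-1/12) p^(-5/4). The
    power of N makes the total deviation tend to 0, and 5/4 > 1 makes it summable over p. *)
Lemma main_factor_approx N p : prime p -> odd p -> (p <= N)%N ->
  `|main_factor N p - sieve_factor N p| <= 32 * (N%:R `^ (- 12^-1) * p%:R `^ (- (5 / 4))).
Proof.
move=> pp op pN; have p0 : (0 : R) < p%:R by rewrite ltr0n prime_gt0.
have N0 : (0 < N)%N by apply: leq_trans pN; exact: prime_gt0.
have Nr : (0 : R) < N%:R by rewrite ltr0n.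
have lp : 0 < ln (p%:R : R) by rewrite ln_gt0 // ltr1n prime_gt1.
rewrite !powR_expR // -expRD /sieve_factor.
have lnN k : (N <= p ^ k)%N -> ln (N%:R : R) <= k%:R * ln p%:R.
  by move=> h; rewrite mulr_natl -lnXn // ler_ln ?posrE ?exprn_gt0 // -natrX ler_nat.
case: leqP => h.
  apply: le_trans (main_factor_small pp op h) _; rewrite ler_pM2l //.
  set K := trunc_log p N.
  have K2 : (2 <= K)%N by apply: trunc_log_max => //; exact: prime_gt1.
  have -> : (Num.sqrt (p%:R : R))^-1 = expR (- 2^-1 * ln p%:R).
    rewrite -powR_expR // powRN powR12_sqrt // ltW //.
  rewrite -expRM_natl ler_expR.
  have := lnN _ (ltnW (trunc_log_ltn N (prime_gt1 pp))); rewrite -/K => lN.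
  have K3 : (3 : R) <= K.+1%:R by rewrite ler_nat.
  by have := ler_wpM2r (ltW lp) K3; lra.
apply: le_trans (main_factor_large pp op _) _; first by rewrite pN.
rewrite ler_pM2l // (_ : p%:R^-1 = expR (- ln p%:R)); last by rewrite expRN lnK.
rewrite -expRM_natl ler_expR; have := lnN _ (ltnW h); lra.
Qed.

End EulerFactor.

(** * Expansion of 1 / P_X into values of the character *)

Section EulerExpansion.
Context (R : realType).

Lemma prime_powerE n q : primes n = [:: q] -> n = (q ^ logn q n)%N.
Proof.
move=> h; have n0 : (0 < n)%N by case: n h.
by rewrite {1}(prod_prime_decomp n0) prime_decompE h big_seq1.
Qed.

Lemma prime_power_sum (g : nat -> R) N :
  (forall n, size (primes n) != 1%N -> g n = 0) ->
  \sum_(2 <= n < N.+1) g n = \sum_(p < N.+1 | prime p) \sum_(1 <= k < N.+1 | (p ^ k <= N)%N) g (p ^ k)%N.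
Proof.
move=> g0; rewrite [RHS](eq_bigr (fun p : 'I_N.+1 => \sum_(2 <= n < N.+1) \sum_(1 <= k < N.+1 | n == (p ^ k)%N) g n)); last first.
  move=> p pp; rewrite [RHS](exchange_big_dep xpredT) //= [LHS]big_mkcond /= [LHS]big_nat_cond [RHS]big_nat_cond.
  apply: eq_bigr => k /andP[/andP[k1 kN] _].
  rewrite (big_nat1_eq _ g) ltnS (leq_trans (prime_gt1 pp)) //.
  by rewrite -{1}(expn1 p) leq_exp2l ?prime_gt1.
rewrite exchange_big /= big_nat_cond [RHS]big_nat_cond; apply: eq_bigr => n /andP[/andP[n2 nN] _].
case: (eqVneq (size (primes n)) 1%N) => [|h]; last first.
  by rewrite g0 // big1 // => p _; rewrite big1.
case Ep: (primes n) => [|q [|]] // _; have nE := prime_powerE Ep; set e := logn q n in nE.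
have qn : q \in primes n by rewrite Ep mem_head.
have [pq n0 qdn] : [/\ prime q, (0 < n)%N & (q %| n)%N] by move: qn; rewrite mem_primes => /and3P.
have qN : (q < N.+1)%N by apply: leq_ltn_trans (dvdn_leq n0 qdn) nN.
have e0 : (0 < e)%N by rewrite /e logn_gt0.
rewrite (bigD1 (Ordinal qN)) //= [X in _ + X]big1 ?addr0 => [|p /andP[pp np]].
  rewrite [in RHS](eq_bigl (fun k => k == e)) => [|k]; last by rewrite nE eqn_exp2l ?prime_gt1 // eq_sym.
  rewrite (big_nat1_eq _ (fun=> g n)) e0 ltnS /=.
  suff -> : (e <= N)%N by [].
  by apply: leq_trans (ltnW (ltn_expl e (prime_gt1 pq))) _; rewrite -nE -ltnS.
rewrite big_nat_cond big1 // => k /andP[/andP[k0 _] /eqP nk].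
have : (p : nat) \in primes n by rewrite nk primesX // primes_prime // mem_head.
by rewrite Ep inE => /eqP pq'; move: np; rewrite -val_eqE /= pq' eqxx.
Qed.

Lemma chi8_exp d p k : (0 < d)%N -> (0 < k)%N -> chi8 d (p ^ k) = chi8 d p ^+ k.
Proof.
move=> d0; case: k => // k _; elim: k => [|k IH] //.
by rewrite expnS chi8_mul // IH [RHS]exprS.
Qed.

Lemma euler_product_log (X : R) d : (0 < d)%N ->
  euler_product X (chi8 d) = \prod_(p < (Num.truncn X).+1 | prime p) expR (@prime_log R (Num.truncn X) p (chi8 d p)%:~R).
Proof.
move=> d0; rewrite /euler_product -expR_sum prime_power_sum; last first.
  move=> n h; rewrite /von_mangoldt; case: (primes n) h => [|q [|]] //= *; rewrite !mul0r //.
congr expR; apply: eq_bigr => p pp; rewrite /prime_log big_nat_cond [RHS]big_nat_cond.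
apply: eq_bigr => k /andP[/andP[k0 _] _]; rewrite /von_mangoldt primesX // primes_prime // chi8_exp // rmorphXn /=.
have p1 : (1 : R) < p%:R by rewrite ltr1n prime_gt1.
have lp : 0 < ln (p%:R : R) by rewrite ln_gt0.
have s0 : 0 < Num.sqrt (p%:R : R) by rewrite sqrtr_gt0; lra.
have k1 : (0 : R) < k%:R by rewrite ltr0n.
rewrite natrX powR12_sqrt ?exprn_ge0 // lnXn; last lra.
have -> : Num.sqrt ((p%:R : R) ^+ k) = Num.sqrt p%:R ^+ k.
  by rewrite -{1}(sqr_sqrtr (ler0n R p)) -exprM mulnC exprM sqrtr_sqr ger0_norm // exprn_ge0 // ltW.
have : 0 < Num.sqrt (p%:R : R) ^+ k by rewrite exprn_gt0.
rewrite -[ln _ *+ k]mulr_natl; move: (Num.sqrt _ ^+ k) (ln _) lp => a b b0 a0.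
by field; rewrite !gt_eqF.
Qed.

Lemma euler_product_inv (X : R) d : (0 < d)%N ->
  (euler_product X (chi8 d))^-1 = \prod_(p < (Num.truncn X).+1 | prime p)
    (1 + coef1 R (Num.truncn X) p * (chi8 d p)%:~R + coef2 R (Num.truncn X) p * (chi8 d p)%:~R ^+ 2).
Proof.
move=> d0; rewrite euler_product_log // -prodfV; apply: eq_bigr => p pp; rewrite -expRN -/(local_factor _ _ _).
set N := Num.truncn X; rewrite /coef1 /coef2.
have F0 : @local_factor R N p 0 = 1.
  rewrite /local_factor /prime_log big_nat_cond big1 ?oppr0 ?expR0 // => k /andP[/andP[k0 _] _].
  by rewrite expr0n gtn_eqF // mul0r.
case: (boolP (odd p)) => op; last first.
  by rewrite chi8_even ?prime_gt0 // F0 !mul0r !addr0.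
have := kronecker_prime_val (8 * d)%N%:Z p; rewrite -(kronecker_primeP _ pp) -/(chi8 d p) !inE => /or3P[]/eqP ->.
- by rewrite F0 expr0n !mulr0 !addr0.
- by rewrite expr1n; field.
- by rewrite (_ : (-1)%:~R = (-1 : R)) // sqrrN expr1n; field.
Qed.

(* The coefficient of chi(p)^j in the factor at p. A non-prime p only admits
   j = 0. *)
Definition coef (N p : nat) (j : 'I_3) : R :=
  if prime p then [:: 1; coef1 R N p; coef2 R N p]`_j else (j == ord0)%:R.

Definition expansion_weight N (f : {ffun 'I_N.+1 -> 'I_3}) : R := \prod_(p < N.+1) coef N p (f p).
(* Choosing the exponent f p at each p gives chi (simple_part f * double_part f ^ 2). *)
Definition simple_part N (f : {ffun 'I_N.+1 -> 'I_3}) : nat := \prod_(p < N.+1 | f p == 1%N :> nat) p.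
Definition double_part N (f : {ffun 'I_N.+1 -> 'I_3}) : nat := \prod_(p < N.+1 | f p == 2%N :> nat) p.

Lemma euler_expansion (X : R) d : (0 < d)%N ->
  (euler_product X (chi8 d))^-1 = \sum_(f : {ffun 'I_(Num.truncn X).+1 -> 'I_3})
    expansion_weight f * (chi8 d (simple_part f * double_part f ^ 2))%:~R.
Proof.
move=> d0; rewrite euler_product_inv //; set N := Num.truncn X.
transitivity (\prod_(p < N.+1) \sum_(j < 3) coef N p j * (chi8 d p)%:~R ^+ j).
  rewrite big_mkcond; apply: eq_bigr => p _; rewrite !big_ord_recr big_ord0 /coef /=.
  by case: ifP => pp; rewrite ?expr0 ?expr1 ?mulr1 ?mul0r ?add0r ?addr0.
rewrite bigA_distr_bigA; apply: eq_bigr => f _; rewrite big_split; congr (_ * _).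
have chi1 : chi8 d 1 = 1 by exact: kronecker1.
rewrite chi8_mul // chi8_exp // /simple_part /double_part !(big_morph (chi8 d) (fun m n => chi8_mul m n d0) chi1).
have -> : \prod_(i < N.+1 | f i == 1%N :> nat) chi8 d i * (\prod_(i < N.+1 | f i == 2%N :> nat) chi8 d i) ^+ 2 =
  \prod_(i < N.+1) chi8 d i ^+ f i.
  rewrite -prodrXl [X in X * _]big_mkcond [X in _ * X]big_mkcond -big_split /=; apply: eq_bigr => p _.
  by case: (f p) => [[|[|[|]]]] //= _; rewrite ?expr0 ?expr1 ?mulr1 ?mul1r.
by rewrite rmorph_prod; apply: eq_bigr => p _; rewrite rmorphXn.
Qed.

Lemma squarefree_prime_prod B (P : pred 'I_B) : (forall p, P p -> prime p) -> squarefree (\prod_(p < B | P p) p).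
Proof.
move=> H; have M0 : (0 < \prod_(p < B | P p) p)%N by apply: prodn_cond_gt0 => p /H; exact: prime_gt0.
apply/(squarefreeP M0) => e eM; have e0 : (0 < e)%N by case: e eM => //; rewrite dvd0n gtn_eqF.
apply/eqP/negPn/negP => e1; have pq : prime (pdiv e) by apply: pdiv_prime; rewrite ltn_neqAle eq_sym e1.
have qM : (pdiv e ^ 2 %| \prod_(p < B | P p) p)%N by apply: dvdn_trans eM; rewrite dvdn_exp2r // pdiv_dvd.
move: (pdiv e) pq qM => q pq qM {e eM e0 e1}.
have : (q %| \prod_(p < B | P p) p)%N by apply: dvdn_trans qM; exact: dvdn_mulr.
rewrite Euclid_dvd_prod // big_orE => /exists_inP[p Pp]; rewrite dvdn_prime2 ?H // => /eqP qp.
move: qM; rewrite (bigD1 p) //= -qp expnS expn1 dvdn_pmul2l ?prime_gt0 // Euclid_dvd_prod // big_orE.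
case/exists_inP => p' /andP[Pp' np']; rewrite dvdn_prime2 ?H // => /eqP qp'.
by move: np'; rewrite -val_eqE /= -qp' -qp eqxx.
Qed.

Lemma expansion_support N (f : {ffun 'I_N.+1 -> 'I_3}) : expansion_weight f != 0 ->
  forall p, f p != ord0 -> prime p && odd p.
Proof.
move=> w p fp; have : coef N p (f p) != 0.
  by apply: contraNneq w => c0; rewrite /expansion_weight (bigD1 p) //= c0 mul0r.
rewrite /coef; case: (boolP (prime p)) => pp /=; last by rewrite (negPf fp) eqxx.
apply: contraNT => op; move: fp; rewrite /coef1 /coef2 (negPf op).
by case: (f p) => [[|[|[|]]]] //= *; rewrite eqxx.
Qed.

Section Support.
Context (N : nat) (f : {ffun 'I_N.+1 -> 'I_3}) (w : expansion_weight f != 0).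

Let supp p (j : nat) : j != 0%N -> f p == j :> nat -> prime p && odd p.
Proof. by move=> j0 /eqP fj; apply: (expansion_support w); rewrite -val_eqE /= fj. Qed.

Lemma simple_part_odd : odd (simple_part f).
Proof. by apply: (big_ind odd) => // [m n|p /supp /andP[]] //; rewrite oddM => -> ->. Qed.

Lemma double_part_odd : odd (double_part f).
Proof. by apply: (big_ind odd) => // [m n|p /supp /andP[]] //; rewrite oddM => -> ->. Qed.

Lemma simple_part_squarefree : squarefree (simple_part f).
Proof. by apply: squarefree_prime_prod => p /supp /andP[]. Qed.

Lemma prime_dvd_parts q : prime q -> (q %| simple_part f * double_part f)%N = [exists p : 'I_N.+1, (f p != ord0) && (p == q :> nat)].
Proof.
move=> pq; rewrite Euclid_dvdM // !Euclid_dvd_prod // !big_orE; apply/idP/existsP.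
  case/orP=> /exists_inP[p fp].
    have /andP[pp _] := supp (isT : 1%N != 0%N) fp; rewrite dvdn_prime2 // => /eqP ->.
    by exists p; rewrite eqxx andbT -val_eqE /= (eqP fp).
  have /andP[pp _] := supp (isT : 2%N != 0%N) fp; rewrite dvdn_prime2 // => /eqP ->.
  by exists p; rewrite eqxx andbT -val_eqE /= (eqP fp).
case=> p /andP[fp /eqP <-]; apply/orP.
case Ef: (f p) fp => [[|[|[|]]] h] // _; [left|right]; apply/exists_inP; exists p; by rewrite ?Ef ?dvdnn.
Qed.

Lemma main_weight_parts : main_weight R (simple_part f * double_part f) =
  \prod_(p < N.+1) (if f p == ord0 then 1 else p%:R ^+ 2 / (p%:R ^+ 2 + p%:R - 1)).
Proof.
set m := (_ * _)%N; have m0 : (0 < m)%N by rewrite muln_gt0 !odd_gt0 ?simple_part_odd ?double_part_odd.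
pose v (p : nat) : R := p%:R ^+ 2 / (p%:R ^+ 2 + p%:R - 1).
have mB : (0 < m < m.+1 + N.+1)%N by rewrite m0 ltn_addr.
rewrite /main_weight (prod_dvd_ext v mB) -(big_mkord (fun p => [&& prime p, odd p & (p %| m)%N]) v).
rewrite (big_cat_nat (leq0n N.+1) (leq_addl _ _)) /= [X in _ * X]big_nat_cond [X in _ * X]big1 ?mulr1; last first.
  move=> p /andP[/andP[Np _] /and3P[pp _]]; rewrite prime_dvd_parts // => /existsP[p' /andP[_ /eqP pE]].
  by move: (ltn_ord p'); rewrite pE ltnNge Np.
rewrite big_mkord big_mkcond; apply: eq_bigr => p _ /=.
case: (eqVneq (f p) ord0) => fp.
  rewrite ifF //; apply/and3P => -[pp _]; rewrite prime_dvd_parts // => /existsP[p' /andP[fp' /eqP/val_inj pE]].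
  by move: fp'; rewrite pE fp eqxx.
have /andP[pp op] := expansion_support w fp.
by rewrite pp op prime_dvd_parts //= ifT //; apply/existsP; exists p; rewrite fp eqxx.
Qed.

End Support.

Lemma simple_part_morph (h : nat -> R) N (f : {ffun 'I_N.+1 -> 'I_3}) : h 1%N = 1 -> {morph h : m n / (m * n)%N >-> m * n} ->
  h (simple_part f) = \prod_(p < N.+1) (if f p == 1%N :> nat then h p else 1).
Proof. by move=> h1 hM; rewrite /simple_part (big_morph h hM h1) big_mkcond. Qed.

Lemma double_part_morph (h : nat -> R) N (f : {ffun 'I_N.+1 -> 'I_3}) : h 1%N = 1 -> {morph h : m n / (m * n)%N >-> m * n} ->
  h (double_part f) = \prod_(p < N.+1) (if f p == 2%N :> nat then h p else 1).
Proof. by move=> h1 hM; rewrite /double_part (big_morph h hM h1) big_mkcond. Qed.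

Lemma expansion_sum N (g : nat -> 'I_3 -> R) :
  \sum_(f : {ffun 'I_N.+1 -> 'I_3}) expansion_weight f * \prod_(p < N.+1) g p (f p) =
  \prod_(p < N.+1) \sum_(j < 3) coef N p j * g p j.
Proof. by rewrite bigA_distr_bigA; apply: eq_bigr => f _; rewrite big_split. Qed.

Lemma expansion_sum_norm N (g : nat -> 'I_3 -> R) :
  \sum_(f : {ffun 'I_N.+1 -> 'I_3}) `|expansion_weight f| * \prod_(p < N.+1) g p (f p) =
  \prod_(p < N.+1) \sum_(j < 3) `|coef N p j| * g p j.
Proof. by rewrite bigA_distr_bigA; apply: eq_bigr => f _; rewrite big_split normr_prod. Qed.

Let sqrt_nat (n : nat) : R := Num.sqrt n%:R.
Let sqrt_natM : {morph sqrt_nat : m n / (m * n)%N >-> m * n}.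
Proof. by move=> m n; rewrite /sqrt_nat natrM sqrtrM. Qed.

Lemma expansion_main N : \sum_(f : {ffun 'I_N.+1 -> 'I_3})
    expansion_weight f * (main_weight R (simple_part f * double_part f) / Num.sqrt (simple_part f)%:R) =
  \prod_(p < N.+1 | prime p && odd p) (1 + (coef1 R N p / Num.sqrt p%:R + coef2 R N p) * (p%:R ^+ 2 / (p%:R ^+ 2 + p%:R - 1))).
Proof.
pose g (p : nat) (j : 'I_3) : R := (if j == ord0 then 1 else p%:R ^+ 2 / (p%:R ^+ 2 + p%:R - 1)) * (if j == 1%N :> nat then Num.sqrt p%:R else 1)^-1.
transitivity (\sum_(f : {ffun 'I_N.+1 -> 'I_3}) expansion_weight f * \prod_(p < N.+1) g p (f p)).
  apply: eq_bigr => f _; case: (eqVneq (expansion_weight f) 0) => [->|w]; first by rewrite !mul0r.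
  rewrite main_weight_parts // -/(sqrt_nat _) (@simple_part_morph sqrt_nat) ?/sqrt_nat ?sqrtr1 //.
  by rewrite -prodfV -big_split.
rewrite expansion_sum big_mkcondr [RHS]big_mkcond /=; apply: eq_bigr => p _.
rewrite !big_ord_recr big_ord0 /coef /g /= /coef1 /coef2.
case: (prime p); rewrite /= ?invr1 ?mulr1 ?mul0r ?add0r ?addr0 //.
case: (odd p); rewrite /= ?mul0r ?addr0 //.
ring.
Qed.

(** If c is the number of primes in [simple_part f], its logarithm is at most c ln N, and 1 + c <=
    e^c; a factor e for each prime makes the sum multiplicative. The exponent 80 = 64 + 16 comes
    from the bounds 16 for [coef1] and [coef2], the former multiplied by e <= 4. *)
Lemma expansion_log_bound N : (0 < N)%N -> \sum_(f : {ffun 'I_N.+1 -> 'I_3})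
    `|expansion_weight f| * ((1 + ln (simple_part f)%:R) / Num.sqrt (simple_part f)%:R) <=
  (1 + ln N%:R) * (prime_sieve R N)^-1 ^+ 80.
Proof.
move=> N0; pose g (p : nat) (j : 'I_3) : R := if j == 1%N :> nat then expR 1 / Num.sqrt p%:R else 1.
have g0 p j : 0 <= g p j by rewrite /g; case: ifP => // _; rewrite divr_ge0 ?expR_ge0 ?sqrtr_ge0.
have lN : 0 <= ln (N%:R : R) by exact: ln_nat_ge0.
apply: (@le_trans _ _ ((1 + ln N%:R) * \sum_(f : {ffun 'I_N.+1 -> 'I_3}) `|expansion_weight f| * \prod_(p < N.+1) g p (f p))).
  rewrite mulr_sumr; apply: ler_sum => f _; rewrite [leRHS]mulrCA.
  case: (eqVneq (expansion_weight f) 0) => [->|w]; first by rewrite normr0 !mul0r.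
  rewrite ler_wpM2l //.
  pose c : R := \sum_(p < N.+1) (f p == 1%N :> nat)%:R.
  have gE : \prod_(p < N.+1) g p (f p) = expR c / Num.sqrt (simple_part f)%:R.
    rewrite -/(sqrt_nat _) (@simple_part_morph sqrt_nat) ?/sqrt_nat ?sqrtr1 //.
    rewrite /c expR_sum -prodfV -big_split /=; apply: eq_bigr => p _.
    by rewrite /g; case: eqP => _; rewrite ?expR0 ?invr1 ?mulr1.
  rewrite gE mulrA; apply: ler_wpM2r; first by rewrite invr_ge0 sqrtr_ge0.
  have c0 : 0 <= c by apply: sumr_ge0.
  have lc : ln (simple_part f)%:R <= ln N%:R * c.
    rewrite /simple_part natr_prod ln_prod => [|p /eqP fp]; last first.
      have /andP[pp _] : prime p && odd p by apply: (expansion_support w); rewrite -val_eqE /= fp.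
      by rewrite ltr0n prime_gt0.
    rewrite big_mkcond /c mulr_sumr; apply: ler_sum => p _; case: ifP => [/eqP fp|_]; last by rewrite mulr0.
    have /andP[pp _] : prime p && odd p by apply: (expansion_support w); rewrite -val_eqE /= fp.
    by rewrite mulr1n mulr1; apply: ler_ln_nat; rewrite ?prime_gt0 // -ltnS.
  have := expR_ge1Dx c; nra.
have l1 : 0 < 1 + ln (N%:R : R) by lra.
rewrite ler_pM2l // expansion_sum_norm /prime_sieve -prodfV -prodrXl [leRHS]big_mkcond /=.
apply: ler_prod => p _; apply/andP; split; first by apply: sumr_ge0 => j _; rewrite mulr_ge0.
rewrite !big_ord_recr big_ord0 /coef /g /= add0r !mulr1.
case: ifP => pp; last by rewrite normr1 !normr0 mul0r !addr0.
have pN : (p <= N)%N by rewrite -ltnS.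
have p1 : (1 : R) < p%:R by rewrite ltr1n prime_gt1.
have x1 : (p%:R : R)^-1 < 1 by rewrite invf_lt1 // ; lra.
have s0 : 0 < Num.sqrt (p%:R : R) by rewrite sqrtr_gt0; lra.
have h1 : `|coef1 R N p| * (expR 1 / Num.sqrt p%:R) <= (16 * (Num.sqrt p%:R)^-1) * (4 / Num.sqrt p%:R).
  have d0 : 0 <= expR 1 / Num.sqrt (p%:R : R) by rewrite divr_ge0 ?expR_ge0 ?sqrtr_ge0.
  apply: (ler_pM _ d0); [exact: normr_ge0|exact: coef1_le|].
  by rewrite ler_pM2r ?invr_gt0 // expR1_le4.
have h2 := coef2_le R pp pN.
have {}h1 : `|coef1 R N p| * (expR 1 / Num.sqrt p%:R) <= 64 * p%:R^-1.
  apply: le_trans h1 _; rewrite -[in X in _ <= X](sqr_sqrtr (_ : 0 <= (p%:R : R))) //.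
  by rewrite le_eqVlt; apply/orP; left; apply/eqP; field; rewrite gt_eqF.
rewrite normr1.
apply: (@le_trans _ _ (expR (80 * p%:R^-1))).
  by apply: le_trans (expR_ge1Dx _); lra.
rewrite expRM_natl; apply: lerXn2r; rewrite ?nnegrE ?expR_ge0 ?invr_ge0 ?subr_ge0 ?(ltW x1) //.
rewrite -[leLHS]invrK -expRN lef_pV2 ?posrE ?expR_gt0 ?subr_gt0 //.
exact: expR_ge1Dx.
Qed.

(** The weight l^s is multiplicative. Since p^s <= sqrt p, each of the two coefficients contributes
    at most 16 N^s / sqrt p, and the sum of 1 / sqrt p over p <= N is at most 2 sqrt N, whence
    64. *)
Lemma expansion_rankin N (s : R) : 0 <= s <= 2^-1 -> \sum_(f : {ffun 'I_N.+1 -> 'I_3})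
    `|expansion_weight f| * (simple_part f * double_part f ^ 2)%:R `^ s <= expR (64 * (N%:R `^ s * Num.sqrt N%:R)).
Proof.
case/andP=> s0 s2; pose h (n : nat) : R := n%:R `^ s.
have h1 : h 1%N = 1 by rewrite /h powR1.
have hM : {morph h : m n / (m * n)%N >-> m * n} by move=> m n; rewrite /h natrM powRM.
have h0 n : 0 <= h n by exact: powR_ge0.
pose g (p : nat) (j : 'I_3) : R := (if j == 1%N :> nat then h p else 1) * (if j == 2%N :> nat then h p else 1) ^+ 2.
rewrite (eq_bigr (fun f : {ffun 'I_N.+1 -> 'I_3} => `|expansion_weight f| * \prod_(p < N.+1) g p (f p))); last first.
  move=> f _; congr (_ * _); rewrite -/(h _) hM -mulnn hM -expr2 (simple_part_morph f h1 hM) (double_part_morph f h1 hM).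
  by rewrite -prodrXl -big_split.
have g0 p j : 0 <= g p j by rewrite mulr_ge0 ?sqr_ge0 //; case: ifP.
rewrite expansion_sum_norm; set T := h N.
apply: (@le_trans _ _ (\prod_(p < N.+1) expR (32 * T * (Num.sqrt p%:R)^-1))); last first.
  rewrite -expR_sum ler_expR -mulr_sumr (_ : 64 = 32 * 2); last by rewrite -natrM.
  rewrite -!mulrA ler_pM2l // mulrCA; apply: ler_wpM2l; first exact: h0.
  rewrite -(big_mkord xpredT (fun p => (Num.sqrt (p%:R : R))^-1)) big_ltn // sqrtr0 invr0 add0r.
  exact: sum_inv_sqrt_le.
apply: ler_prod => p _; apply/andP; split; first by apply: sumr_ge0 => j _; rewrite mulr_ge0.
apply: le_trans (expR_ge1Dx _).
rewrite !big_ord_recr big_ord0 /coef /g /= add0r !expr1n !mulr1 mul1r.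
have T0 : 0 <= T := h0 N.
have i0 : 0 <= (Num.sqrt (p%:R : R))^-1 by rewrite invr_ge0 sqrtr_ge0.
case: ifP => pp; last by rewrite normr1 !normr0 !mul0r !addr0 lerDl !mulr_ge0.
have pN : (p <= N)%N by rewrite -ltnS.
have hT : h p <= T by apply: powR_mono; rewrite ?ler_nat.
have p1 : (1 : R) < p%:R by rewrite ltr1n prime_gt1.
have q0 : 0 < Num.sqrt (p%:R : R) by rewrite sqrtr_gt0; lra.
have a1 : `|coef1 R N p| * h p <= 16 * (Num.sqrt p%:R)^-1 * T by apply: ler_pM => //; exact: coef1_le.
have hs : h p <= Num.sqrt p%:R by rewrite -powR12_sqrt // /h ler_powR // ltW.
have a2 : `|coef2 R N p| * h p ^+ 2 <= (16 * p%:R^-1) * (T * Num.sqrt p%:R).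
  by apply: ler_pM => //; [exact: sqr_ge0|exact: coef2_le|rewrite expr2; apply: ler_pM].
have E : 16 * p%:R^-1 * (T * Num.sqrt p%:R) = 16 * T * (Num.sqrt p%:R)^-1 :> R.
  by rewrite -{1}(sqr_sqrtr (ler0n R p)); field; rewrite gt_eqF.
rewrite normr1; lra.
Qed.

End EulerExpansion.

(** * The first moment of the partial sums against 1 / P_X *)

Section MomentEstimate.
Context (R : realType).

Definition main_coefficient (N : nat) : R :=
  \prod_(p < N.+1 | prime p && odd p) (1 + (coef1 R N p / Num.sqrt p%:R + coef2 R N p) * (p%:R ^+ 2 / (p%:R ^+ 2 + p%:R - 1))).

Lemma odd_constant_le1 : odd_constant R <= 1.
Proof.
apply: (@cvgn_le R (odd_density R) _ _ (@odd_density_cvg R)) => n; rewrite /odd_density.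
apply: (@le_trans _ _ (\prod_(p < n | prime p && odd p) 1)); last by rewrite big1_eq.
by apply: ler_prod => p /andP[pp _]; have /andP[/ltW -> /ltW ->] := odd_density_factor R pp.
Qed.

Lemma powR_ge1 (x s : R) : 1 <= x -> 0 <= s -> 1 <= x `^ s.
Proof. by move=> x1 s0; have := @powR_mono R 1 x s ler01 x1 s0; rewrite powR1. Qed.

(** L separates the l = l1 l2^2 for which [twisted_main] is accurate from those that are bounded
    trivially; L and s receive their values in [error_small]. *)
Lemma moment_estimate : exists2 C : R, 0 < C & forall (X u L s : R) (D : nat),
  0 < u -> (0 < D)%N -> (0 < Num.truncn X)%N -> 1 <= L -> 0 <= s <= 2^-1 ->
  `|\sum_(1 <= d < D.+1 | flat d) (euler_product X (chi8 d))^-1 * Spart (chi8 d) (u * Num.sqrt d%:R)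
    - flat_density R * odd_constant R / 8 * (D%:R * ln D%:R) * main_coefficient (Num.truncn X)| <=
  C * (D%:R * (1 + ln (Num.truncn X)%:R) * (prime_sieve R (Num.truncn X))^-1 ^+ 80 * (1 + `|ln u|) +
     expR (64 * ((Num.truncn X)%:R `^ s * Num.sqrt (Num.truncn X)%:R)) *
      (L * (1 + u) * D%:R `^ (39 / 40) + L `^ (- s) * (D%:R * (1 + ln D%:R) ^+ 3 * (1 + u) ^+ 3))).
Proof.
have [C C0 H] := twisted_main R; exists (C + 101) => [|X u L s D u0 D0 N0 L1 s01]; first by rewrite addr_gt0.
set N := Num.truncn X in N0 *; have /andP[s0 s2] := s01.
have L0 : 0 < L by lra.
set K := flat_density R * odd_constant R / 8 * (D%:R * ln D%:R).
set B1 := L * (1 + u) * D%:R `^ (39 / 40); set B2 := D%:R * (1 + ln D%:R) ^+ 3 * (1 + u) ^+ 3.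
have B10 : 0 <= B1 by rewrite !mulr_ge0 ?powR_ge0 ?(ltW L0) // addr_ge0 // ltW.
have lD : 0 <= ln (D%:R : R) by exact: ln_nat_ge0.
have B20 : 0 <= B2 by rewrite !mulr_ge0 ?exprn_ge0 ?addr_ge0 // ltW.
have lN : 0 <= ln (N%:R : R) by exact: ln_nat_ge0.
have lu : 0 <= `|ln u| by [].
have -> : \sum_(1 <= d < D.+1 | flat d) (euler_product X (chi8 d))^-1 * Spart (chi8 d) (u * Num.sqrt d%:R) - K * main_coefficient N =
  \sum_(f : {ffun 'I_N.+1 -> 'I_3}) expansion_weight R f *
   (\sum_(1 <= d < D.+1 | flat d) (chi8 d (simple_part f * double_part f ^ 2))%:~R * Spart (chi8 d) (u * Num.sqrt d%:R) -
    K * (main_weight R (simple_part f * double_part f) / Num.sqrt (simple_part f)%:R)).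
  rewrite /main_coefficient -expansion_main mulr_sumr.
  rewrite [RHS](eq_bigr (fun f : {ffun 'I_N.+1 -> 'I_3} => expansion_weight R f *
    (\sum_(1 <= d < D.+1 | flat d) (chi8 d (simple_part f * double_part f ^ 2))%:~R * Spart (chi8 d) (u * Num.sqrt d%:R)) -
    K * (expansion_weight R f * (main_weight R (simple_part f * double_part f) / Num.sqrt (simple_part f)%:R)))); last first.
    by move=> f _; rewrite mulrBr; congr (_ - _); exact: mulrCA.
  rewrite sumrB; congr (_ - _); under [RHS]eq_bigr do rewrite mulr_sumr.
  rewrite exchange_big /=; apply: eq_bigr => d fd.
  have d0 : (0 < d)%N by case: d fd.
  by rewrite (euler_expansion X d0) mulr_suml; apply: eq_bigr => f _; rewrite mulrA.
apply: le_trans (ler_norm_sum _ _ _) _.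
have step (f : {ffun 'I_N.+1 -> 'I_3}) : `|expansion_weight R f *
   (\sum_(1 <= d < D.+1 | flat d) (chi8 d (simple_part f * double_part f ^ 2))%:~R * Spart (chi8 d) (u * Num.sqrt d%:R) -
    K * (main_weight R (simple_part f * double_part f) / Num.sqrt (simple_part f)%:R))| <=
  C * D%:R * (1 + `|ln u|) * (`|expansion_weight R f| * ((1 + ln (simple_part f)%:R) / Num.sqrt (simple_part f)%:R)) +
  (C * B1 + L `^ (- s) * (101 * B2)) * (`|expansion_weight R f| * (simple_part f * double_part f ^ 2)%:R `^ s).
  rewrite normrM; case: (eqVneq (expansion_weight R f) 0) => [->|w]; first by rewrite normr0 !(mul0r,mulr0) addr0.
  rewrite [X in _ <= X + _]mulrCA [X in _ <= _ + X]mulrCA -mulrDr; apply: ler_wpM2l => //.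
  set l1 := simple_part f; set l2 := double_part f; set l := (l1 * l2 ^ 2)%N.
  have o1 : odd l1 := simple_part_odd w; have o2 : odd l2 := double_part_odd w.
  have l10 : (0 < l1)%N := odd_gt0 o1.
  have ll : (1 : R) <= l%:R by rewrite ler1n /l odd_gt0 // oddM oddX o1 o2 orbT.
  have l1s : 0 < Num.sqrt (l1%:R : R) by rewrite sqrtr_gt0 ltr0n.
  have ln1 : 0 <= ln (l1%:R : R) by exact: ln_nat_ge0.
  have ls : 1 <= (l%:R : R) `^ s by apply: powR_ge1.
  set T := \sum_(_ <= _ < _ | _) _; set M := K * _.
  have A0 : 0 <= C * D%:R * (1 + `|ln u|) * ((1 + ln l1%:R) / Num.sqrt l1%:R).
    by rewrite !mulr_ge0 ?divr_ge0 ?addr_ge0 ?invr_ge0 // ?ltW.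
  have Ls : 0 <= L `^ (- s) by exact: powR_ge0.
  (* Rankin's trick: a term with l > L is charged (l / L)^s >= 1. *)
  case: (lerP l%:R L) => lL.
    apply: (le_trans (H u l1 l2 D u0 o1 o2 (simple_part_squarefree w) D0)); rewrite -/l.
    have h1 : D%:R / Num.sqrt l1%:R * (1 + ln l1%:R + `|ln u|) <= D%:R * (1 + `|ln u|) * ((1 + ln l1%:R) / Num.sqrt l1%:R).
      rewrite (_ : D%:R * (1 + `|ln u|) * ((1 + ln l1%:R) / Num.sqrt l1%:R) = D%:R / Num.sqrt l1%:R * ((1 + `|ln u|) * (1 + ln l1%:R))); last by ring.
      by apply: ler_wpM2l; [rewrite divr_ge0 // ltW|nra].
    have h2 : l%:R * (1 + u) * D%:R `^ (39 / 40) <= B1.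
      by rewrite /B1 -!mulrA; apply: ler_wpM2r => //; rewrite mulr_ge0 ?powR_ge0 // addr_ge0 // ltW.
    have h3 : B1 <= B1 * l%:R `^ s by rewrite ler_peMr.
    have h4 : 0 <= L `^ (- s) * (101 * B2) * l%:R `^ s by apply: mulr_ge0; [apply: mulr_ge0 => //; exact: mulr_ge0|exact: powR_ge0].
    rewrite [leRHS](_ : _ = C * (D%:R * (1 + `|ln u|) * ((1 + ln l1%:R) / Num.sqrt l1%:R)) + C * (B1 * l%:R `^ s) + L `^ (- s) * (101 * B2) * l%:R `^ s); last by ring.
    rewrite -[leLHS]addr0 -mulrDr; apply: lerD => //; rewrite ler_pM2l //; apply: lerD => //; exact: le_trans h3.
  have h1 : 1 <= L `^ (- s) * l%:R `^ s.
    rewrite powRN mulrC -ler_pdivrMr ?invr_gt0 ?powR_gt0 // invrK mul1r.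
    by apply: powR_mono => //; exact: ltW.
  have h2 : `|T| <= 100 * B2.
    apply: le_trans (ler_norm_sum _ _ _) _; rewrite [leRHS](_ : _ = 100 * D%:R * (1 + ln D%:R) ^+ 3 * (1 + u) ^+ 3); last by rewrite /B2; ring.
    apply: le_trans (Spart_first_moment u0 D0).
    rewrite -(big_mkord (fun d => 0 < d)%N (fun d => `|Spart (chi8 d) (u * Num.sqrt d%:R)|)) big_ltn_cond //= big_nat_cond [leRHS]big_nat_cond.
    rewrite big_mkcond [leRHS]big_mkcond; apply: ler_sum => d _.
    case: (0 < d)%N => //=; rewrite ?andbT; case: (d < D.+1)%N => //=; case: (flat d) => //=.
    rewrite normrM ler_piMl //; exact: kronecker_norm.
  have h3 : `|M| <= B2.
    have k1 := flat_density_gt0 R; have k2 := flat_density_le1 R.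
    have k3 := odd_constant_gt0 R; have k4 := odd_constant_le1.
    have /andP[m0 m1] := main_weight_itv R (l1 * l2).
    have q : main_weight R (l1 * l2) / Num.sqrt l1%:R <= 1.
      rewrite ler_pdivrMr // mul1r; apply: (le_trans m1).
      by have := @ler_wsqrtr R 1 l1%:R; rewrite sqrtr1 ler1n => /(_ l10).
    have q0 : 0 <= main_weight R (l1 * l2) / Num.sqrt l1%:R by rewrite divr_ge0 // ltW.
    have kk : flat_density R * odd_constant R <= 1 by apply: mulr_ile1 => //; exact: ltW.
    have kk0 := mulr_gt0 k1 k3.
    have DL : 0 <= D%:R * ln D%:R :> R by rewrite mulr_ge0.
    have K0 : 0 <= K by apply: mulr_ge0 => //; lra.
    have KB : K <= D%:R * ln D%:R.
      rewrite /K -[leRHS]mul1r; apply: ler_wpM2r; [exact: DL|lra].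
    rewrite ger0_norm; last exact: mulr_ge0. 
    apply: le_trans (ler_piMr K0 q) _; apply: (le_trans KB).
    rewrite /B2 -mulrA ler_wpM2l //.
    have e1 : 1 <= (1 + u) ^+ 3 by apply: exprn_ege1; lra.
    have e2 : 1 + ln D%:R <= (1 + ln D%:R : R) ^+ 3 by apply: ler_eXnr => //; lra.
    have e3 : 0 <= (1 + ln D%:R : R) ^+ 3 by rewrite exprn_ge0 // addr_ge0.
    by apply: le_trans (ler_peMr e3 e1); lra.
  have h4 : 101 * B2 <= L `^ (- s) * (101 * B2) * l%:R `^ s.
    by rewrite mulrAC -[leLHS]mul1r; apply: ler_wpM2r => //; exact: mulr_ge0.
  apply: (le_trans (ler_normB _ _)).
  have h5 : 0 <= C * B1 * l%:R `^ s by apply: mulr_ge0; [apply: mulr_ge0 => //; exact: ltW|exact: powR_ge0].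
  rewrite mulrDl; lra.
apply: (@le_trans _ _ _ _ _ (ler_sum _ (fun f _ => step f))).
rewrite big_split /= -!mulr_sumr.
have r1 := expansion_log_bound R N0; have r2 := expansion_rankin N s01.
set E := expR _ in r2 *; set V := (1 + _) * _ in r1.
have c1 : 0 <= C * D%:R * (1 + `|ln u|) by rewrite !mulr_ge0 ?addr_ge0 // ltW.
have c2 : 0 <= C * B1 + L `^ (- s) * (101 * B2) by apply: addr_ge0; apply: mulr_ge0 => //; [exact: ltW|exact: powR_ge0|exact: mulr_ge0].
apply: le_trans (lerD (ler_wpM2l c1 r1) (ler_wpM2l c2 r2)) _.
have E0 : 0 <= E by exact: expR_ge0.
have V0 : 0 <= V by rewrite mulr_ge0 ?addr_ge0 // exprn_ge0 // invr_ge0 ltW // prime_sieve_gt0.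
have B20' : 0 <= L `^ (- s) * B2 by apply: mulr_ge0 => //; exact: powR_ge0.
have -> : D%:R * (1 + ln N%:R) * (prime_sieve R N)^-1 ^+ 80 * (1 + `|ln u|) = D%:R * (1 + `|ln u|) * V by rewrite /V; ring.
have g1 : 0 <= D%:R * (1 + `|ln u|) * V by apply: mulr_ge0 => //; apply: mulr_ge0 => //; exact: addr_ge0.
have g2 := mulr_ge0 E0 B10; have g3 := mulr_ge0 E0 B20'; have g4 := mulr_ge0 (ltW C0) g3.
lra.
Qed.

End MomentEstimate.

(** * Asymptotics of the main term *)

Section MainAsymptotics.
Context (R : realType).

Lemma prod_perturbation (I : Type) (r : seq I) (P : pred I) (e : I -> R) :
  `|\prod_(i <- r | P i) (1 + e i) - 1| <= expR (\sum_(i <- r | P i) `|e i|) - 1.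
Proof.
elim/big_rec2: _ => [|i s p _ IH]; first by rewrite subrr normr0 expR0 subrr.
have -> : (1 + e i) * p - 1 = (1 + e i) * (p - 1) + e i by ring.
apply: le_trans (ler_normD _ _) _; rewrite normrM expRD.
have h1 : `|1 + e i| <= 1 + `|e i| by apply: le_trans (ler_normD _ _) _; rewrite normr1.
have h2 := expR_ge1Dx `|e i|; have h3 := normr_ge0 (p - 1); have h4 := normr_ge0 (1 + e i).
have h5 : `|1 + e i| * `|p - 1| <= (1 + `|e i|) * (expR s - 1) by apply: ler_pM.
have h6 : 0 <= (expR `|e i| - (1 + `|e i|)) * expR s by rewrite mulr_ge0 ?expR_ge0 // subr_ge0.
lra.
Qed.

Lemma sum_le_prod (I : Type) (r : seq I) (P : pred I) (x : I -> R) : (forall i, P i -> 0 <= x i) ->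
  1 + \sum_(i <- r | P i) x i <= \prod_(i <- r | P i) (1 + x i).
Proof.
move=> x0; suff [] : 1 + \sum_(i <- r | P i) x i <= \prod_(i <- r | P i) (1 + x i) /\ 0 <= \sum_(i <- r | P i) x i by [].
elim/big_rec2: _ => [|i p s Pi [IH s0]]; first by rewrite addr0.
have := x0 _ Pi => xi; have := mulr_ge0 xi s0; split; [nra|exact: addr_ge0].
Qed.

Lemma cvg_truncn : (Num.truncn (x : R)) @[x --> +oo] --> \oo.
Proof.
move=> S [A _ SA]; exists A%:R; split; first exact: num_real.
by move=> x Ax; apply: SA => /=; rewrite truncn_ge_nat ?(ltW Ax) // (le_trans _ (ltW Ax)).
Qed.

Lemma cvg_inv_powR (a : R) : 0 < a -> x `^ (- a) @[x --> +oo] --> (0 : R).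
Proof.
move=> a0; have h : a * ln x @[x --> +oo] --> +oo.
  apply/cvgryPge => A; near=> x.
  have x0 : 0 < x by near: x; exact: nbhs_pinfty_gt.
  rewrite mulrC -ler_pdivrMr // -ler_expR lnK ?posrE //.
have hh := cvg_comp _ _ h (@cvgr_expR R); apply: (cvg_near_eq _ hh).
near=> x; have x0 : 0 < x by near: x; exact: nbhs_pinfty_gt.
by rewrite /= powR_expR // mulNr.
Unshelve. all: by end_near.
Qed.

Lemma sieve_factor_ge N p : prime p -> 2^-1 <= sieve_factor R N p <= 1.
Proof.
move=> pp; have p2 : (2 : R) <= p%:R by rewrite ler_nat prime_gt1.
have i2 : (p%:R : R)^-1 <= 2^-1 by rewrite lef_pV2 ?posrE; lra.
have i0 : 0 < (p%:R : R)^-1 by rewrite invr_gt0; lra.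
rewrite /sieve_factor; case: ifP => _; first by apply/andP; split; lra.
have w0 : 0 <= Num.sqrt (1 - (p%:R : R)^-1) := sqrtr_ge0 _.
have w2 : Num.sqrt (1 - (p%:R : R)^-1) ^+ 2 = 1 - p%:R^-1 by rewrite sqr_sqrtr //; lra.
move: (Num.sqrt _) w0 w2 => w w0 w2; apply/andP; split.
  by rewrite leNgt; apply/negP => h; nra.
by rewrite leNgt; apply/negP => h; nra.
Qed.

(** By [main_factor_approx] the deviations from 1 add up to a multiple of n^(-1/12), the sum of
    p^(-5/4) being at most exp 4; 64 is twice 32 because [sieve_factor] is at least 1/2. *)
Lemma cvg_factor_ratio :
  \prod_(p < n.+1 | prime p && odd p) (main_factor R n p / sieve_factor R n p) @[n --> \oo] --> (1 : R).
Proof.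
pose b (n : nat) : R := expR (64 * expR 4 * n%:R `^ (- 12^-1)) - 1.
have b0 : b n @[n --> \oo] --> (0 : R).
  apply: (@cvg_eq _ _ _ _ (expR (64 * expR 4 * 0) - 1)); last by rewrite mulr0 expR0 subrr.
  apply: cvgB; last exact: cvg_cst.
  have h : 64 * expR 4 * (n%:R : R) `^ (- 12^-1) @[n --> \oo] --> 64 * expR 4 * (0 : R).
    apply: cvgM; first exact: cvg_cst.
    by apply: (cvg_comp _ _ cvgr_idn (cvg_inv_powR _)); rewrite invr_gt0.
  by apply: (cvg_comp _ (@expR R) h); exact: continuous_expR.
apply/cvgrPdist_le => e e0; have /cvgrPdist_le /(_ e e0) h := b0.
near=> n; have : `|0 - b n| <= e by near: n; exact: h.
rewrite sub0r normrN => /(le_trans (ler_norm _)); apply: le_trans; rewrite distrC.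
have F (p : 'I_n.+1) : prime p && odd p -> main_factor R n p / sieve_factor R n p = 1 + (main_factor R n p - sieve_factor R n p) / sieve_factor R n p.
  move=> /andP[pp _]; have /andP[s0 _] := sieve_factor_ge n pp.
  rewrite mulrBl divff; [ring|apply: lt0r_neq0; lra].
rewrite (eq_bigr _ F); apply: le_trans (prod_perturbation _ _ _) _; rewrite /b lerD2r ler_expR.
apply: (@le_trans _ _ (\sum_(p < n.+1 | prime p && odd p) 64 * n%:R `^ (- 12^-1) * p%:R `^ (- (1 + 4^-1)))).
  apply: ler_sum => p /andP[pp op]; have /andP[s0 _] := sieve_factor_ge n pp.
  have pn : (p <= n)%N by rewrite -ltnS.
  have H := main_factor_approx R pp op pn; rewrite (_ : 1 + 4^-1 = 5 / 4); last by field.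
  rewrite normrM [X in _ * X]ger0_norm ?invr_ge0 //; last lra.
  rewrite ler_pdivrMr; last lra.
  apply: (le_trans H); have := powR_ge0 (n%:R : R) (- 12^-1); have := powR_ge0 (p%:R : R) (- (5 / 4)).
  move: (_ `^ _) (_ `^ _) s0 => x y ? ? ?; have : 0 <= y * x by rewrite mulr_ge0. nra.
rewrite -mulr_sumr [leRHS]mulrAC; apply: ler_wpM2l; first by rewrite mulr_ge0 ?powR_ge0.
have s4 : (0 : R) < 4^-1 by rewrite invr_gt0.
have := prod_inv_powR_le n.+1 odd s4; rewrite invrK; apply: le_trans.
by apply: le_trans (sum_le_prod _ _); [rewrite lerDr|move=> p _; exact: powR_ge0].
Unshelve. all: by end_near.
Qed.

(** After squaring, every odd p <= X gives 1 - 1/p, and every odd p <= sqrt X gives it once more.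
    Restoring the prime 2, present in both products since X >= 4, costs a factor 2 each, hence 2
    after the square root. *)
Lemma sieve_factor_prod (X : R) : 4 <= X ->
  \prod_(p < (Num.truncn X).+1 | prime p && odd p) sieve_factor R (Num.truncn X) p =
  2 * Num.sqrt (prime_sieve R (Num.truncn X) * prime_sieve R (Num.truncn (Num.sqrt X))).
Proof.
move=> X4; set N := Num.truncn X; set r := Num.truncn (Num.sqrt X).
have X0 : 0 <= X by lra.
have rE p : (p <= r)%N = (p ^ 2 <= N)%N.
  rewrite !truncn_ge_nat ?sqrtr_ge0 // natrX -[in LHS](ger0_norm (ler0n R p)) -sqrtr_sqr.
  by rewrite ler_sqrt.
have r2 : (2 <= r)%N by rewrite rE truncn_ge_nat.
have rN : (r <= N)%N by have := leqnn r; rewrite {2}/r rE; apply: leq_trans; rewrite -mulnn leq_pmulr // (leq_trans _ r2).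
have odd_prime n : (2 <= n)%N -> \prod_(p < n.+1 | prime p && odd p) (1 - (p%:R : R)^-1) = 2 * prime_sieve R n.
  move=> n2; rewrite /prime_sieve [in RHS](bigD1 (Ordinal (n2 : (2 < n.+1)%N))) //= mulrA (_ : 2 * (1 - 2^-1) = 1); last by field.
  rewrite mul1r; apply: eq_bigl => p; case pp: (prime p) => //=.
  by rewrite -val_eqE /=; case: (even_prime pp) => [->|op] //; rewrite op; apply/esym/eqP => p2; rewrite p2 in op.
have w : 0 <= \prod_(p < N.+1 | prime p && odd p) sieve_factor R N p.
  by apply: prodr_ge0 => p /andP[pp _]; have /andP[+ _] := sieve_factor_ge N pp; apply: le_trans; rewrite invr_ge0.
rewrite -(ger0_norm w) -sqrtr_sqr -prodrXl.
rewrite (eq_bigr (fun p : 'I_N.+1 => (1 - p%:R^-1) * (if (p <= r)%N then 1 - p%:R^-1 else 1))); last first.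
  move=> p /andP[pp _]; rewrite /sieve_factor -rE; case: ifP => _; first by rewrite expr2.
  rewrite mulr1 sqr_sqrtr // subr_ge0 invf_le1 ?ltr0n ?prime_gt0 // ler1n prime_gt0 //.
rewrite big_split /= odd_prime ?(leq_trans r2) //.
have -> : \prod_(p < N.+1 | prime p && odd p) (if (p <= r)%N then 1 - p%:R^-1 else 1) = 2 * prime_sieve R r.
  rewrite -odd_prime // -big_mkcondr /= -!(big_mkord (fun p => prime p && odd p) (fun p => 1 - (p%:R : R)^-1)).
  rewrite -(big_mkord (fun p => (prime p && odd p) && (p <= r)%N) (fun p => 1 - (p%:R : R)^-1)).
  rewrite (big_cat_nat (leq0n r.+1)) //= [X in _ * X]big_nat_cond [X in _ * X]big1 ?mulr1.
    by rewrite big_nat_cond [RHS]big_nat_cond; apply: eq_bigl => p; rewrite ltnS; case: (p <= r)%N; rewrite ?andbT ?andbF.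
  by move=> p /andP[/andP[rp _] /andP[_ pr]]; move: rp; rewrite ltnNge pr.
rewrite (_ : 2 * prime_sieve R N * (2 * prime_sieve R r) = 2 ^+ 2 * (prime_sieve R N * prime_sieve R r)); last by ring.
by rewrite sqrtrM ?sqr_ge0 // sqrtr_sqr ger0_norm.
Qed.

Lemma main_coefficient_factor N : odd_density R N.+1 * main_coefficient R N = \prod_(p < N.+1 | prime p && odd p) main_factor R N p.
Proof.
rewrite /odd_density /main_coefficient -big_split /=; apply: eq_bigr => p /andP[pp op].
have p1 : (1 : R) < p%:R by rewrite ltr1n prime_gt1.
rewrite /main_factor; set a := coef1 R N p / Num.sqrt p%:R; move: a (coef2 R N p) (p%:R : R) p1 => a b x x1.
have : 0 < x ^+ 2 by rewrite exprn_gt0 //; lra.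
by move=> ?; field; do ?[apply/andP; split]; apply: lt0r_neq0; lra.
Qed.

Theorem main_coefficient_asymp :
  odd_constant R * main_coefficient R (Num.truncn X) * ln X @[X --> +oo] --> 2 * Num.sqrt 2 * expR (- euler_gamma R).
Proof.
set g := expR (- euler_gamma R); have g0 : 0 < g := expR_gt0 _.
have m1 := @mertens R; have cs : Num.sqrt (X : R) @[X --> +oo] --> +oo.
  apply/cvgryPge => A; near=> X.
  apply: le_trans (ler_norm A) _; rewrite -sqrtr_sqr; apply: ler_wsqrtr.
  near: X; apply: nbhs_pinfty_ge; exact: num_real.
have m2 := cvg_comp _ _ cs m1; rewrite /= in m2.
(* Each of the two Mertens products is paired with its own logarithm; ln(sqrt X) = ln X / 2 is
   offset by the factor 2 under the root. *)
pose q (X : R) := (odd_constant R / odd_density R (Num.truncn X).+1) *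
   (\prod_(p < (Num.truncn X).+1 | prime p && odd p) (main_factor R (Num.truncn X) p / sieve_factor R (Num.truncn X) p)) *
   (2 * Num.sqrt (2 * (prime_sieve R (Num.truncn X) * ln X) * (prime_sieve R (Num.truncn (Num.sqrt X)) * ln (Num.sqrt X)))).
have qc : q X @[X --> +oo] --> (odd_constant R / odd_constant R) * 1 * (2 * Num.sqrt (2 * g * g)).
  apply: cvgM; [apply: cvgM|apply: cvgM; first exact: cvg_cst].
  - apply: cvgM; first exact: cvg_cst.
    apply: cvgV; first by rewrite gt_eqF // odd_constant_gt0.
    have h : odd_density R n.+1 @[n --> \oo] --> odd_constant R by rewrite (cvg_shiftS (odd_density R)); exact: odd_density_cvg.
    exact: (cvg_comp _ _ cvg_truncn h).
  - exact: (cvg_comp _ _ cvg_truncn cvg_factor_ratio).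
  - have h : 2 * (prime_sieve R (Num.truncn X) * ln X) * (prime_sieve R (Num.truncn (Num.sqrt X)) * ln (Num.sqrt X)) @[X --> +oo] --> 2 * g * g.
      by apply: cvgM => //; apply: cvgM => //; exact: cvg_cst.
    by apply: (cvg_comp _ (@Num.sqrt R) h); exact: sqrt_continuous.
apply: (@cvg_eq _ _ _ _ ((odd_constant R / odd_constant R) * 1 * (2 * Num.sqrt (2 * g * g)))); last first.
  rewrite divff ?gt_eqF ?odd_constant_gt0 // !mul1r -!mulrA sqrtrM // -expr2 sqrtr_sqr gtr0_norm //.
apply: (cvg_near_eq _ qc); near=> X.
have X4 : 4 <= X by near: X; exact: nbhs_pinfty_ge.
have lX : 0 <= ln X by apply: ln_ge0; lra.
rewrite /q; set N := Num.truncn X.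
have sf : \prod_(p < N.+1 | prime p && odd p) sieve_factor R N p != 0.
  apply: lt0r_neq0; apply: prodr_gt0 => p /andP[pp _]; have /andP[h _] := sieve_factor_ge N pp; lra.
have od : odd_density R N.+1 != 0 by apply: lt0r_neq0; apply: lt_le_trans (odd_density_ge R _).
rewrite big_split /= prodfV -main_coefficient_factor.
have -> : ln (Num.sqrt X) = ln X / 2.
  have : ln X = 2 * ln (Num.sqrt X) by rewrite -[in LHS](sqr_sqrtr (_ : 0 <= X)) ?lnXn ?sqrtr_gt0 ?mulr_natl //; lra.
  by move=> ->; field.
set A := prime_sieve R N; set B := prime_sieve R _.
have -> : 2 * Num.sqrt (2 * (A * ln X) * (B * (ln X / 2))) = (2 * Num.sqrt (A * B)) * ln X.
  rewrite (_ : 2 * (A * ln X) * (B * (ln X / 2)) = (A * B) * ln X ^+ 2); last by field.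
  by rewrite sqrtrM ?mulr_ge0 ?(ltW (prime_sieve_gt0 R _)) // sqrtr_sqr ger0_norm // mulrA.
rewrite -(sieve_factor_prod X4) -/N.
by field; rewrite sf od.
Unshelve. all: by end_near.
Qed.

End MainAsymptotics.

(** * Error terms in the range X <= C (log D)^(2 - delta) *)

Section ErrorTerm.
Context (R : realType).

Lemma pow_le_expR (n : nat) (a : R) : 0 < a -> exists2 K : R, 0 < K & forall y : R, 0 <= y -> y ^+ n <= K * expR (a * y).
Proof.
move=> a0; have f0 : (0 : R) < n`!%:R by rewrite ltr0n fact_gt0.
exists (n`!%:R / a ^+ n) => [|x x0]; first by rewrite divr_gt0 // exprn_gt0.
rewrite mulrAC ler_pdivlMr ?exprn_gt0 // mulrC -exprMn; set y := a * x.
have y0 : 0 <= y by rewrite mulr_ge0 // ltW.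
have h : series (exp_coeff y) n.+1 <= expR y.
  apply: nondecreasing_cvgn_le; last exact: is_cvg_series_exp_coeff.
  by apply/nondecreasing_seqP => k; rewrite /series /= big_nat_recr //= lerDl /exp_coeff /= divr_ge0 // exprn_ge0.
rewrite mulrC -ler_pdivrMr //; apply: le_trans h; rewrite /series /= big_nat_recr //= lerDr.
by apply: sumr_ge0 => k _; rewrite /exp_coeff /= divr_ge0 // exprn_ge0.
Qed.

(** For D >= 4 the integer part of D is at least sqrt D. *)
Lemma truncn_ln (D : R) : 4 <= D -> 2^-1 * ln D <= ln (Num.truncn D)%:R <= ln D.
Proof.
move=> D4; have D0 : 0 < D by lra.
have /andP[t1 t2] := truncn_itv (ltW D0); rewrite -natr1 in t2.
have s0 : 0 < Num.sqrt D by rewrite sqrtr_gt0.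
have s2 := sqr_sqrtr (ltW D0).
have h : Num.sqrt D <= (Num.truncn D)%:R by nra.
have n0 : (0 : R) < (Num.truncn D)%:R by lra.
rewrite !ler_ln ?posrE // t1 andbT.
have -> : 2^-1 * ln D = ln (Num.sqrt D); last by rewrite ler_ln.
by rewrite -{1}s2 lnXn // mulrnAr -mulrnAl -[_ *+ 2]mulr_natl mulfV // mul1r.
Qed.

(* With s = delta / 8 the exponent (2 - delta) (s + 1/2) is at most 1 - delta / 4,
   so that exp (64 N^(s + 1/2)) is at most any given positive power of D. *)
Lemma error_small (delta C c : R) : 0 < delta <= 1 -> 0 < C -> 0 < c ->
  exists s K y0, [/\ 0 <= s <= 2^-1, 0 < K &
  forall X D : R, 4 <= X -> c <= prime_sieve R (Num.truncn X) * ln X -> 4 <= D -> y0 <= ln D -> X <= C * ln D `^ (2 - delta) ->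
  ((Num.truncn D)%:R * (1 + ln (Num.truncn X)%:R) * (prime_sieve R (Num.truncn X))^-1 ^+ 80 +
   expR (64 * ((Num.truncn X)%:R `^ s * Num.sqrt (Num.truncn X)%:R)) *
    ((Num.truncn D)%:R `^ (100^-1) * (Num.truncn D)%:R `^ (39 / 40) +
     ((Num.truncn D)%:R `^ (100^-1)) `^ (- s) * ((Num.truncn D)%:R * (1 + ln (Num.truncn D)%:R) ^+ 3))) * ln X <=
  K * ((Num.truncn D)%:R * ln (Num.truncn D)%:R * ln D `^ (- 2^-1))].
Proof.
case/andP=> d0 d1 C0 c0; pose s := delta / 8.
have s0 : 0 < s by rewrite divr_gt0.
(* With L the power 1/100 of the integer part of D, whose logarithm is at least ln D / 2, the factor
   L^(-s) is at most exp(-s ln D / 200) = exp(-2 t ln D). Half of this saving pays for the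
   exponential of [expansion_rankin], and exp(-t ln D) is left against powers of ln D. *)
have [t t0 tE] : exists2 t : R, 0 < t & s = 400 * t by exists (400^-1 * s); lra.
(* 82 = 80 + 2 counts the logarithms of X in the first error term, and 5 = 3 + 2 those of D in the
   second, where ln X <= X <= C (ln D)^2. *)
have [K1 K10 HK1] := @pow_le_expR 82 4^-1 (ltac:(by rewrite invr_gt0)); have [K2 K20 HK2] := @pow_le_expR 5 t t0.
pose C1 := C `^ (2^-1 + s); have C10 : 0 < C1 by rewrite powR_gt0.
(* For ln D beyond [y1] the factor (ln D)^(delta / 4) outweighs 64 C1 / t. *)
pose y1 := (64 * C1 / t) `^ (4 / delta).
pose A1 := 2 * c^-1 ^+ 80 * K1 * C `^ 4^-1 * 2; pose A2 := 16 * C * K2 * 2.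
exists s, (A1 + A2), (Num.max 1 y1); split; first by rewrite ltW //= /s; lra.
  have a1 : 0 < A1 by rewrite /A1 !mulr_gt0 ?exprn_gt0 ?invr_gt0 ?powR_gt0.
  by rewrite addr_gt0 // /A2 !mulr_gt0 ?invr_gt0 ?exprn_gt0.
move=> X D X4 cX D4; rewrite ge_max => /andP[y1' yy1] XC.
set y := ln D in y1' yy1 XC *; set N := Num.truncn X in cX *; set Dn := Num.truncn D.
have y0 : 0 < y by lra.
have /andP[lD1 lD2] := truncn_ln D4; rewrite -/Dn -/y in lD1 lD2.
have Dn0 : (0 : R) < Dn%:R by rewrite ltr0n truncn_gt0; lra.
have lX1 : 1 <= ln X.
  rewrite -ler_expR lnK ?posrE; last lra. exact: le_trans (expR1_le4 R) X4.
have N0 : (0 < N)%N by rewrite truncn_gt0; lra.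
have NX : N%:R <= X by by have /andP[] := @truncn_itv R X (ltac:(lra)).
have Nr : (0 : R) < N%:R by rewrite ltr0n.
have lN : ln (N%:R : R) <= ln X by rewrite ler_ln ?posrE //; lra.
have lN0 : 0 <= ln (N%:R : R) by exact: ln_nat_ge0.
have ps0 := prime_sieve_gt0 R N.
have XCy : X <= C * y ^+ 2.
  apply: (le_trans XC); rewrite ler_pM2l // -powR_mulrn; last exact: ltW.
  by rewrite ler_powR //; lra.
have yh : y `^ (- 2^-1) = (Num.sqrt y)^-1 by rewrite powRN powR12_sqrt // ltW.
have sy0 : 0 < Num.sqrt y by rewrite sqrtr_gt0.
have sy2 := sqr_sqrtr (ltW y0).
have sy1 : 1 <= Num.sqrt y by have := @ler_wsqrtr R 1 y; rewrite sqrtr1; apply.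
rewrite mulrDl [leRHS]mulrDl; apply: lerD.
  have h1 : (prime_sieve R N)^-1 <= ln X / c.
    by rewrite ler_pdivlMr // mulrC ler_pdivrMr // mulrC.
  have h2 : (prime_sieve R N)^-1 ^+ 80 <= (ln X / c) ^+ 80.
    by apply: lerXn2r; rewrite ?nnegrE ?divr_ge0 ?invr_ge0 ?(ltW c0) ?(ltW ps0) //; lra.
  have h3 : ln X ^+ 82 <= K1 * X `^ 4^-1 by rewrite powR_expR; [apply: HK1|]; lra.
  have h4 : X `^ 4^-1 <= C `^ 4^-1 * Num.sqrt y.
    rewrite -powR12_sqrt ?(ltW y0) // (_ : y `^ 2^-1 = (y ^+ 2) `^ 4^-1).
      by rewrite -powRM ?sqr_ge0 ?(ltW C0) //; apply: powR_mono => //; lra.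
    by rewrite -powR_mulrn ?(ltW y0) // -powRrM; congr (_ `^ _); field.
  have h5 : Num.sqrt y <= 2 * (ln Dn%:R * (Num.sqrt y)^-1) by rewrite mulrA ler_pdivlMr // -expr2 sy2; lra.
  have i80 : 0 <= c^-1 ^+ 80 by rewrite exprn_ge0 // invr_ge0 ltW.
  have C40 : 0 <= C `^ 4^-1 by exact: powR_ge0.
  rewrite yh; apply: (@le_trans _ _ (Dn%:R * (2 * c^-1 ^+ 80) * ln X ^+ 82)).
    rewrite (_ : Dn%:R * (2 * c^-1 ^+ 80) * ln X ^+ 82 = Dn%:R * (2 * ln X) * (ln X / c) ^+ 80 * ln X); last first.
      by rewrite expr_div_n -exprVn exprS exprSr; ring.
    apply: ler_wpM2r; first lra.
    apply: ler_pM => //; [by rewrite mulr_ge0 //; lra|by rewrite exprn_ge0 // invr_ge0 ltW|].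
    by apply: ler_wpM2l; lra.
  apply: (@le_trans _ _ (Dn%:R * (2 * c^-1 ^+ 80) * (K1 * (C `^ 4^-1 * (2 * (ln Dn%:R * (Num.sqrt y)^-1)))))).
    apply: ler_wpM2l; first by apply: mulr_ge0; [exact: ltW|exact: mulr_ge0].
    apply: (le_trans h3); rewrite ler_pM2l //; apply: (le_trans h4); exact: ler_wpM2l.
  by rewrite le_eqVlt; apply/orP; left; apply/eqP; rewrite /A1; ring.
have sy : s * y = 400 * (t * y) by rewrite tE mulrA.
have DE : Dn%:R = expR (ln Dn%:R) :> R by rewrite lnK.
have B1 : Dn%:R `^ (100^-1) * Dn%:R `^ (39 / 40) <= Dn%:R * expR (- (2 * t * y)).
  rewrite !powR_expR // {3}DE -!expRD ler_expR.
  have : s * y <= 8^-1 * y by rewrite ler_wpM2r ?(ltW y0) // /s; lra.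
  lra.
have B2 : (Dn%:R `^ (100^-1)) `^ (- s) <= expR (- (2 * t * y)).
  rewrite -powRrM powR_expR // ler_expR.
  have : s * (2^-1 * y) <= s * ln Dn%:R by rewrite ler_pM2l.
  lra.
have B3 : expR (64 * (N%:R `^ s * Num.sqrt N%:R)) <= expR (t * y).
  rewrite ler_expR -powR12_sqrt // -powRD; last by rewrite (gt_eqF Nr) implybT.
  have g1 : (N%:R : R) `^ (s + 2^-1) <= C1 * (y * y `^ (- (delta / 4))).
    apply: (@le_trans _ _ ((C * y `^ (2 - delta)) `^ (s + 2^-1))).
      by apply: powR_mono; [|exact: le_trans XC|lra].
    rewrite powRM ?powR_ge0 ?(ltW C0) // [s + _]addrC -/C1 ler_pM2l // -powRrM.
    rewrite -{2}[y]powRr1 ?(ltW y0) // -powRD; last by rewrite (gt_eqF y0) implybT.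
    by apply: ler_powR => //; rewrite /s; nra.
  have g2 : 64 * C1 * y `^ (- (delta / 4)) <= t.
    rewrite powRN ler_pdivrMr ?powR_gt0 // -ler_pdivrMl //.
    have w : 0 <= 64 * C1 / t by apply: divr_ge0; [apply: mulr_ge0 => //; exact: ltW|exact: ltW].
    apply: (@le_trans _ _ (y1 `^ (delta / 4))).
      rewrite /y1 -powRrM (_ : 4 / delta * (delta / 4) = 1); last by field; rewrite gt_eqF.
      by rewrite powRr1 // mulrC.
    apply: powR_mono => //; [exact: powR_ge0|lra].
  have := ler_wpM2r (ltW y0) g2; have := ler_wpM2l (ltac:(by []) : (0 : R) <= 64) g1; lra.
have lX : ln X <= C * y ^+ 2 by have := ln_le_sub1 (_ : 0 < X); lra.
have y31 : 1 <= y ^+ 3 by apply: exprn_ege1.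
have y38 : (1 + ln Dn%:R) ^+ 3 <= 8 * y ^+ 3.
  rewrite (_ : 8 * y ^+ 3 = (2 * y) ^+ 3); last by ring.
  by apply: lerXn2r; rewrite ?nnegrE; lra.
set B := _ + _ * (_ * _).
have B4 : B <= Dn%:R * expR (- (2 * t * y)) * (16 * y ^+ 3).
  rewrite /B; have e0 := expR_gt0 (- (2 * t * y)); have q0 := mulr_gt0 Dn0 e0.
  have h : Dn%:R `^ (100^-1) `^ (- s) * (Dn%:R * (1 + ln Dn%:R) ^+ 3) <= expR (- (2 * t * y)) * (Dn%:R * (8 * y ^+ 3)).
    apply: ler_pM; [exact: powR_ge0|by rewrite mulr_ge0 ?exprn_ge0 //; lra|exact: B2|by rewrite ler_pM2l].
  have := ler_wpM2l (ltW q0) y31; lra.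
have B0 : 0 <= B.
  apply: addr_ge0; first by apply: mulr_ge0; exact: powR_ge0.
  apply: mulr_ge0; first exact: powR_ge0.
  by apply: mulr_ge0; [exact: ltW|apply: exprn_ge0; lra].
apply: (@le_trans _ _ (expR (t * y) * (Dn%:R * expR (- (2 * t * y)) * (16 * y ^+ 3)) * (C * y ^+ 2))).
  apply: ler_pM => //; [by rewrite mulr_ge0 ?expR_ge0|lra|].
  by apply: ler_pM => //; exact: expR_ge0.
have -> : expR (t * y) * (Dn%:R * expR (- (2 * t * y)) * (16 * y ^+ 3)) * (C * y ^+ 2) =
   16 * C * Dn%:R * (y ^+ 5 / expR (t * y)).
  rewrite (_ : - (2 * t * y) = - (t * y) - (t * y)); last by ring.
  rewrite expRD !expRN; have := expR_gt0 (t * y); move: (expR _) => z z0; field; exact: lt0r_neq0.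
have h6 : y ^+ 5 / expR (t * y) <= K2 by rewrite ler_pdivrMr ?expR_gt0 //; apply: HK2; exact: ltW.
have h7 : 1 <= 2 * (ln Dn%:R * (Num.sqrt y)^-1).
  rewrite mulrA ler_pdivlMr // mul1r; have := sy2; rewrite expr2; nra.
have k0 : 0 < 16 * C * Dn%:R by rewrite !mulr_gt0.
apply: (@le_trans _ _ (16 * C * Dn%:R * K2 * 1)); first by rewrite mulr1 ler_pM2l.
apply: (@le_trans _ _ (16 * C * Dn%:R * K2 * (2 * (ln Dn%:R * (Num.sqrt y)^-1)))).
  by rewrite ler_pM2l // mulr_gt0.
by rewrite yh /A2 le_eqVlt; apply/orP; left; apply/eqP; ring.
Qed.

End ErrorTerm.

(** * From the partial sums to the central values *)

Section MeanEstimate.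
Context (R : realType).
Local Notation intg := (@summable_on_line R).
Local Notation I := (@integral_line R).

(** Dominates the dependences 1 + |ln u| and (1 + u)^3 of [moment_estimate] at u = [tau t]. *)
Let weight (t : R) : R := (1 + `|ln (tau t)|) * (1 + tau t) ^+ 3.

Lemma intg_kern_weight : intg (fun t => kern t * weight t).
Proof.
have [B B0 HB] := kern_bound R; set a : R := Num.sqrt (8 / pi).
have a0 : 0 < a by rewrite sqrtr_gt0 divr_gt0 ?pi_gt0.
have lt t : ln (tau t) = ln a + t / 2 by rewrite /tau -/a lnM ?posrE ?expR_gt0 // expRK.
pose K := (1 + `|ln a|) * (1 + a) ^+ 3 * B * 8.
apply: (@intg_le _ _ (fun t => K * expR (- (8^-1 * `|t|)))); last by apply: intgZ; apply: intg_exp_abs.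
  apply: measurable_funM; first exact: measurable_kern.
  have mt : measurable_fun setT (@tau R).
    apply: measurable_funM => //; apply: (measurableT_comp (@measurable_expR R)).
    exact: measurable_funM.
  apply: measurable_funM.
    apply: measurable_funD => //; apply: measurableT_comp => //.
    by rewrite (_ : (fun x => ln (tau x)) = fun t => ln a + t / 2); [apply: measurable_funD => //; exact: measurable_funM|apply/funext].
  by apply: measurable_funX; apply: measurable_funD.
move=> t; have k0 := kern_gt0 t; have t0 := tau_gt0 t; have la := normr_ge0 (ln a).
have e0 := expR_gt0 (t / 2); have nt := normr_ge0 t.
have w0 : 0 <= weight t by rewrite mulr_ge0 ?exprn_ge0 ?addr_ge0 // ltW.
rewrite ger0_norm; last by apply: mulr_ge0 => //; exact: ltW.
have h1 : 1 + `|ln (tau t)| <= (1 + `|ln a|) * (1 + `|t|).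
  have : `|ln (tau t)| <= `|ln a| + `|t|.
    rewrite lt; apply: le_trans (ler_normD _ _) _; rewrite lerD2l normrM [X in _ * X]ger0_norm //; lra.
  nra.
have h2 : (1 + tau t) ^+ 3 <= (1 + a) ^+ 3 * (1 + expR (t / 2)) ^+ 4.
  apply: (@le_trans _ _ (((1 + a) * (1 + expR (t / 2))) ^+ 3)).
    by apply: lerXn2r; rewrite ?nnegrE ?mulr_ge0 ?addr_ge0 ?(ltW t0) ?(ltW a0) ?(ltW e0) //= /tau -/a; nra.
  rewrite exprMn ler_wpM2l ?exprn_ge0 ?addr_ge0 ?(ltW a0) //.
  by apply: ler_weXn2l => //; lra.
have h3 : 1 + `|t| <= 8 * expR (8^-1 * `|t|) by have := expR_ge1Dx (8^-1 * `|t|); lra.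
have h4 : expR (- (4^-1 * `|t|)) * (1 + `|t|) <= 8 * expR (- (8^-1 * `|t|)).
  rewrite (_ : - (8^-1 * `|t|) = - (4^-1 * `|t|) + 8^-1 * `|t|); last by field.
  by rewrite expRD mulrCA ler_pM2l ?expR_gt0.
apply: (@le_trans _ _ (kern t * (((1 + `|ln a|) * (1 + `|t|)) * ((1 + a) ^+ 3 * (1 + expR (t / 2)) ^+ 4)))).
  rewrite ler_pM2l //; apply: ler_pM; [by rewrite addr_ge0|by rewrite exprn_ge0 // addr_ge0 // ltW|exact: h1|exact: h2].
have c0 : 0 <= (1 + `|ln a|) * (1 + a) ^+ 3 by rewrite mulr_ge0 ?exprn_ge0 ?addr_ge0 // ltW.
rewrite (_ : kern t * _ = ((1 + `|ln a|) * (1 + a) ^+ 3) * ((kern t * (1 + expR (t / 2)) ^+ 4) * (1 + `|t|))); last by ring.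
rewrite [leRHS](_ : _ = ((1 + `|ln a|) * (1 + a) ^+ 3) * (B * (8 * expR (- (8^-1 * `|t|))))); last by rewrite /K; ring.
apply: ler_wpM2l => //.
apply: (@le_trans _ _ (B * expR (- (4^-1 * `|t|)) * (1 + `|t|))).
  by apply: ler_wpM2r; [rewrite addr_ge0|exact: HB].
by rewrite -mulrA ler_pM2l.
Qed.

(** [moment_estimate] at u = [tau t] is integrated against [kern]. The factor 2 of [L_half_integral]
    turns 1/8 into 1/4, and the mass of the kernel is divided out. *)
Lemma mean_estimate : exists2 C : R, 0 < C & forall (X L s : R) (D : nat),
  (0 < D)%N -> (0 < Num.truncn X)%N -> 1 <= L -> 0 <= s <= 2^-1 ->
  `|\sum_(1 <= d < D.+1 | flat d) dirichletL (chi8 d) (2^-1 : R) * (euler_product X (chi8 d))^-1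
    - flat_density R * odd_constant R / 4 * (D%:R * ln D%:R) * main_coefficient R (Num.truncn X)| <=
  C * (D%:R * (1 + ln (Num.truncn X)%:R) * (prime_sieve R (Num.truncn X))^-1 ^+ 80 +
     expR (64 * ((Num.truncn X)%:R `^ s * Num.sqrt (Num.truncn X)%:R)) *
      (L * D%:R `^ (39 / 40) + L `^ (- s) * (D%:R * (1 + ln D%:R) ^+ 3))).
Proof.
have [C C0 H] := moment_estimate R; have k0 := kernI_gt0 R.
have wi := intg_kern_weight.
have w0 t : 0 <= weight t by rewrite mulr_ge0 ?exprn_ge0 ?addr_ge0 // ltW // tau_gt0.
have Iw0 : 0 <= I (fun t => kern t * weight t).
  have h : intg (fun t => 0 * kern t) by apply: intgZ; exact: intg_kern.
  have -> : 0 = I (fun t => 0 * kern t) by rewrite ilZ ?mul0r //; exact: intg_kern.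
  by apply: il_le => // t; rewrite mul0r mulr_ge0 // ltW // kern_gt0.
exists (2 / kernI R * C * (1 + I (fun t => kern t * weight t))) => [|X L s D D0 N0 L1 s01].
  by rewrite !mulr_gt0 ?invr_gt0 //; lra.
set N := Num.truncn X; set M := main_coefficient R N.
set K := flat_density R * odd_constant R / 4 * (D%:R * ln D%:R) * M.
set W := D%:R * (1 + ln N%:R) * _ + _.
pose f d t := if flat d then (euler_product X (chi8 d))^-1 * (kern t * Spart (chi8 d) (tau t * Num.sqrt d%:R)) else 0 * kern t.
have fi d : intg (f d).
  rewrite /f; case fd: (flat d); last exact: (intgZ 0 (@intg_kern R)).
  by have /andP[od sd] := fd; have [h _] := L_half_integral R od sd; exact: (intgZ _ h).
pose Phi t := \sum_(1 <= d < D.+1) f d t.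
have PhiI : intg Phi by apply: intg_sum.
have SE : \sum_(1 <= d < D.+1 | flat d) dirichletL (chi8 d) (2^-1 : R) * (euler_product X (chi8 d))^-1 = 2 / kernI R * I Phi.
  rewrite /Phi il_sum // mulr_sumr big_mkcond; apply: eq_bigr => d _; rewrite /f; case fd: (flat d).
    have /andP[od sd] := fd; have [h ->] := L_half_integral R od sd.
    by rewrite (ilZ _ h) [RHS]mulrCA [LHS]mulrC.
  by rewrite ilZ ?mul0r ?mulr0 //; exact: intg_kern.
have Ki : intg (fun t => (2^-1 * K) * kern t) by apply: intgZ; exact: intg_kern.
have KE : K = 2 / kernI R * I (fun t => (2^-1 * K) * kern t).
  rewrite ilZ; last exact: intg_kern.
  by rewrite -/(kernI R); field; exact: lt0r_neq0.
rewrite SE [in leLHS]KE -mulrBr normrM (ger0_norm (_ : 0 <= 2 / kernI R)); last by rewrite divr_ge0 // ltW.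
set Iw := I (fun t => kern t * weight t) in Iw0 *.
rewrite [leRHS](_ : _ = 2 / kernI R * (C * (1 + Iw) * W)); last by rewrite -!mulrA.
rewrite ler_pM2l ?divr_gt0 //.
have -> : I Phi - I (fun t => 2^-1 * K * kern t) = I (fun t => Phi t + -1 * (2^-1 * K * kern t)).
  by rewrite (ilD PhiI (intgZ (-1) Ki)) (ilZ (-1) Ki) mulN1r.
have D0r : (0 : R) <= D%:R by [].
have lD : 0 <= ln (D%:R : R) by exact: ln_nat_ge0.
set A := D%:R * (1 + ln N%:R) * _ in W *; set E := expR _ in W *; set B1 := D%:R `^ (39 / 40) in W *; set B2 := D%:R * (1 + ln D%:R) ^+ 3 in W *; set Ls := L `^ (- s) in W *.
have A0 : 0 <= A.
  by rewrite /A !mulr_ge0 ?addr_ge0 ?ln_nat_ge0 ?exprn_ge0 ?invr_ge0 ?(ltW (prime_sieve_gt0 R N)).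
have E0 : 0 <= E by exact: expR_ge0.
have L0 : 0 <= L * B1 by rewrite mulr_ge0 ?powR_ge0 //; lra.
have L2 : 0 <= Ls * B2 by rewrite /B2 !mulr_ge0 ?powR_ge0 ?exprn_ge0 ?addr_ge0.
have W0 : 0 <= W by rewrite addr_ge0 // mulr_ge0 // addr_ge0.
have key t : `|Phi t + -1 * (2^-1 * K * kern t)| <= (C * W) * (kern t * weight t).
  have PE : Phi t = kern t * \sum_(1 <= d < D.+1 | flat d) (euler_product X (chi8 d))^-1 * Spart (chi8 d) (tau t * Num.sqrt d%:R).
    rewrite /Phi mulr_sumr [RHS]big_mkcond; apply: eq_bigr => d _; rewrite /f; case: ifP => _; last by rewrite mul0r.
    by rewrite mulrCA.
  have := H X (tau t) L s D (tau_gt0 t) D0 N0 L1 s01; rewrite -/N -/M -/A -/E -/B1 -/Ls.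
  set S := \sum_(_ <= _ < _ | _) _ in PE *.
  have -> : Phi t + -1 * (2^-1 * K * kern t) = kern t * (S - flat_density R * odd_constant R / 8 * (D%:R * ln D%:R) * M).
    by rewrite PE /K; field.
  move=> HH; rewrite normrM (gtr0_norm (kern_gt0 t)) [leRHS]mulrCA ler_pM2l ?kern_gt0 //.
  apply: (le_trans HH); rewrite -[leRHS]mulrA ler_pM2l //.
  have t0 := tau_gt0 t; have l0 := normr_ge0 (ln (tau t)).
  have p1 : 1 + tau t <= (1 + tau t) ^+ 3 by apply: ler_eXnr => //; lra.
  have p2 : 1 <= (1 + tau t) ^+ 3 by lra.
  have w1 : 1 + `|ln (tau t)| <= weight t by rewrite /weight ler_peMr //; lra.
  have w2 : (1 + tau t) ^+ 3 <= weight t by rewrite /weight ler_peMl //; lra.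
  rewrite /W [leRHS]mulrDl; apply: lerD; first exact: ler_wpM2l.
  rewrite -[leRHS]mulrA; apply: ler_wpM2l => //; rewrite [leRHS]mulrDl; apply: lerD.
    rewrite [leLHS](_ : _ = L * B1 * (1 + tau t)); last by ring.
    by apply: ler_wpM2l => //; lra.
  rewrite [leLHS](_ : _ = Ls * B2 * (1 + tau t) ^+ 3); last by rewrite /B2; ring.
  exact: ler_wpM2l.
apply: (@le_trans _ _ (I (fun t => (C * W) * (kern t * weight t)))).
  apply: il_norm => //; [by apply: intgD => //; exact: intgZ|exact: intgZ].
rewrite ilZ // -/Iw -!mulrA ler_pM2l // mulrC; apply: ler_wpM2r => //; lra.
Qed.

End MeanEstimate.

(** * Normalization by D* and the asymptotic formula *)

Section Normalization.
Context (R : realType).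

Lemma ln_truncn_asymp : ln (Num.truncn x)%:R / ln x @[x --> +oo] --> (1 : R).
Proof.
have l0 : (ln x `^ (- 1)) @[x --> +oo] --> (0 : R).
  have h : ln x @[x --> +oo] --> (+oo : set_system R).
    apply/cvgryPge => A; near=> x.
    have x0 : 0 < x by near: x; exact: nbhs_pinfty_gt.
    rewrite -ler_expR lnK ?posrE //.
  by apply: (cvg_comp _ _ h (cvg_inv_powR _)).
apply: (@squeeze_cvgr _ _ _ _ (fun x => 1 - ln 2 * ln x `^ (- 1)) (fun=> 1)).
- near=> x; have x4 : 4 <= x by near: x; exact: nbhs_pinfty_ge.
  have lx : 0 < ln x by apply: ln_gt0; lra.
  have /andP[_ h2] := truncn_ln x4.
  have /andP[t1 t2] := @truncn_itv R x (ltac:(lra)); rewrite -natr1 in t2.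
  have h1 : ln x - ln 2 <= ln (Num.truncn x)%:R.
    have x0 : 0 < x by lra.
    have x2 : 0 < x / 2 by lra.
    rewrite -ln_div ?posrE // ler_ln ?posrE //; lra.
  rewrite powRN powRr1 ?(ltW lx) // ler_pdivlMr // ler_pdivrMr // mul1r h2 andbT.
  by rewrite mulrBl mul1r divfK ?gt_eqF.
- apply: (@cvg_eq _ _ _ _ (1 - ln 2 * 0)); last by rewrite mulr0 subr0.
  by apply: cvgB; [exact: cvg_cst|apply: cvgM => //; exact: cvg_cst].
- exact: cvg_cst.
Unshelve. all: by end_near.
Qed.

Lemma Dstar_asymp : (Num.truncn D)%:R / (Dstar (D : R))%:R @[D --> +oo] --> (flat_density R)^-1.
Proof.
have [C C0 H] := flat_count R; have k0 := flat_density_gt0 R.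
pose c (n : nat) : R := (\sum_(1 <= d < n.+1 | flat d) 1%N)%:R.
suff h : c n / n%:R @[n --> \oo] --> flat_density R.
  have h2 : (c n / n%:R)^-1 @[n --> \oo] --> (flat_density R)^-1 by apply: cvgV => //; exact: lt0r_neq0.
  have hh := cvg_comp _ _ (@cvg_truncn R) h2; apply: (cvg_near_eq _ hh).
  by near=> D; rewrite /= invf_div.
have w1 : coprime_weight R 1 = 1.
  rewrite /coprime_weight big1 // => p /and3P[pp _]; rewrite dvdn1 => /eqP p1; by rewrite p1 in pp.
apply/cvgrPdist_le => e e0.
have p0 : (2 * C + 1) * (n%:R `^ (- (2 / 5))) @[n --> \oo] --> (2 * C + 1) * (0 : R).
  apply: cvgM; first exact: cvg_cst.
  by apply: (cvg_comp _ _ cvgr_idn (cvg_inv_powR _)).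
rewrite mulr0 in p0; have /cvgrPdist_le /(_ e e0) he := p0.
near=> n; have : `|0 - (2 * C + 1) * (n%:R `^ (- (2 / 5)))| <= e by near: n; exact: he.
rewrite sub0r normrN => /(le_trans (ler_norm _)); apply: le_trans.
have n0 : (0 < n)%N by near: n; exact: nbhs_infty_gt.
have nr : (0 : R) < n%:R by rewrite ltr0n.
have n1 : (1 : R) <= n%:R by rewrite ler1n.
have := H 1%N n.+1 isT; rewrite w1 !mulr1.
rewrite (_ : \sum_(1 <= d < n.+1 | flat d && coprime d 1) 1 = c n); last first.
  by rewrite /c natr_sum; apply: eq_bigl => d; rewrite coprimen1 andbT.
move=> h1; have h2 := powR_succ_le R n0 (leqnn n.+1).
have {}h1 : `|c n - flat_density R * n.+1%:R| <= 2 * C * n%:R `^ (3 / 5).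
  by apply: (le_trans h1); have := ler_wpM2l (ltW C0) h2; lra.
have h3 : 1 <= (n%:R : R) `^ (3 / 5) by apply: powR_ge1.
have k1 := flat_density_le1 R.
have h4 : `|c n - flat_density R * n%:R| <= (2 * C + 1) * n%:R `^ (3 / 5).
  have -> : c n - flat_density R * n%:R = (c n - flat_density R * n.+1%:R) + flat_density R by rewrite -natr1; ring.
  apply: le_trans (ler_normD _ _) _; rewrite (gtr0_norm k0) [leRHS]mulrDl mul1r; lra.
have -> : flat_density R - c n / n%:R = - ((c n - flat_density R * n%:R) / n%:R) by field; exact: lt0r_neq0.
rewrite normrN normrM [X in _ * X]ger0_norm ?invr_ge0 // ler_pdivrMr //.
apply: (le_trans h4); rewrite -mulrA ler_wpM2l //; first lra.
rewrite -[X in _ <= _ * X](powRr1 (ler0n R n)) -powRD; last by rewrite (gt_eqF nr) implybT.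
by rewrite (_ : - (2 / 5) + 1 = 3 / 5) //; field.
Unshelve. all: by end_near.
Qed.

End Normalization.

Theorem theoremS3 (R : realType) (delta C : R) (hdelta : 0 < delta)
    (hC : 0 < C) :
  (fun p : R * R => twisted_mean p.1 p.2 : R^o)
    ~_(XD_filter delta C)
  (fun p : R * R =>
     (Num.sqrt 2)^-1 * (ln p.2 / (expR (euler_gamma R) * ln p.1)) : R^o).
Proof.
pose F := XD_filter delta C; have FF : Filter F := XD_filter_filter delta C.
have c1 : p.1 @[p --> F] --> (+oo : set_system R) by apply: cvg_within_filter; exact: cvg_fst.
have c2 : p.2 @[p --> F] --> (+oo : set_system R) by apply: cvg_within_filter; exact: cvg_snd.
have cX : \forall p \near F, p.1 <= C * (ln p.2 `^ (2 - delta)) by exact: withinT.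
(* [error_small] asks for an exponent at most 1; lowering delta only widens the range of X, because
   ln D >= 1. *)
pose del := Num.min delta 1.
have d01 : 0 < del <= 1 by rewrite lt_min hdelta ltr01 ge_min lexx orbT.
set g := expR (euler_gamma R); have g0 : 0 < g := expR_gt0 _.
have c0 : 0 < g^-1 / 2 by rewrite divr_gt0 ?invr_gt0.
have [s [K [y0 [s01 K0 HW]]]] := error_small d01 hC c0.
have [C1 C10 HM] := mean_estimate R.
have k0 := flat_density_gt0 R.
have s20 : 0 < Num.sqrt (2 : R) by rewrite sqrtr_gt0.
have s22 : Num.sqrt (2 : R) ^+ 2 = 2 by rewrite sqr_sqrtr.
pose G (p : R * R) := (Num.sqrt 2)^-1 * (ln p.2 / (g * ln p.1)).
pose Dn (p : R * R) := Num.truncn p.2; pose N (p : R * R) := Num.truncn p.1.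
pose M (p : R * R) := flat_density R * odd_constant R / 4 * ((Dn p)%:R * ln (Dn p)%:R) * main_coefficient R (N p).
pose S (p : R * R) := \sum_(1 <= d < (Dn p).+1 | flat d) dirichletL (chi8 d) (2^-1 : R) * (euler_product p.1 (chi8 d))^-1.
pose r (p : R * R) : R := (Dn p)%:R / (Dstar p.2)%:R.
have rc : r p @[p --> F] --> (flat_density R)^-1 := cvg_comp _ _ c2 (@Dstar_asymp R).
have lc : ln (Dn p)%:R / ln p.2 @[p --> F] --> (1 : R) := cvg_comp _ _ c2 (@ln_truncn_asymp R).
have mc : odd_constant R * main_coefficient R (N p) * ln p.1 @[p --> F] --> 2 * Num.sqrt 2 * g^-1.
  by rewrite /g -expRN; exact: (cvg_comp _ _ c1 (@main_coefficient_asymp R)).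
have lnc : ln x @[x --> +oo] --> (+oo : set_system R).
  apply/cvgryPge => A; near=> x.
  have x0 : 0 < x by near: x; exact: nbhs_pinfty_gt.
  by rewrite -ler_expR lnK ?posrE.
have yc : ln p.2 @[p --> F] --> (+oo : set_system R) := cvg_comp _ _ c2 lnc.
have hc : ln p.2 `^ (- 2^-1) @[p --> F] --> (0 : R).
  by apply: (cvg_comp _ _ yc (cvg_inv_powR _)); rewrite invr_gt0.
(* The main term divided by D* and by the claimed value [G], as [qE] shows. The limit is 2 sqrt 2 /
   g times sqrt 2 g / 4, that is, 1. *)
pose q (p : R * R) := flat_density R * r p * (ln (Dn p)%:R / ln p.2) * (odd_constant R * main_coefficient R (N p) * ln p.1) * (Num.sqrt 2 * g / 4).
have qc : q p @[p --> F] --> (1 : R).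
  apply: (@cvg_eq _ _ _ _ (flat_density R * (flat_density R)^-1 * 1 * (2 * Num.sqrt 2 * g^-1) * (Num.sqrt 2 * g / 4))).
    apply: cvgM; last exact: cvg_cst; apply: cvgM => //; apply: cvgM => //; apply: cvgM => //; exact: cvg_cst.
  have alg (w z : R) : 0 < z -> 2 * w * z^-1 * (w * z / 4) = w ^+ 2 / 2 by move=> z0; field; exact: lt0r_neq0.
  by rewrite divff ?gt_eqF // !mul1r alg // s22 divff.
(* A bound for the error relative to [G]; the saving (ln D)^(-1/2) is the one of [error_small]. *)
pose b (p : R * R) := C1 * K * (Num.sqrt 2 * g) * r p * ln p.2 `^ (- 2^-1).
have bc : b p @[p --> F] --> (0 : R).
  apply: (@cvg_eq _ _ _ _ (C1 * K * (Num.sqrt 2 * g) * (flat_density R)^-1 * 0)); last by rewrite mulr0.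
  by apply: cvgM => //; apply: cvgM => //; exact: cvg_cst.
have ps : \forall x \near +oo, g^-1 / 2 <= prime_sieve R (Num.truncn x) * ln x.
  have /cvgrPdist_le /(_ (g^-1 / 2) c0) := @mertens R; rewrite expRN -/g; apply: filterS => x.
  by rewrite ler_norml => /andP[_]; lra.
have n1 : \forall p \near F, 4 <= p.1 by apply: (c1 (fun x => 4 <= x)); exact: nbhs_pinfty_ge.
have n2 : \forall p \near F, 4 <= p.2 by apply: (c2 (fun x => 4 <= x)); exact: nbhs_pinfty_ge.
have n3 : \forall p \near F, g^-1 / 2 <= prime_sieve R (N p) * ln p.1 := c1 _ ps.
have n4 : \forall p \near F, Num.max 1 y0 <= ln p.2.
  by apply: (yc (fun x => Num.max 1 y0 <= x)); apply: nbhs_pinfty_ge; exact: num_real.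
apply/eqaddoP => e e0.
have /cvgrPdist_le /(_ (e / 2) (ltac:(by rewrite divr_gt0))) hq := qc.
have /cvgrPdist_le /(_ (e / 2) (ltac:(by rewrite divr_gt0))) hb := bc.
near=> p.
have X4 : 4 <= p.1 by near: p; exact: n1.
have D4 : 4 <= p.2 by near: p; exact: n2.
have psp : g^-1 / 2 <= prime_sieve R (N p) * ln p.1 by near: p; exact: n3.
have yy : Num.max 1 y0 <= ln p.2 by near: p; exact: n4.
have y1 : 1 <= ln p.2 by apply: le_trans yy; rewrite le_max lexx.
have yy0 : y0 <= ln p.2 by apply: le_trans yy; rewrite le_max lexx orbT.
have XC : p.1 <= C * ln p.2 `^ (2 - del).
  have : p.1 <= C * ln p.2 `^ (2 - delta) by near: p; exact: cX.
  move/le_trans; apply; rewrite ler_pM2l //; apply: ler_powR => //.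
  by rewrite lerD2l lerN2 ge_min lexx.
have hqp : `|1 - q p| <= e / 2 by near: p; exact: hq.
have hbp : `|0 - b p| <= e / 2 by near: p; exact: hb.
have lX : 0 < ln p.1 by apply: ln_gt0; lra.
have N0 : (0 < N p)%N by rewrite truncn_gt0; lra.
have Dn0 : (0 < Dn p)%N by rewrite truncn_gt0; lra.
have Dn1 : (1 : R) <= (Dn p)%:R by rewrite ler1n.
have /andP[_ lD] := truncn_ln D4; rewrite -/(Dn p) in lD.
have L1 : 1 <= ((Dn p)%:R : R) `^ 100^-1 by apply: powR_ge1; rewrite ?invr_ge0.
have HMp := HM p.1 _ s (Dn p) Dn0 N0 L1 s01.
have := HW p.1 p.2 X4 psp D4 yy0 XC; rewrite -/(N p) -/(Dn p) => HWp.
rewrite -/(S p) -/(M p) in HMp; set W := (_ + _ : R) in HMp; rewrite -/W in HWp.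
have ds0 : (0 : R) < (Dstar p.2)%:R.
  by rewrite ltr0n /Dstar big_ltn_cond ?ltnS.
have G0 : 0 < G p by rewrite /G mulr_gt0 ?invr_gt0 // divr_gt0 ?mulr_gt0 //; lra.
change (`|(Dstar p.2)%:R^-1 * S p - G p| <= e * `|G p|).
have qE : q p * G p = (Dstar p.2)%:R^-1 * M p.
  rewrite /q /G /M /r; move: (ln (Dn p)%:R) (ln p.2) (ln p.1) y1 lX (main_coefficient R (N p)) => a y x y1 x0 mm.
  have alg (w z k rho n ds : R) : 0 < w -> 0 < z -> 0 < ds -> w ^+ 2 = 2 ->
     k * (n / ds) * (a / y) * (rho * mm * x) * (w * z / 4) * (w^-1 * (y / (z * x))) = ds^-1 * (k * rho / 4 * (n * a) * mm).
    by move=> w0 z0 d0 _; field; rewrite !gt_eqF //; lra.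
  by rewrite alg.
have -> : (Dstar p.2)%:R^-1 * S p - G p = (Dstar p.2)%:R^-1 * (S p - M p) + (q p - 1) * G p.
  by rewrite mulrBr mulrBl qE mul1r; ring.
rewrite (gtr0_norm G0); apply: le_trans (ler_normD _ _) _.
rewrite (_ : e * G p = e / 2 * G p + e / 2 * G p); last by field.
apply: lerD; last first.
  by rewrite normrM (gtr0_norm G0) distrC ler_pM2r.
have bG : (Dstar p.2)%:R^-1 * `|S p - M p| <= b p * G p.
  rewrite mulrC ler_pdivrMr //; apply: (le_trans HMp).
  rewrite [leRHS](_ : _ = C1 * (K * ((Dn p)%:R * ln p.2 * ln p.2 `^ (- 2^-1)) / ln p.1)); last first.
    have alg (w z n ds h y x : R) : 0 < w -> 0 < z -> 0 < ds -> 0 < x ->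
      C1 * K * (w * z) * (n / ds) * h * (w^-1 * (y / (z * x))) * ds = C1 * (K * (n * y * h) / x).
      by move=> w0 z0 d0 x0; field; rewrite !gt_eqF.
    exact: alg.
  rewrite ler_pM2l // ler_pdivlMr //; apply: (le_trans HWp); rewrite ler_pM2l //.
  by apply: ler_wpM2r; [exact: powR_ge0|rewrite ler_wpM2l].
rewrite normrM ger0_norm ?invr_ge0 //; apply: (le_trans bG); rewrite ler_pM2r //.
by move: hbp; rewrite sub0r normrN; apply: le_trans; exact: ler_norm.
Unshelve. all: by end_near.
Qed.
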